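(* Assume that $\eta_0\in P_\gamma$ for some $\gamma>3/2$, and let $\eta\in C^0([0,\infty),P_\gamma)$ be the unique solution with initial data $\eta_0$ of the rescaled coarsening equation in integral form (see context). Then $\eta$ is bounded in $L^2_\gamma$ and there exists $C>0$ such that $$\|\eta(\tau)-\eta^*_1\|_{2,\gamma-1}\le C\,e^{-(\gamma-3/2)\tau}\quad\text{for }\tau\ge0.$$ Moreover, if $\gamma\ge2$, then there exists $C>0$ such that $$\|\eta(\tau)-\eta^*_1\|_{2,\gamma}\le C(1+\tau)\,e^{-(\gamma-3/2)\tau}\quad\text{for }\tau\ge0.$$
   Context: Fix an integer $N\ge 1$ and real numbers $p_1,\dots,p_N\ge 0$ with $p_1+\dots+p_N=1$; let $Q(z)=\sum_{j=1}^N p_jz^j$, $q=Q'(1)$, and $\mathbb{Q}[\rho]=\sum_{j=1}^N p_j\,\rho^{*j}$, where $\rho^{*j}$ is the $j$-fold convolution power on $\mathbb{R}$. Functions on $[1,\infty)$ are extended by $0$ to $(-\infty,1)$, so $\mathbb{Q}[\eta]$ makes sense for $\eta\in L^1_{\rm loc}([1,\infty))$. $L^1=L^1((1,\infty),\mathbb{R})$; $\mathbb{P}=\{\eta\in L^1((1,\infty),\mathbb{R}_+) : \int_1^\infty \eta(y)\,dy=1\}$. For $\gamma\ge0$: $\|w\|_{2,\gamma}=\left(\int_1^\infty y^{2\gamma}|w(y)|^2\,dy\right)^{1/2}$, $L^2_\gamma=\{w\in L^1_{\rm loc}([1,\infty),\mathbb{R}) : \|w\|_{2,\gamma}<\infty\}$,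 and $P_\gamma=\mathbb{P}\cap L^2_\gamma$ with the topology of $L^2_\gamma$. $(S_\tau\eta)(y)=e^\tau\eta(e^\tau y)$ for $y\ge1$ and $0$ for $y<1$; $(T_1\eta)(y)=\eta(y-1)$ for $y\ge2$ and $0$ for $y<2$. Rescaled coarsening equation: for $\eta_0\in\mathbb{P}$ there is a unique $\eta\in C^0([0,\infty),L^1)$ (with trace $\beta\in L^1_{\rm loc}([0,\infty))$) such that $\eta(\tau)=S_\tau\eta_0+\int_0^\tau\beta(s)S_{\tau-s}T_1\mathbb{Q}[\eta(s)]\,ds$ for all $\tau\ge0$ and, for every $\tau_0\ge0$, $\beta(\tau)=e^{\tau-\tau_0}\eta(\tau_0,e^{\tau-\tau_0})$ for almost all $\tau\in[\tau_0,\tau_0+\log2]$. One has $\eta(\tau)\in\mathbb{P}$ for all $\tau$, and if $\eta_0\in P_\gamma$ with $\gamma>1/2$ then $\eta\in C^0([0,\infty),P_\gamma)$. $\eta^*_1\in\mathbb{P}$ is the unique locally absolutely continuous function $\eta:[1,\infty)\to\mathbb{R}$ satisfying $(y\eta)'(y)+\frac1q(T_1\mathbb{Q}[\eta])(y)=0$ for almost all $y>1$ and $\eta(1)=\frac1q$. *)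

(* Defs.v *)
From HB Require Import structures.
From mathcomp Require Import all_boot all_order all_algebra.
From mathcomp Require Import all_classical all_reals all_analysis.
From mathcomp Require Import measurable_realfun.

Set Implicit Arguments.
Unset Strict Implicit.
Unset Printing Implicit Defensive.

Import Order.TTheory GRing.Theory Num.Theory.
Import numFieldNormedType.Exports.

Local Open Scope classical_set_scope.
Local Open Scope ring_scope.

(* Functions on [1, oo) are represented by total functions R -> R whose values
   on (-oo, 1) are irrelevant; elements of L^1 and of L^2_gamma are represented
   by arbitrary almost-everywhere representatives. *)

Definition ext1 (R : realType) (f : R -> R) : R -> R :=
  fun y => if 1 <= y then f y else 0.

Definition convolution (R : realType) (f g : R -> R) : R -> R :=
  fun x => Rintegral lebesgue_measure setT (fun y : R => f y * g (x - y)).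

(* The j-fold convolution power, for j >= 1 (the case j = 0 is never used). *)
Definition convpow (R : realType) (f : R -> R) (j : nat) : R -> R :=
  iter j.-1 (convolution f) f.

Definition Qconv (R : realType) (N : nat) (p : nat -> R) (f : R -> R)
    : R -> R :=
  fun y => \sum_(1 <= j < N.+1) p j * convpow (ext1 f) j y.

Definition Qpoly (R : realType) (N : nat) (p : nat -> R) : {poly R} :=
  \sum_(1 <= j < N.+1) p j *: 'X^j.

Definition qmean (R : realType) (N : nat) (p : nat -> R) : R :=
  ((Qpoly N p)^`()).[1].

Definition Sop (R : realType) (tau : R) (f : R -> R) : R -> R :=
  fun y => if 1 <= y then expR tau * f (expR tau * y) else 0.

Definition T1op (R : realType) (f : R -> R) : R -> R :=
  fun y => if 2 <= y then f (y - 1) else 0.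

Definition inL1 (R : realType) (f : R -> R) : Prop :=
  (@lebesgue_measure R).-integrable `[1, +oo[ (EFin \o f).

Definition norm1 (R : realType) (f : R -> R) : \bar R :=
  (\int[@lebesgue_measure R]_(y in `[1%R, +oo[) `|f y|%:E)%E.

(* Extended-real valued, so that an upper bound by a real number entails
   finiteness. *)
Definition norm2 (R : realType) (gamma : R) (f : R -> R) : \bar R :=
  sqrte (\int[@lebesgue_measure R]_(y in `[1%R, +oo[)
           (y `^ (2 * gamma) * `|f y| ^+ 2)%:E)%E.

Definition inP (R : realType) (f : R -> R) : Prop :=
  [/\ inL1 f,
      {ae @lebesgue_measure R, forall y : R, 1 <= y -> 0 <= f y} &
      (\int[@lebesgue_measure R]_(y in `[1%R, +oo[) (f y)%:E = 1)%E].

Definition inL2 (R : realType) (gamma : R) (f : R -> R) : Prop :=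
  (forall b : R, (@lebesgue_measure R).-integrable `[1, b] (EFin \o f)) /\
  (norm2 gamma f < +oo)%E.

Definition inPgamma (R : realType) (gamma : R) (f : R -> R) : Prop :=
  inP f /\ inL2 gamma f.

Definition C0_L1 (R : realType) (eta : R -> R -> R) : Prop :=
  (forall t : R, 0 <= t -> inL1 (eta t)) /\
  (forall t : R, 0 <= t ->
     norm1 (eta s \- eta t) @[s --> within `[0, +oo[ (nbhs t)] --> 0%E).

Definition C0_Pgamma (R : realType) (gamma : R) (eta : R -> R -> R) : Prop :=
  (forall t : R, 0 <= t -> inPgamma gamma (eta t)) /\
  (forall t : R, 0 <= t ->
     norm2 gamma (eta s \- eta t) @[s --> within `[0, +oo[ (nbhs t)] --> 0%E).

(* A list of pairs (A, f) encodes the L^1-valued simple function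
   s |-> \sum 1_A(s) f on the set D. *)
Definition is_simple (R : realType) (D : set R)
    (g : seq (set R * (R -> R))) : Prop :=
  forall u, u \in g ->
    [/\ measurable u.1, u.1 `<=` D, (lebesgue_measure u.1 < +oo)%E &
        inL1 u.2].

Definition simple_val (R : realType) (g : seq (set R * (R -> R))) (s : R)
    : R -> R :=
  fun y => \sum_(u <- g) \1_(u.1) s * u.2 y.

Definition simple_int (R : realType) (g : seq (set R * (R -> R))) : R -> R :=
  fun y => \sum_(u <- g) fine (lebesgue_measure u.1) * u.2 y.

(* F : D -> L^1 is Bochner integrable over D with integral J \in L^1, an
   identity between classes of functions modulo null sets. *)
Definition is_bochner_integral (R : realType) (D : set R) (F : R -> R -> R)
    (J : R -> R) : Prop :=
  [/\ forall s, D s -> inL1 (F s), inL1 J &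
   exists g : nat -> seq (set R * (R -> R)),
     [/\ forall n, is_simple D (g n),
         forall n, measurable_fun D
           (fun s => norm1 (F s \- simple_val (g n) s)),
         (\int[@lebesgue_measure R]_(s in D)
             norm1 (F s \- simple_val (g n) s)%R)%E @[n --> \oo] --> 0%E &
         norm1 (J \- simple_int (g n)) @[n --> \oo] --> 0%E]].

(* The C^0([0, oo), L^1) solutions of the rescaled coarsening equation in
   integral form; beta is the trace of eta at y = 1. *)
Definition is_solution (R : realType) (N : nat) (p : nat -> R)
    (eta0 : R -> R) (eta : R -> R -> R) : Prop :=
  C0_L1 eta /\
  exists beta : R -> R,
    [/\ forall T : R,
          (@lebesgue_measure R).-integrable `[0, T] (EFin \o beta),
        forall tau : R, 0 <= tau ->
          exists2 J : R -> R,
            is_bochner_integral `[0, tau]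
              (fun s y => beta s * Sop (tau - s) (T1op (Qconv N p (eta s))) y)
              J &
            {ae @lebesgue_measure R, forall y : R, 1 <= y ->
               eta tau y = Sop tau eta0 y + J y} &
        forall tau0 : R, 0 <= tau0 ->
          {ae @lebesgue_measure R, forall tau : R,
             tau0 <= tau <= tau0 + ln 2 ->
             beta tau = expR (tau - tau0) * eta tau0 (expR (tau - tau0))}].

Definition abs_continuous_on (R : realType) (a b : R) (f : R -> R) : Prop :=
  forall e : R, 0 < e -> exists2 d : R, 0 < d &
    forall s : seq (R * R),
      all (fun u => [&& a <= u.1, u.1 <= u.2 & u.2 <= b]) s ->
      pairwise (fun u v => (u.2 <= v.1) || (v.2 <= u.1)) s ->
      \sum_(u <- s) (u.2 - u.1) < d ->
      \sum_(u <- s) `|f u.2 - f u.1| < e.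

Definition is_eta_star1 (R : realType) (N : nat) (p : nat -> R)
    (f : R -> R) : Prop :=
  [/\ forall b : R, abs_continuous_on 1 b f,
      {ae @lebesgue_measure R, forall y : R, 1 < y ->
         derivable (fun z : R => z * f z) y 1 /\
         derive1 (fun z : R => z * f z) y
           + (qmean N p)^-1 * T1op (Qconv N p f) y = 0} &
      f 1 = (qmean N p)^-1].

(* Main.v *)
Require Import Defs.
From HB Require Import structures.
From mathcomp Require Import all_boot all_order all_algebra.
From mathcomp Require Import all_classical all_reals all_analysis.
From mathcomp Require Import measurable_realfun ring lra.
Import Order.TTheory GRing.Theory Num.Theory.
Import numFieldNormedType.Exports.
Local Open Scope classical_set_scope.
Local Open Scope ring_scope.
Set Implicit Arguments.
Unset Strict Implicit.
Unset Printing Implicit Defensive.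

(* Write u = eta tau, w = eta*, P for the generating polynomial, q = P'(1).  In
   the Laplace variable the evolution can be integrated: with F the transform of
   u and A the transform of y u, both taken at s e^tau, A / (1 - P(F)) decreases
   by the integral of beta e^r exp(- s e^r).  At tau = 0 the quotient is the
   transform of a renewal function k0 which, by a renewal theorem in L2_(gamma-1),
   is 1/q plus a remainder decaying at the rate of the initial datum.  Inverting,
     y u = (1/q) tail(Q[u])(y - 1) + f,   ||f||_(gamma-1) <= C e^(-(gamma-3/2) tau) (1 + ||u||_gamma),
   while w satisfies the same identity with f = 0.  Since tail(Q[u]) - tail(Q[w])
   = sum_j p_j z_j with z_j a combination of convolutions of Z = tail(u - w), and
   y Z = Z * V + tail f for an integrable kernel V, multiplication by y gains one
   power of weight; lower-order weights are absorbed by interpolation with the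
   L2 norm of Z on a bounded interval, which is controlled by ||f||_1 by iterating
   y |u - w| <= integral_(x <= y - 1) |u - w| + |f|.  The same argument with w
   replaced by the Dirac mass at 0 bounds ||u||_gamma uniformly in tau.  This
   gives the rate e^(-(gamma-3/2) tau) in L2_gamma for every gamma > 3/2. *)

(** * Integrals and convolutions on the line *)

(** The equation is available only in integrated form, with a trace [beta] that is merely locally
    integrable, so nothing can be differentiated in time. Derivatives are taken relative to the
    measure [beta] dr ([dsim]) and integrated by a covering argument of Cousin type. The quotient A
    / (1 - P(F)) is the right quantity because, relative to that measure, A and 1 - P(F) both grow
    with the factor P'(F) exp(- s e^t), which cancels in the quotient. Laplace transforms live on
    the real half-line, and inverting them means injectivity only. The renewal theorem is proved
    without Fourier analysis: the jump law is replaced by a geometric compound of large mean that is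
    positive far out, and this leads to a Neumann series whose kernel has L1 norm below 1. The rate
    comes from scaling: a remainder in L2_(gamma-1) evaluated at e^T y gains e^(-(gamma-1/2) T), and
    one factor e^T is lost again because the remainder also enters through its primitive. Norms are
    handled squared, whence the exponents 2 gamma - 3. *)

Section Integral.
Variable R : realType.
Implicit Types (f g h : R -> R) (a b c s x y : R).
Local Notation mu := (@lebesgue_measure R).

Lemma ae_S (P Q : R -> Prop) : (forall x, P x -> Q x) ->
  {ae mu, forall x, P x} -> {ae mu, forall x, Q x}.
Proof. exact: (@filterS _ _ (ae_filter_ringOfSetsType mu)). Qed.

Lemma ae_I (P Q : R -> Prop) : {ae mu, forall x, P x} -> {ae mu, forall x, Q x} ->
  {ae mu, forall x, P x /\ Q x}.
Proof. exact: (@filterI _ _ (ae_filter_ringOfSetsType mu)). Qed.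

Lemma ae_T (P : R -> Prop) : (forall x, P x) -> {ae mu, forall x, P x}.
Proof. by move=> h; apply: (@filterE _ _ (ae_filter_ringOfSetsType mu)). Qed.

Lemma ae_countable (P : nat -> R -> Prop) : (forall n, {ae mu, forall x, P n x}) ->
  {ae mu, forall x, forall n, P n x}.
Proof.
move=> h; have := negligible_bigcup h; apply: negligibleS => x /= /existsNP[n nP].
by exists n.
Qed.

Lemma ae_neq (a : R) : {ae mu, forall x : R, x != a}.
Proof.
exists [set a]; split; [exact: measurable_set1|exact: lebesgue_measure_set1|].
by move=> x /= /negP; rewrite negbK => /eqP.
Qed.

Definition L1 f := mu.-integrable setT (EFin \o f).
(* Locked: otherwise [done] head-normalizes both sides of every equation between integrals. *)
Fact Int_key : unit. Proof. exact: tt. Qed.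
Definition Int f : R := locked_with Int_key (\int[mu]_x f x).

Lemma IntR f : Int f = \int[mu]_x f x.
Proof. by rewrite /Int locked_withE. Qed.

Lemma L1P f : L1 f <-> mu.-integrable setT (EFin \o f).
Proof. by []. Qed.

Lemma L1_meas f : L1 f -> measurable_fun setT f.
Proof. by move=> /measurable_int /measurable_EFinP. Qed.

Lemma L1_eq f g : (forall x, f x = g x) -> L1 f -> L1 g.
Proof. by move=> e; have -> : g = f by apply/funext => x; rewrite e. Qed.

Lemma Int_eq f g : (forall x, f x = g x) -> Int f = Int g.
Proof. by move=> e; have -> : g = f by apply/funext => x; rewrite e. Qed.

Lemma L1D f g : L1 f -> L1 g -> L1 (fun x => f x + g x).
Proof. by move=> lf lg; apply: (integrableD measurableT lf lg). Qed.

Lemma L1Z c f : L1 f -> L1 (fun x => c * f x).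
Proof. by move=> lf; apply: (integrableZl measurableT c lf). Qed.

Lemma L1N f : L1 f -> L1 (fun x => - f x).
Proof. by move=> /(L1Z (-1)); apply: L1_eq => x; rewrite mulN1r. Qed.

Lemma L1B f g : L1 f -> L1 g -> L1 (fun x => f x - g x).
Proof. by move=> lf /L1N; apply: L1D. Qed.

Lemma L1_0 : L1 (fun=> 0).
Proof. exact: integrable0. Qed.

Lemma L1_abs f : L1 f -> L1 (fun x => `|f x|).
Proof. by move=> /integrable_abse. Qed.

Lemma L1_le f g : measurable_fun setT f -> L1 g -> (forall x, `|f x| <= g x) -> L1 f.
Proof.
move=> mf lg fg; apply: (le_integrable measurableT _ _ lg).
  exact/measurable_EFinP.
by move=> x _ /=; rewrite lee_fin (le_trans (fg x)) // ler_norm.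
Qed.

Lemma L1_ae f g : measurable_fun setT g -> L1 f ->
  {ae mu, forall x, f x = g x} -> L1 g.
Proof.
move=> mg lf fg; apply/integrableP; split; first exact/measurable_EFinP.
have /integrableP [mf] := lf.
rewrite (@ae_eq_integral _ _ _ mu setT (fun x => `|(g x)%:E|)%E) //.
- exact/measurableT_comp.
- exact/measurableT_comp/measurable_EFinP.
- by apply: ae_S fg => x e _ /=; rewrite e.
Qed.

Lemma L1_leae f g : measurable_fun setT f -> L1 g ->
  {ae mu, forall x, `|f x| <= g x} -> L1 f.
Proof.
move=> mf lg fg.
(* Clipping [f] to the range allowed by [g] gives a function dominated at every point that differs
   from [f] only on a null set. *)
pose h x := Num.max (- `|g x|) (Num.min (f x) `|g x|).
have mg := L1_meas lg.
have mh : measurable_fun setT h.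
  apply: measurable_maxr; last exact/measurable_minr/measurableT_comp.
  exact/measurableT_comp/measurableT_comp.
apply: (@L1_ae h) => //.
  apply: L1_le mh (L1_abs lg) _ => x.
  rewrite /h ler_norml le_max lexx /= ge_max ge_min lexx orbT andbT.
  by rewrite (le_trans _ (normr_ge0 (g x)))// oppr_le0.
apply: ae_S fg => x fg; rewrite /h.
move: fg => /le_trans /(_ (ler_norm _)); rewrite ler_norml => /andP[u v].
by rewrite (min_idPl v) (max_idPr u).
Qed.

Lemma IntE f : L1 f -> (\int[mu]_x (f x)%:E = (Int f)%:E)%E.
Proof. by move=> lf; rewrite IntR fineK //; apply: integrable_fin_num. Qed.

Lemma IntD f g : L1 f -> L1 g -> Int (fun x => f x + g x) = Int f + Int g.
Proof. by move=> lf lg; rewrite !IntR; apply: RintegralD. Qed.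

Lemma IntB f g : L1 f -> L1 g -> Int (fun x => f x - g x) = Int f - Int g.
Proof. by move=> lf lg; rewrite !IntR; apply: RintegralB. Qed.

(** If [f] is not integrable, one of its two parts has infinite integral, the difference is
    infinite, and [fine] sends it to 0. This default value is what frees [IntZ] and [Int_reflect]
    from integrability assumptions. *)
Lemma Int_nonL1 f : measurable_fun setT f -> ~ L1 f -> Int f = 0.
Proof.
move=> mf nlf; rewrite ?IntR /Rintegral integralE.
set p := (integral _ _ _); set n := (integral _ _ _).
have p0 : (0 <= p)%E by apply: integral_ge0.
have n0 : (0 <= n)%E by apply: integral_ge0.
have : (p + n = +oo)%E.
  rewrite -ge0_integralD //=; last 2 first.
  - by apply: measurable_funepos; apply/measurable_EFinP.
  - by apply: measurable_funeneg; apply/measurable_EFinP.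
  apply/eqP; rewrite -leye_eq leNgt; apply/negP => h.
  apply: nlf; apply/integrableP; split; first exact/measurable_EFinP.
  apply: le_lt_trans h; apply: ge0_le_integral => //.
  - by apply: measurableT_comp => //; apply/measurable_EFinP.
  - by apply: emeasurable_funD; [apply: measurable_funepos|apply: measurable_funeneg];
      apply/measurable_EFinP.
  - by move=> x _; rewrite -[X in (_ <= X)%E](congr1 (fun F => F x) (fune_abse _)).
by case: p p0 n n0 => [p| |] // ? [n| |].
Qed.

Lemma L1Z_inv c f : c != 0 -> L1 (fun x => c * f x) -> L1 f.
Proof. by move=> c0 /(L1Z c^-1); apply: L1_eq => x; rewrite mulKf. Qed.

Lemma IntZ c f : measurable_fun setT f -> Int (fun x => c * f x) = c * Int f.
Proof.
move=> mf; have [->|c0] := eqVneq c 0.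
  rewrite mul0r (@Int_eq _ (fun=> 0)) => [|x]; last by rewrite mul0r.
  by rewrite ?IntR /Rintegral integral0.
have [lf|nlf] := pselect (L1 f); first by rewrite !IntR -RintegralZl.
rewrite (Int_nonL1 mf nlf) mulr0 Int_nonL1 //; last by move/(L1Z_inv c0).
exact: measurable_funM.
Qed.

Lemma IntN f : measurable_fun setT f -> Int (fun x => - f x) = - Int f.
Proof.
move=> mf; rewrite (@Int_eq _ (fun x => -1 * f x)) => [|x]; last by rewrite mulN1r.
by rewrite IntZ // mulN1r.
Qed.

Lemma Int0 : Int (fun=> 0) = 0.
Proof. by rewrite ?IntR /Rintegral integral0. Qed.

Lemma Int_ge0 f : (forall x, 0 <= f x) -> 0 <= Int f.
Proof. by move=> f0; rewrite IntR; apply: Rintegral_ge0. Qed.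

Lemma Int_ae f g : measurable_fun setT f -> measurable_fun setT g ->
  {ae mu, forall x, f x = g x} -> Int f = Int g.
Proof.
move=> mf mg fg; rewrite ?IntR /Rintegral; congr fine.
apply: ae_eq_integral => //; [exact/measurable_EFinP|exact/measurable_EFinP|].
by apply: ae_S fg => x e _; rewrite e.
Qed.

Lemma Int_le f g : L1 f -> L1 g -> (forall x, f x <= g x) -> Int f <= Int g.
Proof. by move=> lf lg fg; rewrite !IntR; apply: le_Rintegral. Qed.

Lemma Int_leae f g : L1 f -> L1 g -> {ae mu, forall x, f x <= g x} -> Int f <= Int g.
Proof.
move=> lf lg fg; have mf := L1_meas lf; have mg := L1_meas lg.
pose h x := Num.max (f x) (g x).
have mh : measurable_fun setT h by apply: measurable_maxr.
have e : {ae mu, forall x, g x = h x}.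
  by apply: ae_S fg => x u; rewrite /h (max_idPr u).
rewrite (Int_ae mg mh e); apply: Int_le => //; first exact: L1_ae e.
by move=> x; rewrite /h le_max lexx.
Qed.

Lemma Int_absL1 f : L1 f -> `|Int f| <= Int (fun x => `|f x|).
Proof. by move=> lf; rewrite !IntR; apply: le_normr_Rintegral. Qed.

Lemma L1_bound f c : measurable_fun setT f ->
  (\int[mu]_x `|f x|%:E <= c%:E)%E -> L1 f /\ Int (fun x => `|f x|) <= c.
Proof.
move=> mf h; have lf : L1 f.
  apply/integrableP; split; first exact/measurable_EFinP.
  exact: le_lt_trans h (ltry _).
by split=> //; rewrite -lee_fin -IntE //; apply: L1_abs.
Qed.

Lemma Int_abs_eq0 f : L1 f -> Int (fun x => `|f x|) <= 0 -> {ae mu, forall x, f x = 0}.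
Proof.
move=> lf h.
have mf : measurable_fun setT (EFin \o f) by have /measurable_int := lf.
have [+ _] := ae_eq_integral_abs mu measurableT mf.
rewrite (IntE (L1_abs lf)) => h1.
have /h1 : (Int (fun x => `|f x|))%:E = 0%E.
  by congr EFin; apply/eqP; rewrite eq_le h Int_ge0.
by apply: ae_S => x /(_ I) [].
Qed.

(** The image of Lebesgue measure under x -> c x + a, multiplied by |c|, agrees with Lebesgue
    measure on half-open intervals, so the two coincide by uniqueness. *)
Lemma ge0_integral_affine (g : R -> \bar R) c a : c != 0 ->
  measurable_fun setT g -> (forall x, (0 <= g x)%E) ->
  (\int[mu]_x g x = `|c|%:E * \int[mu]_x g (c * x + a)%R)%E.
Proof.
move=> c0 mg g0.
pose phi : measurableTypeR R -> measurableTypeR R := fun x => c * x + a.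
have mphi : measurable_fun setT phi.
  by apply: measurable_funD => //; apply: measurable_funM.
rewrite -(@ge0_integral_pushforward _ _ _ _ _ phi mphi mu setT g) //.
rewrite -(@ge0_integral_mscale _ _ _ (pushforward mu phi) setT measurableT
  (NngNum (normr_ge0 c)) g) //.
apply: eq_measure_integral => A mA _.
apply: lebesgue_measure_unique => // X [[u v] _ <-] /=.
change (mu `]u, v] = `|c|%:E * mu (phi @^-1` `]u, v]))%E.
have [cp|cn|ce] := ltgtP c 0; last by rewrite ce eqxx in c0.
- have -> : phi @^-1` `]u, v] = `[(v - a) / c, (u - a) / c[%classic.
    apply/seteqP; split=> x /=; rewrite !in_itv /= /phi ltr_ndivlMr // ler_ndivrMr //
      => /andP[h1 h2]; apply/andP; split; lra.
  rewrite !lebesgue_measure_itv /= !lte_fin ltr_nM2r ?invr_lt0 // ltrD2r.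
  case: ifP => // _; last by rewrite mule0.
  by rewrite -!EFinB -EFinM ltr0_norm //; congr EFin; field.
- have -> : phi @^-1` `]u, v] = `](u - a) / c, (v - a) / c]%classic.
    apply/seteqP; split=> x /=; rewrite !in_itv /= /phi ltr_pdivrMr // ler_pdivlMr //
      => /andP[h1 h2]; apply/andP; split; lra.
  rewrite !lebesgue_measure_itv /= !lte_fin ltr_pM2r ?invr_gt0 // ltrD2r.
  case: ifP => // _; last by rewrite mule0.
  by rewrite -!EFinB -EFinM gtr0_norm //; congr EFin; field.
Qed.

Lemma ae_affine (P : R -> Prop) c a : c != 0 -> {ae mu, forall x, P x} ->
  {ae mu, forall x, P (c * x + a)}.
Proof.
move=> c0 [N [mN N0 hN]].
have mphi : measurable_fun setT (fun x : R => c * x + a).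
  by apply: measurable_funD => //; apply: measurable_funM.
exists ((fun x : R => c * x + a) @^-1` N); split; last by move=> x; apply: hN.
  by rewrite -[X in measurable X]setTI; apply: mphi.
set N' := _ @^-1` _.
have mN' : measurable N' by rewrite -[X in measurable X]setTI; apply: mphi.
(* The affine change of variables applied to the indicator of the null set shows that its preimage
   is null. *)
have e1 : (\int[mu]_x (\1_N x)%:E = 0)%E by rewrite integral_indic // setIT.
have e2 : (\int[mu]_x (\1_N (c * x + a)%R)%:E = mu N')%E.
  by rewrite -[RHS](_ : (\int[mu]_x (\1_N' x)%:E = mu N')%E) // integral_indic // setIT.
have := @ge0_integral_affine (fun x => (\1_N x)%:E) c a c0.
rewrite e1 e2 => h; apply/eqP.
suff : (`|c|%:E * mu N' == 0)%E by rewrite mule_eq0 eqe normr_eq0 (negbTE c0).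
apply/eqP/esym/h => //; exact/measurable_EFinP/measurable_indic.
Qed.

Lemma L1_ge0 f c : measurable_fun setT f -> (forall x, 0 <= f x) ->
  (\int[mu]_x (f x)%:E <= c%:E)%E -> L1 f /\ Int f <= c.
Proof.
move=> mf f0 h.
have e : (fun x => `|f x|) = f by apply/funext => x; rewrite ger0_norm.
have := @L1_bound f c mf; rewrite e; apply.
by rewrite (_ : (fun x => _) = (fun x => (f x)%:E)) //; apply/funext => x; rewrite ger0_norm.
Qed.

Lemma L1_comp f (u : R -> R) : measurable_fun setT f -> measurable_fun setT u ->
  measurable_fun setT (fun x => f (u x)).
Proof. by move=> mf mu'; apply: (measurableT_comp mf mu'). Qed.

Lemma measurable_affine c a : measurable_fun setT (fun x => c * x + a).
Proof. by apply: measurable_funD => //; apply: measurable_funM. Qed.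

Lemma L1_affine_ge0 f c a : c != 0 -> L1 f -> (forall x, 0 <= f x) ->
  L1 (fun x => f (c * x + a)) /\ Int f = `|c| * Int (fun x => f (c * x + a)).
Proof.
move=> c0 lf f0.
have mf := L1_meas lf.
have mfa : measurable_fun setT (fun x => f (c * x + a)).
  exact: L1_comp (measurable_affine c a).
have h : (\int[mu]_x (f x)%:E = `|c|%:E * \int[mu]_x (f (c * x + a)%R)%:E)%E.
  apply: (@ge0_integral_affine (EFin \o f)) => //; exact/measurable_EFinP.
have l : L1 (fun x => f (c * x + a)).
  apply: (proj1 (@L1_ge0 _ (`|c|^-1 * Int f) mfa _ _)) => //.
  by rewrite EFinM -IntE // h muleA -EFinM mulVf ?normr_eq0 // mul1e.
split=> //; apply: EFin_inj; by rewrite EFinM -!IntE.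
Qed.

Lemma funpn f x : f x = Num.max (f x) 0 - Num.max (- f x) 0.
Proof. by case: (lerP 0 (f x)) => h; [rewrite max_r ?oppr_le0 // subr0|rewrite max_l ?oppr_ge0 ?ltW // sub0r opprK]. Qed.

Lemma L1_pos f : L1 f -> L1 (fun x => Num.max (f x) 0).
Proof.
move=> lf; apply: (L1_le _ (L1_abs lf)) => [|x].
  by apply: measurable_maxr => //; apply: L1_meas.
by rewrite ger0_norm ?le_max ?lexx ?orbT // ge_max ler_norm normr_ge0.
Qed.

Lemma L1_affine f c a : c != 0 -> L1 f ->
  L1 (fun x => f (c * x + a)) /\ Int f = `|c| * Int (fun x => f (c * x + a)).
Proof.
move=> c0 lf.
have [||l1 e1] := @L1_affine_ge0 (fun x => Num.max (f x) 0) c a c0.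
- exact: L1_pos.
- by move=> x; rewrite le_max lexx orbT.
have [||l2 e2] := @L1_affine_ge0 (fun x => Num.max (- f x) 0) c a c0.
- exact/L1_pos/L1N.
- by move=> x; rewrite le_max lexx orbT.
have E g : (fun x => g x) = fun x => Num.max (g x) 0 - Num.max (- g x) 0.
  by apply/funext => x; apply: funpn.
split; first by rewrite (E (fun x => f (c * x + a))); apply: L1B.
rewrite (Int_eq (funpn f)) IntB ?e1 ?e2; last 2 first.
- exact: L1_pos.
- exact/L1_pos/L1N.
by rewrite -mulrBr -IntB //; congr (_ * _); apply: Int_eq => x; rewrite -funpn.
Qed.

Lemma L1_shift f a : L1 f -> L1 (fun x => f (x - a)) /\ Int (fun x => f (x - a)) = Int f.
Proof.
move=> /(@L1_affine f 1 (- a) (oner_neq0 _)) [l e]; split.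
  by apply: L1_eq l => x; rewrite mul1r.
by rewrite e normr1 mul1r; apply: Int_eq => x; rewrite mul1r.
Qed.

Lemma L1_reflect f a : L1 f -> L1 (fun x => f (a - x)).
Proof.
have n0 : (-1 : R) != 0 by rewrite oppr_eq0 oner_neq0.
by move=> /(@L1_affine f (- 1) a n0) [l _]; apply: L1_eq l => x; rewrite mulN1r addrC.
Qed.

Lemma Int_reflect f a : measurable_fun setT f -> Int (fun x => f (a - x)) = Int f.
Proof.
have n0 : (-1 : R) != 0 by rewrite oppr_eq0 oner_neq0.
move=> mf; have [/(@L1_affine f (- 1) a n0)[_ ->]|nl] := pselect (L1 f).
  by rewrite normrN1 mul1r; apply: Int_eq => x; rewrite mulN1r addrC.
rewrite (Int_nonL1 mf nl) Int_nonL1 //.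
  by apply: L1_comp => //; apply: measurable_funB.
move=> /(@L1_reflect _ a); have -> : (fun x => f (a - (a - x))) = f; last by [].
by apply/funext => x; rewrite subKr.
Qed.

Implicit Types H : R * R -> R.

Definition L1xy H := (mu \x mu)%E.-integrable setT (EFin \o H).

Lemma L1xy_crit H : measurable_fun setT H ->
  (forall y, L1 (fun x => H (x, y))) ->
  L1 (fun y => Int (fun x => `|H (x, y)|)) -> L1xy H.
Proof.
move=> mH h1 h2; apply/integrable21ltyP; first exact/measurable_EFinP.
under eq_integral => y _.
  rewrite (_ : (\int[_]_x _)%E = (Int (fun x => `|H (x, y)|))%:E); last first.
    by rewrite -IntE //; exact: L1_abs.
  over.
by rewrite IntE // ltry.
Qed.

Lemma L1xy_swap H : L1xy H -> L1xy (fun z => H (z.2, z.1)).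
Proof.
move=> h; have mH : measurable_fun setT (EFin \o H) by have /measurable_int := h.
apply/integrable21ltyP; last exact: (proj1 (integrable12ltyP mu mu mH) h).
exact: (measurableT_comp mH (@measurable_swap _ _ _ _)).
Qed.

Lemma L1xy_Int H : L1xy H ->
  [/\ L1 (fun x => Int (fun y => H (x, y))), L1 (fun y => Int (fun x => H (x, y))) &
    Int (fun x => Int (fun y => H (x, y))) = Int (fun y => Int (fun x => H (x, y)))].
Proof.
move=> h.
have i1 := integrable_fubini_F h; have i2 := integrable_fubini_F (L1xy_swap h).
have m1 : measurable_fun setT (fun x => Int (fun y => H (x, y))).
  under eq_fun do rewrite IntR.
  by have /measurable_int/(measurableT_comp (@fine_measurable R setT measurableT)) := i1.
have m2 : measurable_fun setT (fun y => Int (fun x => H (x, y))).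
  under eq_fun do rewrite IntR.
  by have /measurable_int/(measurableT_comp (@fine_measurable R setT measurableT)) := i2.
(* Inner integrals in Fubini's theorem may be infinite or undefined on a null set; passing to [fine]
   changes them only there. *)
have fineE (F : R -> \bar R) : mu.-integrable setT F -> measurable_fun setT (fine \o F) ->
    L1 (fine \o F) /\ (\int[mu]_x F x = (Int (fine \o F))%:E)%E.
  move=> iF mF.
  have e : ae_eq mu setT F (EFin \o (fine \o F)).
    by have := integrable_ae measurableT iF; apply: ae_S => x /(_ I) fx _ /=; rewrite fineK.
  have lF : L1 (fine \o F).
    apply: (@le_integrable _ _ _ mu setT measurableT _ F) => //.
      exact/measurable_EFinP.
    move=> x _ /=; by case: (F x) => [r| |] //=; rewrite normr0 leey.
  split=> //; rewrite -IntE //; apply: ae_eq_integral => //; first by have /measurable_int := iF.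
  exact/measurable_EFinP.
have E1 : (fun x => Int (fun y => H (x, y))) = fine \o (fun x => \int[mu]_y (H (x, y))%:E)%E.
  by apply/funext => x; rewrite IntR.
have E2 : (fun y => Int (fun x => H (x, y))) = fine \o (fun y => \int[mu]_x (H (x, y))%:E)%E.
  by apply/funext => x; rewrite IntR.
rewrite E1 in m1 *; rewrite E2 in m2 *.
have [l1 e1] := fineE (fun x => \int[mu]_y (H (x, y))%:E)%E i1 m1.
have [l2 e2] := fineE (fun y => \int[mu]_x (H (x, y))%:E)%E i2 m2.
split; [exact: l1|exact: l2|].
by apply: EFin_inj; rewrite -[LHS]e1 -[RHS]e2; apply: (Fubini h).
Qed.

Lemma L1xy_ae1 H : L1xy H -> {ae mu, forall x, L1 (fun y => H (x, y))}.
Proof. exact: ae_integrable1. Qed.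

Lemma L1xy_le H K : measurable_fun setT H -> L1xy K -> (forall z, `|H z| <= K z) -> L1xy H.
Proof.
move=> mH lK HK; apply: (le_integrable measurableT _ _ lK).
  exact/measurable_EFinP.
by move=> x _ /=; rewrite lee_fin (le_trans (HK x)) // ler_norm.
Qed.

Definition n1 f := Int (fun x => `|f x|).

Lemma n1_ge0 f : 0 <= n1 f.
Proof. exact: Int_ge0. Qed.

Local Notation conv := (@convolution R).

Lemma convE f g x : conv f g x = Int (fun y => f y * g (x - y)).
Proof. by rewrite IntR. Qed.

Lemma measurable_convker f g : measurable_fun setT f -> measurable_fun setT g ->
  measurable_fun setT (fun z : R * R => f z.2 * g (z.1 - z.2)).
Proof.
move=> mf mg; apply: measurable_funM; first exact: measurableT_comp.
by apply: measurableT_comp => //; apply: measurable_funB.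
Qed.

Lemma measurable_convkerx f g x : measurable_fun setT f -> measurable_fun setT g ->
  measurable_fun setT (fun y => f y * g (x - y)).
Proof.
move=> mf mg; apply: measurable_funM => //.
by apply: L1_comp => //; apply: measurable_funB.
Qed.

Lemma conv_L1xy f g : L1 f -> L1 g -> L1xy (fun z => f z.2 * g (z.1 - z.2)).
Proof.
move=> lf lg; have mf := L1_meas lf; have mg := L1_meas lg.
apply: L1xy_crit; first exact: measurable_convker.
  by move=> y /=; have [l _] := L1_shift y lg; apply: L1Z.
apply: L1_eq (L1Z (n1 g) (L1_abs lf)) => y /=.
have [_ e] := L1_shift y (L1_abs lg).
have mg' : measurable_fun setT (fun x => `|g (x - y)|).
  by apply: measurableT_comp => //; apply: L1_comp => //; apply: measurable_funB.
rewrite /n1 -e mulrC -IntZ //.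
by apply: Int_eq => x; rewrite normrM.
Qed.

Lemma conv_ae f g : L1 f -> L1 g -> {ae mu, forall x, L1 (fun y => f y * g (x - y))}.
Proof. by move=> lf lg; apply: (L1xy_ae1 (conv_L1xy lf lg)). Qed.

Lemma conv_L1 f g : L1 f -> L1 g -> L1 (conv f g).
Proof.
move=> lf lg; have [l _ _] := L1xy_Int (conv_L1xy lf lg).
by apply: L1_eq l => x; rewrite convE.
Qed.

Lemma conv_test f g (phi : R -> R) M : L1 f -> L1 g ->
  measurable_fun setT phi -> (forall x, `|phi x| <= M) ->
  [/\ L1 (fun x => conv f g x * phi x),
      L1 (fun y => f y * Int (fun z => g z * phi (y + z))) &
      Int (fun x => conv f g x * phi x) =
      Int (fun y => f y * Int (fun z => g z * phi (y + z)))].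
Proof.
move=> lf lg mphi phiM; have mf := L1_meas lf; have mg := L1_meas lg.
have M0 : 0 <= M by apply: le_trans (phiM 0).
pose H (z : R * R) := f z.2 * g (z.1 - z.2) * phi z.1.
have mH : measurable_fun setT H.
  by apply: measurable_funM; [exact: measurable_convker|exact: measurableT_comp].
have lH : L1xy H.
  apply: (@L1xy_le _ (fun z => `|(M * f z.2)| * `|g (z.1 - z.2)|)) => //.
    exact: (conv_L1xy (L1_abs (L1Z M lf)) (L1_abs lg)).
  by move=> z; rewrite /H !normrM (ger0_norm M0) [M * _]mulrC mulrAC
    ler_wpM2r // ler_wpM2l.
have e1 x : Int (fun y => H (x, y)) = conv f g x * phi x.
  rewrite convE mulrC -IntZ; last exact: measurable_convkerx.
  by apply: Int_eq => y; rewrite /H /= mulrC.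
have e2 y : Int (fun x => H (x, y)) = f y * Int (fun z => g z * phi (y + z)).
  have mgp : measurable_fun setT (fun z => g z * phi (y + z)).
    by apply: measurable_funM => //; apply: L1_comp => //; apply: measurable_funD.
  have lgp : L1 (fun z => g z * phi (y + z)).
    apply: L1_le mgp (L1Z M (L1_abs lg)) _ => z.
    by rewrite normrM mulrC ler_wpM2r.
  have [l <-] := L1_shift y lgp.
  rewrite -IntZ; last exact: L1_meas l.
  by apply: Int_eq => x; rewrite /H /= [y + _]addrC subrK mulrA.
have [l1 l2 e] := L1xy_Int lH.
split; first by apply: L1_eq l1.
  by apply: L1_eq l2.
by rewrite -(Int_eq e1) e (Int_eq e2).
Qed.

Lemma Int_conv f g : L1 f -> L1 g -> Int (conv f g) = Int f * Int g.
Proof.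
move=> lf lg; have b1 x : `|(fun=> 1 : R) x| <= 1 :> R by rewrite normr1.
have [_ _] := @conv_test f g (fun=> 1) 1 lf lg (measurable_cst _) b1.
rewrite (@Int_eq _ (conv f g)) => [->|x]; last by rewrite mulr1.
rewrite mulrC -IntZ; last exact: L1_meas.
by apply: Int_eq => y; rewrite mulrC; congr (_ * _); apply: Int_eq => z; rewrite mulr1.
Qed.

Lemma convC f g x : measurable_fun setT f -> measurable_fun setT g ->
  conv f g x = conv g f x.
Proof.
move=> mf mg; rewrite !convE -(Int_reflect x).
  by apply: Int_eq => y; rewrite subKr mulrC.
exact: measurable_convkerx.
Qed.

Lemma conv_le_abs f g x : L1 (fun y => f y * g (x - y)) ->
  `|conv f g x| <= conv (fun y => `|f y|) (fun y => `|g y|) x.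
Proof.
move=> l; rewrite !convE; apply: le_trans (Int_absL1 l) _.
by rewrite le_eqVlt; apply/orP; left; apply/eqP/Int_eq => y; rewrite normrM.
Qed.

Lemma conv_n1 f g : L1 f -> L1 g -> n1 (conv f g) <= n1 f * n1 g.
Proof.
move=> lf lg; rewrite /n1 -Int_conv; try exact: L1_abs.
apply: Int_leae; first exact/L1_abs/conv_L1.
  by apply: conv_L1; apply: L1_abs.
by apply: ae_S (conv_ae lf lg) => x; apply: conv_le_abs.
Qed.

(** The equality holds at every point and not merely almost everywhere: each value of a convolution
    is an integral, which does not see null sets. *)
Lemma conv_congr f f' g g' x : measurable_fun setT f -> measurable_fun setT g ->
  measurable_fun setT f' -> measurable_fun setT g' ->
  {ae mu, forall x, f x = f' x} -> {ae mu, forall x, g x = g' x} ->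
  conv f g x = conv f' g' x.
Proof.
move=> mf mg mf' mg' ff gg; rewrite !convE; apply: Int_ae; try exact: measurable_convkerx.
have n0 : (-1 : R) != 0 by rewrite oppr_eq0 oner_neq0.
apply: ae_S (ae_I ff (ae_affine x n0 gg)) => y [-> e].
by move: e; rewrite mulN1r addrC => ->.
Qed.

End Integral.

(* Prevents [done] from comparing integrability hypotheses with unrelated boolean goals. *)
Global Opaque L1 L1xy.

(** * Weights and square-integrable functions *)

Section Weighted.
Variable R : realType.
Implicit Types (f g h : R -> R) (a b c s t x y : R).
Local Notation mu := (@lebesgue_measure R).
Local Notation conv := (@convolution R).

(** Restrictions to intervals and half-lines are written as products with [ind], so that every
    integral runs over the whole line and Fubini needs no domains. *)
Definition ind (b : bool) : R := b%:R.

Lemma measurable_ind d (T : measurableType d) (P : T -> bool) :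
  measurable_fun setT P -> measurable_fun setT (fun z => ind (P z)).
Proof.
move=> mP; have -> : (fun z => ind (P z)) = (fun z => if P z then 1 else 0).
  by apply/funext => z; rewrite /ind; case: (P z).
exact: measurable_fun_ifT.
Qed.

Lemma measurable_ind_le a : measurable_fun setT (fun x => ind (x <= a)).
Proof. by apply: measurable_ind; apply: measurable_fun_ler. Qed.

Lemma measurable_ind_ge a : measurable_fun setT (fun x => ind (a <= x)).
Proof. by apply: measurable_ind; apply: measurable_fun_ler. Qed.

Lemma measurable_ind_gt a : measurable_fun setT (fun x => ind (a < x)).
Proof. by apply: measurable_ind; apply: measurable_fun_ltr. Qed.

Lemma ind_ge0 (b : bool) : 0 <= ind b.
Proof. exact: ler0n. Qed.

Lemma ind_le1 (b : bool) : ind b <= 1.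
Proof. by case: b; rewrite /ind ?lexx ?ler01. Qed.

Lemma indM_norm (b : bool) x : `|ind b * x| <= `|x|.
Proof. by case: b; rewrite /ind ?mul1r ?mul0r ?normr0. Qed.

Definition L2 f := measurable_fun setT f /\ L1 (fun x => f x ^+ 2).
Definition sq f := Int (fun x => f x ^+ 2).

Lemma sq_ge0 f : 0 <= sq f.
Proof. by apply: Int_ge0 => x; apply: sqr_ge0. Qed.

Lemma L2_leae f g : measurable_fun setT f -> L2 g ->
  {ae mu, forall x, `|f x| <= `|g x|} -> L2 f /\ sq f <= sq g.
Proof.
move=> mf [mg lg] fg.
have e : {ae mu, forall x, f x ^+ 2 <= g x ^+ 2}.
  by apply: ae_S fg => x; rewrite -(ger0_norm (sqr_ge0 (f x))) -(ger0_norm (sqr_ge0 (g x)))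
    !normrX => u; rewrite lerXn2r // nnegrE.
have l : L1 (fun x => f x ^+ 2).
  apply: (L1_leae _ lg); first exact: measurable_funX.
  by apply: ae_S e => x; rewrite ger0_norm ?sqr_ge0.
by split=> //; apply: Int_leae.
Qed.

Lemma L2_le f g : measurable_fun setT f -> L2 g ->
  (forall x, `|f x| <= `|g x|) -> L2 f /\ sq f <= sq g.
Proof. by move=> mf lg fg; apply: L2_leae => //; apply: ae_T. Qed.

(** The parameter [t] brings the coefficient of one square as close to 1 as desired, which the
    contraction argument in [neumann] requires. *)
Lemma sqrD_le t x y : 0 < t -> (x + y) ^+ 2 <= (1 + t) * x ^+ 2 + (1 + t^-1) * y ^+ 2.
Proof.
move=> t0; rewrite -subr_ge0.
have -> : (1 + t) * x ^+ 2 + (1 + t^-1) * y ^+ 2 - (x + y) ^+ 2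
  = t^-1 * (t * x - y) ^+ 2 by field; rewrite gt_eqF.
by rewrite mulr_ge0 ?sqr_ge0 // invr_ge0 ltW.
Qed.

Lemma L2Dt t f g : 0 < t -> L2 f -> L2 g ->
  L2 (fun x => f x + g x) /\
  sq (fun x => f x + g x) <= (1 + t) * sq f + (1 + t^-1) * sq g.
Proof.
move=> t0 [mf lf] [mg lg].
have m : measurable_fun setT (fun x => f x + g x) by apply: measurable_funD.
have l : L1 (fun x => (1 + t) * f x ^+ 2 + (1 + t^-1) * g x ^+ 2).
  by apply: L1D; apply: L1Z.
have l2 : L1 (fun x => (f x + g x) ^+ 2).
  apply: (L1_le _ l) => [|x]; first exact: measurable_funX.
  by rewrite ger0_norm ?sqr_ge0 // sqrD_le.
split=> //; rewrite /sq -!IntZ; try exact: measurable_funX.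
rewrite -IntD; try exact: L1Z.
by apply: Int_le => // x; apply: sqrD_le.
Qed.

Lemma L2Z c f : L2 f -> L2 (fun x => c * f x) /\ sq (fun x => c * f x) = c ^+ 2 * sq f.
Proof.
move=> [mf lf]; have e x : c ^+ 2 * f x ^+ 2 = (c * f x) ^+ 2 by rewrite exprMn.
split; last by rewrite /sq -(Int_eq e) IntZ //; apply: measurable_funX.
by split; [exact: measurable_funM|apply: L1_eq e _; apply: L1Z].
Qed.

Lemma quad_discr a b c : 0 <= c -> (forall t, 0 <= a - 2 * t * b + t ^+ 2 * c) ->
  b ^+ 2 <= a * c.
Proof.
rewrite le_eqVlt => /predU1P[<-|c0] h; last first.
  have := h (b / c).
  have -> : a - 2 * (b / c) * b + (b / c) ^+ 2 * c = (a * c - b ^+ 2) / c.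
    by field; rewrite gt_eqF.
  by rewrite pmulr_lge0 ?invr_gt0 // subr_ge0.
have [->|b0] := eqVneq b 0; first by rewrite expr0n mulr0.
(* For c = 0 the polynomial is affine in t, and at this value of t it would equal -1. *)
have := h ((a + 1) / (2 * b)); rewrite mulr0 addr0.
have -> : a - 2 * ((a + 1) / (2 * b)) * b = - 1 by field.
by rewrite oppr_ge0 ler10.
Qed.

Lemma cauchy_schwarz f g : L2 f -> L2 g ->
  L1 (fun x => f x * g x) /\ (Int (fun x => `|f x * g x|)) ^+ 2 <= sq f * sq g.
Proof.
move=> [mf lf] [mg lg].
have m : measurable_fun setT (fun x => f x * g x) by apply: measurable_funM.
have l : L1 (fun x => f x * g x).
  apply: (L1_le m (L1D lf lg)) => x; rewrite normrM.
  rewrite -(ger0_norm (sqr_ge0 (f x))) -(ger0_norm (sqr_ge0 (g x))) !normrX.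
  set u := `|f x|; set v := `|g x|.
  have h : u * v <= (u ^+ 2 + v ^+ 2) / 2 by have := sqr_ge0 (u - v); nra.
  have := sqr_ge0 u; have := sqr_ge0 v; nra.
split=> //; apply: quad_discr; first exact: sq_ge0.
move=> t; rewrite /sq -!IntZ; try exact: measurable_funX;
  last by apply: measurableT_comp.
have l1 : L1 (fun x => 2 * t * `|f x * g x|) by apply/L1Z/L1_abs.
rewrite -IntB // -IntD; [|exact: L1B|exact: L1Z].
apply: Int_ge0 => x; rewrite normrM.
rewrite -(ger0_norm (sqr_ge0 (f x))) -(ger0_norm (sqr_ge0 (g x))) !normrX.
by have := sqr_ge0 (`|f x| - t * `|g x|); nra.
Qed.

Lemma measurable_Int (H : R * R -> R) : measurable_fun setT H ->
  measurable_fun setT (fun x => Int (fun y => H (x, y))).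
Proof.
move=> mH; under eq_fun do rewrite IntR /Rintegral.
apply: (measurableT_comp (@fine_measurable R setT measurableT)).
under eq_fun do rewrite integralE.
apply: emeasurable_funB.
- have mp : measurable_fun setT (fun z : R * R => (EFin \o H)^\+ z)%E.
    by apply: measurable_funepos; apply/measurable_EFinP.
  have p0 z : (0 <= (EFin \o H)^\+ z)%E by apply: funepos_ge0.
  have := @measurable_fun_fubini_tonelli_F _ _ _ _ R mu _ mp p0.
  by apply: eq_measurable_fun => x _; apply: eq_integral => y _; rewrite !funeposE.
- have mn : measurable_fun setT (fun z : R * R => (EFin \o H)^\- z)%E.
    by apply: measurable_funeneg; apply/measurable_EFinP.
  have p0 z : (0 <= (EFin \o H)^\- z)%E by apply: funeneg_ge0.
  have := @measurable_fun_fubini_tonelli_F _ _ _ _ R mu _ mn p0.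
  by apply: eq_measurable_fun => x _; apply: eq_integral => y _; rewrite !funenegE.
Qed.

Lemma measurable_conv f g : measurable_fun setT f -> measurable_fun setT g ->
  measurable_fun setT (conv f g).
Proof.
move=> mf mg; have -> : conv f g = (fun x => Int (fun y => f y * g (x - y))).
  by apply/funext => x; rewrite convE.
apply: (@measurable_Int (fun z => f z.2 * g (z.1 - z.2))).
exact: measurable_convker.
Qed.

(** Write |f| |g| as the product of sqrt |f| and sqrt |f| |g|; Cauchy-Schwarz bounds the square of
    the convolution by ||f||_1 times the convolution of |f| with g^2, and this is integrable. *)
Lemma young2 f g : L1 f -> L2 g ->
  [/\ {ae mu, forall x, L1 (fun y => f y * g (x - y))}, L2 (conv f g) &
    sq (conv f g) <= n1 f ^+ 2 * sq g].
Proof.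
move=> lf [mg lg]; have mf := L1_meas lf; have laf := L1_abs lf.
pose u y := Num.sqrt `|f y|.
have mu' : measurable_fun setT u.
  apply: measurableT_comp; last exact: measurableT_comp.
  by apply: continuous_measurable_fun; apply: sqrt_continuous.
have u2 y : u y ^+ 2 = `|f y| by rewrite sqr_sqrtr.
have l2u : L2 u by split=> //; apply: L1_eq laf => y; rewrite u2.
have k : {ae mu, forall x, L1 (fun y => f y * g (x - y)) /\
    (conv f g x) ^+ 2 <= n1 f * conv (fun y => `|f y|) (fun y => g y ^+ 2) x}.
  apply: ae_S (conv_ae laf lg) => x lx.
  have mgx : measurable_fun setT (fun y => g (x - y)).
    by apply: L1_comp => //; apply: measurable_funB.
  have l2v : L2 (fun y => u y * g (x - y)).
    split; first exact: measurable_funM.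
    by apply: L1_eq lx => y; rewrite exprMn u2.
  have [luv cs] := cauchy_schwarz l2u l2v.
  have e y : `|u y * (u y * g (x - y))| = `|f y * g (x - y)|.
    by rewrite mulrA -expr2 u2 !normrM normr_id.
  have l : L1 (fun y => f y * g (x - y)).
    apply: (L1_le _ (L1_abs luv)); first exact: measurable_convkerx.
    by move=> y; rewrite e.
  split=> //; have -> : n1 f = sq u by apply: Int_eq => y; rewrite u2.
  have -> : conv (fun y => `|f y|) (fun y => g y ^+ 2) x = sq (fun y => u y * g (x - y)).
    by rewrite convE; apply: Int_eq => y; rewrite exprMn u2.
  apply: le_trans cs; rewrite (Int_eq e) -(ger0_norm (sqr_ge0 _)) normrX.
  by rewrite convE lerXn2r ?nnegrE ?Int_ge0 // Int_absL1.
have lc := conv_L1 laf lg.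
have mc : measurable_fun setT (conv f g) by apply: measurable_conv.
have ae2 : {ae mu, forall x, conv f g x ^+ 2 <=
    n1 f * conv (fun y => `|f y|) (fun y => g y ^+ 2) x} by apply: ae_S k => x [].
have l2 : L1 (fun x => conv f g x ^+ 2).
  apply: (L1_leae _ (L1Z (n1 f) lc)); first exact: measurable_funX.
  by apply: ae_S ae2 => x; rewrite ger0_norm ?sqr_ge0.
split=> //; first by apply: ae_S k => x [].
rewrite expr2 -mulrA -[X in _ * X](Int_conv laf lg) -IntZ; last exact: L1_meas.
by apply: Int_leae => //; apply: L1Z.
Qed.

(** The weight 1 + |x| replaces y: it is positive on the whole line, satisfies a subadditivity
    estimate under convolution, and is comparable with y on [1, oo). The passage to and from [norm2]
    takes place only at the end. *)
Definition wt s x : R := (1 + `|x|) `^ s.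

Lemma wt_base x : 1 <= 1 + `|x|.
Proof. by rewrite lerDl. Qed.

Lemma wt_gt0 s x : 0 < wt s x.
Proof. by apply: powR_gt0; apply: lt_le_trans (wt_base x). Qed.

Lemma wt_ge0 s x : 0 <= wt s x.
Proof. exact/ltW/wt_gt0. Qed.

Lemma wtD s t x : wt (s + t) x = wt s x * wt t x.
Proof. by rewrite /wt powRD // (gt_eqF (lt_le_trans ltr01 (wt_base x))) implybT. Qed.

Lemma wt_le s t x : s <= t -> wt s x <= wt t x.
Proof. by move=> st; apply: ler_powR => //; apply: wt_base. Qed.

Lemma wt0 x : wt 0 x = 1.
Proof. by rewrite /wt powRr0. Qed.

Lemma measurable_wt s : measurable_fun setT (wt s).
Proof.
apply: (@measurableT_comp _ _ _ _ _ _ (fun z : R => z `^ s)); first exact: measurable_powR.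
by apply: measurable_funD => //; apply: measurableT_comp.
Qed.

Lemma wt_sub s : 0 <= s -> forall x y, wt s (x + y) <= 2 `^ s * (wt s x + wt s y).
Proof.
move=> s0 x y.
wlog xy : x y / `|x| <= `|y|.
  move=> h; have [/h//|/ltW/h] := leP `|x| `|y|.
  by rewrite addrC [wt s y + _]addrC.
apply: (@le_trans _ _ (2 `^ s * wt s y)); last first.
  by rewrite ler_wpM2l ?powR_ge0 // lerDr wt_ge0.
have h := wt_base y; have h' := ler_normD x y; have h2 := wt_base (x + y).
rewrite /wt -powRM ?ler0n //.
by apply: ge0_ler_powR => //; rewrite ?nnegrE; lra.
Qed.

(** Either |y| is at most e (1 + |x|), and then 1 + |x + y| is at most (1 + e)(1 + |x|), or 1 + |x|
    is controlled by |y| / e. All the loss is thus placed on the second term, while the first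
    coefficient tends to 1 with [e]. *)
Lemma wt_sub_sharp s e : 0 <= s -> 0 < e -> exists2 C, 0 <= C &
  forall x y, wt s (x + y) <= (1 + e) `^ s * wt s x + C * wt s y.
Proof.
move=> s0 e0; exists ((1 + e^-1) `^ s); first exact: powR_ge0.
have ei : 0 < e^-1 by rewrite invr_gt0.
move=> x y; have b1 := wt_base x; have b2 := wt_base y; have b3 := ler_normD x y.
have [h|h] := leP `|y| (e * (1 + `|x|)).
  apply: (@le_trans _ _ ((1 + e) `^ s * wt s x)); last first.
    by rewrite lerDl mulr_ge0 ?powR_ge0 // wt_ge0.
  rewrite /wt -powRM //; [|lra].
  apply: ge0_ler_powR => //; rewrite ?nnegrE; have := wt_base (x + y); nra.
apply: (@le_trans _ _ ((1 + e^-1) `^ s * wt s y)); last first.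
  by rewrite lerDr mulr_ge0 ?powR_ge0 // wt_ge0.
rewrite /wt -powRM //; [|lra].
have h2 : 1 + `|x| <= e^-1 * `|y| by rewrite mulrC ler_pdivlMr // mulrC ltW.
apply: ge0_ler_powR => //; rewrite ?nnegrE; have := wt_base (x + y); nra.
Qed.

End Weighted.

(** * Weighted L2 spaces *)

Section WeightedL2.
Variable R : realType.
Implicit Types (f g h : R -> R) (a b c s t x y : R).
Local Notation mu := (@lebesgue_measure R).
Local Notation conv := (@convolution R).
Local Notation ind := (@ind R).

Definition H s f := measurable_fun setT f /\ L2 (fun x => wt s x * f x).
(** This is the square of the weighted norm. All estimates are made on squares, so decay exponents
    appear doubled until the final theorem. *)
Definition n2 s f := sq (fun x => wt s x * f x).

Lemma n2_ge0 s f : 0 <= n2 s f. Proof. exact: sq_ge0. Qed.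

Lemma H_leae s f g : measurable_fun setT f -> H s g ->
  {ae mu, forall x, `|f x| <= `|g x|} -> H s f /\ n2 s f <= n2 s g.
Proof.
move=> mf [mg lg] fg.
have [||l n] := @L2_leae _ (fun x => wt s x * f x) _ _ lg.
- by apply: measurable_funM => //; apply: measurable_wt.
- by apply: ae_S fg => x h; rewrite !normrM ler_wpM2l.
by split.
Qed.

Lemma H_le s f g : measurable_fun setT f -> H s g ->
  (forall x, `|f x| <= `|g x|) -> H s f /\ n2 s f <= n2 s g.
Proof. by move=> mf hg fg; apply: H_leae => //; apply: ae_T. Qed.

Lemma H_ae s f g : measurable_fun setT g -> H s f ->
  {ae mu, forall x, f x = g x} -> H s g /\ n2 s g = n2 s f.
Proof.
move=> mg hf fg; have [mf _] := hf.
have [|hg n] := H_leae mg hf; first by apply: ae_S fg => x ->.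
have [|_ n'] := H_leae mf hg; first by apply: ae_S fg => x ->.
by split=> //; apply/eqP; rewrite eq_le n n'.
Qed.

Lemma H_mono s t f : s <= t -> H t f -> H s f /\ n2 s f <= n2 t f.
Proof.
move=> st [mf lf].
have [||l n] := @L2_leae _ (fun x => wt s x * f x) _ _ lf.
- by apply: measurable_funM => //; apply: measurable_wt.
- apply: ae_T => x; rewrite !normrM ler_wpM2r // !ger0_norm ?wt_ge0 //.
  exact: wt_le.
by split.
Qed.

Lemma H0 s : H s (fun=> 0) /\ n2 s (fun=> 0) = 0.
Proof.
rewrite /H /n2 /sq (@Int_eq _ _ (fun=> 0)) => [|y]; last by rewrite mulr0 expr0n.
rewrite Int0; split=> //; split=> //.
rewrite (_ : (fun y => wt s y * 0) = fun=> 0); last by apply/funext => y; rewrite mulr0.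
by split=> //; apply: L1_eq (L1_0 R) => y; rewrite expr0n.
Qed.

Lemma HDt s t f g : 0 < t -> H s f -> H s g ->
  H s (fun x => f x + g x) /\
  n2 s (fun x => f x + g x) <= (1 + t) * n2 s f + (1 + t^-1) * n2 s g.
Proof.
move=> t0 [mf lf] [mg lg]; have [l n] := L2Dt t0 lf lg.
have e : (fun x => wt s x * f x + wt s x * g x) = (fun x => wt s x * (f x + g x)).
  by apply/funext => x; rewrite mulrDr.
rewrite e in l n; split=> //; split=> //; exact: measurable_funD.
Qed.

Lemma HD s f g : H s f -> H s g ->
  H s (fun x => f x + g x) /\ n2 s (fun x => f x + g x) <= 2 * (n2 s f + n2 s g).
Proof.
by move=> lf lg; have := HDt ltr01 lf lg; rewrite invr1 mulrDr.
Qed.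

Lemma HZ s c f : H s f ->
  H s (fun x => c * f x) /\ n2 s (fun x => c * f x) = c ^+ 2 * n2 s f.
Proof.
move=> [mf lf]; have [l n] := L2Z c lf.
have e : (fun x => c * (wt s x * f x)) = (fun x => wt s x * (c * f x)).
  by apply/funext => x; rewrite mulrCA.
rewrite e in l n; split=> //; split=> //; exact: measurable_funM.
Qed.

Lemma HB s f g : H s f -> H s g ->
  H s (fun x => f x - g x) /\ n2 s (fun x => f x - g x) <= 2 * (n2 s f + n2 s g).
Proof.
move=> hf hg; have [hg' n] := HZ (- 1) hg; have := HD hf hg'.
rewrite n sqrrN expr1n mul1r.
by have -> : (fun x => f x + -1 * g x) = (fun x => f x - g x)
  by apply/funext => x; rewrite mulN1r.
Qed.

Lemma H_abs s f : H s f -> H s (fun x => `|f x|) /\ n2 s (fun x => `|f x|) = n2 s f.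
Proof.
move=> hf; have [mf _] := hf; have m : measurable_fun setT (fun x => `|f x|).
  exact: measurableT_comp.
have [|h1 n1] := H_le m hf; first by move=> x; rewrite normr_id.
have [|h2 n2] := H_le mf h1; first by move=> x; rewrite normr_id.
by split=> //; apply/eqP; rewrite eq_le n1 n2.
Qed.

(** The weight inequality distributes the weight over one factor at a time, and [young2] applies to
    each of the two resulting convolutions. The constants [A], [B] and [t] stay free so that one of
    the two terms can be given a coefficient near 1. *)
Lemma weighted_young s A B t f g : 0 <= A -> 0 <= B ->
  (forall x y, wt s (x + y) <= A * wt s x + B * wt s y) -> 0 < t ->
  L1 f -> L1 g -> H s f -> H s g ->
  H s (conv f g) /\ n2 s (conv f g) <=
    (1 + t) * (A ^+ 2 * (n1 g ^+ 2 * n2 s f))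
    + (1 + t^-1) * (B ^+ 2 * (n1 f ^+ 2 * n2 s g)).
Proof.
move=> A0 B0 AB t0 lf lg [mf hf] [mg hg].
have [ae1 l1 q1] := young2 lg hf; have [ae2 l2 q2] := young2 lf hg.
have lf' := L1_abs lf; have lg' := L1_abs lg.
pose F x := `|wt s x * f x|; pose G x := `|wt s x * g x|.
have mF : measurable_fun setT F by apply: measurableT_comp => //; case: hf.
have mG : measurable_fun setT G by apply: measurableT_comp => //; case: hg.
have absL2 u : L2 u -> L2 (fun x => `|u x|) /\ sq (fun x => `|u x|) <= sq u.
  move=> lu; apply: L2_le => // [|x]; last by rewrite normr_id.
  by apply: measurableT_comp => //; case: lu.
have [hF qF] := absL2 _ hf; have [hG qG] := absL2 _ hg.
have [ae1' l1' q1'] := young2 lg' hF; have [ae2' l2' q2'] := young2 lf' hG.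
have mc : measurable_fun setT (conv f g) by apply: measurable_conv.
have [l1'' q1''] := L2Z A l1'; have [l2'' q2''] := L2Z B l2'.
have [l q] := L2Dt t0 l1'' l2''.
have [||lc qc] := @L2_leae _ (fun x => wt s x * conv f g x) _ _ l.
- by apply: measurable_funM => //; apply: measurable_wt.
- apply: ae_S (ae_I (conv_ae lf lg) (ae_I ae1' ae2')) => x [h0 [h1 h2]].
  have h1' : L1 (fun y => F y * `|g (x - y)|).
    by apply: L1_eq (L1_reflect x h1) => y; rewrite subKr mulrC.
  rewrite normrM (ger0_norm (wt_ge0 _ _)).
  apply: (@le_trans _ _ (wt s x * conv (fun y => `|f y|) (fun y => `|g y|) x)).
    by rewrite ler_wpM2l ?wt_ge0 // conv_le_abs.
  apply: le_trans (ler_norm _); rewrite [conv (fun x => `|g x|) _ _]convC //; last first.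
    exact: L1_meas.
  have l0 : L1 (fun y => `|f y| * `|g (x - y)|).
    by apply: L1_eq (L1_abs h0) => y; rewrite normrM.
  rewrite !convE -!IntZ; try exact: L1_meas.
  rewrite -IntD; try exact: L1Z.
  apply: Int_le; [exact: L1Z|by apply: L1D; apply: L1Z|move=> y].
  rewrite /F /G !normrM !(ger0_norm (wt_ge0 _ _)).
  have := AB y (x - y); rewrite addrC subrK => h.
  have := ler_wpM2r (mulr_ge0 (normr_ge0 (f y)) (normr_ge0 (g (x - y)))) h.
  move=> /le_trans; apply; rewrite le_eqVlt; apply/orP; left; apply/eqP; ring.
split=> //; apply: le_trans qc _; apply: le_trans q _.
have n1a (u : R -> R) : n1 (fun x => `|u x|) = n1 u by apply: Int_eq => x; rewrite normr_id.
have t1 : 0 <= 1 + t by rewrite addr_ge0 // ltW.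
have t2 : 0 <= 1 + t^-1 by rewrite addr_ge0 // invr_ge0 ltW.
rewrite q1'' q2''; apply: lerD.
  apply: (ler_wpM2l t1); apply: (ler_wpM2l (sqr_ge0 A)).
  by apply: (le_trans q1'); rewrite n1a; apply: (ler_wpM2l (sqr_ge0 (n1 g))).
apply: (ler_wpM2l t2); apply: (ler_wpM2l (sqr_ge0 B)).
by apply: (le_trans q2'); rewrite n1a; apply: (ler_wpM2l (sqr_ge0 (n1 f))).
Qed.

Lemma H_conv s f g : 0 <= s -> L1 f -> L1 g -> H s f -> H s g ->
  H s (conv f g) /\ n2 s (conv f g) <=
    2 * (2 `^ s) ^+ 2 * (n1 g ^+ 2 * n2 s f + n1 f ^+ 2 * n2 s g).
Proof.
move=> s0 lf lg hf hg; have p0 : 0 <= 2 `^ s :> R := powR_ge0 _ _.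
have [|h n] := @weighted_young s _ _ 1 f g p0 p0 _ ltr01 lf lg hf hg.
  by move=> x y; rewrite -mulrDr; apply: wt_sub.
by split=> //; apply: le_trans n _; rewrite invr1; nra.
Qed.

Lemma fatou_L1 (u : nat -> R -> R) f C : (forall n, L1 (u n)) ->
  (forall n x, 0 <= u n x) -> (forall n, Int (u n) <= C) ->
  (forall x, u n x @[n --> \oo] --> f x) -> measurable_fun setT f ->
  L1 f /\ Int f <= C.
Proof.
move=> lu u0 uC uf mf.
have f0 x : 0 <= f x.
  rewrite -(cvg_lim _ (uf x)) //; apply: limr_ge; first by apply/cvg_ex; exists (f x).
  by apply: nearW => n; apply: u0.
apply: L1_ge0 => //.
have := @fatou _ _ _ mu setT measurableT (fun n x => (u n x)%:E).
have -> : (fun x => limn_einf (fun n => (u n x)%:E)) = EFin \o f.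
  apply/funext => x /=.
  have c : (fun n => (u n x)%:E) @ \oo --> (f x)%:E by apply/cvg_EFin; [apply: nearW|exact: uf].
  by rewrite (cvg_limn_einf_sup c).
move=> h; apply: le_trans (h _ _) _.
- by move=> n; have /L1_meas/measurable_EFinP := lu n.
- by move=> n x _; rewrite lee_fin.
rewrite limn_einf_lim; apply: lime_le; first exact: is_cvg_einfs.
apply: nearW => n; apply: le_trans (_ : _ <= \int[mu]_x (u n x)%:E)%E _.
  by apply: ereal_inf_lbound; exists n => /=.
by rewrite IntE // lee_fin.
Qed.

Lemma wt_nneg s x : 0 <= x -> wt s x = (1 + x) `^ s.
Proof. by move=> x0; rewrite /wt ger0_norm. Qed.

Lemma L1_restrict (D : set R) (P : R -> bool) f : measurable D ->
  (forall x, P x <-> D x) ->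
  (mu.-integrable D (EFin \o f) <-> L1 (fun x => ind (P x) * f x)) /\
  Rintegral mu D f = Int (fun x => ind (P x) * f x).
Proof.
move=> mD PD.
have e : (fun x => ind (P x) * f x) = f \_ D.
  apply/funext => x; rewrite patchE /ind.
  by case: ifPn => [/set_mem/PD ->|/negP nD]; rewrite ?mul1r //;
    case: (boolP (P x)) => [/PD/mem_set|]; rewrite ?mul0r.
split; last by rewrite IntR Rintegral_mkcond e.
have := @integrable_mkcond _ _ R mu D (EFin \o f) mD; rewrite e => h.
apply: (iff_trans h); apply: iff_sym; apply: (iff_trans (L1P _)).
by have -> : EFin \o f \_ D = (EFin \o f) \_ D
  by apply/funext => x; rewrite /= !patchE; case: ifP.
Qed.

Lemma FTC_Int (F f : R -> R) u v : u < v ->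
  (forall x, u <= x <= v -> is_derive x 1 F (f x)) ->
  (forall x, u <= x <= v -> {for x, continuous f}) ->
  L1 (fun x => ind (u <= x <= v) * f x) /\
  Int (fun x => ind (u <= x <= v) * f x) = F v - F u.
Proof.
move=> uv dF cf.
have P x : (u <= x <= v) <-> `[u, v]%classic x by rewrite /= in_itv.
have [[h _] <-] := L1_restrict f (measurable_itv `[u, v]) P.
have cw : {within `[u, v], continuous f}.
  apply: continuous_in_subspaceT => x; rewrite inE => /P; exact: cf.
have dc x : u <= x <= v -> {for x, continuous F}.
  by move=> /dF [d _]; apply/differentiable_continuous/derivable1_diffP.
split; first by apply/h/continuous_compact_integrable => //; apply: segment_compact.
rewrite /Rintegral (@continuous_FTC2 _ f F) //.
- split.
  + by move=> x; rewrite in_itv => /andP[/ltW ? /ltW ?]; have [] := dF x _; first exact/andP.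
  + by apply: cvg_at_right_filter; apply: dc; rewrite lexx ltW.
  + by apply: cvg_at_left_filter; apply: dc; rewrite lexx ltW.
- move=> x; rewrite in_itv => /andP[/ltW h1 /ltW h2].
  by rewrite derive1E; have [|_ ->] := dF x; rewrite ?h1 ?h2.
Qed.

Lemma powint b u v : b + 1 != 0 -> 0 <= u -> u < v ->
  L1 (fun x => ind (u <= x <= v) * wt b x) /\
  Int (fun x => ind (u <= x <= v) * wt b x)
    = ((1 + v) `^ (b + 1) - (1 + u) `^ (b + 1)) / (b + 1).
Proof.
move=> b1 u0 uv.
have e x : ind (u <= x <= v) * (1 + x) `^ b = ind (u <= x <= v) * wt b x.
  rewrite /ind; case: (boolP (u <= x <= v)) => [/andP[h _]|]; last by rewrite !mul0r.
  by rewrite wt_nneg // (le_trans u0).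
have [||l i] := @FTC_Int (fun x : R => (b + 1)^-1 * (1 + x) `^ (b + 1)) (fun x => (1 + x) `^ b) u v uv.
- move=> x /andP[ux xv]; have x0 : 0 < 1 + x by lra.
  have := is_derive1_powR (b + 1) x0 => d.
  have d1 : is_derive x 1 (fun x : R => 1 + x) 1.
    have := is_derive_shift x (1 : R) 1.
    by have -> : shift (1 : R) = (fun x : R => 1 + x) by apply/funext => z; rewrite /shift addrC.
  have dc := @is_derive1_comp R (fun x : R => x `^ (b + 1)) (fun x : R => 1 + x) x _ _ d d1.
  have -> : (1 + x) `^ b = (b + 1)^-1 *: ((b + 1) * (1 + x) `^ (b + 1 - 1) * 1).
    by rewrite /GRing.scale /= mulr1 mulKf // addrK.
  exact: is_deriveZ.
- move=> x /andP[ux xv]; have x0 : 0 < 1 + x by lra.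
  have := is_derive1_powR b x0 => d.
  have d1 : is_derive x 1 (fun x : R => 1 + x) 1.
    have := is_derive_shift x (1 : R) 1.
    by have -> : shift (1 : R) = (fun x : R => 1 + x) by apply/funext => z; rewrite /shift addrC.
  have [dc _] := @is_derive1_comp R (fun x : R => x `^ b) (fun x : R => 1 + x) x _ _ d d1.
  exact/differentiable_continuous/derivable1_diffP.
split; first exact: L1_eq e l.
by rewrite -(Int_eq e) i -mulrBr mulrC.
Qed.

Lemma indE_le (b1 b2 : bool) x : (b1 -> b2) -> 0 <= x -> ind b1 * x <= ind b2 * x.
Proof.
by move=> h x0; rewrite ler_wpM2r // /ind ler_nat; case: b1 h => // ->.
Qed.

Lemma indT (b : bool) : b -> ind b = 1.
Proof. by rewrite /ind => ->. Qed.

Lemma indF (b : bool) : ~~ b -> ind b = 0.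
Proof. by rewrite /ind => /negbTE ->. Qed.

Lemma measurable_itvind u v : measurable_fun setT (fun x => ind (u <= x <= v)).
Proof.
have -> : (fun x => ind (u <= x <= v)) = (fun x => ind (u <= x) * ind (x <= v)).
  by apply/funext => x; rewrite /ind; case: (u <= x); rewrite ?mul1r ?mul0r.
by apply: measurable_funM; [exact: measurable_ind_ge|exact: measurable_ind_le].
Qed.

Lemma powint_ub b v : -1 < b -> 0 <= v ->
  L1 (fun x => ind (0 <= x <= v) * wt b x) /\
  Int (fun x => ind (0 <= x <= v) * wt b x) <= wt (b + 1) v / (b + 1).
Proof.
move=> b1; rewrite le_eqVlt => /predU1P[<-|v0].
  have m : measurable_fun setT (fun x => ind (0 <= x <= 0) * wt b x).
    by apply: measurable_funM; [exact: measurable_itvind|exact: measurable_wt].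
  have e : {ae mu, forall x, 0 = ind (0 <= x <= 0) * wt b x}.
    exists [set 0]; split; [exact: measurable_set1|exact: lebesgue_measure_set1|].
    move=> x /= h; apply: contrapT => x0; apply: h; rewrite /ind.
    by case: (boolP (0 <= x <= 0)) => [/le_anti h|]; rewrite ?mul0r //; case: x0.
  split; first exact: L1_ae m (L1_0 R) e.
  by rewrite -(Int_ae (measurable_cst _) m e) Int0 divr_ge0 ?wt_ge0 //; lra.
have [||l ->] := @powint b 0 v _ _ v0 => //; first by rewrite gt_eqF //; lra.
split=> //; rewrite wt_nneg ?(ltW v0) //; apply: ler_wpM2r; first by rewrite invr_ge0; lra.
by rewrite gerBl powR_ge0.
Qed.

Lemma powint_uby b u : b < -1 -> 0 <= u ->
  L1 (fun x => ind (u <= x) * wt b x) /\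
  Int (fun x => ind (u <= x) * wt b x) <= wt (b + 1) u / (- (b + 1)).
Proof.
move=> b1 u0.
have b2 : b + 1 != 0 by rewrite lt_eqF //; lra.
have h (n : nat) : u < u + n.+1%:R by rewrite ltrDl.
apply: (@fatou_L1 (fun n x => ind (u <= x <= u + n.+1%:R) * wt b x)).
- by move=> n; have [] := powint b2 u0 (h n).
- by move=> n x; rewrite mulr_ge0 ?wt_ge0 ?ind_ge0.
- move=> n; have [_ ->] := powint b2 u0 (h n).
  rewrite wt_nneg // -subr_ge0.
  set P := (1 + u) `^ (b + 1); set Q := (1 + (u + n.+1%:R)) `^ (b + 1).
  have -> : P / - (b + 1) - (Q - P) / (b + 1) = Q / - (b + 1) by field.
  by rewrite divr_ge0 ?powR_ge0 //; lra.
- move=> x; apply: cvg_near_cst; near=> n.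
  have [ux|] := boolP (u <= x); last by [].
  rewrite /ind /= (_ : x <= _) //.
  have : x - u < n.+1%:R.
    apply: (@lt_le_trans _ _ n%:R); last by rewrite ler_nat.
    near: n; exact: nbhs_infty_gtr.
  by lra.
- by apply: measurable_funM; [exact: measurable_ind_ge|exact: measurable_wt].
Unshelve. all: by end_near. Qed.

Lemma wt_opp s x : wt s (- x) = wt s x.
Proof. by rewrite /wt normrN. Qed.

Lemma wt_L1 b : b < -1 -> L1 (wt b).
Proof.
move=> b1; have [l _] := powint_uby b1 (lexx 0).
apply: (L1_le (measurable_wt b) (L1D l (L1_reflect 0 l))) => x.
rewrite ger0_norm ?wt_ge0 // sub0r wt_opp -mulrDl -[X in X <= _]mul1r.
rewrite ler_wpM2r ?wt_ge0 // oppr_ge0 /ind.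
by have [|/ltW ->] := leP 0 x; rewrite ?lerDl ?lerDr.
Qed.

Lemma wtN s x : wt (- s) x * wt s x = 1.
Proof. by rewrite -wtD addNr wt0. Qed.

Lemma wt_sqr s x : wt s x ^+ 2 = wt (s + s) x.
Proof. by rewrite expr2 wtD. Qed.

Lemma L2_wt s : 2^-1 < s -> L2 (wt (- s)).
Proof.
move=> s1; split; first exact: measurable_wt.
apply: (L1_eq (fun x => esym (wt_sqr _ x))); apply: wt_L1; lra.
Qed.

(** Cauchy-Schwarz against [wt (- s)], which is square integrable since s > 1/2. This threshold is
    behind every condition of the form gam > 3/2: one power of the weight is spent on a first
    moment. *)
Lemma H_L1 s : 2^-1 < s -> exists2 C, 0 <= C &
  forall f, H s f -> L1 f /\ n1 f ^+ 2 <= C * n2 s f.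
Proof.
move=> s1; exists (sq (wt (- s))); first exact: sq_ge0.
move=> f [mf hf]; have [l c] := cauchy_schwarz (L2_wt s1) hf.
have e x : wt (- s) x * (wt s x * f x) = f x by rewrite mulrA wtN mul1r.
split; first exact: L1_eq e l.
by apply: le_trans c; rewrite /n1 le_eqVlt; apply/orP; left; apply/eqP;
  congr (_ ^+ 2); apply: Int_eq => x; rewrite e.
Qed.

Definition tail f y := Int (fun x => ind (y < x) * f x).

Lemma measurable_tail f : measurable_fun setT f -> measurable_fun setT (tail f).
Proof.
move=> mf; apply: (@measurable_Int _ (fun z => ind (z.1 < z.2) * f z.2)).
apply: measurable_funM; last exact: measurableT_comp.
by apply: measurable_ind; apply: measurable_fun_ltr.
Qed.

(* Cauchy-Schwarz with weight [a]. *)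
Lemma tail_bound a : 2^-1 < a -> exists2 C, 0 <= C &
  forall f y, 0 <= y -> H a f ->
  [/\ L1 (fun x => ind (y < x) * `|f x|), L1 (fun x => ind (y < x) * (wt a x * f x) ^+ 2) &
   tail (fun x => `|f x|) y ^+ 2 <=
     C * wt (1 - (a + a)) y * Int (fun x => ind (y < x) * (wt a x * f x) ^+ 2)].
Proof.
move=> a1; exists (- (- a + - a + 1))^-1; first by rewrite invr_ge0; lra.
move=> f y y0 [mf hf].
have a2 : - a + - a < -1 by lra.
have [l i] := powint_uby a2 y0.
have idem (b : bool) x : (ind b * x) ^+ 2 = ind b * x ^+ 2.
  by rewrite /ind; case: b; rewrite ?mul1r ?mul0r ?expr0n.
have mi : measurable_fun setT (fun x => ind (y < x)) by apply: measurable_ind_gt.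
pose u x := ind (y < x) * wt (- a) x; pose v x := ind (y < x) * (wt a x * f x).
have mu' : measurable_fun setT u by apply: measurable_funM => //; apply: measurable_wt.
have l1 : L1 (fun x => ind (y < x) * wt (- a + - a) x).
  apply: (L1_le _ l) => [|x]; first by apply: measurable_funM => //; apply: measurable_wt.
  by rewrite ger0_norm ?mulr_ge0 ?wt_ge0 ?ind_ge0 // indE_le ?wt_ge0 // => /ltW.
have lu : L2 u by split=> //; apply: L1_eq l1 => x; rewrite idem wt_sqr.
have mwf : measurable_fun setT (fun x => wt a x * f x).
  by apply: measurable_funM => //; apply: measurable_wt.
have [||lv _] := @L2_le _ v _ _ hf.
- exact: measurable_funM.
- by move=> x; apply: indM_norm.
have [luv c] := cauchy_schwarz lu lv.
have e x : `|u x * v x| = ind (y < x) * `|f x|.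
  rewrite /u /v /ind; case: (y < x); rewrite ?mul0r ?normr0 //.
  by rewrite !mul1r mulrA wtN mul1r.
split; first exact: L1_eq e (L1_abs luv).
  by have [_] := lv; apply: L1_eq => x; rewrite /v idem.
have -> : tail (fun x => `|f x|) y = Int (fun x => `|u x * v x|).
  by apply: Int_eq => x; rewrite e.
apply: le_trans c _; have -> : sq v = Int (fun x => ind (y < x) * (wt a x * f x) ^+ 2).
  by apply: Int_eq => x; rewrite /v idem.
apply: ler_wpM2r; first by apply: Int_ge0 => x; rewrite mulr_ge0 ?ind_ge0 ?sqr_ge0.
have -> : 1 - (a + a) = - a + - a + 1 by ring.
rewrite mulrC; apply: le_trans i.
apply: Int_le => //; first by case: lu.
move=> x; rewrite /u idem wt_sqr; apply: indE_le; last exact: wt_ge0.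
exact: ltW.
Qed.

Lemma tail_abs f y : L1 f -> `|tail f y| <= tail (fun x => `|f x|) y.
Proof.
move=> lf; have mi : measurable_fun setT (fun x => ind (y < x)) by apply: measurable_ind_gt.
have l : L1 (fun x => ind (y < x) * f x).
  apply: (L1_le _ (L1_abs lf)) => [|x]; last exact: indM_norm.
  by apply: measurable_funM => //; apply: L1_meas.
apply: le_trans (Int_absL1 l) _; rewrite le_eqVlt; apply/orP; left; apply/eqP.
by apply: Int_eq => x; rewrite normrM (ger0_norm (ind_ge0 _ _)).
Qed.

(** A weighted Hardy inequality: taking tails costs exactly one power of the weight. Cauchy-Schwarz
    with an intermediate weight bounds the squared tail by a tail integral, and Fubini then
    integrates the outer power weight over 0 <= y <= x. *)
Lemma hardy s : - 2^-1 < s -> exists2 C, 0 <= C &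
  forall f, H (s + 1) f ->
  H s (fun y => ind (0 <= y) * tail f y) /\
  n2 s (fun y => ind (0 <= y) * tail f y) <= C * n2 (s + 1) f.
Proof.
(* [a] is the midpoint of 1/2 and s + 1, and [b] = 2 s + 1 - 2 a is the exponent left for the outer
   variable. The condition b > -1, which makes the y-integral converge to a power of x, amounts to s
   > - 1/2. *)
move=> s1; pose a := (s + 3 / 2) / 2; pose b := s - 2^-1.
have a1 : 2^-1 < a by rewrite /a; lra.
have b1 : -1 < b by rewrite /b; lra.
have [C C0 hC] := tail_bound a1.
exists (C / (b + 1)); first by rewrite divr_ge0 //; lra.
move=> f hf; have as1 : a <= s + 1 by rewrite /a; lra.
have [ha _] := H_mono as1 hf; have [mf hwf] := ha.
have s2 : 2^-1 < s + 1 by lra.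
have [C1 _ hC1] := H_L1 s2; have [lf _] := hC1 f hf.
pose phi x := (wt a x * f x) ^+ 2.
have mphi : measurable_fun setT phi by case: hwf => m _; apply: measurable_funX.
have phi0 : True -> forall x, 0 <= phi x by move=> _ x; apply: sqr_ge0.
pose K (z : R * R) := ind (0 <= z.1) * wt b z.1 * (ind (z.1 < z.2) * phi z.2).
have mK : measurable_fun setT K.
  apply: measurable_funM.
    apply: measurable_funM.
      by apply: (measurableT_comp (measurable_ind_ge (0 : R))).
    by apply: (measurableT_comp (measurable_wt b)).
  apply: measurable_funM; last exact: measurableT_comp.
  by apply: measurable_ind; apply: measurable_fun_ltr.
have K0 : True -> forall z, 0 <= K z.
  by move=> _ z; apply: mulr_ge0; apply: mulr_ge0; rewrite ?ind_ge0 ?wt_ge0 ?phi0.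
have hK x : L1 (fun y => K (y, x)) /\
    Int (fun y => `|K (y, x)|) <= (b + 1)^-1 * (wt (s + 1) x * f x) ^+ 2.
  have mKx : measurable_fun setT (fun y => K (y, x)).
    by apply: (measurableT_comp mK); apply: measurable_pair2.
  have e : (fun y => `|K (y, x)|) = (fun y => K (y, x)).
    by apply/funext => y; rewrite ger0_norm ?K0.
  have R0 : 0 <= (b + 1)^-1 * (wt (s + 1) x * f x) ^+ 2.
    by rewrite mulr_ge0 ?sqr_ge0 // invr_ge0; lra.
  have [x0|x0] := leP 0 x; last first.
    have e0 : (fun y => K (y, x)) = fun=> 0.
      apply/funext => y; rewrite /K /=; have [y0|y0] := leP 0 y; last by rewrite /ind !mul0r.
      by rewrite [ind (y < x)]indF ?mul0r ?mulr0 // -leNgt (le_trans (ltW x0)).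
    by rewrite e e0 Int0; split=> //; apply: L1_0.
  have [l i] := powint_ub b1 x0.
  have le y : K (y, x) <= phi x * (ind (0 <= y <= x) * wt b y).
    have r0 : 0 <= phi x * (ind (0 <= y <= x) * wt b y).
      by apply: mulr_ge0; rewrite ?phi0 //; apply: mulr_ge0; rewrite ?ind_ge0 ?wt_ge0.
    have [/andP[y0 yx]|h] := boolP ((0 <= y) && (y < x)).
      by rewrite /K /= /ind y0 yx (ltW yx) !mul1r mulrC.
    have -> : K (y, x) = 0; last by [].
    by move: h; rewrite /K /= /ind; case: (0 <= y); case: (y < x); rewrite ?mul0r ?mulr0.
  have lK : L1 (fun y => K (y, x)).
    by apply: (L1_le mKx (L1Z (phi x) l)) => y; rewrite ger0_norm ?K0.
  split=> //; rewrite e; apply: (@le_trans _ _ (phi x * (wt (b + 1) x / (b + 1)))).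
    apply: le_trans (Int_le lK (L1Z (phi x) l) le) _.
    by rewrite IntZ; [apply: ler_wpM2l; rewrite ?phi0|apply: L1_meas].
  rewrite mulrA mulrC ler_wpM2l ?invr_ge0 //; first lra.
  rewrite /phi !exprMn mulrAC ler_wpM2r ?sqr_ge0 // !wt_sqr -wtD.
  by apply: wt_le; rewrite /a /b; lra.
have lR : L1 (fun x => (b + 1)^-1 * (wt (s + 1) x * f x) ^+ 2) by apply: L1Z; case: hf => _ [].
have lI : L1 (fun x => Int (fun y => `|K (y, x)|)).
  apply: (L1_le _ lR) => [|x]; last by rewrite ger0_norm; [case: (hK x)|apply: Int_ge0].
  apply: (@measurable_Int _ (fun z => `|K (z.2, z.1)|)).
  apply: measurableT_comp => //; apply: (measurableT_comp mK); exact: measurable_swap.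
have lK : L1xy K by apply: L1xy_crit => // x; case: (hK x).
have [l1 l2 _] := L1xy_Int lK.
have m : measurable_fun setT (fun y => ind (0 <= y) * tail f y).
  by apply: measurable_funM; [exact: measurable_ind_ge|exact: measurable_tail].
have mw : measurable_fun setT (fun y => wt s y * (ind (0 <= y) * tail f y)).
  by apply: measurable_funM => //; apply: measurable_wt.
have key y : (wt s y * (ind (0 <= y) * tail f y)) ^+ 2 <= C * Int (fun x => K (y, x)).
  have I0 : 0 <= Int (fun x => K (y, x)) by apply: Int_ge0 => x; apply: K0.
  have [y0|y0] := leP 0 y; last by rewrite /ind mul0r mulr0 expr0n mulr_ge0.
  have [t1 t2 t3] := hC f y y0 ha.
  have -> : Int (fun x => K (y, x)) = wt b y * Int (fun x => ind (y < x) * phi x).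
    rewrite -IntZ; last exact: L1_meas.
    by apply: Int_eq => x; rewrite /K /= [ind (0 <= y)]indT // mul1r.
  rewrite [ind _]indT // mul1r exprMn wt_sqr.
  have h : tail f y ^+ 2 <= tail (fun x => `|f x|) y ^+ 2.
    rewrite -[X in X <= _]ger0_norm ?sqr_ge0 // normrX lerXn2r ?nnegrE ?tail_abs //.
    by apply: Int_ge0 => x; rewrite mulr_ge0 ?ind_ge0.
  apply: (@le_trans _ _ (wt (s + s) y * (C * wt (1 - (a + a)) y * Int (fun x => ind (y < x) * phi x)))).
    by rewrite ler_wpM2l ?wt_ge0 // (le_trans h).
  have -> : wt b y = wt (s + s) y * wt (1 - (a + a)) y.
    by rewrite -wtD; congr wt; rewrite /a /b; field.
  by rewrite le_eqVlt; apply/orP; left; apply/eqP; ring.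
have lsq : L1 (fun y => (wt s y * (ind (0 <= y) * tail f y)) ^+ 2).
  apply: (L1_le _ (L1Z C l1)) => [|y]; first exact: measurable_funX.
  by rewrite ger0_norm ?sqr_ge0.
split; first by [].
apply: le_trans (Int_le lsq (L1Z C l1) key) _.
rewrite IntZ; last exact: L1_meas.
have [_ _ ->] := L1xy_Int lK; rewrite -mulrA ler_wpM2l //.
have -> : (b + 1)^-1 * n2 (s + 1) f = Int (fun x => (b + 1)^-1 * (wt (s + 1) x * f x) ^+ 2).
  by rewrite IntZ //; case: hf => _ [m2 _]; apply: measurable_funX.
apply: Int_le => // x; have [_] := hK x; apply: le_trans.
by rewrite le_eqVlt; apply/orP; left; apply/eqP/Int_eq => y; rewrite ger0_norm ?K0.
Qed.


Lemma n2_interp s' s e : s' < s -> 0 < e -> exists Y K, [/\ 0 <= Y, 0 <= K &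
  forall f, H s f -> L2 (fun x => ind (`|x| <= Y) * f x) /\
    n2 s' f <= e * n2 s f + K * sq (fun x => ind (`|x| <= Y) * f x)].
Proof.
move=> ss e0; pose d := 2 * (s - s'); have d0 : 0 < d by rewrite /d; lra.
(* Beyond |x| = [Y] the ratio of the two squared weights, (1 + |x|)^(- d), is at most [e]; inside,
   both weights are bounded above and below. *)
pose Y := (e^-1) `^ d^-1; pose m := `|s' + s'|.
have Y0 : 0 <= Y := powR_ge0 _ _.
exists Y, ((1 + Y) `^ m); split=> [||f hf]; [by []|exact: powR_ge0|].
have [mf hwf] := hf.
have mi : measurable_fun setT (fun x : R => ind (`|x| <= Y)).
  by apply: measurable_ind; apply: measurable_fun_ler => //; apply: measurableT_comp.
have K0 : 0 <= (1 + Y) `^ m by apply: powR_ge0.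
have loc x : `|x| <= Y -> 1 <= (1 + Y) `^ `|s + s| * wt (s + s) x.
  move=> xY; apply: (@le_trans _ _ (wt `|s + s| x * wt (s + s) x)).
    rewrite -wtD -(wt0 x); apply: wt_le; have := ler_norm (- (s + s)).
    rewrite normrN; lra.
  rewrite ler_wpM2r ?wt_ge0 // /wt ge0_ler_powR ?nnegrE ?addr_ge0 //.
  by rewrite lerD2l.
have l2 : L2 (fun x => ind (`|x| <= Y) * f x).
  split; first exact: measurable_funM.
  case: hwf => _ lwf; apply: (L1_le _ (L1Z ((1 + Y) `^ `|s + s|) lwf)) => [|x].
    by apply: measurable_funX; apply: measurable_funM.
  rewrite ger0_norm ?sqr_ge0 // /ind; have [/loc h|_] := boolP (`|x| <= Y).
    rewrite mul1r exprMn wt_sqr mulrA -[X in X <= _]mul1r.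
    by rewrite ler_wpM2r ?sqr_ge0.
  by rewrite mul0r expr0n mulr_ge0 ?powR_ge0 ?sqr_ge0.
split=> //; have [hf' _] := H_mono (ltW ss) hf; have [_ [mw' lw']] := hf'.
have [_ [mw lw]] := hf; have [ml ll] := l2.
rewrite /n2 /sq -!IntZ; try exact: L1_meas.
rewrite -IntD; try exact: L1Z.
apply: Int_le => //; first by apply: L1D; apply: L1Z.
move=> x; rewrite !exprMn !wt_sqr.
have [xY|xY] := leP `|x| Y.
  rewrite [ind _]indT // expr1n mul1r; apply: (@le_trans _ _ ((1 + Y) `^ m * f x ^+ 2)).
    rewrite ler_wpM2r ?sqr_ge0 //; apply: (@le_trans _ _ (wt m x)).
      by apply: wt_le; apply: ler_norm.
    by rewrite /wt ge0_ler_powR ?nnegrE ?addr_ge0 ?lerD2l // normr_ge0.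
  rewrite lerDr; apply: mulr_ge0; first exact: ltW.
  by apply: mulr_ge0; [apply: wt_ge0|apply: sqr_ge0].
have -> : ind false ^+ 2 * f x ^+ 2 = 0 by rewrite /ind expr0n mul0r.
rewrite mulr0 addr0 [e * _]mulrA ler_wpM2r ?sqr_ge0 //.
have -> : s' + s' = (s + s) + - d by rewrite /d; ring.
rewrite wtD mulrC ler_wpM2r ?wt_ge0 //.
rewrite /wt powRN -[X in _ <= X]invrK lef_pV2 ?posrE ?invr_gt0 //.
have -> : e^-1 = Y `^ d by rewrite /Y -powRrM mulVf ?gt_eqF // powRr1 // invr_ge0 ltW.
rewrite ge0_ler_powR ?nnegrE ?addr_ge0 // ?(ltW d0) //; lra.
Qed.

(* Tested against the truncations of [f]. *)
Lemma H_lsc s (g : nat -> R -> R) f C : measurable_fun setT f ->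
  (forall n, H s (g n) /\ n2 s (g n) <= C) ->
  (forall (M : nat) n, L1 (fun x => ind (`|x| <= M%:R) * (g n x - f x))) ->
  (forall (M : nat) e, 0 < e ->
     exists n, n1 (fun x => ind (`|x| <= M%:R) * (g n x - f x)) <= e) ->
  H s f /\ n2 s f <= C.
Proof.
move=> mf hg lgf gf.
pose phi (M : nat) x := ind (`|x| <= M%:R) * (ind (`|f x| <= M%:R) * f x).
have mi (u : R -> R) M : measurable_fun setT u -> measurable_fun setT (fun x : R => ind (`|u x| <= M)).
  by move=> mu'; apply: measurable_ind; apply: measurable_fun_ler => //; apply: measurableT_comp.
have mi0 M : measurable_fun setT (fun x : R => ind (`|x| <= M)) by apply: (mi id).
have mphi M : measurable_fun setT (phi M).
  by apply: measurable_funM => //; apply: measurable_funM => //; apply: mi.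
have phi_le M x : `|phi M x| <= ind (`|x| <= M%:R) * M%:R.
  rewrite /phi normrM (ger0_norm (ind_ge0 _ _)) ler_wpM2l ?ind_ge0 // /ind.
  by case: (boolP (`|f x| <= M%:R)) => h; rewrite ?mul1r ?mul0r ?normr0 ?ler0n.
have mw : measurable_fun setT (wt s) := measurable_wt s.
have wt_loc M x : `|x| <= M%:R -> wt (s + s) x <= (1 + M%:R) `^ `|s + s|.
  move=> xM; apply: (@le_trans _ _ (wt `|s + s| x)); first by apply: wt_le; apply: ler_norm.
  by rewrite /wt ge0_ler_powR ?nnegrE ?addr_ge0 ?lerD2l.
have lphi M : L1 (fun x => (wt s x * phi M x) ^+ 2).
  pose k : R := -2.
  have l2 : L1 (wt k) by apply: wt_L1; rewrite /k; lra.
  pose m : R := `|s + s| + 2.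
  apply: (L1_le _ (L1Z ((1 + M%:R) `^ m * M%:R ^+ 2) l2)) => [|x].
    by apply: measurable_funX; apply: measurable_funM.
  rewrite ger0_norm ?sqr_ge0 // exprMn wt_sqr.
  have := phi_le M x; rewrite /ind; have [xM|_] := boolP (`|x| <= M%:R).
    rewrite mul1r => h2; have -> : s + s = (s + s + 2) + k by rewrite /k; ring.
    rewrite wtD mulrAC ler_wpM2r ?wt_ge0 //.
    apply: ler_pM; rewrite ?wt_ge0 ?sqr_ge0 //.
      apply: (@le_trans _ _ (wt m x)); first by apply: wt_le; rewrite /m lerD2r ler_norm.
      by rewrite /wt ge0_ler_powR ?nnegrE ?addr_ge0 ?lerD2l.
    by rewrite -[X in X <= _]ger0_norm ?sqr_ge0 // normrX lerXn2r ?nnegrE.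
  rewrite mul0r normr_le0 => /eqP ->; rewrite expr0n mulr0.
  by rewrite !mulr_ge0 ?powR_ge0 ?wt_ge0 ?sqr_ge0.
have bound M : Int (fun x => (wt s x * phi M x) ^+ 2) <= C.
  set J := Int _; pose K := (1 + M%:R) `^ `|s + s| * M%:R.
  have K0 : 0 <= K by rewrite mulr_ge0 ?powR_ge0.
  apply/ler_addgt0Pr => e e0.
  have e1 : 0 < e / (2 * (K + 1)) by rewrite divr_gt0 // mulr_gt0 //; lra.
  have [n hn] := gf M _ e1; have [[mgn [mwg lwg]] hgC] := hg n.
  pose r x := wt (s + s) x * phi M x * (g n x - f x).
  have rle x : `|r x| <= K * `|ind (`|x| <= M%:R) * (g n x - f x)|.
    rewrite /r; move: (phi_le M x); move: (phi M x) => P.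
    rewrite !normrM (ger0_norm (wt_ge0 _ _)) (ger0_norm (ind_ge0 _ _)).
    have := wt_loc M x; rewrite /ind; case: (boolP (`|x| <= M%:R)) => _.
      move=> /(_ isT) h1; rewrite !mul1r => h2; rewrite ler_wpM2r //.
      by apply: ler_pM; rewrite ?wt_ge0.
    by move=> _; rewrite !mul0r normr_le0 => /eqP ->; rewrite normr0 !mulr0 mul0r.
  have mr : measurable_fun setT r.
    by apply: measurable_funM; [apply: measurable_funM => //; apply: measurable_wt|apply: measurable_funB].
  have lr : L1 r := L1_le mr (L1Z K (L1_abs (lgf M n))) rle.
  (* Since [phi M] times [f] equals [phi M] squared, completing the square compares the truncation
     of [f] with [g n]. The half of [J] on the right is absorbed, and the mixed error [r] is small
     because g n - f is small in L1 on the ball. *)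
  have Jle : J <= Int (fun x => 2^-1 * (wt s x * phi M x) ^+ 2 + (2^-1 * (wt s x * g n x) ^+ 2 - r x)).
    apply: Int_le => //; first by apply: L1D; [exact: L1Z|apply: L1B => //; exact: L1Z].
    move=> x; rewrite /r -wt_sqr.
    have pf : phi M x * f x = phi M x ^+ 2.
      by rewrite /phi /ind; do 2 case: (_ <= _); rewrite ?(mul0r, mul1r, mulr0, expr2).
    have := sqr_ge0 (wt s x * phi M x - wt s x * g n x).
    rewrite mulrBr -[X in _ - (_ - X)]mulrA pf; set W := wt s x; set P := phi M x; set G := g n x.
    by nra.
  rewrite IntD in Jle; [|exact: L1Z|by apply: L1B => //; exact: L1Z].
  rewrite IntB in Jle; [|exact: L1Z|by []].
  rewrite !IntZ in Jle; [|exact: L1_meas..].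
  have r1 : - Int r <= K * (e / (2 * (K + 1))).
    apply: le_trans (ler_norm _) _; rewrite normrN; apply: le_trans (Int_absL1 lr) _.
    apply: le_trans (Int_le (L1_abs lr) (L1Z K (L1_abs (lgf M n))) rle) _.
    by rewrite IntZ; [apply: ler_wpM2l|apply: L1_meas (L1_abs (lgf M n))].
  have r2 : K * (e / (2 * (K + 1))) <= e / 2.
    rewrite mulrA ler_pdivrMr; last lra.
    have -> : e / 2 * (2 * (K + 1)) = K * e + e by field.
    by rewrite lerDl ltW.
  by move: Jle hgC; rewrite -/J /n2 /sq; lra.
have [] := @fatou_L1 (fun M x => (wt s x * phi M x) ^+ 2) (fun x => (wt s x * f x) ^+ 2) C lphi _ bound.
- by move=> n x; apply: sqr_ge0.
- move=> x; apply: cvg_near_cst; near=> M.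
  have h : `|x| <= M%:R /\ `|f x| <= M%:R.
    by split; near: M; exact: nbhs_infty_ger.
  by rewrite /phi !indT ?mul1r; case: h.
- by apply: measurable_funX; apply: measurable_funM.
by move=> l i; split=> //; split=> //; split=> //; apply: measurable_funM.
Unshelve. all: by end_near. Qed.
End WeightedL2.

(** * Neumann series *)

Section Neumann.
Variable R : realType.
Implicit Types (f g h k : R -> R) (a b c s t x y : R).
Local Notation mu := (@lebesgue_measure R).
Local Notation conv := (@convolution R).
Local Notation ind := (@ind R).

Lemma L1_emeas f : L1 f -> measurable_fun setT (fun x => (f x)%:E).
Proof. by move=> /L1_meas lf; apply/measurable_EFinP. Qed.

Lemma fatou_ae (u : nat -> R -> R) f C : (forall n, L1 (u n)) ->
  (forall n x, 0 <= u n x) -> (forall n, Int (u n) <= C) ->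
  {ae mu, forall x, u n x @[n --> \oo] --> f x} -> measurable_fun setT f ->
  L1 f /\ Int f <= C.
Proof.
move=> lu u0 uC [N [mN N0 hN]] mf.
pose i x : R := \1_(~` N) x.
have mi : measurable_fun setT i by apply: measurable_indic; apply: measurableC.
have i01 x : i x = 0 \/ i x = 1.
  by rewrite /i indicE; case: (_ \in _); [right|left].
have le n x : i x * u n x <= u n x.
  by have [->|->] := i01 x; rewrite ?mul0r ?mul1r ?u0.
have pos n x : 0 <= i x * u n x.
  by have [->|->] := i01 x; rewrite ?mul0r ?mul1r ?u0.
have l n : L1 (fun x => i x * u n x).
  apply: (L1_le _ (lu n)) => [|x]; last by rewrite ger0_norm.
  by apply: measurable_funM => //; apply: L1_meas.
have [|||||l1 l2] := @fatou_L1 _ (fun n x => i x * u n x) (fun x => i x * f x) C.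
- exact: l.
- exact: pos.
- by move=> n; apply: le_trans (uC n); apply: Int_le => // x; apply: le.
- move=> x; have [Nx|Nx] := pselect (N x).
    have -> : i x = 0 by rewrite /i indicE memNset // => /(_ Nx).
    by rewrite mul0r; apply: cvg_near_cst; apply: nearW => n; rewrite mul0r.
  by apply: cvgM; [exact: cvg_cst|apply: contrapT => h; exact/Nx/hN].
- exact: measurable_funM.
have e : {ae mu, forall x, i x * f x = f x}.
  exists N; split=> // x /= h; apply: contrapT => Nx; apply: h.
  by rewrite /i indicE mem_set // mul1r.
split; first exact: L1_ae mf l1 e.
by rewrite -(Int_ae (L1_meas l1) mf e).
Qed.

Lemma L1_sum (u : nat -> R -> R) n : (forall i, L1 (u i)) ->
  L1 (fun x => \sum_(i < n) u i x) /\
  Int (fun x => \sum_(i < n) u i x) = \sum_(i < n) Int (u i).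
Proof.
move=> lu; elim: n => [|n [l e]].
  have -> : (fun x => \sum_(i < 0) u i x) = fun=> 0 by apply/funext => x; rewrite big_ord0.
  by rewrite big_ord0 Int0; split=> //; apply: L1_0.
have E : (fun x => \sum_(i < n.+1) u i x) = (fun x => \sum_(i < n) u i x + u n x).
  by apply/funext => x; rewrite big_ord_recr.
by rewrite E big_ord_recr /= -e IntD //; split=> //; apply: L1D.
Qed.

Lemma geom_le c n : 0 <= c -> c < 1 -> \sum_(i < n) c ^+ i <= (1 - c)^-1.
Proof.
move=> c0 c1; have h : 0 < 1 - c by lra.
rewrite -[X in _ <= X]mul1r ler_pdivlMr //.
by have := subrX1 c n; have := exprn_ge0 n c0; move: (\sum_(i < n) _) => S; lra.
Qed.

Lemma L1_series (u : nat -> R -> R) C c : 0 <= c -> c < 1 -> 0 <= C ->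
  (forall n, L1 (u n) /\ n1 (u n) <= C * c ^+ n) ->
  exists2 g, L1 g & forall N, n1 (fun x => g x - \sum_(i < N) u i x) <= C * c ^+ N / (1 - c).
Proof.
move=> c0 c1 C0 hu.
have lu n : L1 (u n) by case: (hu n).
have lau n : L1 (fun x => `|u n x|) by apply: L1_abs.
have c1' : 0 < 1 - c by lra.
pose S N x := \sum_(i < N) u i x; pose A N x := \sum_(i < N) `|u i x|.
have lS N : L1 (S N) := proj1 (L1_sum N lu).
have lA N : L1 (A N) := proj1 (@L1_sum (fun i x => `|u i x|) N lau).
have A0 N x : 0 <= A N x by apply: sumr_ge0.
have ndA x : nondecreasing_seq (fun n => (A n x)%:E).
  apply/nondecreasing_seqP => n; rewrite lee_fin /A big_ord_recr /=.
  by rewrite lerDl.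
have IA N : Int (A N) <= C / (1 - c).
  have -> : Int (A N) = \sum_(i < N) n1 (u i) := proj2 (@L1_sum (fun i x => `|u i x|) N lau).
  apply: (@le_trans _ _ (\sum_(i < N) C * c ^+ i)); first by apply: ler_sum => i _; case: (hu i).
  by rewrite -mulr_sumr ler_wpM2l // geom_le.
have good : {ae mu, forall x, cvgn (S ^~ x)}.
  pose F x := limn (fun n => (A n x)%:E).
  have mA n : measurable_fun setT (EFin \o A n) by apply: L1_emeas.
  have F0 x : (0 <= F x)%E.
    by apply: lime_ge; [apply: ereal_nondecreasing_is_cvgn|apply: nearW => n; rewrite lee_fin].
  have mF : measurable_fun setT F.
    apply: (emeasurable_fun_cvg (fun n => EFin \o A n)) => // x _.
    exact: (ereal_nondecreasing_is_cvgn (ndA x)).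
  have IF : (\int[mu]_x F x <= (C / (1 - c))%:E)%E.
    rewrite (@monotone_convergence _ _ _ mu setT measurableT (fun n => EFin \o A n)) //.
    - apply: lime_le; last first.
        by apply: nearW => n; rewrite (_ : (\int[mu]_x _)%E = (Int (A n))%:E) ?lee_fin //; apply: IntE.
      apply: ereal_nondecreasing_is_cvgn => n m nm.
      have E i : (\int[mu]_x (EFin \o A i) x)%E = (Int (A i))%:E by apply: IntE.
      rewrite !E lee_fin; apply: Int_le => // x.
      by have := ndA x _ _ nm; rewrite lee_fin.
    - by move=> n x _; rewrite lee_fin.
    - by move=> x _; apply: ndA.
  have iF : mu.-integrable setT F.
    apply/integrableP; split=> //; apply: le_lt_trans (ltry (C / (1 - c))).
    by under eq_integral do rewrite gee0_abs //.
  apply: ae_S (integrable_ae measurableT iF) => x /(_ I) Fx.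
  have : cvgn [normed series (u ^~ x)].
    apply: nondecreasing_is_cvgn.
      by apply: nondecreasing_series => n _ _; apply: normr_ge0.
    exists (fine (F x)) => _ [n _ <-]; rewrite -lee_fin fineK //.
    have -> : [normed series (u ^~ x)] n = A n x.
      by rewrite /series /= /A -(big_mkord xpredT (fun i => `|u i x|)).
    apply: lime_ge; first exact: (ereal_nondecreasing_is_cvgn (ndA x)).
    by exists n => // m nm; apply: ndA.
  move=> /normed_cvg; have -> // : series (u ^~ x) = S ^~ x.
  by apply/funext => n; rewrite /series /= /S -(big_mkord xpredT (fun i => u i x)).
(* The upper limit is defined and measurable everywhere; where the partial sums converge it is their
   limit. *)
pose g x := fine (limn_esup (fun n => (S n x)%:E)).
have mg : measurable_fun setT g.
  apply: (measurableT_comp (@fine_measurable R setT measurableT)).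
  by apply: measurable_fun_limn_esup => n; apply: L1_emeas.
have Sg : {ae mu, forall x, S n x @[n --> \oo] --> g x}.
  apply: ae_S good => x /cvg_ex[/= l Sl].
  have h : (fun n => (S n x)%:E) @ \oo --> l%:E by apply/cvg_EFin => //; apply: nearW.
  by rewrite /g (cvg_limn_einf_sup h).
have tailb N : L1 (fun x => `|g x - S N x|) /\ Int (fun x => `|g x - S N x|) <= C * c ^+ N / (1 - c).
  apply: (@fatou_ae (fun M x => `|S (N + M)%N x - S N x|)).
  - by move=> n; apply/L1_abs/L1B.
  - by move=> n x; apply: normr_ge0.
  - move=> M.
    have e x : S (N + M)%N x - S N x = \sum_(i < M) u (N + i)%N x.
      by rewrite /S big_split_ord /= addrAC subrr add0r.
    have [l i] := @L1_sum (fun i x => `|u (N + i)%N x|) M (fun i => lau (N + i)%N).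
    apply: (@le_trans _ _ (Int (fun x => \sum_(i < M) `|u (N + i)%N x|))).
      by apply: Int_le => // [|x]; [apply/L1_abs/L1B|rewrite e ler_norm_sum].
    rewrite i; apply: (@le_trans _ _ (\sum_(i < M) C * c ^+ N * c ^+ i)).
      by apply: ler_sum => j _; case: (hu (N + j)%N) => _; rewrite exprD mulrA.
    by rewrite -mulr_sumr ler_wpM2l ?geom_le // mulr_ge0 ?exprn_ge0.
  - apply: ae_S Sg => x h; apply: cvg_norm; apply: cvgB; last exact: cvg_cst.
    have := h; rewrite -(cvg_shiftn N).
    by under eq_fun do rewrite addnC.
  - apply: measurableT_comp => //; apply: measurable_funB => //; exact: L1_meas.
exists g; last by move=> N; case: (tailb N).
have [l _] := tailb 0%N; apply: (L1_le mg l) => x.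
by rewrite /S big_ord0 subr0.
Qed.


Lemma n1_le_add f g : L1 f -> L1 g -> n1 (fun x => f x + g x) <= n1 f + n1 g.
Proof.
move=> lf lg; rewrite /n1 -IntD; try exact: L1_abs.
by apply: Int_le => [||x]; [apply/L1_abs/L1D|apply: L1D; apply: L1_abs|exact: ler_normD].
Qed.

Lemma n1N f : n1 (fun x => - f x) = n1 f.
Proof. by apply: Int_eq => x; rewrite normrN. Qed.

Lemma n1_ae f g : L1 f -> measurable_fun setT g -> {ae mu, forall x, f x = g x} -> n1 f = n1 g.
Proof.
move=> lf mg fg; apply: Int_ae.
- by apply: measurableT_comp => //; apply: L1_meas.
- exact: measurableT_comp.
- by apply: ae_S fg => x ->.
Qed.

Lemma n1Z c f : L1 f -> n1 (fun x => c * f x) = `|c| * n1 f.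
Proof.
move=> lf; rewrite /n1 -IntZ; last by apply: L1_meas; apply: L1_abs.
by apply: Int_eq => x; rewrite normrM.
Qed.

Lemma conv_addr f g h : L1 f -> L1 g -> L1 h ->
  {ae mu, forall x, conv f (fun x => g x + h x) x = conv f g x + conv f h x}.
Proof.
move=> lf lg lh; apply: ae_S (ae_I (conv_ae lf lg) (conv_ae lf lh)) => x [l1 l2].
by rewrite !convE -IntD //; apply: Int_eq => y; rewrite mulrDr.
Qed.

Lemma conv_subr f g h : L1 f -> L1 g -> L1 h ->
  {ae mu, forall x, conv f (fun x => g x - h x) x = conv f g x - conv f h x}.
Proof.
move=> lf lg lh; apply: ae_S (ae_I (conv_ae lf lg) (conv_ae lf lh)) => x [l1 l2].
by rewrite !convE -IntB //; apply: Int_eq => y; rewrite mulrBr.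
Qed.

Lemma conv_ge0 f g x : (forall x, 0 <= f x) -> (forall x, 0 <= g x) -> 0 <= conv f g x.
Proof. by move=> f0 g0; rewrite convE; apply: Int_ge0 => y; rewrite mulr_ge0. Qed.

Lemma exp_small c C e : 0 <= c -> c < 1 -> 0 < e -> exists N, C * c ^+ N <= e.
Proof.
move=> c0 c1 e0; have : (fun n => C * c ^+ n) @ \oo --> C * 0.
  by apply: cvgM; [exact: cvg_cst|apply: cvg_expr; rewrite ger0_norm].
rewrite mulr0 => /cvgrPdist_le /(_ e e0) [N _ /(_ N (leqnn N))].
by rewrite sub0r normrN => h; exists N; apply: le_trans h; apply: ler_norm.
Qed.

Lemma le0_geom x c C : 0 <= c -> c < 1 -> (forall N, x <= C * c ^+ N) -> x <= 0.
Proof.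
move=> c0 c1 h; apply/ler_addgt0Pr => e e0; rewrite add0r.
by have [N hN] := @exp_small c C e c0 c1 e0; apply: le_trans hN.
Qed.

Lemma rec_bound (A : nat -> R) r C : 0 <= r -> r < 1 -> 0 <= C -> A 0%N <= C / (1 - r) ->
  (forall n, A n.+1 <= C + r * A n) -> forall n, A n <= C / (1 - r).
Proof.
move=> r0 r1 C0 A0 h; have r1' : 0 < 1 - r by lra.
elim=> // n IH; apply: le_trans (h n) _.
have -> : C / (1 - r) = C + r * (C / (1 - r)) by field; rewrite gt_eqF.
by rewrite lerD2l ler_wpM2l.
Qed.

Lemma n1_tri f g : L1 f -> L1 g -> n1 g <= n1 (fun x => f x - g x) + n1 f.
Proof.
move=> lf lg; rewrite -(n1N (fun x => f x - g x)).
apply: le_trans (n1_le_add _ lf); last exact/L1N/L1B.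
rewrite le_eqVlt; apply/orP; left; apply/eqP/Int_eq => x.
by congr `|_|; ring.
Qed.

(** The Neumann series for convolution by [k]. For the weighted clause only [n1 k < 1] is available,
    while [n2 s k] may be large: by [wt_sub_sharp] nearly all the weight can be put on the partial
    sum, so its weighted norm obeys a linear recursion with ratio close to the square of [n1 k], the
    other terms involving only L1 norms of partial sums. The bound passes to the limit by
    [H_lsc]. *)
Lemma neumann k g0 : L1 k -> n1 k < 1 -> L1 g0 -> exists g,
  [/\ L1 g, {ae mu, forall x, g x = g0 x + conv k g x},
      forall s, 0 <= s -> H s k -> H s g0 -> H s g &
      (forall x, 0 <= k x) -> (forall x, 0 <= g0 x) -> {ae mu, forall x, 0 <= g x}].
Proof.
move=> lk k1 lg0; pose c := n1 k; have c0 : 0 <= c := n1_ge0 _.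
have c1 : 0 < 1 - c by rewrite /c; lra.
pose u n := iter n (conv k) g0.
have hu n : L1 (u n) /\ n1 (u n) <= n1 g0 * c ^+ n.
  elim: n => [|n [l i]]; first by rewrite expr0 mulr1.
  split; first exact: conv_L1.
  by apply: le_trans (conv_n1 lk l) _; rewrite exprS mulrCA ler_wpM2l.
have lu n : L1 (u n) := proj1 (hu n).
have [g lg hg] := L1_series c0 k1 (n1_ge0 g0) hu.
pose S N x := \sum_(i < N) u i x.
have lS N : L1 (S N) := proj1 (L1_sum N lu).
pose D := n1 g0 / (1 - c); have D0 : 0 <= D by rewrite divr_ge0 ?n1_ge0 // ltW.
have gS N : n1 (fun x => g x - S N x) <= D * c ^+ N.
  by apply: le_trans (hg N) _; rewrite /D mulrAC.
have S_rec N : {ae mu, forall x, S N.+1 x = g0 x + conv k (S N) x}.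
  elim: N => [|N IH].
    have e : {ae mu, forall x, 0 = S 0%N x} by apply: ae_T => x; rewrite /S big_ord0.
    apply: ae_T => x; rewrite /S big_ord1 -(conv_congr _ _ _ _ _ (ae_T (fun x => erefl (k x))) e) //;
      try exact: L1_meas.
    by rewrite convE (@Int_eq _ _ (fun=> 0)) ?Int0 ?addr0 // => y; rewrite mulr0.
  apply: ae_S (ae_I IH (conv_addr lk (lS N) (lu N))) => x [IHx e].
  have -> : conv k (S N.+1) x = conv k (fun y => S N y + u N y) x.
    by congr (conv k _ x); apply/funext => y; rewrite /S big_ord_recr.
  by rewrite e addrA -IHx /S big_ord_recr.
have nS N : n1 (S N) <= 2 * D + n1 g.
  have := n1_tri lg (lS N) => h; apply: le_trans h _; rewrite lerD2r.
  apply: le_trans (gS N) _; have : c ^+ N <= 1 by rewrite exprn_ile1 // ltW // -subr_gt0.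
  by have := exprn_ge0 N c0; nra.
exists g; split=> //.
- have lr : L1 (fun x => g x - (g0 x + conv k g x)) by apply/L1B/L1D => //; apply: conv_L1.
  suff : n1 (fun x => g x - (g0 x + conv k g x)) <= 0.
    by move=> /(Int_abs_eq0 lr); apply: ae_S => x /eqP; rewrite subr_eq0 => /eqP.
  apply: (@le0_geom _ c (2 * D) c0 k1) => N.
  have lgS : L1 (fun x => g x - S N x) by apply: L1B.
  have lgS' : L1 (fun x => g x - S N.+1 x) by apply: L1B.
  have lc : L1 (conv k (fun x => g x - S N x)) by apply: conv_L1.
  rewrite (@n1_ae _ (fun x => (g x - S N.+1 x) + - conv k (fun x => g x - S N x) x)) //; last 2 first.
  - by apply: L1_meas; apply: L1D => //; apply: L1N.
  - apply: ae_S (ae_I (S_rec N) (conv_subr lk lg (lS N))) => x [-> ->]; ring.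
  apply: le_trans (n1_le_add lgS' (L1N lc)) _; rewrite n1N.
  have h1 := gS N.+1; have h2 := conv_n1 lk lgS; have h3 := gS N.
  have cN := exprn_ge0 N c0; rewrite exprS in h1.
  have h4 : c * n1 (fun x => g x - S N x) <= 1 * (D * c ^+ N).
    by apply: ler_pM; rewrite ?n1_ge0 // ltW.
  have h5 : D * (c * c ^+ N) <= D * c ^+ N by have := mulr_ge0 (mulr_ge0 D0 cN) (ltW c1); nra.
  by apply: le_trans (lerD h1 h2) _; rewrite -/c; lra.
- move=> s s0 hk hg0.
  (* With c = 1 - 4 t the product (1 + t)^2 c stays below 1; [e] is then chosen so small that (1 +
     e)^s <= 1 + t. *)
  pose t := (1 - c) / 4; have t0 : 0 < t by rewrite divr_gt0.
  have ti : 0 < t^-1 by rewrite invr_gt0.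
  pose e := (1 + t) `^ ((s + 1)^-1) - 1.
  have e0 : 0 < e.
    have s1 : 0 < (s + 1)^-1 by rewrite invr_gt0; lra.
    have := @gt0_ltr_powR R _ s1 1 (1 + t); rewrite !nnegrE powR1 subr_gt0.
    by apply; lra.
  have es : (1 + e) `^ s <= 1 + t.
    rewrite addrC subrK -powRrM ler1_powR //; first lra.
    by rewrite mulrC ler_pdivrMr ?mul1r; lra.
  have [B B0 hB] := @wt_sub_sharp R s e s0 e0.
  (* The four factors 1 + t in [r] come from adding [g0], from splitting the convolution into two
     terms, and twice from the square of (1 + e)^s. *)
  pose r := ((1 + t) ^+ 2 * c) ^+ 2.
  have q1 : 0 <= (1 + t) ^+ 2 * c by rewrite mulr_ge0 ?sqr_ge0.
  have q2 : (1 + t) ^+ 2 * c < 1 by rewrite /t -/c in k1 *; nra.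
  have r0 : 0 <= r := sqr_ge0 _.
  have r1 : r < 1 by rewrite /r expr_lt1.
  pose K := (1 + t) * ((1 + t^-1) * (B ^+ 2 * ((2 * D + n1 g) ^+ 2 * n2 s k))) + (1 + t^-1) * n2 s g0.
  have a1 : 0 <= 1 + t by lra.
  have a2 : 0 <= 1 + t^-1 by lra.
  have K0 : 0 <= K.
    have k2 := n2_ge0 s k; have g2 := n2_ge0 s g0.
    apply: addr_ge0; last exact: mulr_ge0.
    apply: mulr_ge0 => //; apply: mulr_ge0 => //; apply: mulr_ge0; first exact: sqr_ge0.
    by apply: mulr_ge0 => //; exact: sqr_ge0.
  have HS N : H s (S N) /\ n2 s (S N) <= K / (1 - r).
    have HSN M : H s (S M) /\ n2 s (S M.+1) <= K + r * n2 s (S M).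
      have step N' : H s (S N') -> H s (S N'.+1) /\ n2 s (S N'.+1) <= K + r * n2 s (S N').
        move=> hS.
        have [|hc nc] := @weighted_young _ s B ((1 + e) `^ s) t^-1 k (S N') B0 (powR_ge0 _ _) _ ti lk (lS N') hk hS.
          by move=> x y; rewrite addrC [X in _ <= X]addrC.
        rewrite invrK in nc.
        have [hcg ncg] := HDt t0 hc hg0.
        have eS : {ae mu, forall x, conv k (S N') x + g0 x = S N'.+1 x}.
          by apply: ae_S (S_rec N') => x ->; rewrite addrC.
        have [hS' ->] := H_ae (L1_meas (lS N'.+1)) hcg eS.
        split=> //; apply: (le_trans ncg).
        have E0 : 0 <= (1 + e) `^ s by apply: powR_ge0.
        have i1 : n1 (S N') ^+ 2 <= (2 * D + n1 g) ^+ 2.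
          by rewrite lerXn2r ?nnegrE ?n1_ge0 // addr_ge0 ?n1_ge0 // mulr_ge0.
        have i2 : ((1 + e) `^ s) ^+ 2 <= (1 + t) ^+ 2 by rewrite lerXn2r ?nnegrE.
        have i3 : B ^+ 2 * (n1 (S N') ^+ 2 * n2 s k) <= B ^+ 2 * ((2 * D + n1 g) ^+ 2 * n2 s k).
          by apply: ler_wpM2l; [exact: sqr_ge0|apply: ler_wpM2r => //; exact: n2_ge0].
        have i4 : ((1 + e) `^ s) ^+ 2 * (n1 k ^+ 2 * n2 s (S N')) <= (1 + t) ^+ 2 * (c ^+ 2 * n2 s (S N')).
          by apply: ler_wpM2r => //; apply: mulr_ge0; [exact: sqr_ge0|exact: n2_ge0].
        rewrite /K addrAC lerD2r.
        have -> : r * n2 s (S N') = (1 + t) * ((1 + t) * ((1 + t) ^+ 2 * (c ^+ 2 * n2 s (S N')))).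
          by rewrite /r; ring.
        rewrite -mulrDr; apply: (ler_wpM2l a1); apply: (le_trans nc); apply: lerD.
          exact: (ler_wpM2l a2).
        exact: (ler_wpM2l a1).
      have HS' : H s (S M).
        elim: M => [|M IH]; last by case: (step M IH).
        have [|//] := @H_le _ s (S 0%N) g0 (L1_meas (lS _)) hg0.
        by move=> x; rewrite /S big_ord0 normr0.
      by split=> //; case: (step M HS').
    split; first by case: (HSN N).
    apply: (@rec_bound (fun N => n2 s (S N)) r K r0 r1 K0); last by move=> n; case: (HSN n).
    rewrite /n2 /sq (@Int_eq _ _ (fun=> 0)) ?Int0 ?divr_ge0 //; first lra.
    by move=> x; rewrite /S big_ord0 mulr0 expr0n.
  have [] := @H_lsc R s S g (K / (1 - r)) (L1_meas lg) HS.
  + move=> M n; have l : L1 (fun x => S n x - g x) by apply: L1B.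
    apply: (L1_le _ (L1_abs l)) => [|x]; last exact: indM_norm.
    apply: measurable_funM; last exact: L1_meas.
    by apply: measurable_ind; apply: measurable_fun_ler => //; apply: measurableT_comp.
  + move=> M d d0; have [N hN] := @exp_small c D d c0 k1 d0; exists N.
    apply: le_trans hN; apply: le_trans (gS N).
    have l : L1 (fun x => g x - S N x) by apply: L1B.
    apply: Int_le; last by move=> x; rewrite [`|g x - _|]distrC indM_norm.
      apply: L1_abs; apply: (L1_le _ (L1_abs l)) => [|x]; last by rewrite distrC indM_norm.
      apply: measurable_funM; last by apply: measurable_funB; apply: L1_meas.
      by apply: measurable_ind; apply: measurable_fun_ler => //; apply: measurableT_comp.
    exact: L1_abs.
  by [].
- move=> kp gp.
  have uS N x : 0 <= S N x.
    apply: sumr_ge0 => i _; elim: (nat_of_ord i) x => [|n IH] x; first exact: gp.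
    by apply: conv_ge0.
  have ln : L1 (fun x => Num.max (- g x) 0) by apply/L1_pos/L1N.
  (* The partial sums are nonnegative, so the negative part of [g] is at most |g - S N|, whose
     integral tends to 0. *)
  suff : n1 (fun x => Num.max (- g x) 0) <= 0.
    move=> /(Int_abs_eq0 ln); apply: ae_S => x h.
    by have := le_max (- g x) (- g x) 0; rewrite h lexx /= oppr_le0 => ->.
  apply: (@le0_geom _ c D c0 k1) => N; apply: le_trans (gS N).
  apply: Int_le; [exact: L1_abs|by apply/L1_abs/L1B|move=> x].
  have := uS N x; have := ler_norm (- (g x - S N x)); rewrite normrN => h1 h2.
  by rewrite ger0_norm ?le_max ?lexx ?orbT // ge_max normr_ge0 andbT; lra.
Qed.
End Neumann.

(** * Laplace transforms *)

Section Laplace.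
Variable R : realType.
Implicit Types (f g h k : R -> R) (a b c s t x y : R).
Local Notation mu := (@lebesgue_measure R).
Local Notation conv := (@convolution R).
Local Notation ind := (@ind R).

Lemma EFin_meas f : measurable_fun setT f -> measurable_fun setT (fun x => (f x)%:E).
Proof. by move=> mf; apply/measurable_EFinP. Qed.

Lemma Int_dct (u : nat -> R -> R) f G : L1 G ->
  (forall n, measurable_fun setT (u n)) -> measurable_fun setT f ->
  (forall n x, `|u n x| <= G x) -> {ae mu, forall x, u n x @[n --> \oo] --> f x} ->
  L1 f /\ Int (u n) @[n --> \oo] --> Int f.
Proof.
move=> lG mu' mf uG uf.
have [] := @dominated_convergence _ _ _ mu setT measurableT (fun n x => (u n x)%:E)
  (fun x => (f x)%:E) (fun x => (G x)%:E).
- by move=> n; apply: EFin_meas.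
- exact: EFin_meas.
- by apply: ae_S uf => x h _; apply/cvg_EFin => //; apply: nearW.
- exact: (proj1 (L1P G) lG).
- by apply: ae_T => x n _; rewrite lee_fin.
move=> /L1P lf _ c; split=> //.
rewrite IntE // in c.
have e n : (\int[mu]_x (u n x)%:E)%E = (Int (u n))%:E.
  by apply: IntE; apply: (L1_le (mu' n) lG).
have {}c : (Int (u n))%:E @[n --> \oo] --> (Int f)%:E.
  by apply: cvg_trans c; apply: near_eq_cvg; apply: nearW => n; rewrite -e.
by move/fine_cvgP: c => [].
Qed.

Definition causal f := forall x, x < 0 -> f x = 0.
Definition ew s f x := expR (- s * x) * f x.
(** Integrability is required only after multiplication by exp(- s x) with s > 0, so that
    non-integrable functions such as the Heaviside function and primitives have transforms as
    well. *)
Definition LT f := [/\ measurable_fun setT f, causal f & forall s, 0 < s -> L1 (ew s f)].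
Definition Lap f s := Int (ew s f).

Lemma measurable_expM s : measurable_fun setT (fun x => expR (s * x)).
Proof. by apply: measurableT_comp => //; apply: measurable_funM. Qed.

Lemma measurable_ew s f : measurable_fun setT f -> measurable_fun setT (ew s f).
Proof. by move=> mf; apply: measurable_funM => //; apply: measurable_expM. Qed.

Lemma LT_meas f : LT f -> measurable_fun setT f. Proof. by case. Qed.

Lemma L1_LT f : causal f -> L1 f -> LT f.
Proof.
move=> cf lf; have mf := L1_meas lf; split=> // s s0.
apply: (L1_le (measurable_ew s mf) (L1_abs lf)) => x; rewrite /ew normrM.
rewrite ger0_norm ?expR_ge0 //; have [x0|/cf ->] := leP 0 x; last by rewrite normr0 mulr0.
by rewrite -[X in _ <= X]mul1r ler_wpM2r // expR_le1 mulNr oppr_le0 mulr_ge0 // ltW.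
Qed.

Lemma LT_le f g : measurable_fun setT f -> LT g -> (forall x, `|f x| <= `|g x|) -> LT f.
Proof.
move=> mf [mg cg lg] fg; split=> // [x /cg gx|s /lg l].
  by apply/eqP; rewrite -normr_le0 (le_trans (fg x)) // gx normr0.
apply: (L1_le (measurable_ew s mf) (L1_abs l)) => x; rewrite /ew !normrM.
by rewrite ler_wpM2l.
Qed.

Lemma LT_ae f g : measurable_fun setT g -> causal g -> LT f ->
  {ae mu, forall x, f x = g x} -> LT g /\ forall s, Lap g s = Lap f s.
Proof.
move=> mg cg [mf cf lf] fg; have e s : {ae mu, forall x, ew s f x = ew s g x}.
  by apply: ae_S fg => x; rewrite /ew => ->.
split; last by move=> s; rewrite /Lap -(Int_ae _ _ (e s)) //; apply: measurable_ew.
by split=> // s /lf l; apply: L1_ae l (e s); apply: measurable_ew.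
Qed.

Lemma LT_D f g : LT f -> LT g -> LT (fun x => f x + g x).
Proof.
move=> [mf cf lf] [mg cg lg]; split=> [|x x0|s s0].
- exact: measurable_funD.
- by rewrite cf // cg // addr0.
- by apply: L1_eq (L1D (lf s s0) (lg s s0)) => x; rewrite /ew mulrDr.
Qed.

Lemma Lap_D f g s : 0 < s -> LT f -> LT g -> Lap (fun x => f x + g x) s = Lap f s + Lap g s.
Proof.
move=> s0 [mf cf lf] [mg cg lg]; rewrite /Lap -IntD; [|exact: lf|exact: lg].
by apply: Int_eq => x; rewrite /ew mulrDr.
Qed.

Lemma LT_Z c f : LT f -> LT (fun x => c * f x).
Proof.
move=> [mf cf lf]; split=> [|x x0|s s0].
- exact: measurable_funM.
- by rewrite cf // mulr0.
- by apply: L1_eq (L1Z c (lf s s0)) => x; rewrite /ew mulrCA.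
Qed.

Lemma Lap_Z c f s : LT f -> Lap (fun x => c * f x) s = c * Lap f s.
Proof.
move=> [mf cf lf]; rewrite /Lap -IntZ; last exact: measurable_ew.
by apply: Int_eq => x; rewrite /ew mulrCA.
Qed.

Lemma LT_B f g : LT f -> LT g -> LT (fun x => f x - g x).
Proof.
move=> lf /(LT_Z (-1)) lg; have := LT_D lf lg.
by have -> : (fun x => f x + -1 * g x) = (fun x => f x - g x)
  by apply/funext => x; rewrite mulN1r.
Qed.

Lemma Lap_B f g s : 0 < s -> LT f -> LT g -> Lap (fun x => f x - g x) s = Lap f s - Lap g s.
Proof.
move=> s0 [mf cf lf] [mg cg lg]; rewrite /Lap -IntB; [|exact: lf|exact: lg].
by apply: Int_eq => x; rewrite /ew mulrBr.
Qed.

Lemma ew_conv s f g x : measurable_fun setT f -> measurable_fun setT g ->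
  ew s (conv f g) x = conv (ew s f) (ew s g) x.
Proof.
move=> mf mg; rewrite /ew !convE -IntZ; last exact: measurable_convkerx.
apply: Int_eq => y; rewrite mulrACA; congr (_ * _).
by rewrite -expRD; congr expR; ring.
Qed.

Lemma causal_conv f g : causal f -> causal g -> causal (conv f g).
Proof.
move=> cf cg x x0; rewrite convE (@Int_eq _ _ (fun=> 0)) ?Int0 // => y.
have [y0|/cf ->] := leP 0 y; last by rewrite mul0r.
by rewrite (cg (x - y)) ?mulr0 //; lra.
Qed.

Lemma LT_conv f g : LT f -> LT g -> LT (conv f g).
Proof.
move=> [mf cf lf] [mg cg lg]; split=> [||s s0].
- exact: measurable_conv.
- exact: causal_conv.
- by apply: L1_eq (conv_L1 (lf s s0) (lg s s0)) => x; rewrite ew_conv.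
Qed.

Lemma Lap_conv f g s : 0 < s -> LT f -> LT g -> Lap (conv f g) s = Lap f s * Lap g s.
Proof.
move=> s0 [mf cf lf] [mg cg lg]; rewrite /Lap -Int_conv; [|exact: lf|exact: lg].
by apply: Int_eq => x; rewrite ew_conv.
Qed.

Lemma LT_conv_ae f g : LT f -> LT g -> {ae mu, forall x, L1 (fun y => f y * g (x - y))}.
Proof.
move=> [mf cf lf] [mg cg lg].
apply: ae_S (conv_ae (lf 1 ltr01) (lg 1 ltr01)) => x l.
have /L1Z_inv h : expR (- 1 * x) != 0 by rewrite gt_eqF // expR_gt0.
apply: h; apply: L1_eq l => y; rewrite /ew mulrACA; congr (_ * _).
by rewrite -expRD; congr expR; ring.
Qed.

Lemma LT_mulx f : LT f -> LT (fun x => x * f x).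
Proof.
move=> [mf cf lf]; have mx : measurable_fun setT (fun x => x * f x) by apply: measurable_funM.
split=> // [x /cf ->|s s0]; first by rewrite mulr0.
have s2 : 0 < s / 2 by rewrite divr_gt0.
apply: (L1_le (measurable_ew s mx) (L1Z (s / 2)^-1 (L1_abs (lf _ s2)))) => x.
have [x0|/cf x0] := leP 0 x; last by rewrite /ew x0 !mulr0 normr0 mulr0.
rewrite /ew !normrM !(ger0_norm (expR_ge0 _)) (ger0_norm x0) !mulrA ler_wpM2r //.
have -> : - s * x = - (s / 2) * x + - (s / 2 * x) by field.
have h1 : expR (- (s / 2 * x)) * x <= (s / 2)^-1.
  rewrite expRN ler_pdivrMl ?expR_gt0 // mulrC ler_pdivlMl //.
  by have := expR_ge1Dx (s / 2 * x); lra.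
have := ler_wpM2l (expR_ge0 (- (s / 2) * x)) h1.
by rewrite expRD mulrA [X in _ -> _ <= X]mulrC.
Qed.

Lemma mulx_conv f g : LT f -> LT g -> {ae mu, forall x,
  x * conv f g x = conv (fun y => y * f y) g x + conv f (fun y => y * g y) x}.
Proof.
move=> lf lg; have lxf := LT_mulx lf; have lxg := LT_mulx lg.
have mf := LT_meas lf; have mg := LT_meas lg.
apply: ae_S (ae_I (LT_conv_ae lxf lg) (LT_conv_ae lf lxg)) => x [l1 l2].
rewrite !convE -IntD // -IntZ; last exact: measurable_convkerx.
by apply: Int_eq => y; ring.
Qed.

Lemma Lap_mulx_conv f g s : 0 < s -> LT f -> LT g ->
  Lap (fun x => x * conv f g x) s =
  Lap (fun x => x * f x) s * Lap g s + Lap f s * Lap (fun x => x * g x) s.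
Proof.
move=> s0 lf lg; have lxf := LT_mulx lf; have lxg := LT_mulx lg.
rewrite -!Lap_conv // -(Lap_D s0); try exact: LT_conv.
have l : LT (fun x => x * conv f g x) by apply/LT_mulx/LT_conv.
apply: Int_ae; try (apply: measurable_ew; apply: LT_meas); [exact: l|by apply: LT_D; apply: LT_conv|].
by apply: ae_S (mulx_conv lf lg) => x; rewrite /ew => ->.
Qed.

Lemma Lap_shift f a s : 0 <= a -> LT f ->
  LT (fun x => f (x - a)) /\ (0 < s -> Lap (fun x => f (x - a)) s = expR (- s * a) * Lap f s).
Proof.
move=> a0 [mf cf lf].
have m : measurable_fun setT (fun x => f (x - a)).
  by apply: (measurableT_comp mf); apply: measurable_funB.
have e r x : ew r (fun x => f (x - a)) x = expR (- r * a) * ew r f (x - a).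
  by rewrite /ew mulrA -expRD; congr (expR _ * _); ring.
have h r : 0 < r -> L1 (ew r (fun x => f (x - a))) /\ Lap (fun x => f (x - a)) r = expR (- r * a) * Lap f r.
  move=> r0; have [l i] := L1_shift a (lf r r0).
  split; first by apply: L1_eq (L1Z (expR (- r * a)) l) => x; rewrite e.
  by rewrite /Lap (Int_eq (e r)) IntZ ?i //; apply: L1_meas.
split; last by case/h.
by split=> // [x x0|r /h []//]; apply: cf; lra.
Qed.

Definition heav x := ind (0 <= x).

Lemma heav_Lap : LT heav /\ forall s, 0 < s -> Lap heav s = s^-1.
Proof.
have mh : measurable_fun setT heav := @measurable_ind_ge R 0.
have ft s n : 0 < s -> L1 (fun x => ind (0 <= x <= n.+1%:R) * expR (- s * x)) /\
   Int (fun x => ind (0 <= x <= n.+1%:R) * expR (- s * x)) = (1 - expR (- s * n.+1%:R)) / s.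
  move=> s0; have n0 : (0 : R) < n.+1%:R by rewrite ltr0n.
  have d x : is_derive x 1 (fun x : R => expR (- s * x)) (- s * expR (- s * x)).
    have d1 : is_derive x 1 (fun x : R => - s * x) (- s).
      by have := is_deriveZ (- s) (is_derive_id x (1 : R)); rewrite /GRing.scale /= mulr1.
    have := @is_derive1_comp R (@expR R) (fun x : R => - s * x) x _ _ (is_derive_expR _) d1.
    by rewrite mulrC.
  have [||l i] := @FTC_Int R (fun x : R => (- s)^-1 * expR (- s * x)) (fun x => expR (- s * x)) 0 n.+1%:R n0.
  - move=> x _; have := is_deriveZ (- s)^-1 (d x).
    by rewrite /GRing.scale /= mulKf // oppr_eq0 gt_eqF.
  - by move=> x _; have [dx _] := d x; apply/differentiable_continuous/derivable1_diffP.
  split=> //; rewrite i mulr0 expR0; field; rewrite gt_eqF //.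
have key s : 0 < s -> L1 (ew s heav) /\ Int (ew s heav) <= s^-1.
  move=> s0; apply: (@fatou_L1 _ (fun n x => ind (0 <= x <= n.+1%:R) * expR (- s * x))).
  - by move=> n; case: (ft s n s0).
  - by move=> n x; rewrite mulr_ge0 ?ind_ge0 ?expR_ge0.
  - move=> n; case: (ft s n s0) => _ ->; rewrite -[X in _ <= X]mul1r ler_wpM2r ?invr_ge0 ?ltW //.
    by have := expR_gt0 (- s * n.+1%:R); lra.
  - move=> x; apply: cvg_near_cst; near=> n; rewrite /ew /heav mulrC.
    have [x0|] := boolP (0 <= x); last by [].
    rewrite /ind /= (_ : x <= _) //.
    apply: (@le_trans _ _ n%:R); last by rewrite ler_nat.
    near: n; exact: nbhs_infty_ger.
  - exact: measurable_ew.
have lt : LT heav.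
  split=> // [x x0|s /key []//]; by rewrite /heav /ind leNgt x0.
split=> // s s0; apply/eqP; rewrite eq_le; case: (key s s0) => l -> /=.
rewrite -subr_le0; apply: (@le0_geom R _ (expR (- s)) s^-1); [exact: expR_ge0| |move=> n].
  by rewrite expR_lt1 oppr_lt0.
have [l' i'] := ft s n s0.
have : Int (fun x => ind (0 <= x <= n.+1%:R) * expR (- s * x)) <= Lap heav s.
  apply: Int_le => // x; rewrite /ew mulrC ler_wpM2l ?expR_ge0 // /heav /ind.
  by case: (0 <= x); rewrite //= ler_nat leq_b1.
rewrite i' expRM_natr exprS => h.
have : expR (- s) * expR (- s) ^+ n <= expR (- s) ^+ n.
  by rewrite ger_pMl ?exprn_gt0 ?expR_gt0 // expR_le1 oppr_le0 ltW.
rewrite lerBlDr => h2; apply: (le_trans _ (lerD (lexx _) h)).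
have si : 0 < s^-1 by rewrite invr_gt0.
rewrite -subr_ge0 in h2; have := mulr_ge0 (ltW si) h2.
by move: (expR (- s)) => E; lra.
Unshelve. all: by end_near. Qed.

Lemma Lap_inj_pow f (n m j : nat) : LT f -> (forall s, 0 < s -> Lap f s = 0) ->
  let h y := ew 1 f y * (expR (- n%:R * y) ^+ j * (1 - expR (- n%:R * y)) ^+ m) in
  L1 h /\ Int h = 0.
Proof.
move=> [mf cf lf] f0; elim: m j => [|m IH] j /=.
  have s0 : 0 < 1 + j%:R * n%:R :> R by rewrite ltr_wpDr // mulr_ge0.
  have e y : ew (1 + j%:R * n%:R) f y =
      ew 1 f y * (expR (- n%:R * y) ^+ j * (1 - expR (- n%:R * y)) ^+ 0).
    rewrite expr0 mulr1 /ew mulrAC; congr (_ * _).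
    by rewrite -expRM_natr -expRD; congr expR; ring.
  split; first exact: L1_eq e (lf _ s0).
  by rewrite -(Int_eq e); apply: f0.
have [l1 i1] := IH j; have [l2 i2] := IH j.+1.
have e y : ew 1 f y * (expR (- n%:R * y) ^+ j * (1 - expR (- n%:R * y)) ^+ m) -
    ew 1 f y * (expR (- n%:R * y) ^+ j.+1 * (1 - expR (- n%:R * y)) ^+ m) =
    ew 1 f y * (expR (- n%:R * y) ^+ j * (1 - expR (- n%:R * y)) ^+ m.+1).
  by rewrite !exprS; ring.
split; first exact: L1_eq e (L1B l1 l2).
by rewrite -(Int_eq e) IntB // i1 i2 subrr.
Qed.

Lemma bernoulli_le x m : 0 <= x -> x <= 1 -> 1 - m%:R * x <= (1 - x) ^+ m.
Proof.
move=> x0 x1; elim: m => [|m IH]; first by rewrite mul0r subr0 expr0.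
rewrite exprS -natr1; have m0 : (0 : R) <= m%:R by rewrite ler0n.
have := exprn_ge0 m (_ : 0 <= 1 - x); rewrite subr_ge0 => /(_ x1) p0.
by nra.
Qed.

(** With about exp(n a) factors the power behaves like exp(- exp(n (a - y))), a smooth step at y = a
    that sharpens as n grows. Bernoulli's inequality gives the lower bound for y > a, and 1 - x <=
    exp(- x) the upper bound for y < a. *)
Lemma exp_pow_approx a y : 0 <= a -> 0 <= y -> a != y ->
  (1 - expR (- n%:R * y)) ^+ (Num.truncn (expR (n%:R * a))) @[n --> \oo] --> ind (a < y).
Proof.
move=> a0 y0 ay.
have x01 n : 0 <= expR (- n%:R * y) <= 1.
  by rewrite expR_ge0 expR_le1 mulNr oppr_le0 mulr_ge0.
have tr n : expR (n%:R * a) - 1 <= (Num.truncn (expR (n%:R * a)))%:R <= expR (n%:R * a).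
  have /andP[h1 h2] := truncn_itv (expR_ge0 (n%:R * a)).
  by rewrite h1 andbT; rewrite -natr1 in h2; lra.
have geo d : 0 < d -> expR (- n%:R * d) @[n --> \oo] --> (0 : R).
  move=> d0; have -> : (fun n => expR (- n%:R * d)) = (fun n => expR (- d) ^+ n).
    by apply/funext => n; rewrite -expRM_natl; congr expR; ring.
  by apply: cvg_expr; rewrite ger0_norm ?expR_ge0 // expR_lt1 oppr_lt0.
have [lt|ge] := ltP a y.
- apply: (@squeeze_cvgr _ _ _ _ (fun n => 1 - expR (- n%:R * (y - a))) (fun=> 1)); last 2 first.
  + rewrite -[X in _ --> X]subr0; apply: cvgB; [exact: cvg_cst|apply: geo; lra].
  + exact: cvg_cst.
  apply: nearW => n; have /andP[p0 p1] := x01 n; have /andP[t0 t1] := tr n.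
  apply/andP; split; last by rewrite exprn_ile1 //; lra.
  apply: le_trans (bernoulli_le _ p0 p1); rewrite lerD2l lerN2.
  have -> : - n%:R * (y - a) = n%:R * a + - n%:R * y by ring.
  by rewrite expRD ler_wpM2r.
- have {}ge : y < a by rewrite lt_neqAle eq_sym ay.
  apply: (@squeeze_cvgr _ _ _ _ (fun=> 0) (fun n => expR (- n%:R * (a - y)))); last 2 first.
  + exact: cvg_cst.
  + by apply: geo; lra.
  apply: nearW => n; have /andP[p0 p1] := x01 n; have /andP[t0 t1] := tr n.
  apply/andP; split; first by rewrite exprn_ge0 //; lra.
  set m := Num.truncn _ in t0 t1 *.
  have h1 : (1 - expR (- n%:R * y)) ^+ m <= expR (- expR (- n%:R * y)) ^+ m.
    by rewrite lerXn2r ?nnegrE ?expR_ge0 //; [lra|exact: expR_ge1Dx].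
  apply: le_trans h1 _; rewrite -expRM_natl ler_expR.
  have h2 : (expR (n%:R * a) - 1) * expR (- n%:R * y) <= m%:R * expR (- n%:R * y).
    by rewrite ler_wpM2r.
  have h3 : expR (n%:R * a) * expR (- n%:R * y) = expR (n%:R * (a - y)).
    by rewrite -expRD; congr expR; ring.
  have h4 := expR_ge1Dx (n%:R * (a - y)).
  rewrite mulrBl h3 mul1r in h2; have -> : - n%:R * (a - y) = - (n%:R * (a - y)) by ring.
  by rewrite mulrN lerN2; lra.
Qed.

(** By [Lap_inj_pow] the function exp(- y) f(y) integrates to 0 against the steps of
    [exp_pow_approx]. Dominated convergence gives vanishing tails beyond every a >= 0, so the
    primitive is constant on (0, oo), and Lebesgue differentiation yields f = 0. *)
Lemma Lap_inj f : LT f -> (forall s, 0 < s -> Lap f s = 0) -> {ae mu, forall x, f x = 0}.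
Proof.
move=> ltf f0; have [mf cf lf] := ltf; pose h := ew 1 f.
have lh : L1 h by apply: lf.
have mh : measurable_fun setT h by apply: L1_meas.
have ch : causal h by move=> x /cf; rewrite /h /ew => ->; rewrite mulr0.
have I0 a : 0 <= a -> Int (fun y => h y * ind (a < y)) = 0.
  move=> a0.
  pose u n y := h y * (1 - expR (- n%:R * y)) ^+ (Num.truncn (expR (n%:R * a))).
  have [||||_ c] := @Int_dct u (fun y => h y * ind (a < y)) (fun y => `|h y|) (L1_abs lh).
  - move=> n; apply: measurable_funM => //; apply: measurable_funX.
    by apply: measurable_funB => //; apply: measurable_expM.
  - by apply: measurable_funM => //; apply: measurable_ind_gt.
  - move=> n y; have [y0|/ch hy] := leP 0 y; last by rewrite /u hy mul0r normr0.
    rewrite /u normrM -[X in _ <= X]mulr1 ler_wpM2l // normrX exprn_ile1 //.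
    have := expR_ge0 (- n%:R * y); have : expR (- n%:R * y) <= 1.
      by rewrite expR_le1 mulNr oppr_le0 mulr_ge0.
    by move=> e1 e0; rewrite ger0_norm; lra.
  - exists [set a]; split; [exact: measurable_set1|exact: lebesgue_measure_set1|].
    move=> y /= hy; apply: contrapT => ya; apply: hy.
    have [y0|/ch hy] := leP 0 y.
      apply: cvgM; [exact: cvg_cst|apply: exp_pow_approx => //].
      by apply/eqP => ay; apply: ya.
    by rewrite /u hy mul0r; apply: cvg_near_cst; apply: nearW => n; rewrite mul0r.
  have {}c : (fun=> 0 : R) @ \oo --> Int (fun y => h y * ind (a < y)).
    apply: cvg_trans c; apply: near_eq_cvg; apply: nearW => n.
    have [_ <-] := @Lap_inj_pow f n (Num.truncn (expR (n%:R * a))) 0 ltf f0.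
    by apply: Int_eq => y; rewrite expr0 mul1r.
  by apply: (cvg_unique _ c); [exact: norm_hausdorff|exact: cvg_cst].
have il y : mu.-integrable `]-oo, y] (EFin \o h).
  apply: (@integrableS _ _ _ mu setT) => //; exact: (proj1 (L1P h) lh).
have := @FTC1Ny R h il.
have loc : locally_integrable setT h.
  by apply: open_integrable_locally; [exact: openT|exact: (proj1 (L1P h) lh)].
pose F x : R := \int[mu]_(t in `]-oo, x]) h t.
move=> /(_ loc); rewrite -/F => ftc.
have F0 x : 0 < x -> F x = Int h.
  move=> x0; rewrite /F.
  have P z : (z <= x) <-> `]-oo, x]%classic z by rewrite /= in_itv.
  have [_ ->] := @L1_restrict R `]-oo, x] (fun z => z <= x) h (measurable_itv _) P.
  rewrite -[LHS]addr0 -(I0 x (ltW x0)) -IntD.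
  - by apply: Int_eq => z; rewrite mulrC -mulrDr /ind; case: (leP z x) => _; rewrite ?addr0 ?add0r mulr1.
  - by apply: (L1_le _ (L1_abs lh)) => [|z]; [apply: measurable_funM => //; apply: measurable_ind_le|exact: indM_norm].
  - by apply: (L1_le _ (L1_abs lh)) => [|z]; [apply: measurable_funM => //; apply: measurable_ind_gt|rewrite mulrC indM_norm].
apply: ae_S (ae_I ftc (ae_neq 0)) => x [[_ dF] x0].
have [xn|xp] := ltP x 0; first exact: cf.
have {}xp : 0 < x by rewrite lt_neqAle eq_sym x0.
have : F^`()%classic x = 0.
  rewrite derive1E (@near_eq_derive _ _ _ F (cst (Int h))) ?derive_cst //.
  by near=> z; rewrite F0 //; near: z; exact: lt_nbhsr.
rewrite dF /h /ew => /eqP; rewrite mulf_eq0 gt_eqF ?expR_gt0 //= => /eqP //.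
Unshelve. all: by end_near. Qed.

Lemma Lap_inj2 f g : LT f -> LT g -> (forall s, 0 < s -> Lap f s = Lap g s) ->
  {ae mu, forall x, f x = g x}.
Proof.
move=> lf lg h; have h2 : {ae mu, forall x, f x - g x = 0}.
  by apply: Lap_inj; [exact: LT_B|move=> s s0; rewrite Lap_B // h // subrr].
by apply: ae_S h2 => x /eqP; rewrite subr_eq0 => /eqP.
Qed.

End Laplace.

(** * A renewal equation *)

Section Renewal.
Variable R : realType.
Implicit Types (f g h k : R -> R) (a b c s t x y : R).
Local Notation mu := (@lebesgue_measure R).
Local Notation conv := (@convolution R).
Local Notation ind := (@ind R).
Local Notation heav := (@heav R).

Lemma L1_indM (P : R -> bool) f : measurable_fun setT P -> L1 f -> L1 (fun x => ind (P x) * f x).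
Proof.
move=> mP lf; apply: (L1_le _ (L1_abs lf)) => [|x]; last exact: indM_norm.
by apply: measurable_funM; [exact: measurable_ind|exact: L1_meas].
Qed.

Lemma Int_itv u v : u <= v ->
  L1 (fun x => ind (u <= x <= v)) /\ Int (fun x => ind (u <= x <= v)) = v - u.
Proof.
move=> uv; have P x : (u <= x <= v) <-> `[u, v]%classic x by rewrite /= in_itv.
have [[h _] e] := L1_restrict (fun=> 1) (measurable_itv `[u, v]) P.
have E : (fun x => ind (u <= x <= v) * 1) = (fun x => ind (u <= x <= v)).
  by apply/funext => x; rewrite mulr1.
rewrite E in h e; rewrite -e; split.
  have -> : (fun x => ind (u <= x <= v)) = \1_`[u, v].
    apply/funext => x; rewrite indicE /ind; congr (_%:R); congr nat_of_bool.
    by apply/idP/idP; [move/P/mem_set|move/set_mem/P].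
  exact/L1P/integrable_indic_itv.
have m1 : mu `[u, v]%classic = (v - u)%:E.
  rewrite lebesgue_measure_itv /= lte_fin; have [//|vu] := ltP u v.
  by rewrite (le_anti (introT andP (conj uv vu))) subrr.
by rewrite Rintegral_cst // mul1r; exact: (congr1 (@fine R) m1).
Qed.

Lemma tail_split f y : L1 f -> tail f y = Int f - Int (fun x => ind (x <= y) * f x).
Proof.
move=> lf; have m1 : measurable_fun setT (fun x : R => x <= y) by apply: measurable_fun_ler.
rewrite -IntB //; last exact: L1_indM.
apply: Int_eq => x; rewrite /ind ltNge; case: (x <= y).
  by rewrite /= mul0r mul1r subrr.
by rewrite /= mul0r mul1r subr0.
Qed.

Lemma conv_heav f y : measurable_fun setT f ->
  conv heav f y = Int (fun x => ind (x <= y) * f x).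
Proof.
move=> mf; rewrite convC //; last exact: measurable_ind_ge.
by rewrite convE; apply: Int_eq => x; rewrite /heav subr_ge0 mulrC.
Qed.

Lemma LT_heav : LT heav. Proof. by case: (heav_Lap R). Qed.

Lemma Lap_heav s : 0 < s -> Lap heav s = s^-1. Proof. by case: (heav_Lap R) => _; apply. Qed.

(** Cutting the tail at 0 makes it causal, with transform (Int f - Lap f s) / s for causal [f];
    below 0 the plain tail would be the constant total mass. *)
Definition ctail f y := ind (0 <= y) * tail f y.

Lemma ctailE f y : L1 f -> causal f -> ctail f y = Int f * heav y - conv heav f y.
Proof.
move=> lf cf; rewrite /ctail /heav; have [y0|y0] := leP 0 y.
  by rewrite mul1r mulr1 conv_heav ?tail_split //; apply: L1_meas.
rewrite mul0r mulr0 causal_conv ?subrr //.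
by move=> x x0; rewrite /heav /ind leNgt x0.
Qed.

Lemma LT_ctail f : L1 f -> causal f -> LT (ctail f).
Proof.
move=> lf cf; have -> : ctail f = (fun y => Int f * heav y - conv heav f y).
  by apply/funext => y; rewrite ctailE.
by apply: LT_B; [apply/LT_Z/LT_heav|apply: LT_conv; [exact: LT_heav|exact: L1_LT]].
Qed.

Lemma Lap_ctail f s : 0 < s -> L1 f -> causal f -> Lap (ctail f) s = (Int f - Lap f s) / s.
Proof.
move=> s0 lf cf; have -> : ctail f = (fun y => Int f * heav y - conv heav f y).
  by apply/funext => y; rewrite ctailE.
have lt := L1_LT cf lf.
rewrite Lap_B // ?Lap_Z ?Lap_conv ?Lap_heav //; try exact: LT_heav.
- by rewrite mulrBl [s^-1 * _]mulrC.
- exact/LT_Z/LT_heav.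
- by apply: LT_conv => //; exact: LT_heav.
Qed.

Lemma tail_ge0 f y : (forall x, 0 <= f x) -> 0 <= tail f y.
Proof. by move=> f0; apply: Int_ge0 => x; rewrite mulr_ge0 ?ind_ge0. Qed.

Lemma tail_le f y : L1 f -> (forall x, 0 <= f x) -> tail f y <= Int f.
Proof.
move=> lf f0; rewrite tail_split // lerBlDr lerDl.
by apply: Int_ge0 => x; rewrite mulr_ge0 ?ind_ge0.
Qed.

Lemma Int_ctail f : L1 f -> causal f -> L1 (fun x => x * f x) ->
  L1 (ctail f) /\ Int (ctail f) = Int (fun x => x * f x).
Proof.
move=> lf cf lxf; have mf := L1_meas lf.
pose K (z : R * R) := ind (0 <= z.1) * (ind (z.1 < z.2) * f z.2).
have mK : measurable_fun setT K.
  apply: measurable_funM; first by apply: (measurableT_comp (measurable_ind_ge (0 : R))).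
  apply: measurable_funM; last exact: measurableT_comp.
  by apply: measurable_ind; apply: measurable_fun_ltr.
have E x : 0 <= x -> {ae mu, forall y, ind (0 <= y <= x) * f x = K (y, x)}.
  move=> x0; exists [set x]; split; [exact: measurable_set1|exact: lebesgue_measure_set1|].
  move=> y /= h; apply: contrapT => /eqP yx; apply: h; rewrite /K /= mulrA; congr (_ * _).
  by rewrite /ind lt_neqAle yx; case: (0 <= y); rewrite ?mul1r ?mul0r.
have hK x : L1 (fun y => K (y, x)) /\ Int (fun y => K (y, x)) = x * f x.
  have mKx : measurable_fun setT (fun y => K (y, x)).
    by apply: (measurableT_comp mK); apply: measurable_pair2.
  have [x0|x0] := leP 0 x; last first.
    have -> : (fun y => K (y, x)) = fun=> 0.
      by apply/funext => y; rewrite /K /= cf // !mulr0.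
    by rewrite Int0 cf // mulr0; split=> //; exact: L1_0.
  have [l i] := Int_itv x0.
  have l' : L1 (fun y => ind (0 <= y <= x) * f x) by apply: L1_eq (L1Z (f x) l) => y; rewrite mulrC.
  split; first exact: L1_ae mKx l' (E x x0).
  rewrite -(Int_ae (L1_meas l') mKx (E x x0)).
  rewrite (@Int_eq _ _ (fun y => f x * ind (0 <= y <= x))) => [|y]; last by rewrite mulrC.
  by rewrite IntZ ?i ?subr0 1?mulrC //; apply: L1_meas.
have nK x y : `|K (y, x)| = ind (0 <= y) * (ind (y < x) * `|f x|).
  by rewrite /K !normrM !(ger0_norm (ind_ge0 _ _)).
have lK : L1xy K.
  apply: L1xy_crit => // [x|]; first by case: (hK x).
  apply: (L1_le _ (L1_abs lxf)) => [|x].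
    apply: (@measurable_Int _ (fun z => `|K (z.2, z.1)|)).
    by apply: measurableT_comp => //; apply: (measurableT_comp mK); exact: measurable_swap.
  rewrite ger0_norm; last by apply: Int_ge0.
  have [f0|f0] := leP 0 (f x).
    rewrite (@Int_eq _ _ (fun y => K (y, x))) => [|y]; last by rewrite nK /K /= ger0_norm.
    by case: (hK x) => _ ->; rewrite ler_norm.
  rewrite (@Int_eq _ _ (fun y => - K (y, x))) => [|y]; last by rewrite nK /K /= ltr0_norm // !mulrN.
  rewrite IntN; last by case: (hK x) => l _; apply: L1_meas.
  by case: (hK x) => _ ->; rewrite -normrN ler_norm.
have [l1 _ i] := L1xy_Int lK.
have e y : Int (fun x => K (y, x)) = ctail f y.
  rewrite /ctail /tail -IntZ; first by apply: Int_eq => x.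
  by apply: measurable_funM; [exact: measurable_ind_gt|exact: mf].
by split; [exact: L1_eq e l1|rewrite -(Int_eq e) i; apply: Int_eq => x; case: (hK x)].
Qed.

Lemma H_mulx s f : H (s + 1) f -> H s (fun x => x * f x) /\ n2 s (fun x => x * f x) <= n2 (s + 1) f.
Proof.
move=> [mf hf]; have m : measurable_fun setT (fun x => x * f x) by apply: measurable_funM.
have [||l n] := @L2_le _ (fun x => wt s x * (x * f x)) _ _ hf.
- by apply: measurable_funM => //; apply: measurable_wt.
- move=> x; rewrite mulrA !normrM ler_wpM2r // !(ger0_norm (wt_ge0 _ _)) wtD ler_wpM2l ?wt_ge0 //.
  by rewrite /wt powRr1 ?addr_ge0 // lerDr.
by split.
Qed.

Lemma Int_pos_itv f u v : u < v -> L1 f -> (forall x, 0 <= f x) ->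
  {ae mu, forall x, u < x < v -> 0 < f x} -> 0 < Int f.
Proof.
move=> uv lf f0 fp; rewrite lt_neqAle Int_ge0 // andbT; apply/eqP => /esym i0.
have h : {ae mu, forall x, f x = 0}.
  apply: (Int_abs_eq0 lf); rewrite (@Int_eq _ _ f) ?i0 // => x; exact: ger0_norm.
have [N [mN N0 hN]] := ae_I fp h.
have sub : `]u, v[%classic `<=` N.
  move=> x /=; rewrite in_itv => /= xuv; apply: hN => /= -[/(_ xuv) p e].
  by rewrite e ltxx in p.
have h1 : (mu `]u, v[%classic <= 0)%E.
  by apply: le_trans (le_measure mu (mem_set (measurable_itv `]u, v[)) (mem_set mN) sub) _; rewrite -N0.
by move: h1; rewrite lebesgue_measure_itv /= lte_fin uv -EFinB lee_fin subr_le0 leNgt uv.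
Qed.

(** Some level set of [f] has positive measure and hence a density point [x]. Near [x] the level set
    E fills most of a ball, so for y close to 2 x the sets E and y - E overlap in a set of definite
    measure, on which both factors of the convolution are at least [e]. *)
Lemma spread f : L1 f -> (forall x, 0 <= f x) -> (forall x, x < 1 -> f x = 0) -> 0 < Int f ->
  exists b1 b2 c, [/\ 0 < b1, b1 < b2, 0 < c & forall y, b1 < y < b2 ->
    L1 (fun z => f z * f (y - z)) -> c <= conv f f y].
Proof.
move=> lf f0 f1 fp; have mf := L1_meas lf.
have mE0 e : measurable [set x | (e <= f x)%R].
  have := measurable_fun_ler (measurable_cst e) mf.
  by move=> /(_ measurableT [set true] Logic.I); rewrite setTI; congr measurable; apply/seteqP; split.
have [e e0 he] : exists2 e, 0 < e & (0 < mu [set x | (e <= f x)%R])%E.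
  apply: contrapT => hn; suff : Int f <= 0 by rewrite leNgt fp.
  have z n : {ae mu, forall x, f x < n.+1%:R^-1}.
    exists [set x | (n.+1%:R^-1 <= f x)%R]; split; [exact: mE0| |].
      apply/eqP; rewrite eq_le measure_ge0 andbT leNgt; apply/negP => p.
      by apply: hn; exists n.+1%:R^-1 => //; rewrite invr_gt0.
    by move=> x /= /negP; rewrite -leNgt.
  rewrite -(Int0 R); apply: Int_leae; [exact: lf|exact: L1_0|].
  apply: ae_S (ae_countable z) => x h; rewrite leNgt; apply/negP => fx.
  have := h (Num.truncn (f x)^-1); apply/negP; rewrite -leNgt.
  rewrite -[X in _ <= X]invrK lef_pV2 ?posrE ?invr_gt0 //.
  by apply: ltW; apply: truncnS_gt.
pose E := [set x | (e <= f x)%R].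
have mE : measurable E by apply: mE0.
have [x Ex [r r0 hr]] : exists2 x, E x & exists2 r, 0 < r &
    ((3 / 2 * r)%:E <= mu (E `&` ball x r))%E.
  have [x Ex dx] : exists2 x, E x & (mu (E `&` ball x r) / mu (ball x r))%E @[r --> 0^'+] --> (\1_E x)%:E.
    apply: contrapT => hn; have [N [mN N0 hN]] := lebesgue_density mE.
    have sub : E `<=` N by move=> x Ex; apply: hN => h; apply: hn; exists x.
    have h1 : (mu E <= 0)%E by apply: le_trans (le_measure mu (mem_set mE) (mem_set mN) sub) _; rewrite -N0.
    by move: h1; rewrite leNgt he.
  exists x => //; rewrite indicE mem_set //= in dx.
  have op : nbhs (1%:E : \bar R) [set z | ((3 / 4)%:E < z)%E].
    apply: open_nbhs_nbhs; split; first exact: open_ereal_gt_ereal.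
    by rewrite /= lte_fin; lra.
  have := dx _ op; rewrite /nbhs /= => -[d /= d0 hd].
  have d2 : 0 < d / 2 by rewrite divr_gt0.
  exists (d / 2) => //.
  have := hd (d / 2); rewrite /ball /= sub0r normrN gtr0_norm // => /(_ _ d2).
  have -> : d / 2 < d by lra.
  move=> /(_ isT); rewrite (lebesgue_measure_ball x (ltW d2)).
  have fin : mu (E `&` ball x (d / 2)) \is a fin_num.
    rewrite ge0_fin_numE //; apply: le_lt_trans (ltry ((d / 2) *+ 2)).
    have mB : measurable (ball x (d / 2)) by apply: measurable_ball.
    have := le_measure mu (mem_set (measurableI _ _ mE mB)) (mem_set mB) (@subIsetr _ E (ball x (d / 2))).
    have E2 : mu (ball x (d / 2)) = (d / 2 *+ 2)%:E by apply: lebesgue_measure_ball; apply: ltW.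
    by move=> h; apply: (le_trans h); rewrite -E2.
  rewrite -(fineK fin); set A := fine _.
  have d3 : d / 2 *+ 2 = d by rewrite -mulr_natr divfK.
  rewrite d3 inver gt_eqF // -EFinM lte_fin ltr_pdivlMr //.
  by rewrite lee_fin => h; lra.
have x1 : 1 <= x.
  by rewrite leNgt; apply/negP => /f1 fx; have : (e <= f x)%R := Ex; rewrite fx leNgt e0.
(* Two sets of measure at least 3 r / 2 lie in a window of length 2 r + 2 d <= 5 r / 2, so they
   overlap in measure at least r / 2. The bound d <= 1 together with x >= 1 keeps 2 x - d
   positive. *)
pose d := Num.min (r / 4) 1; have d0 : 0 < d by rewrite lt_min ltr01 divr_gt0.
have dr : d <= r / 4 by rewrite ge_min lexx.
have d1 : d <= 1 by rewrite ge_min lexx orbT.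
exists (2 * x - d), (2 * x + d), (e ^+ 2 * (r / 2)); split; [lra|lra| |].
  by rewrite mulr_gt0 ?exprn_gt0 // divr_gt0.
move=> y /andP[y1 y2] l.
pose u z : R := \1_(E `&` ball x r) z.
have mI : measurable (E `&` ball x r) by apply: measurableI => //; apply: measurable_ball.
have u01 z : u z = 0 \/ u z = 1 by rewrite /u indicE; case: (_ \in _); [right|left].
have uE z : u z <> 0 -> e <= f z /\ x - r <= z <= x + r.
  rewrite /u indicE; case: (boolP (z \in _)) => // /set_mem[Ez].
  rewrite /ball /= => h _; split=> //; have := ltr_distlC x z r; rewrite h => /esym/andP[/ltW -> /ltW ->].
  by [].
have xr : x - r <= x + r by lra.
have lu : L1 u.
  apply: (L1_le _ (proj1 (Int_itv xr))) => [|z]; first exact: measurable_indic.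
  have [->|uz] := u01 z; first by rewrite normr0 ind_ge0.
  by rewrite uz normr1 indT //; apply: (proj2 (uE z _)); rewrite uz; apply/eqP/oner_neq0.
have iu : 3 / 2 * r <= Int u.
  by rewrite -lee_fin -IntE // integral_indic // setIT.
have [luy iuy] : L1 (fun z => u (y - z)) /\ Int (fun z => u (y - z)) = Int u.
  by split; [exact: L1_reflect|apply: Int_reflect; apply: L1_meas].
have vw : x - r - d <= x + r + d by lra.
have [lK iK] := Int_itv vw.
(* The inclusion-exclusion bound for the overlap in pointwise form: the bracket equals 1 only where
   both indicators are 1, and is otherwise at most 0. *)
have le z : e ^+ 2 * (u z + u (y - z) - ind (x - r - d <= z <= x + r + d)) <= f z * f (y - z).
  have p := mulr_ge0 (f0 z) (f0 (y - z)).
  have e2 : 0 <= e ^+ 2 := sqr_ge0 _.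
  have [uz|uz] := u01 z; have [uy|uy] := u01 (y - z); rewrite uz uy.
  - apply: le_trans p; rewrite add0r sub0r mulrN oppr_le0 mulr_ge0 ?ind_ge0 //.
  - have [_ /andP[h1 h2]] : e <= f (y - z) /\ x - r <= y - z <= x + r by apply: uE; rewrite uy; apply/eqP/oner_neq0.
    rewrite indT; last by apply/andP; split; lra.
    by rewrite add0r subrr mulr0.
  - have [_ /andP[h1 h2]] : e <= f z /\ x - r <= z <= x + r by apply: uE; rewrite uz; apply/eqP/oner_neq0.
    rewrite indT; last by apply/andP; split; lra.
    by rewrite addr0 subrr mulr0.
  - have [g1 /andP[h1 h2]] : e <= f z /\ x - r <= z <= x + r by apply: uE; rewrite uz; apply/eqP/oner_neq0.
    have [g2 _] : e <= f (y - z) /\ x - r <= y - z <= x + r by apply: uE; rewrite uy; apply/eqP/oner_neq0.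
    rewrite indT; last by apply/andP; split; lra.
    by rewrite addrK mulr1 expr2; apply: ler_pM => //; apply: ltW.
rewrite convE; have lS : L1 (fun z => u z + u (y - z) - ind (x - r - d <= z <= x + r + d)).
  by apply: L1B => //; apply: L1D.
apply: le_trans (Int_le (L1Z (e ^+ 2) lS) l le).
rewrite IntZ; last exact: L1_meas.
rewrite ler_wpM2l ?sqr_ge0 // IntB ?IntD //; last exact: L1D.
by rewrite iuy iK; lra.
Qed.


(** The restriction h of the solution to x < 0 satisfies |h| <= |k| convolved with |h|, hence
    ||h||_1 <= ||k||_1 ||h||_1 and h = 0 almost everywhere. A change on a null set then gives
    causality, and positivity when it is due, at every point. *)
Lemma neumann_causal k g0 : L1 k -> causal k -> n1 k < 1 -> L1 g0 -> causal g0 ->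
  exists g, [/\ L1 g, causal g, {ae mu, forall x, g x = g0 x + conv k g x},
      forall s, 0 <= s -> H s k -> H s g0 -> H s g &
      (forall x, 0 <= k x) -> (forall x, 0 <= g0 x) -> forall x, 0 <= g x].
Proof.
move=> lk ck k1 lg0 cg0; have [g [lg eg hg pg]] := neumann lk k1 lg0.
have mk := L1_meas lk; have mg := L1_meas lg.
have mneg : measurable_fun setT (fun x : R => x < 0) by apply: measurable_fun_ltr.
have mpos : measurable_fun setT (fun x : R => 0 <= x) by apply: measurable_fun_ler.
pose h x := ind (x < 0) * g x.
have lh : L1 h by apply: L1_indM.
have hle : {ae mu, forall x, `|h x| <= conv (fun y => `|k y|) (fun y => `|h y|) x}.
  apply: ae_S (ae_I eg (conv_ae lk lh)) => x [e l]; apply: le_trans (conv_le_abs l).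
  rewrite /h; have [x0|x0] := ltP x 0; last by rewrite indF ?mul0r ?normr0 // -leNgt.
  rewrite indT // mul1r e cg0 // add0r !convE le_eqVlt; apply/orP; left; apply/eqP.
  congr `|_|; apply: Int_eq => y; have [y0|/ck ->] := leP 0 y; last by rewrite !mul0r.
  by rewrite indT ?mul1r //; lra.
have h0 : {ae mu, forall x, h x = 0}.
  apply: (Int_abs_eq0 lh).
  have := Int_leae (L1_abs lh) (conv_L1 (L1_abs lk) (L1_abs lh)) hle.
  rewrite Int_conv; [|exact: L1_abs..]; rewrite -/(n1 k) => h1.
  have := n1_ge0 h; rewrite /n1 => h2; nra.
have z x : ind (0 <= x) = 1 - ind (x < 0) :> R.
  by rewrite /ind leNgt; case: (x < 0); rewrite ?subrr ?subr0.
(* Two representatives will be used: an absolute value when [k] and [g0] are nonnegative, so that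
   positivity holds everywhere, and the plain restriction to x >= 0 otherwise. *)
have fin g' : measurable_fun setT g' -> causal g' -> {ae mu, forall x, g x = g' x} ->
    (forall x, 0 <= g' x) \/ ~ ((forall x, 0 <= k x) /\ (forall x, 0 <= g0 x)) ->
    exists g, [/\ L1 g, causal g, {ae mu, forall x, g x = g0 x + conv k g x},
      forall s, 0 <= s -> H s k -> H s g0 -> H s g &
      (forall x, 0 <= k x) -> (forall x, 0 <= g0 x) -> forall x, 0 <= g x].
  move=> mg' cg' e' pos; exists g'; split=> //.
  - exact: L1_ae mg' lg e'.
  - apply: ae_S (ae_I eg e') => x [e1 e2]; rewrite -e2 e1; congr (_ + _).
    by apply: conv_congr => //; apply: ae_T.
  - by move=> s s0 hk hg0; apply: (proj1 (H_ae mg' (hg s s0 hk hg0) e')).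
  - by move=> pk pg0; case: pos => // -[].
have e1 : {ae mu, forall x, g x = ind (0 <= x) * g x}.
  by apply: ae_S h0 => x hx; rewrite z mulrBl mul1r [_ * g x]hx subr0.
have cind x : x < 0 -> ind (0 <= x) = 0 :> R by move=> x0; rewrite indF // -ltNge.
have m1 : measurable_fun setT (fun x => ind (0 <= x) * g x).
  by apply: measurable_funM => //; exact: measurable_ind.
have [[pk pg0]|np] := pselect ((forall x, 0 <= k x) /\ (forall x, 0 <= g0 x)).
  apply: (fin (fun x => `|ind (0 <= x) * g x|)).
  - exact: measurableT_comp.
  - by move=> x x0; rewrite cind // mul0r normr0.
  - by apply: ae_S (ae_I e1 (pg pk pg0)) => x [<- p]; rewrite ger0_norm.
  - by left.
apply: (fin (fun x => ind (0 <= x) * g x)) => //; last by right.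
by move=> x x0; rewrite cind // mul0r.
Qed.

Lemma H_L1' s f : 2^-1 < s -> H s f -> L1 f.
Proof. by move=> s1 hf; have [C _ /(_ f hf)[]] := H_L1 s1. Qed.

Lemma Int_lin f g h a b : measurable_fun setT f -> L1 g -> L1 h ->
  {ae mu, forall x, f x = a * g x + b * h x} -> Int f = a * Int g + b * Int h.
Proof.
move=> mf lg lh e; rewrite -!IntZ; [|exact: L1_meas..].
rewrite -IntD; [|exact: L1Z..]; apply: Int_ae => //.
by apply: L1_meas; apply: L1D; apply: L1Z.
Qed.

Lemma conv_Zl c f g x : measurable_fun setT f -> measurable_fun setT g ->
  conv (fun y => c * f y) g x = c * conv f g x.
Proof.
move=> mf mg; rewrite !convE -IntZ; last exact: measurable_convkerx.
by apply: Int_eq => y; rewrite mulrA.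
Qed.

Lemma conv_Zr c f g x : measurable_fun setT f -> measurable_fun setT g ->
  conv f (fun y => c * g y) x = c * conv f g x.
Proof.
move=> mf mg; rewrite !convE -IntZ; last exact: measurable_convkerx.
by apply: Int_eq => y; rewrite mulrCA.
Qed.

Lemma L1_mulx s f : 3 / 2 < s -> H s f -> L1 (fun x => x * f x).
Proof.
move=> s1 hf; have hf' : H (s - 1 + 1) f by rewrite subrK.
by apply: (@H_L1' (s - 1)); [lra|exact: (proj1 (H_mulx hf'))].
Qed.

(** [f] is the geometric compound (1 - th) sum_n th^n r^(n+1) in the sense of convolution, the
    solution of f = (1 - th) r + th (r convolved with f). Its mean blows up as th tends to 1, while
    the threshold [Y] beyond which it is positive depends on [r] alone; this contrast is what
    [renewal] exploits. *)
Lemma renewal_density gam r : 3 / 2 < gam -> L1 r -> (forall x, 0 <= r x) ->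
  (forall x, x < 1 -> r x = 0) -> Int r = 1 -> H gam r ->
  exists Y, 0 < Y /\ forall th, 0 < th -> th < 1 -> exists f,
  [/\ L1 f /\ L1 (fun x => x * f x), causal f, forall x, 0 <= f x, H gam f &
      [/\ Int f = 1, Int (fun x => x * f x) = Int (fun x => x * r x) / (1 - th),
          {ae mu, forall y, Y < y -> 0 < f y} &
          forall s, 0 < s -> Lap f s * (1 - th * Lap r s) = (1 - th) * Lap r s]].
Proof.
move=> g1 lr r0 r1 ir hr.
have cr : causal r by move=> x x0; apply: r1; lra.
have ir0 : 0 < Int r by rewrite ir.
have [b1 [b2 [c [b10 b12 c0 hc]]]] := spread lr r0 r1 ir0.
(* The intervals (n b1, n b2) cover (Y, oo). For y > Y take n to be one less than the integer part
   of y / b1: then n b1 < y < (n + 2) b1, and 2 b1 <= n (b2 - b1) gives y < n b2. *)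
pose Y := b1 * (2 * b1 / (b2 - b1) + 2).
have Y0 : 0 < Y by rewrite mulr_gt0 // addr_gt0 // divr_gt0 ?mulr_gt0 // subr_gt0.
exists Y; split=> // th th0 th1.
have [lthr nthr] : L1 (fun x => th * r x) /\ n1 (fun x => th * r x) < 1.
  split; first exact: L1Z.
  rewrite n1Z // /n1 (@Int_eq _ _ r) ?ir ?mulr1 ?gtr0_norm // => x; exact: ger0_norm.
have cthr : causal (fun x => th * r x) by move=> x /cr ->; rewrite mulr0.
have lg0 := L1Z (1 - th) lr.
have cg0 : causal (fun x => (1 - th) * r x) by move=> x /cr ->; rewrite mulr0.
have th1' : 0 <= 1 - th by lra.
have [f [lf cf ef hf pf]] := neumann_causal lthr cthr nthr lg0 cg0.
have {}pf x : 0 <= f x by apply: pf => z; rewrite mulr_ge0 // ltW.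
have {}hf : H gam f by apply: hf; [lra|exact: (proj1 (HZ _ hr))..].
have mr := L1_meas lr; have mf := L1_meas lf.
have {}ef : {ae mu, forall x, f x = (1 - th) * r x + th * conv r f x}.
  by apply: ae_S ef => x; rewrite conv_Zl.
have lxr := L1_mulx g1 hr; have lxf := L1_mulx g1 hf.
have Lr := L1_LT cr lr; have Lf := L1_LT cf lf.
have lrf := conv_L1 lr lf.
have If : Int f = 1.
  have := Int_lin mf lr lrf ef; rewrite Int_conv // ir mul1r => e.
  by apply: (@mulfI _ (1 - th)); [rewrite gt_eqF //; lra|lra].
exists f; split; [by []|by []|by []|by []|split; [exact: If| | |]].
- have l1 : L1 (conv (fun y => y * r y) f) by apply: conv_L1.
  have l2 : L1 (conv r (fun y => y * f y)) by apply: conv_L1.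
  have e1 : {ae mu, forall x, x * f x = (1 - th) * (x * r x) +
     th * (conv (fun y => y * r y) f x + conv r (fun y => y * f y) x)}.
    by apply: ae_S (ae_I ef (mulx_conv Lr Lf)) => x [{1}-> <-]; ring.
  have := Int_lin (L1_meas lxf) lxr (L1D l1 l2) e1; rewrite IntD // !Int_conv // ir If mul1r mulr1 => e.
  apply: (@mulIf _ (1 - th)); [rewrite gt_eqF //; lra|].
  by rewrite divfK ?gt_eqF //; lra.
- have th2 : 0 < th * (1 - th) by rewrite mulr_gt0 //; lra.
  have lrr := conv_L1 lr lr.
  have base : {ae mu, forall y, b1 < y < b2 -> 0 < f y}.
    have e2 : {ae mu, forall y, conv r f y = (1 - th) * conv r r y + th * conv r (conv r f) y}.
      have lg1 : L1 (fun x => th * conv r f x) by apply: L1Z.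
      apply: ae_S (conv_addr lr lg0 lg1) => y; rewrite (conv_congr y mr mf mr _ _ ef); last exact: ae_T.
        by move=> ->; rewrite !conv_Zr //; exact: L1_meas lrf.
      by apply: L1_meas; apply: L1D.
    apply: ae_S (ae_I (conv_ae lr lr) (ae_I ef e2)) => y [l [e1 e2']] hy.
    have h1 := hc y hy l; have h2 := r0 y.
    have h3 : 0 <= conv r (conv r f) y by apply: conv_ge0 => // z; apply: conv_ge0.
    rewrite e1 e2'; have h4 : 0 < th * (1 - th) * c by rewrite mulr_gt0.
    have h5 : 0 <= (1 - th) * r y by rewrite mulr_ge0.
    have h6 : 0 <= th * (th * conv r (conv r f) y) by rewrite !mulr_ge0 // ltW.
    have h7 : th * (1 - th) * c <= th * (1 - th) * conv r r y by rewrite ler_pM2l.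
    by rewrite mulrDr mulrA; lra.
  have ass : {ae mu, forall y, conv r (conv r f) y = conv (conv r r) f y}.
    have Lrf := LT_conv Lr Lf; have Lrr := LT_conv Lr Lr.
    apply: Lap_inj2 => [||s s0]; [exact: LT_conv|exact: LT_conv|].
    by rewrite !Lap_conv // mulrA.
  have low : {ae mu, forall y, th ^+ 2 * conv (conv r r) f y <= f y}.
    have e2 : {ae mu, forall y, th * conv r (conv r f) y <= conv r f y}.
      have lg1 : L1 (fun x => th * conv r f x) by apply: L1Z.
      apply: ae_S (conv_addr lr lg0 lg1) => y; rewrite [X in _ -> _ <= X](conv_congr y mr mf mr _ _ ef); last exact: ae_T.
        move=> ->; rewrite [X in _ <= _ + X]conv_Zr //; last exact: L1_meas lrf.
        by rewrite lerDr; apply: conv_ge0 => // z; rewrite mulr_ge0.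
      by apply: L1_meas; apply: L1D.
    apply: ae_S (ae_I ef (ae_I e2 ass)) => y [e1 [h1 h2]]; rewrite -h2 expr2.
    have h5 : 0 <= (1 - th) * r y by rewrite mulr_ge0.
    have : th * (th * conv r (conv r f) y) <= th * conv r f y by rewrite ler_pM2l.
    by rewrite mulrA; lra.
  (* [f] dominates th^2 times its convolution with r convolved with itself, which is bounded below
     on (b1, b2). Each such convolution lengthens the interval of positivity from the n-fold to the
     (n+1)-fold dilation. *)
  have pos n : (1 <= n)%N -> {ae mu, forall y, n%:R * b1 < y < n%:R * b2 -> 0 < f y}.
    case: n => // n _; elim: n => [|n IH]; first by apply: ae_S base => y; rewrite !mul1r.
    apply: ae_S (ae_I low (conv_ae lrr lf)) => y [h l] /andP[y1 y2].
    apply: lt_le_trans h; rewrite mulr_gt0 ?exprn_gt0 //.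
    have n0 : 0 <= n%:R :> R := ler0n _ _.
    pose u := Num.max b1 (y - n.+1%:R * b2); pose v := Num.min b2 (y - n.+1%:R * b1).
    have uv : u < v.
      rewrite /u /v gt_max !lt_min b12 /=.
      rewrite -[n.+2%:R]natr1 mulrDl mul1r in y1; rewrite -[n.+2%:R]natr1 mulrDl mul1r in y2.
      have : n.+1%:R * b1 < n.+1%:R * b2 by rewrite ltr_pM2l // ltr0n.
      by move=> h'; apply/andP; split; [|apply/andP; split]; lra.
    rewrite convE; apply: (Int_pos_itv uv l) => [z|].
      by rewrite mulr_ge0 //; apply: conv_ge0.
    have m1 : (-1 : R) != 0 by rewrite oppr_eq0 oner_neq0.
    apply: ae_S (ae_I (conv_ae lr lr) (ae_affine y m1 IH)) => z [lz hz] /andP[].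
    rewrite /u /v gt_max lt_min => /andP[z1 z2] /andP[z3 z4].
    rewrite mulr_gt0 //; first by apply: lt_le_trans c0 (hc z _ lz); rewrite z1.
    have -> : y - z = -1 * z + y by ring.
    by apply: hz; apply/andP; split; lra.
  apply: ae_S (ae_countable (fun n => pos n.+1 isT)) => y h yY.
  pose n := Num.truncn (y / b1).
  have b12' : 0 < b2 - b1 by rewrite subr_gt0.
  have y0 : 0 <= y / b1 by rewrite divr_ge0 // ltW // (lt_trans Y0).
  have /andP[n1' n2'] := truncn_itv y0.
  have yb : 2 * b1 / (b2 - b1) + 2 < y / b1 by rewrite ltr_pdivlMr // mulrC.
  have q0 : 0 < 2 * b1 / (b2 - b1) by rewrite divr_gt0 ?mulr_gt0.
  rewrite -/n in n1' n2'.
  have : (2 < n.+1)%N by rewrite -(ltr_nat R); lra.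
  case E : n => [|[|m]] // _; apply: (h m).
  rewrite E -!natr1 in n1' n2'; rewrite ler_pdivlMr // in n1'; rewrite ltr_pdivrMr // in n2'.
  have mq : 2 * b1 / (b2 - b1) < m.+1%:R by rewrite -ltr_pdivrMr // -natr1 in n2' *; lra.
  rewrite ltr_pdivrMr // in mq; rewrite -natr1 in mq *.
  by apply/andP; split; lra.
- move=> s s0.
  have Lrf := LT_conv Lr Lf.
  have cs : causal (fun x => (1 - th) * r x + th * conv r f x).
    by move=> x x0; rewrite cr // causal_conv // !mulr0 addr0.
  have [_ e] := LT_ae (L1_meas (L1D lg0 (L1Z th lrf))) cs Lf ef.
  have : Lap f s = (1 - th) * Lap r s + th * (Lap r s * Lap f s).
    have Lrf' := LT_conv Lr Lf.
    by rewrite -[LHS]e (Lap_D s0 (LT_Z _ Lr) (LT_Z _ Lrf')) !Lap_Z // Lap_conv.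
  by move=> e'; rewrite mulrBr mulr1 {1}e'; ring.
Qed.

Lemma causal_ctail f : causal (ctail f).
Proof. by move=> y y0; rewrite /ctail indF ?mul0r // -ltNge. Qed.

Lemma H_ctail s f : - 2^-1 < s -> H (s + 1) f -> H s (ctail f).
Proof. by move=> s1 hf; have [C _ /(_ f hf)[]] := hardy s1. Qed.

(* Dominated convergence: [max (ctail f - n f, 0)] tends to 0 wherever [f > 0],
   and for y <= Y it is at most the total mass 1. *)
Lemma excess_small f Y M : 0 < Y -> L1 f -> causal f -> (forall x, 0 <= f x) -> Int f = 1 ->
  L1 (ctail f) -> {ae mu, forall y, Y < y -> 0 < f y} -> Y < M ->
  exists n, Int (fun y => Num.max (ctail f y - n.+1%:R * f y) 0) < M.
Proof.
move=> Y0 lf cf f0 If lF fY YM; have mf := L1_meas lf; have mF := L1_meas lF.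
have F0 y : 0 <= ctail f y by rewrite mulr_ge0 ?ind_ge0 ?tail_ge0.
have mn : measurable_fun setT (fun x : R => f x <= 0) by apply: measurable_fun_ler.
have cvn y : (fun n : nat => Num.max (ctail f y - n.+1%:R * f y) 0) @ \oo -->
    ctail f y * ind (f y <= 0).
  have [fy|fy] := ltP 0 (f y).
    rewrite indF -?ltNge // mulr0; apply: cvg_near_cst; near=> n.
    apply/max_idPr; rewrite subr_le0 -ler_pdivrMr //.
    by near: n; exists (Num.truncn (ctail f y / f y)) => // n /= hn;
       apply: (le_trans (ltW (truncnS_gt _))); rewrite ler_nat ltnS.
  have -> : f y = 0 by apply: le_anti; rewrite fy f0.
  rewrite indT // mulr1.
  have -> : (fun n : nat => Num.max (ctail f y - n.+1%:R * 0) 0) = fun=> ctail f y.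
    by apply/funext => n; rewrite mulr0 subr0; apply/max_idPl.
  exact: cvg_cst.
have ml : measurable_fun setT (fun y => ctail f y * ind (f y <= 0)).
  by apply: measurable_funM => //; exact: measurable_ind.
have mu' n : measurable_fun setT (fun y => Num.max (ctail f y - n.+1%:R * f y) 0).
  by apply: measurable_maxr => //; apply: measurable_funB => //; apply: measurable_funM.
have dom (n : nat) y : `|Num.max (ctail f y - n.+1%:R * f y) 0| <= ctail f y.
  rewrite ger0_norm ?le_max ?lexx ?orbT // ge_max F0 andbT lerBlDr lerDl.
  by rewrite mulr_ge0.
have [lL cv] := Int_dct lF mu' ml dom (ae_T cvn).
have [lI iI] := Int_itv (ltW Y0); rewrite subr0 in iI.
have hL : Int (fun y => ctail f y * ind (f y <= 0)) <= Y.
  rewrite -iI; apply: Int_leae => //; apply: ae_S fY => y hy.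
  have [y0|y0] := ltP y 0; first by rewrite causal_ctail // mul0r ind_ge0.
  have [yY|yY] := leP y Y; last by rewrite (@indF _ (f y <= 0)) ?mulr0 ?ind_ge0 // -ltNge hy.
  have F1 : ctail f y <= 1 by rewrite /ctail indT // mul1r -If tail_le.
  rewrite (_ : ind (true && true) = 1) //.
  by rewrite -[X in _ <= X]mulr1 ler_pM ?ind_ge0 ?ind_le1.
have hM : Int (fun y => ctail f y * ind (f y <= 0)) < M by apply: le_lt_trans YM.
have := cvgr_lt _ cv _ hM => -[n _ hn]; exists n; exact: (hn n (leqnn n)).
Unshelve. all: by end_near. Qed.

(* With [c] small, [f - c (ctail f)] has L1 norm below 1, although
   [Int f = 1]: the c-term gains [c M] and loses twice the excess. *)
Lemma renewal gam r (a : R -> R) q : 3 / 2 < gam -> L1 r -> (forall x, 0 <= r x) ->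
  (forall x, x < 1 -> r x = 0) -> Int r = 1 -> H gam r ->
  L1 a -> causal a -> H (gam - 1) a -> 0 < q -> Int (fun x => x * r x) = q * Int a ->
  exists c g, [/\ 0 < c, L1 g, causal g, H (gam - 1) g & Int g = 0 /\
    forall s, 0 < s ->
     ((q * s)^-1 + (1 + c / s) * Lap g s) * (1 - Lap r s) = Lap a s].
Proof.
move=> g1 lr r0 r1 Ir hr la ca ha q0 Ira.
have [Y [Y0 hY]] := renewal_density g1 lr r0 r1 Ir hr.
have lxr := L1_mulx g1 hr; pose Mr := Int (fun x => x * r x).
have Mr0 : 1 <= Mr.
  rewrite -Ir; apply: Int_le => // x; have [x1|/r1 ->] := leP 1 x; last by rewrite mulr0.
  by rewrite ler_peMl.
(* Since Mr >= 1, it suffices to take 1 - th = 1 / (2 Y + 2). The factor 2 is needed because the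
   negative part of the kernel below is counted twice in its L1 norm. *)
have [th [th0 th1 hth]] : exists th, [/\ 0 < th, th < 1 & 2 * Y < Mr / (1 - th)].
  exists (1 - (2 * Y + 2)^-1); have z : 0 < 2 * Y + 2 by lra.
  have : (2 * Y + 2)^-1 < 1 by rewrite invf_lt1 //; lra.
  have : 0 < (2 * Y + 2)^-1 by rewrite invr_gt0.
  by split; [lra|lra|rewrite subKr invrK; nra].
have [f [[lf lxf] cf f0 hf [If Ixf fY Lf]]] := hY th th0 th1.
pose M := Mr / (1 - th); rewrite -/Mr -/M in Ixf hth.
have M0 : 0 < M by lra.
have [lF IF] := Int_ctail lf cf lxf; rewrite Ixf in IF.
have YM : Y < M / 2 by rewrite ltr_pdivlMr //; lra.
have [n hn] := excess_small Y0 lf cf f0 If lF fY YM.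
pose c : R := n.+1%:R^-1; have c0 : 0 < c by rewrite invr_gt0.
have cn : c * n.+1%:R = 1 by rewrite mulVf.
have mf := L1_meas lf; have mF := L1_meas lF.
(* The point of this kernel is the identity 1 - Lap k = (1 + c / s)(1 - Lap f): solving for [g] with
   the prefactor 1 + c / s is a convolution equation with kernel [k], although 1 - Lap f itself
   vanishes at s = 0. *)
pose k y := f y - c * ctail f y.
have lcF : L1 (fun y => c * ctail f y) by apply: L1Z.
have lk : L1 k by apply: L1B.
have ck : causal k by move=> y y0; rewrite /k cf // causal_ctail // mulr0 subrr.
have lmx : L1 (fun y => Num.max (ctail f y - n.+1%:R * f y) 0).
  by apply: L1_pos; apply: L1B => //; apply: L1Z.
have n1k : n1 k < 1.
  have -> : n1 k = Int (fun y => k y + 2 * c * Num.max (ctail f y - n.+1%:R * f y) 0).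
    apply: Int_eq => y.
    have -> : 2 * c * Num.max (ctail f y - n.+1%:R * f y) 0 = 2 * Num.max (- k y) 0.
      rewrite -mulrA; congr (2 * _); rewrite maxr_pMr ?ltW // mulr0; congr (Num.max _ 0).
      by rewrite mulrBr [c * (_ * f y)]mulrA cn /k; ring.
    have [k0|k0] := leP 0 (k y).
      by rewrite ger0_norm // (max_idPr _) ?mulr0 ?addr0 // oppr_le0.
    by rewrite ltr0_norm // (max_idPl _); [ring|rewrite oppr_ge0 ltW].
  rewrite IntD //; last exact: L1Z.
  rewrite IntZ; last exact: L1_meas.
  rewrite IntB // IntZ // If IF.
  have : 2 * c * Int (fun y => Num.max (ctail f y - n.+1%:R * f y) 0) < 2 * c * (M / 2).
    by rewrite ltr_pM2l // mulr_gt0.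
  have -> : 2 * c * (M / 2) = c * M by field.
  lra.
(* With F = Lap f and l = Lap r one has (1 - F)(1 - th l) = 1 - l and (1 + z F)(1 - th l) = 1. Hence
   the desired identity becomes (1 + c / s)(1 - F) Lap g = A (1 + z F) - (1 - F) / (q s), whose
   right side is the transform of [g0]. *)
pose z := th / (1 - th); have th1' : 1 - th != 0 by rewrite gt_eqF // subr_gt0.
pose g0 y := a y + z * conv a f y + (- q^-1) * ctail f y.
have laf := conv_L1 la lf.
have lz : L1 (fun y => a y + z * conv a f y) by apply: L1D => //; apply: L1Z.
have lg0 : L1 g0 by apply: L1D => //; apply: L1Z.
have cg0 : causal g0.
  by move=> y y0; rewrite /g0 ca // causal_conv // causal_ctail // !mulr0 !addr0.
have [g [lg cg eg hg _]] := neumann_causal lk ck n1k lg0 cg0.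
have gm : 0 <= gam - 1 by lra.
have [hf1 _] : H (gam - 1) f /\ True by have [] := @H_mono R (gam - 1) gam f _ hf; [lra|].
have hF : H (gam - 1) (ctail f) by apply: H_ctail; [lra|rewrite subrK].
have hgg : H (gam - 1) g.
  apply: hg => //; first by apply: (proj1 (HB _ _)) => //; apply: (proj1 (HZ _ _)).
  apply: (proj1 (HD _ _)); last by apply: (proj1 (HZ _ _)).
  apply: (proj1 (HD _ _)) => //; apply: (proj1 (HZ _ _)).
  by apply: (proj1 (H_conv _ _ _ _ _)).
have Lra := L1_LT ca la; have Lrf := L1_LT cf lf; have LrF := L1_LT (@causal_ctail f) lF.
have Lrg := L1_LT cg lg; have Lrk := L1_LT ck lk; have Lrr : LT r.
  by apply: L1_LT => // x x0; apply: r1; lra.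
exists c, g; split=> //; split=> [|s s0].
  have lkg := conv_L1 lk lg.
  have e1 : {ae mu, forall x, g x = 1 * g0 x + 1 * conv k g x}.
    by apply: ae_S eg => x ->; rewrite !mul1r.
  have := Int_lin (L1_meas lg) lg0 lkg e1; rewrite !mul1r Int_conv //.
  rewrite (IntD lz); last exact: L1Z.
  rewrite IntD //; last exact: L1Z.
  rewrite !IntZ //; last exact: L1_meas.
  rewrite IntB // IntZ // Int_conv // If IF mulr1 => e2.
  (* The coefficient 1 / q of the constant part is exactly what makes [g0] of integral zero, since 1
     + z = 1 / (1 - th) and M = q Int a / (1 - th). As Int k = 1 - c M, [g] then has integral zero
     too. *)
  have e3 : Int a + z * Int a + - q^-1 * M = 0.
    by rewrite /M /Mr Ira /z; field; rewrite th1' gt_eqF.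
  rewrite e3 add0r in e2; apply: (@mulfI _ (c * M)); first exact: lt0r_neq0 (mulr_gt0 c0 M0).
  lra.
have cgg : causal (fun x => g0 x + conv k g x).
  by move=> x x0; rewrite cg0 // causal_conv // addr0.
have [_ e] := LT_ae (L1_meas (L1D lg0 (conv_L1 lk lg))) cgg Lrg eg.
have Laf := LT_conv Lra Lrf.
have LzF : LT (fun y => a y + z * conv a f y) by apply: LT_D => //; apply: LT_Z.
have {}e : Lap g s = Lap a s + z * (Lap a s * Lap f s) + - q^-1 * ((1 - Lap f s) / s)
     + (Lap f s - c * ((1 - Lap f s) / s)) * Lap g s.
  rewrite -[LHS]e Lap_D //; [|exact: L1_LT|exact: LT_conv].
  rewrite (Lap_D s0 LzF); last exact: LT_Z.
  rewrite (Lap_D s0) //; last exact: LT_Z.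
  rewrite !Lap_Z // !Lap_conv // Lap_B //; last exact: LT_Z.
  by rewrite Lap_Z // Lap_ctail // If.
have e1 := Lf s s0; move: e e1; set F := Lap f s; set l := Lap r s; set G := Lap g s; set A := Lap a s.
move=> e e1.
have e2 : ((q * s)^-1 + (1 + c / s) * G) * (1 - F) = A * (1 + z * F).
  have : G = A * (1 + z * F) - (q * s)^-1 * (1 - F) + (F - c / s * (1 - F)) * G.
    by rewrite {1}e invfM; ring.
  move=> e3; lra.
have e3 : (1 - F) * (1 - th * l) = 1 - l by rewrite mulrBl e1; ring.
have e4 : (1 + z * F) * (1 - th * l) = 1.
  rewrite mulrDl -mulrA e1 /z mul1r mulrA divfK //; ring.
by rewrite -e3 mulrA e2 -mulrA e4 mulr1.
Qed.
End Renewal.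

(** * Straddle calculus *)

Section Straddle.
Variable R : realType.
Implicit Types (f g h : R -> R) (a b c e s t x y : R).
Local Notation mu := (@lebesgue_measure R).
Local Notation ind := (@ind R).

(** Compactness for interval functions, by a supremum argument. Asking only for short intervals that
    contain [t] suits pointwise derivatives, where the admissible length depends on the point. *)
Lemma cousin (P : R -> R -> Prop) a b : a <= b ->
  (forall x y z, x <= y -> y <= z -> P x y -> P y z -> P x z) ->
  (forall t, a <= t <= b -> exists2 d, 0 < d &
    forall x y, a <= x -> x <= t -> t <= y -> y <= b -> y - x <= d -> P x y) ->
  P a b.
Proof.
move=> ab tr loc; pose S := [set x | a <= x <= b /\ P a x].
have Sa : S a.
  split; first by rewrite lexx.
  have [|d d0 hd] := loc a; first by rewrite lexx.
  by apply: hd => //; rewrite subrr ltW.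
have ubS : ubound S b by move=> x [/andP[_ h] _].
have hs : has_sup S by split; [exists a|exists b].
pose s := sup S.
have sa : a <= s by apply: ub_le_sup => //; exists b.
have sb : s <= b by apply: ge_sup => //; exists a.
have [|d d0 hd] := loc s; first by rewrite sa sb.
have [x [/andP[ax xb] Px] sx] : exists2 x, S x & s - d < x by apply: sup_adherent.
have xs : x <= s by apply: ub_le_sup; [exists b|split; [rewrite ax xb|]].
have Ps : P a s by apply: (tr a x s) => //; apply: hd => //; lra.
have [bs|sb'] := leP b s; first by have -> : b = s by lra.
pose v := Num.min b (s + d).
have vb : v <= b by rewrite ge_min lexx.
have vd : v <= s + d by rewrite ge_min lexx orbT.
have sv : s < v by rewrite lt_min sb' ltrDl.
have Pv : P a v by apply: (tr a s v) => //; [exact: ltW|apply: hd => //; lra].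
have : v <= s by apply: ub_le_sup; [exists b|split=> //; rewrite vb andbT; lra].
by rewrite leNgt sv.
Qed.

Lemma L1_excess f e : L1 f -> 0 < e -> exists n : nat,
  L1 (fun z => Num.max (`|f z| - n.+1%:R) 0) /\ Int (fun z => Num.max (`|f z| - n.+1%:R) 0) < e.
Proof.
move=> lf e0; have mf := L1_meas lf; have laf := L1_abs lf.
have le n z : `|Num.max (`|f z| - n.+1%:R) 0| <= `|f z|.
  by rewrite ger0_norm ?le_max ?lexx ?orbT // ge_max normr_ge0 andbT lerBlDr lerDl ler0n.
have ms n : measurable_fun setT (fun z => Num.max (`|f z| - n.+1%:R) 0).
  by apply: measurable_maxr => //; apply: measurable_funB => //; apply: measurableT_comp.
have cv (z : R) : (fun n : nat => Num.max (`|f z| - n.+1%:R) 0) @ \oo --> (0 : R).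
  apply: cvg_near_cst; near=> n; apply/max_idPr; rewrite subr_le0.
  near: n; exists (Num.truncn `|f z|) => // n /= hn.
  by apply: (le_trans (ltW (truncnS_gt _))); rewrite ler_nat ltnS.
have [||||_ cv2] := @Int_dct _ (fun (n : nat) z => Num.max (`|f z| - n.+1%:R) 0) (fun=> 0) _ laf.
- exact: ms.
- exact: measurable_cst.
- exact: le.
- exact: ae_T.
rewrite Int0 in cv2; have [n _ h] := cvgr_lt _ cv2 _ e0.
by exists n; split; [exact: L1_le (ms n) laf (le n)|exact: (h n (leqnn n))].
Unshelve. all: by end_near. Qed.

(** Absolute continuity of the integral: the part of |f| above a high level n + 1 has integral below
    e / 2, and the rest contributes at most n + 1 times the length. *)
Lemma Int_small f e : L1 f -> 0 < e -> exists2 d, 0 < d &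
  forall x y, x <= y -> y - x <= d -> Int (fun z => ind (x <= z <= y) * `|f z|) <= e.
Proof.
move=> lf e0; have mf := L1_meas lf; have laf := L1_abs lf.
have e2 : 0 < e / 2 by rewrite divr_gt0.
have [n [lm hn]] := L1_excess lf e2.
exists (e / 2 / n.+1%:R) => [|x y xy yx]; first by rewrite divr_gt0.
have [lI iI] := Int_itv xy.
have h1 : Int (fun z => ind (x <= z <= y) * `|f z|) <=
    Int (fun z => n.+1%:R * ind (x <= z <= y) + Num.max (`|f z| - n.+1%:R) 0).
  apply: Int_le; [|by apply: L1D => //; apply: L1Z|].
    apply: (L1_le _ laf) => [|z]; last by apply: le_trans (indM_norm _ _) _; rewrite normr_id.
    apply: measurable_funM; first exact: L1_meas lI.
    exact: measurableT_comp.
  move=> z; rewrite /ind; case: (_ <= _ <= _) => /=; rewrite ?mul1r ?mul0r ?mulr1 ?mulr0 ?add0r.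
    by rewrite -lerBlDl le_max lexx.
  by rewrite le_max lexx orbT.
apply: (le_trans h1); rewrite IntD //; last exact: L1Z.
rewrite IntZ ?iI; last exact: L1_meas lI.
have : n.+1%:R * (y - x) <= e / 2 by rewrite mulrC -ler_pdivlMr.
lra.
Qed.


(* [dsim B V T G t c]: at time t, G has derivative c with respect to B, the
   error being measured by the increments of the variation V. *)
Definition dsim (B V : R -> R) T (G : R -> R) t c := forall e, 0 < e -> exists2 d, 0 < d &
  forall x y, 0 <= x -> x <= t -> t <= y -> y <= T -> y - x <= d ->
  `|G y - G x - c * (B y - B x)| <= e * (V y - V x).

(** In the application [B] is the primitive of the trace and [V] that of its absolute value; the
    second clause is the uniform continuity of [V]. *)
Definition ctrl (B V : R -> R) :=
  (forall x y, x <= y -> `|B y - B x| <= V y - V x) /\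
  (forall e, 0 < e -> exists2 d, 0 < d & forall x y, x <= y -> y - x <= d -> V y - V x <= e).

(** The local errors e (V y - V x) add up over a subdivision to e (V T - V 0), so [cousin] turns a
    nonpositive derivative relative to [V] into a global inequality. *)
Lemma straddle_le (V : R -> R) T (G : R -> R) : 0 <= T -> 
  (forall x y, x <= y -> V x <= V y) ->
  (forall t, 0 <= t <= T -> forall e, 0 < e -> exists2 d, 0 < d &
  forall x y, 0 <= x -> x <= t -> t <= y -> y <= T -> y - x <= d ->
  G y - G x <= e * (V y - V x)) -> G T <= G 0.
Proof.
move=> T0 mV h; apply/ler_addgt0Pr => e e0.
have V1 : 0 < V T - V 0 + 1 by rewrite ltr_wpDl // subr_ge0 mV.
have e1 : 0 < e / (V T - V 0 + 1) by rewrite divr_gt0.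
have : G T - G 0 <= e / (V T - V 0 + 1) * (V T - V 0).
  apply: (cousin (P := fun x y => G y - G x <= e / (V T - V 0 + 1) * (V y - V x)) T0).
    by move=> x y z _ _ h1 h2; lra.
  by move=> t /h /(_ _ e1).
have : e / (V T - V 0 + 1) * (V T - V 0) <= e.
  rewrite -[X in _ <= X]mulr1 -mulrA ler_pM2l // mulrC ler_pdivrMr // mul1r; lra.
lra.
Qed.

Section Dsim.
Variables (B V : R -> R) (T : R).
Hypothesis BV : ctrl B V.
Local Notation dsim := (dsim B V T).

Lemma ctrl_mono x y : x <= y -> V x <= V y.
Proof. by case: BV => h _ xy; rewrite -subr_ge0; apply: le_trans (h _ _ xy). Qed.

Lemma dsim_cst a t : dsim (fun=> a) t 0.
Proof.
move=> e e0; exists 1 => // x y x0 xt ty yT _.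
by rewrite subrr mul0r subr0 normr0 mulr_ge0 ?subr_ge0 ?ctrl_mono //; [exact: ltW|exact: le_trans ty].
Qed.

Lemma straddle (G : R -> R) : 0 <= T -> (forall t, 0 <= t <= T -> dsim G t 0) -> G T = G 0.
Proof.
move=> T0 h; apply: le_anti; apply/andP; split.
  apply: (straddle_le T0 ctrl_mono) => t /h ht e e0; have [d d0 hd] := ht e e0.
  exists d => // x y x0 xt ty yT yx; have := hd x y x0 xt ty yT yx.
  by rewrite mul0r subr0; apply: le_trans; exact: ler_norm.
rewrite -lerN2; apply: (straddle_le (G := fun x => - G x) T0 ctrl_mono) => t /h ht e e0.
have [d d0 hd] := ht e e0.
exists d => // x y x0 xt ty yT yx; have := hd x y x0 xt ty yT yx.
by rewrite mul0r subr0 -normrN opprB; apply: le_trans; rewrite opprK addrC; exact: ler_norm.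
Qed.

Lemma dsim_K (G : R -> R) t c K : 0 <= K ->
  (forall e, 0 < e -> e <= 1 -> exists2 d, 0 < d &
    forall x y, 0 <= x -> x <= t -> t <= y -> y <= T -> y - x <= d ->
    `|G y - G x - c * (B y - B x)| <= K * e * (V y - V x)) -> dsim G t c.
Proof.
move=> K0 h e e0; have K1 : 0 < K + 1 by lra.
have [||d d0 hd] := h (Num.min (e / (K + 1)) 1).
- by rewrite lt_min ltr01 divr_gt0.
- by rewrite ge_min lexx orbT.
exists d => // x y x0 xt ty yT yx; apply: le_trans (hd x y x0 xt ty yT yx) _.
rewrite ler_wpM2r ?subr_ge0 ?ctrl_mono //; first exact: le_trans ty.
apply: le_trans (_ : K * (e / (K + 1)) <= _); first by rewrite ler_wpM2l // ge_min lexx.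
rewrite mulrCA -[X in _ <= X]mulr1 ler_pM2l // ler_pdivrMr // mul1r; lra.
Qed.

Lemma dsim_cont (G : R -> R) t c e : 0 <= t <= T -> dsim G t c -> 0 < e -> exists2 d, 0 < d &
  forall x, 0 <= x <= T -> `|x - t| <= d -> `|G x - G t| <= e.
Proof.
move=> /andP[t0 tT] hG e0; have [d d0 hd] := hG 1 ltr01.
have c1 : 0 < `|c| + 1 by rewrite ltr_wpDl.
have e1 : 0 < e / (`|c| + 1) by rewrite divr_gt0.
have [BV1 VC] := BV.
have [d' d'0 hd'] := VC _ e1.
have key x y : 0 <= x -> x <= t -> t <= y -> y <= T -> y - x <= Num.min d d' -> `|G y - G x| <= e.
  move=> x0 xt ty yT; rewrite le_min => /andP[yx yx'].
  have xy : x <= y := le_trans xt ty.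
  have h1 := hd x y x0 xt ty yT yx; have h2 := hd' x y xy yx'; have h3 := BV1 x y xy.
  rewrite mul1r in h1; rewrite ler_pdivlMr // in h2.
  have -> : G y - G x = (G y - G x - c * (B y - B x)) + c * (B y - B x) by ring.
  apply: le_trans (ler_normD _ _) _; rewrite (normrM c).
  have : `|c| * `|B y - B x| <= `|c| * (V y - V x) by rewrite ler_wpM2l.
  lra.
exists (Num.min d d') => [|x /andP[x0 xT]]; first by rewrite lt_min d0.
have [xt|tx] := leP x t => hx.
  by rewrite distrC; apply: key => //; rewrite distrC ger0_norm ?subr_ge0 // in hx.
by apply: key => //; [exact: ltW|move: hx; rewrite ger0_norm // subr_ge0 ltW].
Qed.

Lemma dsim_add (G H : R -> R) t c d : dsim G t c -> dsim H t d -> dsim (fun x => G x + H x) t (c + d).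
Proof.
move=> hG hH; apply: (@dsim_K _ _ _ 2) => // e e0 _; have [d1 d10 h1] := hG e e0; have [d2 d20 h2] := hH e e0.
exists (Num.min d1 d2) => [|x y x0 xt ty yT]; first by rewrite lt_min d10.
rewrite le_min => /andP[/(h1 x y x0 xt ty yT) k1 /(h2 x y x0 xt ty yT) k2].
have -> : G y + H y - (G x + H x) - (c + d) * (B y - B x) =
  (G y - G x - c * (B y - B x)) + (H y - H x - d * (B y - B x)) by ring.
by apply: le_trans (ler_normD _ _) _; lra.
Qed.

Lemma dsim_mul (G H : R -> R) t c d : 0 <= t <= T -> dsim G t c -> dsim H t d ->
  dsim (fun x => G x * H x) t (c * H t + G t * d).
Proof.
move=> tT hG hH; have K0 : 0 <= `|G t| + 1 + `|d| + (`|H t| + 1) + `|c| by rewrite !addr_ge0.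
apply: (dsim_K K0) => // e e0 e1.
have [d1 d10 h1] := hG e e0; have [d2 d20 h2] := hH e e0.
have [d3 d30 h3] := dsim_cont tT hG e0; have [d4 d40 h4] := dsim_cont tT hH e0.
exists (Num.min (Num.min d1 d2) (Num.min d3 d4)) => [|x y x0 xt ty yT].
  by rewrite !lt_min d10 d20 d30.
rewrite !le_min => /andP[/andP[/(h1 x y x0 xt ty yT) k1 /(h2 x y x0 xt ty yT) k2] /andP[yx3 yx4]].
have xT : 0 <= x <= T by rewrite x0 (le_trans xt) // (le_trans ty).
have yT' : 0 <= y <= T by rewrite yT (le_trans x0) // (le_trans xt).
have k3 : `|G y - G t| <= e by apply: h3 => //; rewrite ger0_norm ?subr_ge0 //; lra.
have k4 : `|H x - H t| <= e by apply: h4 => //; rewrite distrC ger0_norm ?subr_ge0 //; lra.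
have xy : x <= y := le_trans xt ty.
have kB := BV.1 x y xy; have V0 : 0 <= V y - V x by rewrite subr_ge0 ctrl_mono.
have -> : G y * H y - G x * H x - (c * H t + G t * d) * (B y - B x) =
  G y * (H y - H x - d * (B y - B x)) + (G y - G t) * d * (B y - B x) +
  H x * (G y - G x - c * (B y - B x)) + (H x - H t) * c * (B y - B x) by ring.
have nG : `|G y| <= `|G t| + 1.
  have -> : G y = G t + (G y - G t) by ring.
  by apply: le_trans (ler_normD _ _) _; lra.
have nH : `|H x| <= `|H t| + 1.
  have -> : H x = H t + (H x - H t) by ring.
  by apply: le_trans (ler_normD _ _) _; lra.
have t1 : `|G y| * `|H y - H x - d * (B y - B x)| <= (`|G t| + 1) * (e * (V y - V x)) by apply: ler_pM.
have t2 : `|G y - G t| * `|d| * `|B y - B x| <= e * `|d| * (V y - V x).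
  by apply: ler_pM; rewrite ?mulr_ge0 ?ler_wpM2r.
have t3 : `|H x| * `|G y - G x - c * (B y - B x)| <= (`|H t| + 1) * (e * (V y - V x)) by apply: ler_pM.
have t4 : `|H x - H t| * `|c| * `|B y - B x| <= e * `|c| * (V y - V x).
  by apply: ler_pM; rewrite ?mulr_ge0 ?ler_wpM2r.
rewrite -!normrM in t1 t2 t3 t4.
apply: (le_trans (ler_normD _ _)); apply: (le_trans (lerD (ler_normD _ _) t4)).
apply: (le_trans (lerD (lerD (ler_normD _ _) t3) (lexx _))); lra.
Qed.

Lemma dsim_scale a (G : R -> R) t c : 0 <= t <= T -> dsim G t c -> dsim (fun x => a * G x) t (a * c).
Proof. by move=> tT hG; have := dsim_mul tT (@dsim_cst a t) hG; rewrite mul0r add0r. Qed.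

Lemma dsim_horner (P : {poly R}) (G : R -> R) t c : 0 <= t <= T -> dsim G t c ->
  dsim (fun x => P.[G x]) t (P^`().[G t] * c).
Proof.
move=> tT hG; elim/poly_ind: P => [|P a IH].
  rewrite deriv0 horner0 mul0r (_ : (fun x => _) = fun=> 0); first exact: dsim_cst.
  by apply/funext => x; rewrite horner0.
rewrite derivD derivM derivX derivC addr0 mulr1 hornerD hornerM hornerX.
rewrite (_ : (fun x => _) = fun x => P.[G x] * G x + a); last first.
  by apply/funext => x; rewrite hornerMXaddC.
rewrite (_ : _ * c = (P^`().[G t] * c * G t + P.[G t] * c) + 0); last by rewrite addr0; ring.
by apply: dsim_add; [exact: dsim_mul|exact: dsim_cst].
Qed.

Lemma dsim_inv (G : R -> R) t c : 0 <= t <= T -> 0 < G t -> dsim G t c ->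
  dsim (fun x => (G x)^-1) t (- c / G t ^+ 2).
Proof.
move=> tT g0 hG; pose g := G t; rewrite -/g.
have K0 : 0 <= 4 / g ^+ 2 + `|c| * (12 / g ^+ 3).
  by rewrite addr_ge0 ?mulr_ge0 // ?invr_ge0 ?exprn_ge0 // ltW.
apply: (dsim_K K0) => e e0 e1; have e2 : 0 < Num.min e (g / 2) by rewrite lt_min e0 divr_gt0.
have [d1 d10 h1] := hG e e0; have [d2 d20 h2] := dsim_cont tT hG e2.
exists (Num.min d1 d2) => [|x y x0 xt ty yT]; first by rewrite lt_min d10.
rewrite le_min => /andP[/(h1 x y x0 xt ty yT) k1 yx2].
have xT : 0 <= x <= T by rewrite x0 (le_trans xt) // (le_trans ty).
have yT' : 0 <= y <= T by rewrite yT (le_trans x0) // (le_trans xt).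
have : `|G x - G t| <= Num.min e (g / 2) by apply: h2 => //; rewrite distrC ger0_norm ?subr_ge0 //; lra.
have : `|G y - G t| <= Num.min e (g / 2) by apply: h2 => //; rewrite ger0_norm ?subr_ge0 //; lra.
rewrite -/g !le_min => /andP[ye yg] /andP[xe xg].
have xy : x <= y := le_trans xt ty.
have kB := BV.1 x y xy; have V0 : 0 <= V y - V x by rewrite subr_ge0 ctrl_mono.
have /andP[xg1 xg2] : - (g / 2) <= G x - g <= g / 2 by rewrite -ler_norml.
have /andP[yg1 yg2] : - (g / 2) <= G y - g <= g / 2 by rewrite -ler_norml.
have gx : g / 2 <= G x by lra.
have gy : g / 2 <= G y by lra.
have gp : 0 < g by [].
have gx0 : 0 < G x by lra.
have gy0 : 0 < G y by lra.
have -> : (G y)^-1 - (G x)^-1 - - c / g ^+ 2 * (B y - B x) =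
   - (G y - G x - c * (B y - B x)) / (G x * G y) +
   c * (B y - B x) * ((G x * (G y - g) + g * (G x - g)) / (G x * G y * g ^+ 2)).
  by field; rewrite !lt0r_neq0.
have gg : g ^+ 2 / 4 <= G x * G y.
  have -> : g ^+ 2 / 4 = (g / 2) * (g / 2) by field.
  by apply: ler_pM => //; lra.
have gg0 : 0 < g ^+ 2 by rewrite exprn_gt0.
have igg : (G x * G y)^-1 <= 4 / g ^+ 2.
  rewrite -[4 / _]invrK lef_pV2 ?posrE ?mulr_gt0 ?invr_gt0 // ?divr_gt0 //.
  by rewrite invf_div.
have ig0 : 0 <= (G x * G y)^-1 by rewrite invr_ge0 mulr_ge0 // ltW.
have t1 : `|- (G y - G x - c * (B y - B x)) / (G x * G y)| <= 4 / g ^+ 2 * e * (V y - V x).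
  rewrite normrM normrN (ger0_norm ig0) -[_ * e * _]mulrA [4 / _ * _]mulrC.
  exact: ler_pM.
have t2 : `|(G x * (G y - g) + g * (G x - g)) / (G x * G y * g ^+ 2)| <= 12 / g ^+ 3 * e.
  have n0 : 0 <= g ^- 2 by rewrite invr_ge0 ltW.
  rewrite normrM invfM (ger0_norm (mulr_ge0 ig0 n0)).
  have -> : 12 / g ^+ 3 * e = (3 * g * e) * (4 / g ^+ 2 * g ^- 2).
    by field; rewrite lt0r_neq0.
  apply: ler_pM => //; [exact: mulr_ge0| |by rewrite ler_wpM2r].
  apply: le_trans (ler_normD _ _) _; rewrite !normrM (gtr0_norm gx0) (gtr0_norm gp).
  have : G x * `|G y - g| <= (2 * g) * e by apply: ler_pM => //; lra.
  have : g * `|G x - g| <= g * e by apply: ler_pM => //; lra.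
  lra.
apply: (le_trans (ler_normD _ _)); rewrite [X in _ + X]normrM (normrM c).
have t3 : `|c| * `|B y - B x| <= `|c| * (V y - V x) by rewrite ler_wpM2l.
have : `|c| * `|B y - B x| * `|(G x * (G y - g) + g * (G x - g)) / (G x * G y * g ^+ 2)| <=
   `|c| * (V y - V x) * (12 / g ^+ 3 * e) by apply: ler_pM => //; rewrite mulr_ge0.
lra.
Qed.

End Dsim.
End Straddle.

(** * Weak form of the Bochner integral *)

Section Translate.
Variable R : realType.
Implicit Types (f g h phi J : R -> R) (a b c e s t x y M : R).
Local Notation mu := (@lebesgue_measure R).
Local Notation ind := (@ind R).

Lemma ext1E f x : ext1 f x = ind (1 <= x) * f x.
Proof. by rewrite /ext1 /ind; case: (1 <= x); rewrite ?mul1r ?mul0r. Qed.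

Lemma ext1_funE f : ext1 f = (fun x => ind (1 <= x) * f x).
Proof. by apply/funext => x; rewrite ext1E. Qed.

Lemma itv1P x : (1 <= x) <-> `[1, +oo[%classic x.
Proof. by rewrite /= in_itv /= andbT. Qed.

Lemma inL1P f : inL1 f <-> L1 (ext1 f).
Proof. by rewrite ext1_funE; case: (L1_restrict f (measurable_itv `[1, +oo[) itv1P). Qed.

Lemma norm1E f : inL1 f -> norm1 f = (n1 (ext1 f))%:E.
Proof.
move=> /inL1P l; rewrite /norm1 /n1 -IntE; last exact: L1_abs.
rewrite integral_mkcond; apply: eq_integral => x _; rewrite patchE ext1E.
case: ifPn => [/set_mem/itv1P ->|/negP h]; first by rewrite mul1r.
by rewrite indF ?mul0r ?normr0 //; apply/negP => /itv1P/mem_set.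
Qed.

Lemma ext1B f g : ext1 (fun x => f x - g x) = (fun x => ext1 f x - ext1 g x).
Proof. by apply/funext => x; rewrite !ext1E mulrBr. Qed.

Lemma ext1Z c f : ext1 (fun x => c * f x) = (fun x => c * ext1 f x).
Proof. by apply/funext => x; rewrite !ext1E mulrCA. Qed.

Lemma ext1_sum (I : Type) (r : seq I) (F : I -> R -> R) :
  ext1 (fun x => \sum_(i <- r) F i x) = (fun x => \sum_(i <- r) ext1 (F i) x).
Proof. by apply/funext => x; rewrite ext1E mulr_sumr; apply: eq_bigr => i _; rewrite ext1E. Qed.

Lemma ecvg0_lt (T : Type) (F : set_system T) (FF : Filter F) (u : T -> \bar R) e :
  u @ F --> 0%E -> 0 < e -> \forall x \near F, (u x < e%:E)%E.
Proof.
move=> cv e0; have op : nbhs (0%:E : \bar R) [set z | (z < e%:E)%E].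
  apply: open_nbhs_nbhs; split; first exact: open_ereal_lt_ereal.
  by rewrite /= lte_fin.
exact: (cv _ op).
Qed.

Lemma Int_sum_seq (I : eqType) (r : seq I) (F : I -> R -> R) : (forall i, i \in r -> L1 (F i)) ->
  L1 (fun x => \sum_(i <- r) F i x) /\ Int (fun x => \sum_(i <- r) F i x) = \sum_(i <- r) Int (F i).
Proof.
elim: r => [|i r IH] h.
  have E : (fun x => \sum_(i <- [::]) F i x) = (fun=> 0) by apply/funext => x; rewrite big_nil.
  by rewrite E big_nil Int0; split=> //; exact: L1_0.
have [l e] := IH (fun j hj => h j (mem_behead (s := i :: r) hj)).
have hi : L1 (F i) by apply: h; rewrite mem_head.
have E : (fun x => \sum_(j <- i :: r) F j x) = (fun x => F i x + \sum_(j <- r) F j x).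
  by apply/funext => x; rewrite big_cons.
by rewrite E big_cons IntD // e; split=> //; exact: L1D.
Qed.

Lemma L1_bounded f phi M : L1 f -> measurable_fun setT phi -> (forall x, `|phi x| <= M) ->
  L1 (fun x => f x * phi x) /\ `|Int (fun x => f x * phi x)| <= M * n1 f.
Proof.
move=> lf mphi hM; have lMf : L1 (fun x => M * `|f x|) by apply: L1Z; exact: L1_abs.
have le x : `|f x * phi x| <= M * `|f x| by rewrite normrM mulrC ler_wpM2r.
have l : L1 (fun x => f x * phi x).
  by apply: L1_le lMf le; apply: measurable_funM => //; exact: L1_meas.
split=> //; apply: le_trans (Int_absL1 l) _.
by rewrite /n1 -IntZ; [apply: Int_le => //; exact: L1_abs|apply: L1_meas; exact: L1_abs].
Qed.

Lemma Int_indic (A : set R) : measurable A -> (mu A < +oo)%E ->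
  L1 (\1_A : R -> R) /\ Int (\1_A : R -> R) = fine (mu A).
Proof.
move=> mA fA; split; last by rewrite IntR /Rintegral integral_indic // setIT.
apply/integrableP; split; first exact/measurable_EFinP.
have -> : (\int[mu]_x `|(EFin \o \1_A) x| = \int[mu]_x (\1_A x)%:E)%E.
  by apply: eq_integral => x _; rewrite /= ger0_norm.
by rewrite integral_indic // setIT.
Qed.

(** A single approximating simple function serves all bounded tests: the error density [Ne] is fixed
    before [phi]. The scalar function [G] stands in for the pairing of [F s] with [phi], whose
    measurability in s is thereby never asked for. *)
Lemma bochner_weak T F J : is_bochner_integral `[0, T]%classic F J -> forall e, 0 < e ->
  exists Ne : R -> R, [/\ L1 Ne, Int Ne <= e, (forall s, 0 <= Ne s) &
  forall phi M, measurable_fun setT phi -> (forall x, `|phi x| <= M) ->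
  exists G : R -> R, [/\ L1 G,
   (forall s, 0 <= s <= T -> `|G s - Int (fun x => ext1 (F s) x * phi x)| <= M * Ne s),
   (forall s, ~~ (0 <= s <= T) -> G s = 0) &
   `|Int G - Int (fun x => ext1 J x * phi x)| <= M * e]].
Proof.
move=> [F1 J1 [g [gs gm gi gJ]]] e e0.
have [n [h1 h2]] : exists n,
   (\int[mu]_(s in `[0%R, T]) norm1 (F s \- simple_val (g n) s)%R < e%:E)%E /\
   (norm1 (J \- simple_int (g n))%R < e%:E)%E.
  have [n _ hn] := filterI (ecvg0_lt _ gi e0) (ecvg0_lt _ gJ e0).
  by exists n; apply: (hn n (leqnn n)).
have l2 u : u \in g n -> L1 (ext1 u.2) by move=> /gs[_ _ _ /inL1P].
have LS (cf : set R * (R -> R) -> R) :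
    L1 (fun x => \sum_(u <- g n) cf u * ext1 u.2 x) /\
    forall phi M, measurable_fun setT phi -> (forall x, `|phi x| <= M) ->
    Int (fun x => (\sum_(u <- g n) cf u * ext1 u.2 x) * phi x) =
    \sum_(u <- g n) cf u * Int (fun x => ext1 u.2 x * phi x).
  have h u : u \in g n -> L1 (fun x => cf u * ext1 u.2 x) by move=> /l2; exact: L1Z.
  split; first by case: (Int_sum_seq h).
  move=> phi M mphi hM.
  have h' u : u \in g n -> L1 (fun x => cf u * (ext1 u.2 x * phi x)).
    by move=> /l2 lu; apply: L1Z; case: (L1_bounded lu mphi hM).
  rewrite (@Int_eq _ _ (fun x => \sum_(u <- g n) cf u * (ext1 u.2 x * phi x))).
    rewrite (proj2 (Int_sum_seq h')); apply: eq_big_seq => u /l2 lu.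
    by rewrite IntZ //; apply: L1_meas; case: (L1_bounded lu mphi hM).
  by move=> x; rewrite mulr_suml; apply: eq_bigr => u _; rewrite mulrA.
have sv s : ext1 (simple_val (g n) s) = (fun x => \sum_(u <- g n) \1_(u.1) s * ext1 u.2 x).
  by rewrite ext1_sum; apply/funext => x; apply: eq_bigr => u _; rewrite ext1Z.
have si : ext1 (simple_int (g n)) = (fun x => \sum_(u <- g n) fine (mu u.1) * ext1 u.2 x).
  by rewrite ext1_sum; apply/funext => x; apply: eq_bigr => u _; rewrite ext1Z.
have Fd s : 0 <= s <= T -> L1 (ext1 (F s)).
  by move=> sT; apply/inL1P; apply: F1; rewrite /= in_itv.
have inD s : 0 <= s <= T -> inL1 (F s \- simple_val (g n) s).
  move=> sT; apply/inL1P; rewrite (ext1B (F s)); apply: L1B; first exact: Fd.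
  by rewrite sv; case: (LS (fun u => \1_(u.1) s)).
pose nu s := norm1 (F s \- simple_val (g n) s).
have nuE s : 0 <= s <= T -> nu s = (n1 (ext1 (F s \- simple_val (g n) s)))%:E.
  by move=> /inD; exact: norm1E.
pose Ne s := ind (0 <= s <= T) * fine (nu s).
have mD : measurable (`[0, T]%classic : set R) by exact: measurable_itv.
have PD s : (0 <= s <= T) <-> `[0, T]%classic s by rewrite /= in_itv.
have nu_int : (\int[mu]_(s in `[0%R, T]) nu s = \int[mu]_(s in `[0%R, T]) (fine (nu s))%:E)%E.
  by apply: eq_integral => s /set_mem/PD/nuE ->.
have Ne0 s : 0 <= Ne s.
  rewrite /Ne /ind; case: (boolP (0 <= s <= T)) => [/nuE ->|_]; last by rewrite mul0r.
  by rewrite mul1r; exact: n1_ge0.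
have int_nu : mu.-integrable `[0, T] (EFin \o (fun s => fine (nu s))).
  apply/integrableP; split.
    apply: (eq_measurable_fun _ _ (gm n)) => s /set_mem/PD sT.
    by rewrite /= -/(nu s) nuE.
  have -> : (\int[mu]_(x in `[0%R, T]) `|(EFin \o (fun s => fine (nu s))) x| = \int[mu]_(s in `[0%R, T]) nu s)%E.
    by apply: eq_integral => s /set_mem/PD sT; rewrite /= nuE //= ger0_norm //; exact: n1_ge0.
  by apply: lt_trans h1 _; rewrite ltry.
have [[lN _] iN] := L1_restrict (fun s => fine (nu s)) mD PD.
have {}lN := lN int_nu.
exists Ne; split=> //.
  by rewrite -iN -lee_fin /Rintegral fineK ?integrable_fin_num // -nu_int; exact: ltW.
move=> phi M mphi hM.
pose G s := \sum_(u <- g n) \1_(u.1) s * Int (fun x => ext1 u.2 x * phi x).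
have lG u : u \in g n -> L1 (fun s => \1_(u.1) s * Int (fun x => ext1 u.2 x * phi x)).
  move=> /gs[mA _ fA _]; apply: (L1_eq _ (L1Z (Int (fun x => ext1 u.2 x * phi x)) (proj1 (Int_indic mA fA)))).
  by move=> s; rewrite mulrC.
have [lGG iG] := Int_sum_seq lG.
have GE s : G s = Int (fun x => ext1 (simple_val (g n) s) x * phi x).
  by rewrite sv; case: (LS (fun u => \1_(u.1) s)) => _ /(_ phi M mphi hM) ->.
exists G; split=> //.
- move=> s sT; have [l1 _] := LS (fun u => \1_(u.1) s); rewrite -sv in l1.
  rewrite GE -IntB; [|by case: (L1_bounded l1 mphi hM)|by case: (L1_bounded (Fd s sT) mphi hM)].
  rewrite (@Int_eq _ _ (fun x => - ext1 (F s \- simple_val (g n) s) x * phi x)); last first.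
    by move=> x; rewrite (ext1B (F s)); ring.
  have := inD s sT => /inL1P l3.
  have := proj2 (L1_bounded (L1N l3) mphi hM); rewrite n1N.
  by rewrite /Ne indT // mul1r nuE.
- move=> s sT; rewrite /G big_seq big1 // => u /gs[_ sub _ _].
  by rewrite indicE memNset ?mul0r // => /sub h; case/negP: sT; exact/PD.
- have iG' : Int G = Int (fun x => ext1 (simple_int (g n)) x * phi x).
    rewrite iG si; case: (LS (fun u => fine (mu u.1))) => _ /(_ phi M mphi hM) ->.
    apply: eq_big_seq => u /gs[mA _ fA _]; have [li ii] := Int_indic mA fA.
    rewrite -ii mulrC -IntZ; last exact: L1_meas.
    by apply: Int_eq => s; rewrite mulrC.
  have [l1 _] := LS (fun u => fine (mu u.1)); rewrite -si in l1.
  have lJ : L1 (ext1 J) by apply/inL1P.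
  rewrite iG' -IntB; [|by case: (L1_bounded l1 mphi hM)|by case: (L1_bounded lJ mphi hM)].
  have eJ : ext1 (J \- simple_int (g n)) = (fun x => ext1 J x - ext1 (simple_int (g n)) x) by exact: ext1B.
  have lD : L1 (ext1 (J \- simple_int (g n))) by rewrite eJ; exact: L1B.
  rewrite (@Int_eq _ _ (fun x => - ext1 (J \- simple_int (g n)) x * phi x)); last first.
    by move=> x; rewrite eJ; ring.
  have := proj2 (L1_bounded (L1N lD) mphi hM); rewrite n1N => h; apply: le_trans h _.
  have M0 : 0 <= M by apply: le_trans (hM 0).
  rewrite ler_wpM2l //; apply: ltW; rewrite -lte_fin -norm1E //; exact/inL1P.
Qed.

End Translate.

(** * Convolution powers *)

Section Powers.
Variable R : realType.
Implicit Types (f g h phi : R -> R) (a b c e s t x y M : R).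
Local Notation mu := (@lebesgue_measure R).
Local Notation ind := (@ind R).
Local Notation conv := (@convolution R).

Definition vanish a f := forall x, x < a -> f x = 0.

Lemma vanish_causal a f : 0 <= a -> vanish a f -> causal f.
Proof. by move=> a0 vf x x0; apply: vf; apply: lt_le_trans x0 a0. Qed.

Lemma vanish_conv a b f g : vanish a f -> vanish b g -> vanish (a + b) (conv f g).
Proof.
move=> vf vg x xab; rewrite convE (@Int_eq _ _ (fun=> 0)) ?Int0 // => y.
have [ya|/vf ->] := leP a y; last by rewrite mul0r.
by rewrite (vg (x - y)) ?mulr0 //; lra.
Qed.

Lemma vanish_le a b f : a <= b -> vanish b f -> vanish a f.
Proof. by move=> ab vf x xa; apply: vf; apply: lt_le_trans xa ab. Qed.

Lemma vanish_ext1 f : vanish 1 (ext1 f).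
Proof. by move=> x x1; rewrite /ext1 leNgt x1. Qed.

Lemma ext1_id f : vanish 1 f -> ext1 f = f.
Proof. by move=> vf; apply/funext => x; rewrite /ext1; case: leP => // /vf. Qed.

Lemma Int_mulx_conv f g : L1 f -> L1 g -> causal f -> causal g ->
  L1 (fun x => x * f x) -> L1 (fun x => x * g x) ->
  L1 (fun x => x * conv f g x) /\ Int (fun x => x * conv f g x) =
    Int (fun x => x * f x) * Int g + Int f * Int (fun x => x * g x).
Proof.
move=> lf lg cf cg lxf lxg; have e := mulx_conv (L1_LT cf lf) (L1_LT cg lg).
have l1 := conv_L1 lxf lg; have l2 := conv_L1 lf lxg.
have m : measurable_fun setT (fun x => x * conv f g x).
  by apply: measurable_funM => //; apply: L1_meas; exact: conv_L1.
split; first by apply: (L1_ae m (L1D l1 l2)); apply: ae_S e => x ->.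
rewrite -(Int_conv lxf lg) -(Int_conv lf lxg) -(IntD l1 l2).
exact: Int_ae m (L1_meas (L1D l1 l2)) e.
Qed.

Lemma convpowS f j : convpow f j.+2 = conv f (convpow f j.+1). Proof. by []. Qed.

Lemma convpow_ind (P : (R -> R) -> Prop) f j : P f -> (forall g, P g -> P (conv f g)) -> P (convpow f j).
Proof. by case: j => [|j] // Pf h; elim: j => [|j IH] //; rewrite convpowS; apply: h. Qed.

Section Pow.
Variable f : R -> R.
Hypotheses (lf : L1 f) (vf : vanish 1 f).

Lemma L1_convpow j : L1 (convpow f j).
Proof. exact: (@convpow_ind (fun g => L1 g) f j lf (fun g lg => conv_L1 lf lg)). Qed.

Lemma vanish_convpow j : vanish 1 (convpow f j).
Proof.
apply: (@convpow_ind (fun g => vanish 1 g) f j vf) => g vg; apply: vanish_le (vanish_conv vf vg); lra.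
Qed.

Lemma LT_vanish g : L1 g -> vanish 1 g -> LT g.
Proof. by move=> lg vg; apply: L1_LT => //; apply: vanish_causal vg. Qed.

Lemma LT_convpow j : LT (convpow f j).
Proof. exact: LT_vanish (@L1_convpow j) (@vanish_convpow j). Qed.

Lemma convpow_ge0 j : (forall x, 0 <= f x) -> forall x, 0 <= convpow f j x.
Proof. move=> f0; apply: (@convpow_ind (fun g => forall x, 0 <= g x) f j f0) => g g0 x; exact: conv_ge0. Qed.

Lemma Int_convpow j : Int (convpow f j.+1) = Int f ^+ j.+1.
Proof.
elim: j => [|j IH]; first by rewrite expr1.
by rewrite convpowS Int_conv // ?IH -?exprS //; exact: L1_convpow.
Qed.

Lemma Lap_convpow j s : 0 < s -> Lap (convpow f j.+1) s = Lap f s ^+ j.+1.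
Proof.
move=> s0; elim: j => [|j IH]; first by rewrite expr1.
by rewrite convpowS Lap_conv // ?IH -?exprS //; [exact: LT_vanish|exact: LT_convpow].
Qed.

Lemma Lap_mulx_convpow j s : 0 < s ->
  Lap (fun x => x * convpow f j.+1 x) s = j.+1%:R * Lap f s ^+ j * Lap (fun x => x * f x) s.
Proof.
move=> s0; have Lf := LT_vanish lf vf; elim: j => [|j IH]; first by rewrite expr0 !mul1r.
rewrite convpowS Lap_mulx_conv //; last exact: LT_convpow.
by rewrite IH Lap_convpow // -[j.+2%:R]natr1 exprS; ring.
Qed.

Lemma Int_mulx_convpow j : L1 (fun x => x * f x) -> Int f = 1 ->
  L1 (fun x => x * convpow f j.+1 x) /\
  Int (fun x => x * convpow f j.+1 x) = j.+1%:R * Int (fun x => x * f x).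
Proof.
move=> lxf If; elim: j => [|j [l IH]]; first by rewrite mul1r.
have cf := vanish_causal ler01 vf.
have cp := vanish_causal ler01 (@vanish_convpow j.+1).
have [l' ->] := Int_mulx_conv lf (@L1_convpow j.+1) cf cp lxf l.
by split=> //; rewrite IH Int_convpow If expr1n mul1r mulr1 -[j.+2%:R]natr1; ring.
Qed.

End Pow.

Lemma H_convpow s : 0 <= s -> forall j, exists2 K, 0 <= K & forall f, L1 f -> n1 f <= 1 -> H s f ->
  H s (convpow f j) /\ n2 s (convpow f j) <= K * n2 s f.
Proof.
move=> s0; case=> [|j]; first by exists 1 => // f _ _ hf; rewrite mul1r.
elim: j => [|j [K K0 IH]]; first by exists 1 => // f _ _ hf; rewrite mul1r.
have c0 : 0 <= 2 * (2 `^ s) ^+ 2 :> R by rewrite mulr_ge0 ?sqr_ge0.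
exists (2 * (2 `^ s) ^+ 2 * (1 + K)) => [|f lf f1 hf].
  by rewrite mulr_ge0 // addr_ge0.
have [hc nc] := IH f lf f1 hf; rewrite convpowS.
have lc := L1_convpow lf j.+1.
have [hh nn] := H_conv s0 lf lc hf hc; split=> //; apply: le_trans nn _.
rewrite -[X in _ <= X]mulrA ler_wpM2l // mulrDl mul1r.
have n1c : n1 (convpow f j.+1) <= 1.
  elim: (j) => [|i IHi] //; rewrite convpowS; apply: le_trans (conv_n1 lf (L1_convpow lf i.+1)) _.
  by rewrite -[X in _ <= X]mulr1 ler_pM ?n1_ge0.
have h1 : n1 (convpow f j.+1) ^+ 2 <= 1 by rewrite expr_le1 ?n1_ge0.
have h2 : n1 f ^+ 2 <= 1 by rewrite expr_le1 ?n1_ge0.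
apply: lerD; first by rewrite -[X in _ <= X]mul1r ler_wpM2r ?n2_ge0.
by apply: le_trans nc; rewrite -[X in _ <= X]mul1r ler_wpM2r ?n2_ge0.
Qed.

Lemma convpow_H s : 0 <= s -> forall n, exists2 K, 0 <= K & forall j f, (j <= n)%N -> L1 f -> n1 f <= 1 -> H s f ->
  H s (convpow f j) /\ n2 s (convpow f j) <= K * n2 s f.
Proof.
move=> s0; elim=> [|n [K K0 IH]].
  have [K K0 h] := H_convpow s0 0; exists K => // j f; rewrite leqn0 => /eqP ->; exact: h.
have [K' K'0 h] := H_convpow s0 n.+1; exists (K + K') => [|j f jn lf f1 hf]; first exact: addr_ge0.
have n0 := n2_ge0 s f.
move: jn; rewrite leq_eqVlt => /orP[/eqP ->|]; last rewrite ltnS => jn.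
  have [hh nn] := h f lf f1 hf; split=> //; apply: (le_trans nn).
  by rewrite ler_wpM2r // lerDr.
have [hh nn] := IH j f jn lf f1 hf; split=> //; apply: (le_trans nn).
by rewrite ler_wpM2r // lerDl.
Qed.

Lemma ae_convpow f g j : measurable_fun setT f -> measurable_fun setT g ->
  {ae mu, forall x, f x = g x} -> {ae mu, forall x, convpow f j x = convpow g j x}.
Proof.
move=> mf mg e; case: j => [|[|j]] //; apply: ae_T => x; rewrite !convpowS.
have mp h i : measurable_fun setT h -> measurable_fun setT (convpow h i.+1).
  by move=> mh; elim: i => // i IH; rewrite convpowS; exact: measurable_conv.
have {}e j' : {ae mu, forall x, convpow f j'.+1 x = convpow g j'.+1 x}.
  elim: j' => // i IH; apply: ae_T => z; rewrite !convpowS.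
  by apply: conv_congr => //; exact: mp.
by apply: conv_congr (e 0%N) (e j) => //; exact: mp.
Qed.

Section Mixture.
Variables (N : nat) (p : nat -> R).
Hypotheses (hp0 : forall j : nat, (1 <= j <= N)%N -> 0 <= p j) (hp1 : \sum_(1 <= j < N.+1) p j = 1).
Local Notation Q := (Qconv N p).
Local Notation P := (Qpoly N p).

Lemma QE f : vanish 1 f -> Q f = (fun y => \sum_(1 <= j < N.+1) p j * convpow f j y).
Proof. by move=> vf; apply/funext => y; rewrite /Qconv ext1_id. Qed.

Lemma Q_ext1 f : Q (ext1 f) = Q f.
Proof. by apply/funext => y; rewrite /Qconv (ext1_id (@vanish_ext1 f)). Qed.

Lemma P_eval x : P.[x] = \sum_(1 <= j < N.+1) p j * x ^+ j.
Proof. by rewrite /Qpoly horner_sum; apply: eq_bigr => j _; rewrite hornerZ hornerXn. Qed.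

Lemma P_deriv x : P^`().[x] = \sum_(1 <= j < N.+1) p j * (j%:R * x ^+ j.-1).
Proof.
rewrite /Qpoly raddf_sum horner_sum; apply: eq_bigr => j _.
by rewrite /= derivZ derivXn hornerZ hornerMn hornerXn mulr_natl.
Qed.

Lemma hp0' j : j \in index_iota 1 N.+1 -> 0 <= p j.
Proof. by rewrite mem_index_iota ltnS => /hp0. Qed.

Lemma P1 : P.[1] = 1.
Proof. by rewrite P_eval -[RHS]hp1; apply: eq_bigr => j _; rewrite expr1n mulr1. Qed.

Lemma qmeanE : qmean N p = \sum_(1 <= j < N.+1) p j * j%:R.
Proof. by rewrite /qmean P_deriv; apply: eq_bigr => j _; rewrite expr1n mulr1. Qed.

Lemma qmean_ge1 : 1 <= qmean N p.
Proof.
rewrite qmeanE -{1}hp1 [X in X <= _]big_seq [X in _ <= X]big_seq; apply: ler_sum => j jN.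
rewrite ler_peMr ?hp0' //; rewrite mem_index_iota in jN; case/andP: jN => j1 _.
by rewrite ler1n.
Qed.

Lemma P_le1 x : 0 <= x -> x <= 1 -> [/\ 0 <= P.[x], P.[x] <= x & 1 - P.[x] <= qmean N p * (1 - x)].
Proof.
move=> x0 x1; rewrite P_eval qmeanE mulr_suml; split.
- rewrite big_seq; apply: sumr_ge0 => j jN; rewrite mulr_ge0 ?hp0' ?exprn_ge0 //.
- rewrite -[x in X in _ <= X]mul1r -hp1 mulr_suml.
  rewrite [X in X <= _]big_seq [X in _ <= X]big_seq; apply: ler_sum => j jN; rewrite ler_wpM2l ?hp0' //.
  rewrite mem_index_iota in jN; case: j jN => // j _; rewrite exprS -[X in _ <= X]mulr1 ler_wpM2l //.
  by rewrite exprn_ile1.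
- rewrite -{1}hp1 -sumrB.
  rewrite [X in X <= _]big_seq [X in _ <= X]big_seq; apply: ler_sum => j jN.
  rewrite -{1}[p j]mulr1 -mulrBr -mulrA ler_wpM2l ?hp0' //.
  elim: (j) => [|i IH]; first by rewrite expr0 subrr mul0r.
  rewrite -[i.+1%:R]natr1 exprS mulrDl mul1r.
  have e0 : 0 <= x ^+ i by apply: exprn_ge0.
  have e1 : x ^+ i <= 1 by apply: exprn_ile1.
  nra.
Qed.

Section Fixed.
Variable f : R -> R.
Hypotheses (lf : L1 f) (vf : vanish 1 f).

Lemma Lsum (G : nat -> R -> R) : (forall j, j \in index_iota 1 N.+1 -> L1 (G j)) ->
  L1 (fun y => \sum_(1 <= j < N.+1) p j * G j y) /\
  Int (fun y => \sum_(1 <= j < N.+1) p j * G j y) = \sum_(1 <= j < N.+1) p j * Int (G j).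
Proof.
move=> lG; have [l ->] := @Int_sum_seq R _ (index_iota 1 N.+1) (fun j y => p j * G j y)
  (fun j hj => L1Z (p j) (lG j hj)).
split=> //; apply: eq_big_seq => j hj; rewrite IntZ //; apply: L1_meas; exact: lG.
Qed.

Lemma L1_Q : L1 (Q f).
Proof. by rewrite QE //; have [] := @Lsum (convpow f) (fun j _ => L1_convpow lf j). Qed.

Lemma Int_Q : Int (Q f) = P.[Int f].
Proof.
rewrite QE // P_eval; have [_ ->] := @Lsum (convpow f) (fun j _ => L1_convpow lf j).
by apply: eq_big_nat => -[|j] // _; rewrite Int_convpow.
Qed.

Lemma vanish_Q : vanish 1 (Q f).
Proof.
by move=> x x1; rewrite QE // big1 // => j _; rewrite (vanish_convpow vf) // mulr0.
Qed.

Lemma LT_Q : LT (Q f). Proof. exact: LT_vanish L1_Q vanish_Q. Qed.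

Lemma Q_ge0 : (forall x, 0 <= f x) -> forall x, 0 <= Q f x.
Proof.
move=> f0 x; rewrite QE // big_seq; apply: sumr_ge0 => j /hp0' pj.
by rewrite mulr_ge0 // convpow_ge0.
Qed.

Lemma Lap_Q s : 0 < s -> Lap (Q f) s = P.[Lap f s].
Proof.
move=> s0; rewrite QE // P_eval /Lap.
have l j : j \in index_iota 1 N.+1 -> L1 (ew s (convpow f j)).
  by move=> _; case: (LT_convpow lf vf j) => _ _; apply.
have [_ e] := Lsum l; rewrite -[RHS](_ : \sum_(1 <= j < N.+1) p j * Int (ew s (convpow f j)) = _).
  by rewrite -e; apply: Int_eq => x; rewrite /ew mulr_sumr; apply: eq_bigr => j _; rewrite mulrCA.
by apply: eq_big_nat => -[|j] // _; rewrite -/(Lap _ s) Lap_convpow.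
Qed.

Lemma Lap_mulx_Q s : 0 < s -> Lap (fun x => x * Q f x) s = P^`().[Lap f s] * Lap (fun x => x * f x) s.
Proof.
move=> s0; rewrite QE // P_deriv /Lap mulr_suml.
have l j : j \in index_iota 1 N.+1 -> L1 (ew s (fun x => x * convpow f j x)).
  by move=> _; case: (LT_mulx (LT_convpow lf vf j)) => _ _; apply.
have [_ e] := Lsum l.
transitivity (\sum_(1 <= j < N.+1) p j * Int (ew s (fun x => x * convpow f j x))).
  rewrite -e; apply: Int_eq => x; rewrite /ew mulr_sumr mulr_sumr; apply: eq_bigr => j _; ring.
apply: eq_big_nat => -[|j] // _; rewrite -/(Lap _ s) Lap_mulx_convpow //= /Lap; rewrite ?mulrA; congr (_ * _).
Qed.

Lemma Int_mulx_Q : L1 (fun x => x * f x) -> Int f = 1 ->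
  L1 (fun x => x * Q f x) /\ Int (fun x => x * Q f x) = qmean N p * Int (fun x => x * f x).
Proof.
move=> lxf If; rewrite QE // qmeanE mulr_suml.
have h j : j \in index_iota 1 N.+1 -> L1 (fun x => x * convpow f j x) /\
   Int (fun x => x * convpow f j x) = j%:R * Int (fun x => x * f x).
  by rewrite mem_index_iota; case: j => // j _; exact: Int_mulx_convpow.
have [l e] := Lsum (fun j hj => proj1 (h j hj)).
have E : (fun x => x * \sum_(1 <= j < N.+1) p j * convpow f j x) =
    (fun y => \sum_(1 <= j < N.+1) p j * (y * convpow f j y)).
  by apply/funext => x; rewrite mulr_sumr; apply: eq_bigr => j _; rewrite mulrCA.
rewrite E; split=> //; rewrite e; apply: eq_big_seq => j hj.
by rewrite (proj2 (h j hj)) mulrA.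
Qed.

End Fixed.

Lemma ae_Q f g : L1 f -> L1 g -> vanish 1 f -> vanish 1 g ->
  {ae mu, forall x, f x = g x} -> {ae mu, forall x, Q f x = Q g x}.
Proof.
move=> lf lg vf vg e; rewrite !QE //.
have h : {ae mu, forall x, forall j, convpow f j x = convpow g j x}.
  by apply: ae_countable => j; apply: ae_convpow => //; exact: L1_meas.
by apply: ae_S h => x hx; apply: eq_bigr => j _; rewrite hx.
Qed.

Lemma H_sum s (I : Type) (r : seq I) : exists2 K, 0 <= K & forall (F : I -> R -> R) b,
  (forall i, H s (F i) /\ n2 s (F i) <= b) ->
  H s (fun x => \sum_(i <- r) F i x) /\ n2 s (fun x => \sum_(i <- r) F i x) <= K * b.
Proof.
elim: r => [|i r [K K0 IH]].
  exists 0 => // F b h; have -> : (fun x => \sum_(i <- [::]) F i x) = (fun=> 0).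
    by apply/funext => x; rewrite big_nil.
  by rewrite mul0r; have [h0 ->] := H0 s.
exists (2 * (1 + K)) => [|F b h]; first by rewrite mulr_ge0 // addr_ge0.
have [hr nr] := IH F b h; have [hi ni] := h i.
have E : (fun x => \sum_(j <- i :: r) F j x) = (fun x => F i x + \sum_(j <- r) F j x).
  by apply/funext => x; rewrite big_cons.
have [hh nn] := HD hi hr; rewrite E; split=> //; apply: le_trans nn _; lra.
Qed.

Lemma p_le1 j : (1 <= j <= N)%N -> p j <= 1.
Proof.
move=> jN; rewrite -hp1 (big_rem j) /=; last by rewrite mem_index_iota ltnS.
rewrite lerDl big_seq; apply: sumr_ge0 => i /mem_rem; exact: hp0'.
Qed.

Lemma H_Q s : 0 <= s -> exists2 K, 0 <= K & forall f, L1 f -> vanish 1 f -> n1 f <= 1 -> H s f ->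
  H s (Q f) /\ n2 s (Q f) <= K * n2 s f.
Proof.
move=> s0; have [K K0 hK] := convpow_H s0 N.
have [Ks Ks0 hs] := @H_sum s nat (index_iota 1 N.+1).
exists (Ks * K) => [|f lf vf f1 hf]; first exact: mulr_ge0.
rewrite QE // -mulrA.
pose F j y := if (1 <= j <= N)%N then p j * convpow f j y else 0.
have -> : (fun y => \sum_(1 <= j < N.+1) p j * convpow f j y) = (fun y => \sum_(1 <= j < N.+1) F j y).
  by apply/funext => y; apply: eq_big_nat => j; rewrite /F ltnS => ->.
apply: hs => j; have [jN|jN] := boolP (0 < j <= N)%N; last first.
  have [h0 n0] := HZ 0 hf; rewrite expr0n /= mul0r in n0.
  have E : (fun x => 0 * f x) = F j by apply/funext => x; rewrite mul0r /F (negbTE jN).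
  by rewrite E in h0 n0; split=> //; rewrite n0 mulr_ge0 ?n2_ge0.
have -> : F j = fun y => p j * convpow f j y by apply/funext => y; rewrite /F jN.
  have [hh nn] := hK j f (proj2 (andP jN)) lf f1 hf.
  have [hz ->] := HZ (p j) hh; split=> //; apply: le_trans nn.
  by rewrite ler_piMl ?n2_ge0 // expr_le1 ?hp0 ?p_le1.
Qed.

End Mixture.
End Powers.

(** * Weak form of the evolution equation *)

Section WeakForm.
Variable R : realType.
Implicit Types (f g h phi J : R -> R) (c s t x y M : R).
Local Notation mu := (@lebesgue_measure R).
Local Notation ind := (@ind R).
Local Notation conv := (@convolution R).

(** For [f] in the class [inP] this is a representative that is nonnegative and vanishes below 1 at
    every point, so the later pointwise arguments need no exceptional sets. *)
Definition rep f : R -> R := fun y => `|ext1 f y|.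

Lemma vanish_rep f : vanish 1 (rep f).
Proof. by move=> x x1; rewrite /rep vanish_ext1 // normr0. Qed.

Lemma rep_ge0 f x : 0 <= rep f x. Proof. exact: normr_ge0. Qed.

Lemma inP_rep f : inP f -> [/\ L1 (rep f), Int (rep f) = 1, L1 (ext1 f) &
  {ae mu, forall x, ext1 f x = rep f x}].
Proof.
move=> [/inL1P lf f0 i1].
have e : {ae mu, forall x, ext1 f x = rep f x}.
  apply: ae_S f0 => x h; rewrite /rep ext1E /ind; case: (boolP (1 <= x)) => [/h x0|_].
    by rewrite mul1r ger0_norm.
  by rewrite mul0r normr0.
split=> //; first exact: L1_abs.
rewrite -(Int_ae (L1_meas lf) (L1_meas (L1_abs lf)) e).
by rewrite ext1_funE -(proj2 (L1_restrict f (measurable_itv `[1, +oo[) (@itv1P R))) /Rintegral i1.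
Qed.

Lemma Int_scale f c : 0 < c -> L1 f -> L1 (fun x => c * f (c * x)) /\ Int (fun x => c * f (c * x)) = Int f.
Proof.
move=> c0 lf; have [l e] := L1_affine 0 (lt0r_neq0 c0) lf.
have E : (fun x => f (c * x + 0)) = (fun x => f (c * x)) by apply/funext => x; rewrite addr0.
rewrite E in l e; split; first exact: L1Z.
by rewrite IntZ; [rewrite e gtr0_norm|exact: L1_meas l].
Qed.

Lemma ln2_le t : t <= ln 2 -> expR t <= 2.
Proof. by move=> h; rewrite -[leRHS]lnK ?ler_expR // posrE. Qed.

Lemma expR_cmp t u z : (expR t <= expR u * z) = (expR (t - u) <= z).
Proof. by rewrite -(ler_pM2l (expR_gt0 u) (expR (t - u)) z) -expRD addrC subrK. Qed.

Definition prim (b : R -> R) t := Int (fun r => ind (r <= t) * b r).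

Lemma L1_prim b t : L1 b -> L1 (fun r => ind (r <= t) * b r).
Proof. by apply: L1_indM; apply: measurable_fun_ler. Qed.

Lemma prim_diff b x y : L1 b -> x <= y ->
  L1 (fun r => ind (x < r <= y) * b r) /\ prim b y - prim b x = Int (fun r => ind (x < r <= y) * b r).
Proof.
move=> lb xy; have E r : ind (x < r <= y) * b r = ind (r <= y) * b r - ind (r <= x) * b r.
  rewrite -mulrBl; congr (_ * _); rewrite /ind ltNge; have [rx|rx] /= := leP r x; last by rewrite subr0.
  by rewrite (le_trans rx xy) subrr.
have l := L1B (L1_prim y lb) (L1_prim x lb).
split; first by apply: L1_eq l => r; rewrite E.
by rewrite /prim -IntB; [apply: Int_eq => r; rewrite E|exact: L1_prim..].
Qed.

Lemma prim_ctrl b : L1 b -> ctrl (prim b) (prim (fun r => `|b r|)).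
Proof.
move=> lb; split=> [x y xy|e e0].
  have [l ->] := prim_diff lb xy; have [l' ->] := prim_diff (L1_abs lb) xy.
  apply: le_trans (Int_absL1 l) _; apply: Int_le => //; first exact: L1_abs.
  by move=> r; rewrite normrM ger0_norm ?ind_ge0.
have [d d0 hd] := Int_small lb e0; exists d => // x y xy yx.
have [l' ->] := prim_diff (L1_abs lb) xy; apply: le_trans (hd x y xy yx).
have m : measurable_fun setT (fun r : R => x <= r <= y).
  by apply: measurable_and; apply: measurable_fun_ler.
apply: Int_le => //; first by apply: L1_indM => //; exact: L1_abs.
move=> r; rewrite ler_wpM2r // /ind ler_nat; case: (ltP x r) => //= xr.
by rewrite (ltW xr).
Qed.

Section Solution.
Variables (N : nat) (p : nat -> R).
Hypotheses (hp0 : forall j : nat, (1 <= j <= N)%N -> 0 <= p j) (hp1 : \sum_(1 <= j < N.+1) p j = 1).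
Local Notation Q := (Qconv N p).
Variables (eta : R -> R -> R) (eta0 : R -> R) (beta : R -> R).
Hypothesis hP : forall t, 0 <= t -> inP (eta t).
Hypothesis h0P : inP eta0.
Hypothesis hbeta : forall T : R, mu.-integrable `[0, T] (EFin \o beta).
Hypothesis hsol : forall tau : R, 0 <= tau ->
  exists2 J : R -> R,
   is_bochner_integral `[0, tau]%classic
     (fun s y => beta s * Sop (tau - s) (T1op (Q (eta s))) y) J &
   {ae mu, forall y : R, 1 <= y -> eta tau y = Sop tau eta0 y + J y}.
Local Notation e t := (rep (eta t)).

Definition bT T r := ind (0 <= r <= T) * beta r.

Lemma L1_bT T : L1 (bT T).
Proof.
have PD s : (0 <= s <= T) <-> `[0, T]%classic s by rewrite /= in_itv.
by have [[h _] _] := L1_restrict beta (measurable_itv `[0, T]) PD; apply: h.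
Qed.

(* The value of the kernel tested against h in the frame z = e^s y. *)
Lemma kernel_test a s h M : 0 <= s -> 0 <= a -> measurable_fun setT h -> (forall x, `|h x| <= M) ->
  Int (fun y => ext1 (Sop a (T1op (Q (eta s)))) y * h (expR (a + s) * y)) =
  Int (fun z => (ind (expR a <= z) * ind (2 <= z)) * (Q (eta s) (z - 1) * h (expR s * z))).
Proof.
move=> s0 a0 mh hM; have ea : 0 < expR a := expR_gt0 a.
have [_ _ le _] := inP_rep (hP s0).
have lQ : L1 (Q (eta s)) by rewrite -Q_ext1; apply: L1_Q => //; exact: vanish_ext1.
have lF : L1 (fun z => (ind (expR a <= z) * ind (2 <= z)) * (Q (eta s) (z - 1) * h (expR s * z))).
  have [l1 _] := L1_shift 1 lQ.
  have m1 : measurable_fun setT (fun z => h (expR s * z)).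
    by apply: L1_comp => //; apply: measurable_funM.
  have [l2 _] := @L1_bounded _ _ (fun z => h (expR s * z)) M l1 m1 (fun x => hM _).
  have l3 := L1_indM (@measurable_fun_ler _ _ _ setT (cst (expR a)) id (@measurable_cst _ _ _ _ _ _) (@measurable_id _ _ _))
     (L1_indM (@measurable_fun_ler _ _ _ setT (cst 2) id (@measurable_cst _ _ _ _ _ _) (@measurable_id _ _ _)) l2).
  by apply: L1_eq l3 => x; rewrite mulrA.
have [_ <-] := Int_scale ea lF; apply: Int_eq => y.
have -> : expR (a + s) * y = expR s * (expR a * y) by rewrite expRD; ring.
rewrite ext1E /Sop /T1op -(ler_pM2l ea 1 y) mulr1 /ind.
have [y1|y1] := leP (expR a) (expR a * y); last by rewrite !mul0r mulr0.
rewrite !mul1r; case: (2 <= _); rewrite ?mul1r ?mul0r ?mulr0 ?mul0r //; ring.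
Qed.

(** For a <= ln 2 the cutoff z >= e^a, which records loss through the boundary since emission, is
    implied by z >= 2, where the source lives: over such short times nothing newly created has yet
    left. *)
Lemma kernel_test_sup a s h M : 0 <= s -> 0 <= a -> a <= ln 2 -> measurable_fun setT h -> (forall x, `|h x| <= M) ->
  Int (fun z => (ind (expR a <= z) * ind (2 <= z)) * (Q (eta s) (z - 1) * h (expR s * z))) =
  Int (fun y => Q (e s) y * h (expR s * (y + 1))).
Proof.
move=> s0 a0 a2 mh hM; have [lr _ le er] := inP_rep (hP s0).
have vQ := vanish_Q N p (@vanish_ext1 _ (eta s)); rewrite Q_ext1 in vQ.
have E z : (ind (expR a <= z) * ind (2 <= z)) * (Q (eta s) (z - 1) * h (expR s * z)) =
   Q (eta s) (z - 1) * h (expR s * (z - 1 + 1)).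
  rewrite subrK; have [z2|z2] := leP 2 z; last by rewrite vQ ?mul0r ?mulr0 //; lra.
  by rewrite !indT ?mul1r //; exact: le_trans (ln2_le a2) z2.
have mh' : measurable_fun setT (fun y => h (expR s * (y + 1))).
  by apply: L1_comp => //; apply: measurable_funM => //; apply: measurable_funD.
have lQ : L1 (Q (eta s)) by rewrite -Q_ext1; apply: L1_Q => //; exact: vanish_ext1.
have lQr : L1 (Q (e s)) by apply: L1_Q => //; exact: vanish_rep.
have [l _] := @L1_bounded _ _ (fun y => h (expR s * (y + 1))) M lQ mh' (fun x => hM _).
have [_ e2] := L1_shift 1 l; rewrite (Int_eq E) e2; apply: Int_ae.
- exact: L1_meas l.
- by apply: measurable_funM => //; exact: L1_meas lQr.
have := ae_Q N p le lr (@vanish_ext1 _ _) (@vanish_rep _) er.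
by rewrite Q_ext1; apply: ae_S => x ->.
Qed.

(** The balance over a step of length at most ln 2, in the frame z = e^s y: what survives from time
    [t0] lies above e^(t - t0), and the source is frozen at the value [Ph] up to [eps]. It is the
    difference of the integrated equations at [t] and [t0], so [beta] enters only through its
    primitive. *)
Lemma weak_incr T t0 t h M Ph eps : 0 <= t0 -> t0 <= t -> t <= T -> t - t0 <= ln 2 ->
  measurable_fun setT h -> (forall x, `|h x| <= M) ->
  (forall s, t0 <= s <= t -> `|Int (fun y => Q (e s) y * h (expR s * (y + 1))) - Ph| <= eps) ->
  `|Int (fun y => e t y * h (expR t * y))
    - Int (fun z => ind (expR (t - t0) <= z) * (e t0 z * h (expR t0 * z)))
    - Ph * (prim (bT T) t - prim (bT T) t0)| <=
  eps * (prim (fun r => `|bT T r|) t - prim (fun r => `|bT T r|) t0).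
Proof.
move=> t00 t0t tT tln mh hM hPh; have t_0 : 0 <= t := le_trans t00 t0t.
have M0 : 0 <= M by apply: le_trans (hM 0).
(* Four errors of size M e' will occur: the integrals of the two error densities and the two
   discrepancies between Bochner integrals and their simple approximations. *)
apply/ler_addgt0Pr => e1 e10; pose e' := e1 / (4 * (M + 1)).
have M1 : 0 < M + 1 by lra.
have e'0 : 0 < e' by rewrite divr_gt0 ?mulr_gt0.
have Me : 4 * (M * e') <= e1.
  have -> : e1 = 4 * ((M + 1) * e') by rewrite /e'; field; lra.
  by rewrite ler_pM2l // ler_pM2r //; lra.
have [J bJ eJ] := hsol t_0; have [J' bJ' eJ'] := hsol t00.
have [Ne [lN iN N0 hN]] := bochner_weak bJ e'0.
have [Ne' [lN' iN' N0' hN']] := bochner_weak bJ' e'0.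
pose phi y := h (expR t * y); pose la := t - t0.
(* Both tests are [h] in the fixed frame; the cutoff keeps from time [t0] only what is still above y
   = 1 at time [t]. With this choice the initial-data terms, and the contributions emitted before
   [t0], coincide and cancel. *)
pose phi' y := ind (expR la <= y) * h (expR t0 * y).
have mphi : measurable_fun setT phi by apply: L1_comp => //; apply: measurable_funM.
have mphi' : measurable_fun setT phi'.
  apply: measurable_funM; first by apply: measurable_ind; apply: measurable_fun_ler.
  by apply: L1_comp => //; apply: measurable_funM.
have bphi x : `|phi x| <= M by exact: hM.
have bphi' x : `|phi' x| <= M by apply: le_trans (indM_norm _ _) (hM _).
have [G [lG hG G0 iG]] := hN phi M mphi bphi.
have [G' [lG' hG' G'0 iG']] := hN' phi' M mphi' bphi'.
have extb u a f : ext1 (fun y => u * Sop a f y) = (fun y => u * ext1 (Sop a f) y) by exact: ext1Z.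
pose U s := Int (fun z => (ind (expR (t - s) <= z) * ind (2 <= z)) * (Q (eta s) (z - 1) * h (expR s * z))).
have mk s a : 0 <= s -> 0 <= a -> forall k : R -> R, measurable_fun setT k -> (forall x, `|k x| <= M) ->
   Int (fun x => beta s * ext1 (Sop a (T1op (Q (eta s)))) x * k (expR (a + s) * x)) =
   beta s * Int (fun x => ext1 (Sop a (T1op (Q (eta s)))) x * k (expR (a + s) * x)).
  move=> s0 a0 k km kM; rewrite -IntZ; first by apply: Int_eq => x; rewrite mulrA.
  apply: measurable_funM; last by apply: L1_comp => //; apply: measurable_funM.
  have [_ _ le _] := inP_rep (hP s0).
  have lQ : L1 (Q (eta s)) by rewrite -Q_ext1; apply: L1_Q => //; exact: vanish_ext1.
  have mQ := L1_meas lQ.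
  rewrite (_ : ext1 _ = fun y => ind (1 <= y) * (expR a * (ind (2 <= expR a * y) * Q (eta s) (expR a * y - 1)))).
    apply: measurable_funM; first exact: measurable_ind_ge.
    apply: measurable_funM => //; apply: measurable_funM.
      by apply: measurable_ind; apply: measurable_fun_ler => //; apply: measurable_funM.
    by apply: L1_comp => //; apply: measurable_funB => //; apply: measurable_funM.
  apply/funext => y; rewrite ext1E /Sop /T1op /ind; case: (1 <= y); last by rewrite !mul0r.
  by case: (2 <= _); rewrite ?mul1r ?mul0r.
have FE s : 0 <= s <= t ->
   Int (fun x => ext1 (fun y => beta s * Sop (t - s) (T1op (Q (eta s))) y) x * phi x) = beta s * U s.
  move=> /andP[s0 st]; have ts : 0 <= t - s by rewrite subr_ge0.
  rewrite extb /U -(kernel_test s0 ts mh hM) -(mk s _ s0 ts h mh hM).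
  by apply: Int_eq => x; rewrite subrK.
have FE' s : 0 <= s <= t0 ->
   Int (fun x => ext1 (fun y => beta s * Sop (t0 - s) (T1op (Q (eta s))) y) x * phi' x) = beta s * U s.
  move=> /andP[s0 st]; have ts : 0 <= t0 - s by rewrite subr_ge0.
  pose k x := ind (expR t <= x) * h x.
  have mk' : measurable_fun setT k.
    by apply: measurable_funM => //; apply: measurable_ind; apply: measurable_fun_ler.
  have kM x : `|k x| <= M by apply: le_trans (indM_norm _ _) (hM _).
  have kE x : phi' x = k (expR (t0 - s + s) * x).
    by rewrite subrK /k /phi' expR_cmp.
  rewrite extb (Int_eq (fun x => congr1 _ (kE x))) (mk s _ s0 ts k mk' kM); congr (_ * _).
  rewrite (kernel_test s0 ts mk' kM) /U; apply: Int_eq => z; rewrite /k.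
  rewrite expR_cmp.
  rewrite /ind; have [z1|z1] := leP (expR (t - s)) z; last by rewrite !mul0r !mulr0.
  have -> : expR (t0 - s) <= z by apply: le_trans z1; rewrite ler_expR; lra.
  by rewrite !mul1r.
have US s : t0 <= s <= t -> `|U s - Ph| <= eps.
  move=> /andP[s0 st]; rewrite /U (@kernel_test_sup _ _ _ M) //; [by apply: hPh; rewrite s0|..]; lra.
have lb := L1_bT T.
have [lbt Bt] := prim_diff lb t0t; have [lvt Vt] := prim_diff (L1_abs lb) t0t.
rewrite Bt Vt.
have bE s : t0 < s <= t -> bT T s = beta s.
  by move=> /andP[s1 s2]; rewrite /bT indT ?mul1r //; apply/andP; split; lra.
have lD : L1 (fun s => G s - G' s - Ph * (ind (t0 < s <= t) * bT T s)).
  by apply: L1B; [exact: L1B|exact: L1Z].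
have lB : L1 (fun s => M * (Ne s + Ne' s) + eps * (ind (t0 < s <= t) * `|bT T s|)).
  by apply: L1D; apply: L1Z => //; apply: L1D.
have hD s : `|G s - G' s - Ph * (ind (t0 < s <= t) * bT T s)| <=
    M * (Ne s + Ne' s) + eps * (ind (t0 < s <= t) * `|bT T s|).
  have [/andP[s0 st]|o] := boolP (0 <= s <= t); last first.
    have o1 : ~~ (0 <= s <= t0) by apply: contra o => /andP[-> h']; exact: le_trans h' t0t.
    have o2 : ~~ (t0 < s <= t).
      by apply: contra o => /andP[h' ->]; rewrite andbT ltW // (le_lt_trans t00 h').
    rewrite G0 // G'0 // indF // !mul0r !mulr0 !subr0 normr0 addr0.
    by rewrite mulr_ge0 // addr_ge0.
  have k1 := hG s; rewrite s0 st FE ?s0 ?st // in k1; have {}k1 := k1 isT.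
  have [st0|st0] := leP s t0.
    have k2 := hG' s; rewrite s0 st0 FE' ?s0 ?st0 // in k2; have {}k2 := k2 isT.
    rewrite (@indF _ (false && (s <= t))) // !mul0r !mulr0 subr0 addr0.
    have -> : G s - G' s = (G s - beta s * U s) - (G' s - beta s * U s) by ring.
    by apply: le_trans (ler_normB _ _) _; lra.
  rewrite G'0; last by rewrite (leNgt s t0) st0 andbF.
  rewrite st (@indT _ (true && true)) // !mul1r bE ?st0 ?st // subr0.
  have -> : G s - Ph * beta s = (G s - beta s * U s) + beta s * (U s - Ph) by ring.
  apply: le_trans (ler_normD _ _) _; rewrite (normrM (beta s)).
  have := US s; rewrite (ltW st0) st => /(_ isT) k2.
  have : `|beta s| * `|U s - Ph| <= `|beta s| * eps by rewrite ler_wpM2l.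
  have : 0 <= M * Ne' s by rewrite mulr_ge0.
  lra.
have main : `|Int G - Int G' - Ph * Int (fun r => ind (t0 < r <= t) * bT T r)| <=
    M * (2 * e') + eps * Int (fun r => ind (t0 < r <= t) * `|bT T r|).
  rewrite -IntB // -[Ph * Int _]IntZ; last exact: L1_meas.
  rewrite -IntB; [|exact: L1B|exact: L1Z].
  apply: le_trans (Int_absL1 lD) _; apply: le_trans (Int_le (L1_abs lD) lB hD) _.
  rewrite IntD; [|by apply: L1Z; apply: L1D|exact: L1Z].
  rewrite !IntZ; [|exact: L1_meas|by apply: L1_meas; apply: L1D].
  rewrite IntD // lerD2r ler_wpM2l //; lra.
have [_ _ le0 _] := inP_rep h0P.
have [lr _ le1 er] := inP_rep (hP t_0); have [lr' _ le1' er'] := inP_rep (hP t00).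
have JE u (w : R -> R) : 0 <= u -> L1 (ext1 w) -> {ae mu, forall y, 1 <= y -> eta u y = Sop u eta0 y + w y} ->
   forall k : R -> R, measurable_fun setT k -> (forall x, `|k x| <= M) ->
   L1 (fun x => expR u * (ind (expR u <= expR u * x) * (ext1 eta0 (expR u * x) * k x))) /\
   Int (fun x => ext1 w x * k x) = Int (fun x => e u x * k x) -
     Int (fun x => expR u * (ind (expR u <= expR u * x) * (ext1 eta0 (expR u * x) * k x))).
  move=> u0 lw ew k km kM; have [lru _ _ eru] := inP_rep (hP u0).
  have [ls _] := Int_scale (expR_gt0 u) le0.
  have [ls2 _] := L1_bounded ls km kM.
  have mind : measurable_fun setT (fun x => expR u <= expR u * x).
    by apply: measurable_fun_ler => //; apply: measurable_funM.
  have ls3 := L1_indM mind ls2.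
  have ls4 : L1 (fun x => expR u * (ind (expR u <= expR u * x) * (ext1 eta0 (expR u * x) * k x))).
    by apply: L1_eq ls3 => x; ring.
  have [l5 _] := L1_bounded lw km kM; have [l6 _] := L1_bounded lru km kM.
  split=> //; rewrite -IntB //; apply: Int_ae; [exact: L1_meas|by apply: L1_meas; exact: L1B|].
  apply: ae_S (ae_I eru ew) => x [er1 ew1]; rewrite -er1 !ext1E.
  have ex : (expR u <= expR u * x) = (1 <= x) by rewrite -{1}[expR u]mulr1 ler_pM2l // expR_gt0.
  rewrite ex /ind; have [x1|x1] := leP 1 x; last by rewrite !mul0r mulr0 subrr.
  rewrite !mul1r ew1 // /Sop x1.
  have -> : 1 <= expR u * x.
    have x0 := le_trans ler01 x1; apply: (le_trans x1); apply: ler_peMl => //.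
    by rewrite -expR0 ler_expR.
  rewrite mul1r; ring.
have lJ : L1 (ext1 J) by apply/inL1P; case: bJ.
have lJ' : L1 (ext1 J') by apply/inL1P; case: bJ'.
have [q1 q2] := JE t J t_0 lJ eJ phi mphi bphi.
have [q3 q4] := JE t0 J' t00 lJ' eJ' phi' mphi' bphi'.
have sc : Int (fun x => expR t * (ind (expR t <= expR t * x) * (ext1 eta0 (expR t * x) * phi x))) =
   Int (fun x => expR t0 * (ind (expR t0 <= expR t0 * x) * (ext1 eta0 (expR t0 * x) * phi' x))).
  have [l7 _] := L1_bounded le0 mh hM.
  have mind : measurable_fun setT (fun z => expR t <= z) by apply: measurable_fun_ler.
  have l8 := L1_indM mind l7.
  have [_ w1] := Int_scale (expR_gt0 t) l8; have [_ w2] := Int_scale (expR_gt0 t0) l8.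
  rewrite [LHS]w1 -w2; apply: Int_eq => x; congr (_ * _); rewrite /phi'.
  rewrite expR_cmp -/la.
  rewrite /ind; have [x1|x1] := leP (expR la) x; last by rewrite !mul0r !mulr0.
  have x1' : 1 <= x by apply: le_trans x1; rewrite -expR0 ler_expR subr_ge0.
  by rewrite expR_cmp subrr expR0 x1' !mul1r.
rewrite sc in q2.
have E4 : Int (fun x => e t0 x * phi' x) =
   Int (fun z => ind (expR (t - t0) <= z) * (e t0 z * h (expR t0 * z))).
  by apply: Int_eq => x; rewrite /phi' /la; ring.
rewrite E4 in q4; rewrite q2 in iG; rewrite q4 in iG'.
move: iG iG' main.
set A1 := Int (fun x => e t x * phi x); set A2 := Int (fun z => _ * (e t0 z * _)); set A3 := Int (fun x => expR t0 * _).
set g1 := Int G; set g2 := Int G'; set bb := Int (fun r => _ * bT T r); set vv := Int (fun r => _ * `|_|).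
move=> iG iG' main.
have -> : A1 - A2 - Ph * bb = (g1 - g2 - Ph * bb) - (g1 - (A1 - A3)) + (g2 - (A2 - A3)) by ring.
apply: le_trans (ler_normD _ _) _; apply: le_trans (lerD (ler_normB _ _) (lexx _)) _; lra.
Qed.

End Solution.
End WeakForm.

(** * Laplace transform of the evolution *)

Section Evolution.
Variable R : realType.
Implicit Types (f g h phi J : R -> R) (c s t x y M : R).
Local Notation mu := (@lebesgue_measure R).
Local Notation ind := (@ind R).
Local Notation conv := (@convolution R).
Local Notation heav := (@heav R).

Lemma xexp_le s x : 0 < s -> `|ind (0 <= x) * (x * expR (- s * x))| <= s^-1.
Proof.
move=> s0; have [x0|x0] := leP 0 x; last by rewrite indF // mul0r normr0 invr_ge0 ltW.
rewrite indT // mul1r ger0_norm ?mulr_ge0 ?expR_ge0 //.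
rewrite mulNr expRN -[leRHS]mul1r ler_pdivlMr // mulrAC ler_pdivrMr ?expR_gt0 // mul1r.
by apply: le_trans (expR_ge1Dx _); rewrite mulrC lerDr.
Qed.

Lemma exp_ind_le s x : 0 < s -> `|ind (0 <= x) * expR (- s * x)| <= 1.
Proof.
move=> s0; have [x0|x0] := leP 0 x; last by rewrite indF // mul0r normr0.
by rewrite indT // mul1r ger0_norm ?expR_ge0 // -expR0 ler_expR mulNr oppr_le0 mulr_ge0 // ltW.
Qed.

Lemma prim_dsim (b k : R -> R) T t : L1 b -> L1 (fun r => b r * k r) ->
  (forall e, 0 < e -> exists2 d, 0 < d & forall x, 0 <= x <= T -> `|x - t| <= d -> `|k x - k t| <= e) ->
  dsim (prim b) (prim (fun r => `|b r|)) T (prim (fun r => b r * k r)) t (k t).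
Proof.
move=> lb lbk kc e e0; have [d d0 hd] := kc e e0; exists d => // x y x0 xt ty yT yx.
have xy : x <= y := le_trans xt ty.
have [l1 ->] := prim_diff lbk xy; have [l2 ->] := prim_diff lb xy.
have [l3 ->] := prim_diff (L1_abs lb) xy.
rewrite -IntZ; last exact: L1_meas.
rewrite -IntB //; last exact: L1Z.
have lD : L1 (fun r => ind (x < r <= y) * (b r * k r) - k t * (ind (x < r <= y) * b r)).
  by apply: L1B => //; exact: L1Z.
apply: le_trans (Int_absL1 lD) _; rewrite -IntZ; last exact: L1_meas.
apply: Int_le => [||r]; [exact: L1_abs|exact: L1Z|].
have [/andP[xr ry]|nr] := boolP (x < r <= y); last by rewrite indF // !mul0r !mulr0 subrr normr0.
rewrite (@indT _ true) // !mul1r -[k t * b r]mulrC -mulrBr normrM mulrC.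
have hr : `|k r - k t| <= e.
  apply: hd; first by apply/andP; split; lra.
  by rewrite ler_norml; apply/andP; split; lra.
by rewrite ler_wpM2r.
Qed.

Lemma ind_near (k : R -> R) x : 0 < x -> continuous k -> {for x, continuous (fun z : R => ind (0 <= z) * k z)}.
Proof.
move=> x0 kc; rewrite /prop_for /continuous_at indT ?mul1r; last exact: ltW.
apply: cvg_trans (kc x); apply: near_eq_cvg; near=> z; rewrite indT ?mul1r //.
by apply: ltW; near: z; exact: lt_nbhsr.
Unshelve. all: by end_near. Qed.

Lemma powint_inf u : 0 <= u -> let k : R := -2 in
  L1 (fun x => ind (u <= x) * wt k x) /\ Int (fun x => ind (u <= x) * wt k x) = (1 + u)^-1.
Proof.
move=> u0 k; have k1 : k < -1 by rewrite /k; lra.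
have k2 : k + 1 = -1 by rewrite /k; lra.
have [l h] := powint_uby k1 u0; split=> //; apply: le_anti; apply/andP; split.
  by apply: le_trans h _; rewrite k2 opprK divr1 wt_nneg // powR_inv1 //; lra.
apply/ler_addgt0Pr => eps eps0; pose v := u + eps^-1.
have i0 : 0 < eps^-1 by rewrite invr_gt0.
have uv : u < v by rewrite /v; lra.
have k0 : k + 1 != 0 by rewrite k2 oppr_eq0 oner_neq0.
have [l' e'] := powint k0 u0 uv.
have : Int (fun x => ind (u <= x <= v) * wt k x) <= Int (fun x => ind (u <= x) * wt k x).
  by apply: Int_le => // x; apply: indE_le; [case/andP|exact: wt_ge0].
rewrite e' k2 !powR_inv1; [|lra..].
have : (1 + v)^-1 <= eps.
  by rewrite -[leRHS]invrK lef_pV2 ?posrE //; rewrite /v; lra.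
rewrite invrN1 mulrN1; lra.
Qed.

(* Fubini, since 1/(1+u) is the integral of (1+x)^-2 over x >= u. *)
Lemma layer (h u : R -> R) : L1 h -> measurable_fun setT u -> (forall r, 0 <= u r) ->
  let k : R := -2 in
  L1 (fun x => ind (0 <= x) * wt k x * Int (fun r => h r * ind (u r <= x))) /\
  Int (fun r => h r / (1 + u r)) = Int (fun x => ind (0 <= x) * wt k x * Int (fun r => h r * ind (u r <= x))).
Proof.
move=> lh mu' u0 k; have mh := L1_meas lh.
pose K (z : R * R) := h z.2 * (ind (u z.2 <= z.1) * wt k z.1).
have mK : measurable_fun setT K.
  apply: measurable_funM; first exact: measurableT_comp.
  apply: measurable_funM; last by apply: (measurableT_comp (measurable_wt k)).
  apply: measurable_ind; apply: measurable_fun_ler => //; exact: measurableT_comp.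
have hr r : L1 (fun x => ind (u r <= x) * wt k x) /\ Int (fun x => ind (u r <= x) * wt k x) = (1 + u r)^-1.
  exact: powint_inf.
have iu r : 0 <= (1 + u r)^-1 <= 1.
  by rewrite invr_ge0 addr_ge0 //= invf_le1 ?lerDl // ltr_pwDl.
have lK : L1xy K.
  apply: L1xy_crit => // [r|]; first exact: (L1Z (h r) (proj1 (hr r))).
  apply: (L1_le _ (L1_abs lh)) => [|r].
    apply: (@measurable_Int _ (fun z => `|K (z.2, z.1)|)).
    by apply: measurableT_comp => //; apply: (measurableT_comp mK); exact: measurable_swap.
  rewrite (@Int_eq _ _ (fun x => `|h r| * (ind (u r <= x) * wt k x))) => [|x]; last first.
    by rewrite /K !normrM (ger0_norm (wt_ge0 _ _)) (ger0_norm (ind_ge0 _ _)).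
  rewrite IntZ; last by apply: L1_meas; case: (hr r).
  rewrite (proj2 (hr r)); have /andP[i0 i1] := iu r.
  by rewrite normrM normr_id (ger0_norm i0) -[leRHS]mulr1 ler_wpM2l.
have E x : Int (fun r => K (x, r)) = ind (0 <= x) * wt k x * Int (fun r => h r * ind (u r <= x)).
  have [x0|x0] := leP 0 x.
    rewrite indT // mul1r -IntZ; first by apply: Int_eq => r; rewrite /K /=; ring.
    by apply: measurable_funM => //; apply: measurable_ind; apply: measurable_fun_ler.
  rewrite (@indF _ false) // !mul0r (@Int_eq _ _ (fun=> 0)) ?Int0 // => r.
  by rewrite /K /= indF ?mul0r ?mulr0 // -ltNge; apply: lt_le_trans x0 (u0 r).
have [l1 _ e] := L1xy_Int lK; split; first exact: L1_eq E l1.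
rewrite -(Int_eq E) e; clear e; apply: Int_eq => r; rewrite -(proj2 (hr r)) -IntZ //.
exact: L1_meas (proj1 (hr r)).
Qed.

Lemma Lap_lim0 f c : L1 f -> causal f -> (forall s, 0 < s -> Lap f s <= c) -> Int f <= c.
Proof.
move=> lf cf h; have mf := L1_meas lf.
have lim x : (fun n : nat => ew (n.+1%:R^-1) f x) @ \oo --> f x.
  have hz : (fun n : nat => - n.+1%:R^-1 * x) @ \oo --> - 0 * x.
    by apply: cvgM; [apply: cvgN; exact: (@cvg_harmonic R)|exact: cvg_cst].
  rewrite oppr0 mul0r in hz; rewrite -[X in _ --> X]mul1r; apply: cvgM; last exact: cvg_cst.
  by rewrite -[X in _ --> X]expR0; apply: continuous_cvg; [exact: continuous_expR|exact: hz].
have [|_ cv] := Int_dct (L1_abs lf) (fun n => measurable_ew (n.+1%:R^-1) mf) mf _ (ae_T lim).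
  move=> n x; rewrite /ew normrM; have [x0|/cf ->] := leP 0 x; last by rewrite normr0 mulr0.
  rewrite -[leRHS]mul1r ler_wpM2r // ger0_norm ?expR_ge0 // -expR0 ler_expR mulNr oppr_le0.
  by rewrite mulr_ge0 // invr_ge0.
rewrite -(cvg_lim _ cv) //; apply: limr_le; first by apply/cvg_ex; exists (Int f).
by apply: nearW => n; apply: h; rewrite invr_gt0.
Qed.

(** The function of z is the distribution function of the image under [u] of the measure b dr;
    Fubini reduces its transform to shifted Heaviside functions. *)
Lemma Lap_cum (b u : R -> R) s : 0 < s -> L1 b -> measurable_fun setT u -> (forall r, 0 <= u r) ->
  LT (fun z => Int (fun r => b r * ind (u r <= z))) /\
  Lap (fun z => Int (fun r => b r * ind (u r <= z))) s = Int (fun r => b r * expR (- s * u r)) / s.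
Proof.
move=> s0 lb mu' u0; have mb := L1_meas lb.
have mN : measurable_fun setT (fun z => Int (fun r => b r * ind (u r <= z))).
  apply: (@measurable_Int _ (fun z => b z.2 * ind (u z.2 <= z.1))).
  apply: measurable_funM; first exact: measurableT_comp.
  apply: measurable_ind; apply: measurable_fun_ler => //; exact: measurableT_comp.
have mi z : measurable_fun setT (fun r => u r <= z) by apply: measurable_fun_ler.
split.
  apply: (LT_le mN (LT_Z (n1 b) (LT_heav R))) => z; have [z0|z0] := leP 0 z; last first.
    rewrite (@Int_eq _ _ (fun=> 0)) ?Int0 ?normr0 // => r.
    by rewrite indF ?mulr0 // -ltNge (lt_le_trans z0).
  have l : L1 (fun r => b r * ind (u r <= z)).
    by apply: L1_eq (L1_indM (mi z) lb) => r; rewrite mulrC.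
  apply: le_trans (Int_absL1 l) _; rewrite /heav indT // mulr1 ger0_norm ?n1_ge0 //.
  apply: Int_le => [||r]; [exact: L1_abs|exact: L1_abs|].
  by rewrite mulrC; exact: indM_norm.
pose K (z : R * R) := b z.2 * (ind (u z.2 <= z.1) * expR (- s * z.1)).
have mK : measurable_fun setT K.
  apply: measurable_funM; first exact: measurableT_comp.
  apply: measurable_funM; last by apply: (measurableT_comp (measurable_expM (- s))).
  apply: measurable_ind; apply: measurable_fun_ler => //; exact: measurableT_comp.
have hr r : L1 (fun x => ind (u r <= x) * expR (- s * x)) /\
    Int (fun x => ind (u r <= x) * expR (- s * x)) = expR (- s * u r) / s.
  have [[_ _ lh] eh] := Lap_shift s (u0 r) (LT_heav R).
  have E x : ew s (fun x => heav (x - u r)) x = ind (u r <= x) * expR (- s * x).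
    by rewrite /ew /heav subr_ge0 mulrC.
  split; first by apply: L1_eq (lh s s0).
  by rewrite -(Int_eq E) -/(Lap _ s) eh // Lap_heav.
have lK : L1xy K.
  apply: L1xy_crit => // [r|]; first exact: (L1Z (b r) (proj1 (hr r))).
  apply: (L1_le _ (L1Z s^-1 (L1_abs lb))) => [|r].
    apply: (@measurable_Int _ (fun z => `|K (z.2, z.1)|)).
    by apply: measurableT_comp => //; apply: (measurableT_comp mK); exact: measurable_swap.
  rewrite (@Int_eq _ _ (fun x => `|b r| * (ind (u r <= x) * expR (- s * x)))) => [|x]; last first.
    by rewrite /K !normrM (ger0_norm (expR_ge0 _)) (ger0_norm (ind_ge0 _ _)).
  rewrite IntZ; last by apply: L1_meas; case: (hr r).
  rewrite (proj2 (hr r)) normrM normr_id ger0_norm; last by rewrite divr_ge0 ?expR_ge0 // ltW.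
  rewrite mulrC ler_wpM2r // -[leRHS]mul1r ler_wpM2r ?invr_ge0 ?(ltW s0) //.
  by rewrite -expR0 ler_expR mulNr oppr_le0 mulr_ge0 // ltW.
have E x : ew s (fun z => Int (fun r => b r * ind (u r <= z))) x = Int (fun r => K (x, r)).
  rewrite /ew -IntZ; first by apply: Int_eq => r; rewrite /K /=; ring.
  by apply: measurable_funM; [exact: mb|apply: measurable_ind; exact: mi].
have [_ _ e] := L1xy_Int lK; rewrite /Lap (Int_eq E) e; clear e.
rewrite mulrC -IntZ; last first.
  apply: measurable_funM; first exact: mb.
  by apply: (measurableT_comp (measurable_expM (- s))); exact: mu'.
apply: Int_eq => r; transitivity (b r * Int (fun x => ind (u r <= x) * expR (- s * x))).
  by rewrite -IntZ //; exact: L1_meas (proj1 (hr r)).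
by rewrite (proj2 (hr r)); ring.
Qed.

Lemma ae_pick (Pr : R -> Prop) u v : u < v -> {ae mu, forall x, Pr x} -> exists2 x, u < x < v & Pr x.
Proof.
move=> uv h; apply: contrapT => nh.
have : 0 < Int (fun x => ind (u <= x <= v)) by rewrite (proj2 (Int_itv (ltW uv))) subr_gt0.
have l := proj1 (Int_itv (ltW uv)).
have -> : Int (fun x => ind (u <= x <= v)) = Int (fun=> 0 : R).
  apply: Int_ae; [exact: L1_meas l|exact: measurable_cst|].
  apply: ae_S (ae_I h (ae_I (ae_neq u) (ae_neq v))) => x [Px [xu xv]]; rewrite indF //; apply/negP => /andP[ux xv'].
  by apply: nh; exists x => //; rewrite !lt_neqAle eq_sym xu ux xv xv'.
by rewrite Int0 ltxx.
Qed.

Lemma Lap_scale f c : 0 < c -> L1 f -> vanish 1 f ->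
  [/\ L1 (fun z => c * f (c * z)), vanish c^-1 (fun z => c * f (c * z)) &
   forall s, Lap (fun z => c * f (c * z)) s = Lap f (s / c)].
Proof.
move=> c0 lf vf; have [l _] := Int_scale c0 lf; split=> // [x xc|s].
  by rewrite vf ?mulr0 // mulrC -ltr_pdivlMr // div1r.
have E y : c * ew (s / c) f (c * y) = ew s (fun z => c * f (c * z)) y.
  rewrite /ew mulrCA; congr (expR _ * _); field; exact: lt0r_neq0.
have [lw|nw] := pselect (L1 (ew (s / c) f)).
  by rewrite /Lap -(Int_eq E); case: (Int_scale c0 lw).
rewrite /Lap [RHS]Int_nonL1 //; last by apply: measurable_ew; exact: L1_meas.
apply: Int_nonL1; first by apply: measurable_ew; exact: L1_meas.
move=> lw; apply: nw; have c1 : 0 < c^-1 by rewrite invr_gt0.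
have [l' _] := Int_scale c1 lw; apply: L1_eq l' => x.
by rewrite -E mulKf ?lt0r_neq0 // mulVKf ?lt0r_neq0.
Qed.

Lemma prim_heav f z : measurable_fun setT f -> conv heav f z = prim f z.
Proof. exact: conv_heav. Qed.

Lemma LT_loc f v : LT f -> L1 (fun x => ind (x <= v) * f x).
Proof.
move=> [mf cf lf]; have m : measurable_fun setT (fun x : R => x <= v) by apply: measurable_fun_ler.
apply: (L1_le _ (L1Z (expR `|v|) (L1_abs (lf 1 ltr01)))) => [|x].
  by apply: measurable_funM => //; exact: measurable_ind.
have [xv|xv] := leP x v; last by rewrite (@indF _ false) // mul0r normr0 mulr_ge0 ?expR_ge0.
rewrite (@indT _ true) // mul1r /ew normrM (ger0_norm (expR_ge0 _)) mulrA -expRD -[leLHS]mul1r.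
rewrite ler_wpM2r //; apply: le_trans (expR_ge1Dx _).
by rewrite lerDl mulN1r subr_ge0 (le_trans xv) // ler_norm.
Qed.

Section Fixed.
Variables (N : nat) (p : nat -> R) (T : R).
Hypotheses (hp0 : forall j : nat, (1 <= j <= N)%N -> 0 <= p j) (hp1 : \sum_(1 <= j < N.+1) p j = 1).
Local Notation Q := (Qconv N p).
Local Notation P := (Qpoly N p).
Local Notation q := (qmean N p).
Variables (e : R -> R -> R) (b : R -> R).
Hypotheses (T0 : 0 <= T) (lb : L1 b).
Hypothesis b0 : forall r, ~~ (0 <= r <= T) -> b r = 0.
Hypothesis le : forall t, 0 <= t <= T -> L1 (e t).
Hypothesis lxe : forall t, 0 <= t <= T -> L1 (fun x => x * e t x).
Hypothesis ve : forall t, vanish 1 (e t).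
Hypothesis e0 : forall t x, 0 <= e t x.
Hypothesis Ie : forall t, 0 <= t <= T -> Int (e t) = 1.
Local Notation B := (prim b).
Local Notation V := (prim (fun r => `|b r|)).
(** The conclusion of [weak_incr], taken as the only link to the evolution: the rest of this section
    concerns a family of probability densities [e t] and an integrable function [b]. *)
Hypothesis WI : forall t0 t h M Ph eps, 0 <= t0 -> t0 <= t -> t <= T -> t - t0 <= ln 2 ->
  measurable_fun setT h -> (forall x, `|h x| <= M) ->
  (forall s, t0 <= s <= t -> `|Int (fun y => Q (e s) y * h (expR s * (y + 1))) - Ph| <= eps) ->
  `|Int (fun y => e t y * h (expR t * y))
    - Int (fun z => ind (expR (t - t0) <= z) * (e t0 z * h (expR t0 * z)))
    - Ph * (B t - B t0)| <= eps * (V t - V t0).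

Let BV : ctrl B V := prim_ctrl lb.

(** The pairing is taken in the unscaled variable x = e^t y, where the dilation disappears: the
    density changes only by losing mass at x = e^t and by gaining the source. *)
Definition tst h t := Int (fun y => e t y * h (expR t * y)).
Definition src h t := Int (fun y => Q (e t) y * h (expR t * (y + 1))).

Lemma msc h c : measurable_fun setT h -> measurable_fun setT (fun y => h (c * y)).
Proof. by move=> mh; apply: L1_comp => //; apply: measurable_funM. Qed.

Lemma L1tst h M t : 0 <= t <= T -> measurable_fun setT h -> (forall x, `|h x| <= M) ->
  L1 (fun y => e t y * h (expR t * y)).
Proof.
move=> tT mh hM; have [] := @L1_bounded _ (e t) (fun y => h (expR t * y)) M (le tT) (msc _ mh) => //.
Qed.

Lemma src_le h M t : 0 <= t <= T -> measurable_fun setT h -> (forall x, `|h x| <= M) -> `|src h t| <= M.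
Proof.
move=> tT mh hM; have lQ : L1 (Q (e t)) by apply: L1_Q => //; exact: le.
have mh' : measurable_fun setT (fun y => h (expR t * (y + 1))).
  by apply: L1_comp => //; apply: measurable_funM => //; apply: measurable_funD.
have [_ h1] := @L1_bounded _ _ (fun y => h (expR t * (y + 1))) M lQ mh' (fun y => hM _).
apply: le_trans h1 _; rewrite /n1 (@Int_eq _ _ (Q (e t))) => [|x]; last first.
  by rewrite ger0_norm // (Q_ge0 hp0) //; exact: le.
by rewrite Int_Q ?Ie ?P1 ?mulr1 //; exact: le.
Qed.

(** Testing with h = 1: total mass is conserved and the source has mass 1, so the increment of [B]
    equals the mass swept through the boundary. In particular [B] is nondecreasing. *)
Lemma mass t0 t : 0 <= t0 -> t0 <= t -> t <= T -> t - t0 <= ln 2 ->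
  Int (fun z => ind (z < expR (t - t0)) * e t0 z) = B t - B t0.
Proof.
move=> t00 t0t tT tln; have t0T : 0 <= t0 <= T by rewrite t00 (le_trans t0t).
have tT' : 0 <= t <= T by rewrite tT andbT (le_trans t00).
have := @WI t0 t (fun=> 1) 1 1 0 t00 t0t tT tln (measurable_cst _).
move=> /(_ (fun x => eq_ind_r (fun z => z <= 1) (lexx _) (normr1 _))).
move=> H0; have {H0} : `|Int (e t) - Int (fun z => ind (expR (t - t0) <= z) * e t0 z) - (B t - B t0)| <= 0.
  rewrite -(mul0r (V t - V t0)) -[B t - B t0]mul1r.
  rewrite (@Int_eq _ (e t) (fun y => e t y * 1)) => [|x]; last by rewrite mulr1.
  rewrite (@Int_eq _ (fun z => ind (expR (t - t0) <= z) * e t0 z) (fun z => ind (expR (t - t0) <= z) * (e t0 z * 1))).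
    apply: H0 => s /andP[s0 st].
    have sT : 0 <= s <= T by apply/andP; split; lra.
    rewrite (@Int_eq _ _ (Q (e s))) => [|x]; last by rewrite mulr1.
    by rewrite Int_Q ?Ie ?P1 ?subrr ?normr0 //; exact: le.
  by move=> x; rewrite mulr1.
rewrite normr_le0 subr_eq0 => /eqP <-; rewrite Ie // -(Ie t0T).
rewrite -IntB; [|exact: le|by apply: L1_indM; [exact: measurable_fun_ler|exact: le]].
by apply: Int_eq => z; rewrite /ind ltNge; case: (_ <= z); rewrite ?mul0r ?mul1r ?subrr ?subr0.
Qed.

Lemma mass_ge0 t0 t : 0 <= t0 -> t0 <= t -> t <= T -> 0 <= B t - B t0.
Proof.
move=> t00 t0t tT.
apply: (cousin (P := fun x y => 0 <= B y - B x) t0t) => [x y z _ _|u /andP[u0 ut]]; first by lra.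
exists (ln 2) => [|x y x0 xu uy yt yx]; first by rewrite ln_gt0 // ltr1n.
by rewrite -mass //; [apply: Int_ge0 => z; rewrite mulr_ge0 ?ind_ge0|lra..].
Qed.

(** The gain is [Ph] times the increment of [B] up to [eps], and the lost mass, equal to that
    increment, sits in e^t0 <= x <= e^t where [h] is within [eps] of [hs]. The factor 2 adds the two
    errors. *)
Lemma tst_step h M Ph eps t0 t hs : 0 <= t0 -> t0 <= t -> t <= T -> t - t0 <= ln 2 ->
  measurable_fun setT h -> (forall x, `|h x| <= M) ->
  (forall s, t0 <= s <= t -> `|src h s - Ph| <= eps) ->
  (forall x, expR t0 <= x <= expR t -> `|h x - hs| <= eps) ->
  `|tst h t - tst h t0 - (Ph - hs) * (B t - B t0)| <= 2 * eps * (V t - V t0).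
Proof.
move=> t00 t0t tT tln mh hM hPh hhs; have t0T : 0 <= t0 <= T by rewrite t00 (le_trans t0t).
have ms := mass t00 t0t tT tln.
have h1 := WI t00 t0t tT tln mh hM hPh.
have lt0 := L1tst t0T mh hM.
have mi : measurable_fun setT (fun z : R => expR (t - t0) <= z) by apply: measurable_fun_ler.
have mi' : measurable_fun setT (fun z : R => z < expR (t - t0)) by apply: measurable_fun_ltr.
have l1 := L1_indM mi lt0; have l2 := L1_indM mi' lt0; have l3 := L1_indM mi' (le t0T).
have E1 : tst h t0 - Int (fun z => ind (expR (t - t0) <= z) * (e t0 z * h (expR t0 * z))) =
   Int (fun z => ind (z < expR (t - t0)) * (e t0 z * h (expR t0 * z))).
  rewrite -IntB //; apply: Int_eq => z; rewrite /ind ltNge.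
  by case: (_ <= z); rewrite ?mul0r ?mul1r ?subrr ?subr0.
have h2 : `|Int (fun z => ind (z < expR (t - t0)) * (e t0 z * h (expR t0 * z))) - hs * (B t - B t0)|
    <= eps * (B t - B t0).
  rewrite -ms -!IntZ; [|exact: L1_meas..].
  rewrite -IntB //; last exact: L1Z.
  have lD : L1 (fun z => ind (z < expR (t - t0)) * (e t0 z * h (expR t0 * z)) -
     hs * (ind (z < expR (t - t0)) * e t0 z)) by apply: L1B => //; exact: L1Z.
  apply: le_trans (Int_absL1 lD) _; apply: Int_le => [||z]; [exact: L1_abs|exact: L1Z|].
  have [z1|z1] := ltP z (expR (t - t0)); last first.
    by rewrite (@indF _ false) // !mul0r !mulr0 subrr normr0.
  rewrite (@indT _ true) // !mul1r mulrC -mulrBl normrM (ger0_norm (e0 _ _)).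
  have [z2|/ve ->] := leP 1 z; last by rewrite !mulr0.
  rewrite ler_wpM2r //; apply: hhs; rewrite -{1}[expR t0]mulr1 ler_pM2l ?expR_gt0 // z2 /=.
  by rewrite -[leRHS](_ : expR t0 * expR (t - t0) = _) ?ler_pM2l ?expR_gt0 ?(ltW z1) // -expRD addrC subrK.
have -> : tst h t - tst h t0 - (Ph - hs) * (B t - B t0) =
   (tst h t - Int (fun z => ind (expR (t - t0) <= z) * (e t0 z * h (expR t0 * z))) - Ph * (B t - B t0))
   - (Int (fun z => ind (z < expR (t - t0)) * (e t0 z * h (expR t0 * z))) - hs * (B t - B t0)).
  rewrite -E1; ring.
apply: le_trans (ler_normB _ _) _.
have eps0 : 0 <= eps by apply: le_trans (hPh t0 _); rewrite ?lexx.
have : eps * (B t - B t0) <= eps * (V t - V t0).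
  by rewrite ler_wpM2l //; apply: le_trans (BV.1 t0 t t0t); exact: ler_norm.
move: h1; rewrite -/(tst h t) => h1; lra.
Qed.

Lemma tst_cont h M t eps : 0 <= t <= T -> measurable_fun setT h -> (forall x, `|h x| <= M) ->
  0 < eps -> exists2 d, 0 < d & forall x, 0 <= x <= T -> `|x - t| <= d -> `|tst h x - tst h t| <= eps.
Proof.
move=> tT mh hM eps0; have M0 : 0 <= M by apply: le_trans (hM 0).
have M1 : 0 < 2 * M + 1 by lra.
have e1 : 0 < eps / (2 * M + 1) by rewrite divr_gt0.
have [d d0 hd] := BV.2 _ e1.
have key x y : 0 <= x -> x <= y -> y <= T -> y - x <= Num.min d (ln 2) -> `|tst h y - tst h x| <= eps.
  move=> x0 xy yT; rewrite le_min => /andP[yx yx2].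
  (* The crude choice of 0 for both frozen values, with error M, already bounds the increment by 2 M
     times that of [V], which gives continuity. *)
  have := @tst_step h M 0 M x y 0 x0 xy yT yx2 mh hM; rewrite subrr mul0r subr0 => h1.
  have h2 := hd x y xy yx; rewrite ler_pdivlMr // in h2.
  have V0 := ctrl_mono BV xy.
  apply: le_trans (h1 _ _) _ => [s /andP[s0 st]|z _|].
  - by rewrite subr0; apply: src_le => //; apply/andP; split; lra.
  - by rewrite subr0.
  - lra.
have dl : 0 < Num.min d (ln 2) by rewrite lt_min d0 ln_gt0 // ltr1n.
exists (Num.min d (ln 2)) => // x /andP[x0 xT]; case/andP: tT => t0 tT.
have [xt|tx] := leP x t => hx.
  by rewrite distrC; apply: key => //; move: hx; rewrite distrC ger0_norm // subr_ge0.
by apply: key => //; [exact: ltW|move: hx; rewrite ger0_norm // subr_ge0 ltW].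
Qed.

Lemma tst_dsim h M t : 0 <= t <= T -> measurable_fun setT h -> (forall x, `|h x| <= M) ->
  (forall eps, 0 < eps -> exists2 d, 0 < d & forall x, 0 <= x <= T -> `|x - t| <= d -> `|src h x - src h t| <= eps) ->
  {for expR t, continuous h} -> dsim B V T (tst h) t (src h t - h (expR t)).
Proof.
move=> tT mh hM hs hc; apply: (dsim_K BV (K := 2)) => // eps eps0 _.
have [d d0 hd] := hs eps eps0.
have hc2 : {for t, continuous (h \o @expR R)}.
  by apply: continuous_comp => //; exact: continuous_expR.
move/cvgrPdist_le: hc2 => /(_ _ eps0) /nbhs_ballP[d' /= d'0 hd'].
exists (Num.min (Num.min d (ln 2)) (d' / 2)) => [|x y x0 xt ty yT].
  by rewrite !lt_min d0 ln_gt0 ?ltr1n // divr_gt0.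
rewrite !le_min => /andP[/andP[yx yx2] yx3].
apply: tst_step mh hM _ _ => //; first exact: le_trans ty.
- move=> s /andP[xs sy]; apply: hd; first by apply/andP; split; lra.
  by rewrite ler_norml; apply/andP; split; lra.
move=> z /andP[z1 z2]; have z0 : 0 < z := lt_le_trans (expR_gt0 x) z1.
have zE : z = expR (ln z) by rewrite lnK.
rewrite zE !ler_expR in z1 z2; rewrite zE distrC; apply: hd'.
by rewrite /ball /= ltr_norml; apply/andP; split; lra.
Qed.

Lemma cont_within (G : R -> R) t :
  (forall eps, 0 < eps -> exists2 d, 0 < d & forall x, 0 <= x <= T -> `|x - t| <= d -> `|G x - G t| <= eps) <->
  G x @[x --> within [set x | 0 <= x <= T] (nbhs t)] --> G t.
Proof.
split=> [h|/cvgrPdist_le h eps eps0].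
  apply/cvgrPdist_le => eps eps0; have [d d0 hd] := h eps eps0.
  rewrite near_withinE; apply/nbhs_ballP; exists d => //= x; rewrite /ball /= => xt xT.
  by rewrite distrC; apply: hd => //; rewrite distrC ltW.
have := h eps eps0; rewrite near_withinE => /nbhs_ballP[d /= d0 hd].
exists (d / 2) => [|x xT xt]; first by rewrite divr_gt0.
by rewrite distrC; apply: hd => //; rewrite /ball /= distrC; lra.
Qed.

(** * The quotient of transforms at a fixed Laplace parameter *)

Section LaplaceParam.
Variable s : R.
Hypothesis s0 : 0 < s.
Let h1 x := ind (0 <= x) * expR (- s * x).
Let h2 x := ind (0 <= x) * (x * expR (- s * x)).

Definition Fh t := Lap (e t) (s * expR t).
(** Minus the derivative of [Fh] with respect to the parameter s; the factor e^t is the first power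
    of the unscaled variable x = e^t y. *)
Definition Ah t := expR t * Lap (fun x => x * e t x) (s * expR t).
Definition Eh t := expR (- s * expR t).

Lemma st0 t : 0 < s * expR t. Proof. by rewrite mulr_gt0 ?expR_gt0. Qed.

Lemma LTe t : 0 <= t <= T -> LT (e t).
Proof. by move=> tT; apply: LT_vanish; [exact: le|exact: ve]. Qed.

Lemma mh1 : measurable_fun setT h1.
Proof. by apply: measurable_funM; [exact: measurable_ind_ge|exact: measurable_expM]. Qed.

Lemma mh2 : measurable_fun setT h2.
Proof.
apply: measurable_funM; first exact: measurable_ind_ge.
by apply: measurable_funM => //; exact: measurable_expM.
Qed.

Lemma h1_le x : `|h1 x| <= 1. Proof. exact: exp_ind_le. Qed.
Lemma h2_le x : `|h2 x| <= s^-1. Proof. exact: xexp_le. Qed.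

Lemma tst1 t : tst h1 t = Fh t.
Proof.
apply: Int_eq => y; rewrite /ew /h1; have [y1|/ve ->] := leP 1 y; last by rewrite mul0r mulr0.
rewrite indT ?mul1r; last by rewrite mulr_ge0 ?expR_ge0 // (le_trans ler01).
by rewrite mulrC mulrA mulNr.
Qed.

Lemma tst2 t : 0 <= t <= T -> tst h2 t = Ah t.
Proof.
move=> tT; rewrite /Ah /Lap -IntZ; last by apply: measurable_ew; apply: L1_meas; exact: lxe.
apply: Int_eq => y; rewrite /ew /h2; have [y1|/ve ->] := leP 1 y; last by rewrite mul0r !mulr0.
rewrite indT ?mul1r; last by rewrite mulr_ge0 ?expR_ge0 // (le_trans ler01).
by rewrite [- s * _]mulrA -mulNr; ring.
Qed.

Lemma LTQ t : 0 <= t <= T -> LT (Q (e t)).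
Proof. by move=> tT; apply: LT_Q; [exact: le|exact: ve]. Qed.

Lemma src1 t : 0 <= t <= T -> src h1 t = Eh t * P.[Fh t].
Proof.
move=> tT; rewrite -(Lap_Q _ _ (le tT) (@ve t) (st0 t)) /Lap -IntZ; last first.
  by apply: measurable_ew; apply: LT_meas; exact: LTQ.
apply: Int_eq => y; rewrite /ew /h1; have [y1|y1] := leP 1 y; last by rewrite vanish_Q // mul0r !mulr0.
rewrite indT ?mul1r; last by rewrite mulr_ge0 ?expR_ge0 //; lra.
by rewrite mulrA -expRD mulrC; congr (expR _ * _); ring.
Qed.

Lemma src2 t : 0 <= t <= T ->
  src h2 t = Eh t * (expR t * P.[Fh t] + P^`().[Fh t] * Ah t).
Proof.
move=> tT; have -> : P^`().[Fh t] * Ah t = expR t * Lap (fun x => x * Q (e t) x) (s * expR t).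
  by rewrite Lap_mulx_Q //; [rewrite mulrCA|exact: le|exact: st0].
rewrite -(Lap_Q _ _ (le tT) (@ve t) (st0 t)) -mulrDr mulrA addrC -Lap_D; last 3 first.
- exact: st0.
- by apply: LT_mulx; exact: LTQ.
- exact: LTQ.
rewrite /Lap -IntZ; last first.
  by apply: measurable_ew; apply: LT_meas; apply: LT_D; [apply: LT_mulx|]; exact: LTQ.
apply: Int_eq => y; rewrite /ew /h2; have [y1|y1] := leP 1 y; last by rewrite vanish_Q // !(mul0r, mulr0, addr0).
rewrite indT ?mul1r; last by rewrite mulr_ge0 ?expR_ge0 //; lra.
have -> : expR (- s * (expR t * (y + 1))) = Eh t * expR (- (s * expR t) * y).
  by rewrite -expRD; congr expR; ring.
by rewrite /Eh; ring.
Qed.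

Lemma Fh_lt1 t : 0 <= t <= T -> [/\ 0 <= Fh t, Fh t < 1 & 0 <= P.[Fh t]] /\ P.[Fh t] <= Fh t.
Proof.
move=> tT; have F0 : 0 <= Fh t by apply: Int_ge0 => x; rewrite mulr_ge0 ?expR_ge0.
have F1 : Fh t < 1.
  have l : L1 (ew (s * expR t) (e t)) by case: (LTe tT) => _ _; apply; exact: st0.
  apply: le_lt_trans (_ : expR (- (s * expR t)) < 1); last by rewrite expR_lt1 oppr_lt0 st0.
  rewrite -[leRHS]mulr1 -(Ie tT) -IntZ; last by apply: L1_meas; exact: le.
  apply: Int_le => [//||x]; first by apply: L1Z; exact: le.
  have [x1|/ve] := leP 1 x; last by rewrite /ew => ->; rewrite !mulr0.
  rewrite /ew ler_wpM2r // ler_expR mulNr lerN2 ler_peMr //; exact/ltW/st0.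
by have [] := P_le1 hp0 hp1 F0 (ltW F1).
Qed.

Lemma Eh_cont t : Eh x @[x --> within [set x | 0 <= x <= T] (nbhs t)] --> Eh t.
Proof.
apply: (@cvg_comp _ _ _ _ (@expR R)); last exact: continuous_expR.
by apply: cvgZr; apply: cvg_within_filter; exact: continuous_expR.
Qed.

Lemma Fh_cont t : 0 <= t <= T -> Fh x @[x --> within [set x | 0 <= x <= T] (nbhs t)] --> Fh t.
Proof.
move=> tT; apply/cont_within => eps eps0; have [d d0 hd] := tst_cont tT mh1 h1_le eps0.
by exists d => // x xT xt; rewrite -!tst1; apply: hd.
Qed.

Lemma Ah_cont t : 0 <= t <= T -> Ah x @[x --> within [set x | 0 <= x <= T] (nbhs t)] --> Ah t.
Proof.
move=> tT; apply/cont_within => eps eps0; have [d d0 hd] := tst_cont tT mh2 h2_le eps0.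
by exists d => // x xT xt; rewrite -!tst2 //; apply: hd.
Qed.

Lemma Fh_poly_cont (G : {poly R}) t : 0 <= t <= T ->
  G.[Fh x] @[x --> within [set x | 0 <= x <= T] (nbhs t)] --> G.[Fh t].
Proof.
by move=> tT; apply: (@cvg_comp _ _ _ _ (horner G)) (Fh_cont tT) _; exact: continuous_horner.
Qed.

Lemma src1_cont t : 0 <= t <= T -> forall eps, 0 < eps -> exists2 d, 0 < d &
  forall x, 0 <= x <= T -> `|x - t| <= d -> `|src h1 x - src h1 t| <= eps.
Proof.
move=> tT eps eps0; have [|d d0 hd] := proj2 (@cont_within (fun x => Eh x * P.[Fh x]) t) _ eps eps0.
  by apply: cvgM; [exact: Eh_cont|exact: Fh_poly_cont].
by exists d => // x xT xt; rewrite !src1 //; apply: hd.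
Qed.

Lemma src2_cont t : 0 <= t <= T -> forall eps, 0 < eps -> exists2 d, 0 < d &
  forall x, 0 <= x <= T -> `|x - t| <= d -> `|src h2 x - src h2 t| <= eps.
Proof.
move=> tT eps eps0.
have ce : expR x @[x --> within [set x | 0 <= x <= T] (nbhs t)] --> expR t.
  by apply: cvg_within_filter; exact: continuous_expR.
have [|d d0 hd] := proj2 (@cont_within (fun x => Eh x * (expR x * P.[Fh x] + P^`().[Fh x] * Ah x)) t) _ eps eps0.
  apply: cvgM; first exact: Eh_cont.
  by apply: cvgD; apply: cvgM => //; [exact: Fh_poly_cont|exact: Fh_poly_cont|exact: Ah_cont].
by exists d => // x xT xt; rewrite !src2 //; apply: hd.
Qed.

Lemma expM_cont : continuous (fun x => expR (- s * x)).
Proof. by move=> x; apply: (@cvg_comp _ _ _ _ (@expR R)); [apply: cvgZr; exact: cvg_id|exact: continuous_expR]. Qed.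

Lemma Fh_dsim t : 0 <= t <= T -> dsim B V T Fh t (- Eh t * (1 - P.[Fh t])).
Proof.
move=> tT; have -> : - Eh t * (1 - P.[Fh t]) = src h1 t - h1 (expR t).
  by rewrite src1 // /h1 indT ?mul1r ?expR_ge0 // -/(Eh t); ring.
have -> : Fh = tst h1 by apply/funext => x; rewrite tst1.
apply: tst_dsim tT mh1 h1_le (src1_cont tT) _.
by apply: ind_near; [exact: expR_gt0|exact: expM_cont].
Qed.

Lemma tst2_dsim t : 0 <= t <= T ->
  dsim B V T (tst h2) t (Eh t * (- expR t * (1 - P.[Fh t]) + P^`().[Fh t] * Ah t)).
Proof.
move=> tT; have -> : Eh t * (- expR t * (1 - P.[Fh t]) + P^`().[Fh t] * Ah t) = src h2 t - h2 (expR t).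
  by rewrite src2 // /h2 indT ?mul1r ?expR_ge0 // -/(Eh t); ring.
apply: tst_dsim tT mh2 h2_le (src2_cont tT) _.
apply: ind_near; first exact: expR_gt0.
by move=> x; apply: cvgM; [exact: cvg_id|exact: expM_cont].
Qed.

Definition Dh t := 1 - P.[Fh t].

Lemma Dh_gt0 t : 0 <= t <= T -> 0 < Dh t.
Proof. by move=> /Fh_lt1[[_ F1 _] PF]; rewrite subr_gt0; exact: le_lt_trans PF F1. Qed.

Lemma Dh_dsim t : 0 <= t <= T -> dsim B V T Dh t (P^`().[Fh t] * (Eh t * Dh t)).
Proof.
move=> tT; have h := dsim_horner BV P tT (Fh_dsim tT).
have := dsim_add BV (@dsim_cst _ _ _ T BV 1 t) (dsim_scale BV (-1) tT h).
rewrite (_ : 0 + -1 * _ = P^`().[Fh t] * (Eh t * Dh t)); last by rewrite /Dh; ring.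
by rewrite (_ : (fun x => 1 + -1 * _) = Dh) //; apply/funext => x; rewrite /Dh mulN1r.
Qed.

Definition Wh t := prim (fun r => b r * (expR r * expR (- s * expR r))) t.

Lemma Wk_L1 : L1 (fun r => b r * (expR r * expR (- s * expR r))).
Proof.
have m : measurable_fun setT (fun r : R => expR r * expR (- s * expR r)).
  have me : measurable_fun setT (@expR R) by exact: measurable_expR.
  apply: measurable_funM => //; apply: (measurableT_comp me).
  exact: measurable_funM.
by case: (L1_bounded lb m (fun r => _ : `|_| <= s^-1)) => // r;
  have := xexp_le (expR r) s0; rewrite indT ?expR_ge0 // mul1r.
Qed.

Lemma Wh_dsim t : 0 <= t <= T -> dsim B V T Wh t (expR t * Eh t).
Proof.
move=> tT; apply: (prim_dsim lb Wk_L1); apply/cont_within.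
apply: cvgM; last exact: Eh_cont.
by apply: cvg_within_filter; exact: continuous_expR.
Qed.

Lemma Wh0 : Wh 0 = 0.
Proof.
rewrite /Wh /prim -[RHS](Int0 R); have l := L1_prim 0 Wk_L1; apply: Int_ae; [exact: L1_meas l|exact: measurable_cst|].
apply: ae_S (ae_neq 0) => r r0; have [r1|r1] := leP r 0; last by rewrite (@indF _ false) ?mul0r.
by rewrite b0 ?mul0r ?mulr0 // negb_and -ltNge lt_neqAle r0 r1.
Qed.

(** Relative to [B], the derivative of [Ah] is Eh (- e^t Dh + P'(Fh) Ah) and that of [Dh] is Eh
    P'(Fh) Dh. In the quotient the terms with P' cancel and only - e^t Eh is left, which [Wh]
    compensates. *)
Lemma AD_const : Ah T / Dh T = Ah 0 / Dh 0 - Wh T.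
Proof.
have TT : 0 <= T <= T by rewrite T0 lexx.
have OT : (0 : R) <= 0 <= T by rewrite lexx.
pose G t := tst h2 t * (Dh t)^-1 + Wh t.
have GT : G T = G 0.
  apply: (straddle BV T0) => t tT; have Dt := Dh_gt0 tT.
  have d1 := dsim_inv BV tT Dt (Dh_dsim tT).
  have d2 := dsim_add BV (dsim_mul BV tT (tst2_dsim tT) d1) (Wh_dsim tT).
  rewrite (_ : _ + expR t * Eh t = 0) // in d2; rewrite tst2 // -/(Dh t).
  by field; rewrite lt0r_neq0.
move: GT; rewrite /G !tst2 // Wh0 addr0 => <-; ring.
Qed.

(** A Gronwall estimate: relative to [B], 1 - F grows at the rate Eh (1 - P(F)), at most q (1 - F),
    and [B] is nondecreasing. It is a bound for the first moment before the limit s -> 0. *)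
Lemma mean_step : 1 - Fh T <= (1 - Fh 0) * expR (q * B T).
Proof.
have q1 := qmean_ge1 hp0 hp1; have q0 : 0 <= q := le_trans ler01 q1.
have B0 : B 0 = 0.
  rewrite /prim -[RHS](Int0 R); have l := L1_prim 0 lb; apply: Int_ae; [exact: L1_meas l|exact: measurable_cst|].
  apply: ae_S (ae_neq 0) => r r0; have [r1|r1] := leP r 0; last by rewrite (@indF _ false) ?mul0r.
  by rewrite b0 ?mulr0 // negb_and -ltNge lt_neqAle r0 r1.
pose G t := (1 - Fh t) * expR (- q * B t).
have : G T <= G 0.
  apply: (straddle_le T0 (ctrl_mono BV)) => t tT eps eps0.
  have e1 : 0 < eps / (q + 1) by rewrite divr_gt0 //; lra.
  have [d d0 hd] := Fh_dsim tT e1.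
  have [d' d'0 hd'] := dsim_cont BV tT (Fh_dsim tT) e1.
  exists (Num.min d d') => [|x y x0 xt ty yT]; first by rewrite lt_min d0.
  rewrite le_min => /andP[yx yx'].
  have xy := le_trans xt ty.
  have {}hd := hd x y x0 xt ty yT yx.
  have xT : 0 <= x <= T by rewrite x0 (le_trans xy).
  have {}hd' : `|Fh x - Fh t| <= eps / (q + 1).
    by apply: hd' => //; rewrite ler_norml; apply/andP; split; lra.
  have m := mass_ge0 x0 xy yT; have mV := le_trans (ler_norm _) (BV.1 x y xy).
  have By : 0 <= B y by have := mass_ge0 (lexx 0) (le_trans x0 xy) yT; rewrite B0 subr0.
  have [[F0 F1 P0] PF] := Fh_lt1 tT; have [_ _ Pq] := P_le1 hp0 hp1 F0 (ltW F1).
  have [[Fx0 Fx1 _] _] := Fh_lt1 xT.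
  have E1 : Eh t <= 1 by rewrite -expR0 ler_expR mulNr oppr_le0 ltW // st0.
  have E0 : 0 <= Eh t := expR_ge0 _.
  rewrite /G; have -> : - q * B x = - q * B y + q * (B y - B x) by ring.
  rewrite expRD; set w := expR (- q * B y).
  have w0 : 0 <= w := expR_ge0 _.
  have w1 : w <= 1 by rewrite -expR0 ler_expR mulNr oppr_le0 mulr_ge0.
  have ew : 1 + q * (B y - B x) <= expR (q * (B y - B x)) := expR_ge1Dx _.
  have key : (1 - Fh y) - (1 - Fh x) * expR (q * (B y - B x)) <= eps * (V y - V x).
    have k1 : (1 - Fh x) * (1 + q * (B y - B x)) <= (1 - Fh x) * expR (q * (B y - B x)).
      by rewrite ler_wpM2l //; lra.
    have k2 : - (Fh y - Fh x) - Eh t * (1 - P.[Fh t]) * (B y - B x) <= eps / (q + 1) * (V y - V x).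
      by apply: le_trans hd; rewrite -normrN; apply: le_trans (ler_norm _); rewrite le_eqVlt; apply/orP; left; apply/eqP; ring.
    have k3 : Eh t * (1 - P.[Fh t]) * (B y - B x) <= q * (1 - Fh t) * (B y - B x).
      rewrite ler_wpM2r //; apply: le_trans Pq; rewrite -[leRHS]mul1r ler_wpM2r //; lra.
    have k4 : q * (Fh x - Fh t) * (B y - B x) <= q * (eps / (q + 1)) * (V y - V x).
      apply: le_trans (ler_norm _) _; rewrite !normrM (ger0_norm q0).
      apply: ler_pM => //; [exact: mulr_ge0|exact: ler_wpM2l|exact: BV.1].
    have -> : eps = q * (eps / (q + 1)) + eps / (q + 1) by field; lra.
    lra.
  rewrite mulrCA [_ * w]mulrC -mulrBr.
  have [neg|pos] := leP ((1 - Fh y) - (1 - Fh x) * expR (q * (B y - B x))) 0.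
    apply: le_trans (_ : 0 <= _); first by rewrite mulr_ge0_le0.
    by rewrite mulr_ge0 ?subr_ge0 ?(ctrl_mono BV) // ltW.
  by apply: le_trans key; rewrite -[leRHS]mul1r ler_wpM2r // ltW.
rewrite /G B0 mulr0 expR0 mulr1 mulNr expRN => h.
by rewrite -ler_pdivrMr ?expR_gt0.
Qed.

End LaplaceParam.

Lemma prim_T (k : R -> R) : prim (fun r => b r * k r) T = Int (fun r => b r * k r).
Proof.
apply: Int_eq => r; have [rT|rT] := leP r T; first by rewrite (@indT _ true) // mul1r.
by rewrite b0 ?mul0r ?mulr0 // negb_and -!ltNge rT orbT.
Qed.

(** Divide [mean_step] by s and let s tend to 0. On the left y exp(- y) <= 1 - exp(- y) compares s
    [Ah] with 1 - [Fh], and on the right 1 - exp(- y) <= y produces the initial mean. *)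
Lemma mean_bound : Int (fun x => x * e T x) * expR T <= Int (fun x => x * e 0 x) * expR (q * B T).
Proof.
have TT : 0 <= T <= T by rewrite T0 lexx.
have OT : (0 : R) <= 0 <= T by rewrite lexx.
have step s : 0 < s -> s * Ah s T <= (s * Int (fun x => x * e 0 x)) * expR (q * B T).
  move=> s0.
  have h1 t : 0 <= t <= T -> L1 (ew (s * expR t) (e t)).
    by move=> tT; case: (LTe tT) => _ _; apply; exact: st0.
  apply: le_trans (_ : 1 - Fh s T <= _).
    rewrite -(Ie TT) /Ah mulrA /Fh /Lap -IntB //; [|exact: le|exact: h1].
    rewrite -IntZ; last by apply: measurable_ew; apply: L1_meas; exact: lxe.
    apply: Int_le => [||x]; [|by apply: L1B; [exact: le|exact: h1]|].
      by apply: L1Z; case: (LT_mulx (LTe TT)) => _ _; apply; exact: st0.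
    rewrite /ew; have [x1|/ve ->] := leP 1 x; last by rewrite !mulr0 subrr.
    rewrite -[leRHS](_ : (1 - expR (- (s * expR T) * x)) * e T x = _); last by ring.
    rewrite !mulrA ler_wpM2r // mulNr; set y := s * expR T * x.
    have := expR_ge1Dx y; have := expR_gt0 y; rewrite -/y expRN => p1 p2.
    rewrite mulrAC -/y lerBrDr -[y / _ + _](_ : (1 + y) / expR y = _); last by rewrite mulrDl mul1r addrC.
    by rewrite ler_pdivrMr // mul1r.
  apply: le_trans (mean_step s0) _; rewrite ler_wpM2r ?expR_ge0 //.
  rewrite -(Ie OT) /Fh /Lap -IntB //; [|exact: le|exact: h1].
  rewrite -IntZ; last by apply: L1_meas; exact: lxe.
  apply: Int_le => [||x]; [by apply: L1B; [exact: le|exact: h1]|by apply: L1Z; exact: lxe|].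
  rewrite /ew -[leLHS](_ : (1 - expR (- (s * expR 0) * x)) * e 0 x = _); last by ring.
  rewrite mulrA ler_wpM2r // expR0 mulr1.
  by have := expR_ge1Dx (- s * x); lra.
have cv : causal (fun x => x * e T x) by move=> x x0; rewrite ve ?mulr0 //; lra.
have : Int (fun x => x * e T x) <= Int (fun x => x * e 0 x) * expR (q * B T) / expR T.
  apply: Lap_lim0 cv _ => [|s s0]; first exact: lxe.
  have s1 : 0 < s / expR T by rewrite divr_gt0 ?expR_gt0.
  have := step _ s1; rewrite -[leRHS]mulrA ler_pM2l // /Ah divfK ?lt0r_neq0 ?expR_gt0 // => h.
  by rewrite ler_pdivlMr ?expR_gt0 // mulrC.
by rewrite ler_pdivlMr ?expR_gt0.
Qed.

(** * Inverting the transform identity at time T *)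

Section Identify.
Variable k0 : R -> R.
Hypothesis Lk0 : LT k0.
Hypothesis hk0 : forall s, 0 < s -> Lap k0 s * (1 - P.[Lap (e 0) s]) = Lap (fun x => x * e 0 x) s.
Let S := expR T.
Let bb r := b r * expR r.
Let Nf z := Int (fun r => bb r * ind (expR r <= z)).
(** By [AD_const] the transform of [X] is Ah / (Dh s) at time T, just as that of the primitive of
    [k0] is at time 0; [X] is thus the primitive of the renewal function of the solution at time T,
    in the unscaled frame. *)
Let X z := conv heav k0 z - Nf z.

Lemma S_gt0 : 0 < S. Proof. exact: expR_gt0. Qed.
Lemma S_ge1 : 1 <= S. Proof. by rewrite -expR0 ler_expR. Qed.

Lemma L1bb : L1 bb.
Proof.
apply: (L1_le _ (L1Z S (L1_abs lb))) => [|r].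
  by apply: measurable_funM; [exact: L1_meas|exact: measurable_expR].
rewrite normrM mulrC ger0_norm ?expR_ge0 //.
have [rT|rT] := boolP (0 <= r <= T); last by rewrite b0 // normr0 !mulr0.
by rewrite ler_wpM2r // ler_expR; case/andP: rT.
Qed.

Lemma LX : LT X /\ forall s, 0 < s -> Lap X s = Ah s T / Dh s T / s.
Proof.
have h s : 0 < s -> LT Nf /\ Lap Nf s = Wh s T / s.
  move=> s0; have [l e'] := Lap_cum s0 L1bb (@measurable_expR R) (fun r => expR_ge0 r).
  split=> //; rewrite e' /Wh prim_T; congr (_ / s); apply: Int_eq => r; rewrite /bb; ring.
have [lN _] := h 1 ltr01.
have Lh := LT_conv (LT_heav R) Lk0.
split=> [|s s0]; first exact: LT_B.
rewrite Lap_B // Lap_conv // ?Lap_heav //; last exact: LT_heav.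
have [_ ->] := h s s0; rewrite AD_const //.
have OT : (0 : R) <= 0 <= T by rewrite lexx.
have D0 := Dh_gt0 s0 OT; rewrite /Dh /Fh expR0 mulr1 in D0.
rewrite /Ah /Dh /Fh expR0 mul1r mulr1 -hk0 // mulfK ?lt0r_neq0 // mulrBl; ring.
Qed.

Let a z := S^-1 * (S * (S^-1 * z * e T (S^-1 * z))).
Let rho z := S^-1 * Q (e T) (S^-1 * z).

Lemma TT : 0 <= T <= T. Proof. by rewrite T0 lexx. Qed.
Lemma iS_gt0 : 0 < S^-1. Proof. by rewrite invr_gt0 S_gt0. Qed.

Lemma a_props : [/\ L1 a, vanish S a & forall s, Lap a s = Ah s T].
Proof.
have l : L1 (fun x => S * (x * e T x)) by apply: L1Z; apply: lxe; exact: TT.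
have v : vanish 1 (fun x => S * (x * e T x)) by move=> x /ve ->; rewrite !mulr0.
have [l' v' h] := Lap_scale iS_gt0 l v; rewrite invrK in v' h; split=> // s.
rewrite h Lap_Z //; apply: LT_mulx; exact: LTe TT.
Qed.

Lemma rho_props : [/\ L1 rho, vanish S rho & forall s, 0 < s -> Lap rho s = P.[Fh s T]].
Proof.
have l : L1 (Q (e T)) by apply: L1_Q => //; apply: le; exact: TT.
have v : vanish 1 (Q (e T)) by apply: vanish_Q.
have [l' v' h] := Lap_scale iS_gt0 l v; rewrite invrK in v' h; split=> // s s0.
by rewrite h Lap_Q //; [apply: le; exact: TT|rewrite mulr_gt0 ?S_gt0].
Qed.

Lemma X_eq : {ae mu, forall z, conv a heav z = X z - conv rho X z}.
Proof.
have [la va ha] := a_props; have [lr vr hr] := rho_props; have [lX hX] := LX.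
have La : LT a by apply: L1_LT => //; apply: vanish_causal va; exact: ltW S_gt0.
have Lr : LT rho by apply: L1_LT => //; apply: vanish_causal vr; exact: ltW S_gt0.
have lc := LT_conv Lr lX; have lh := LT_conv La (LT_heav R).
apply: Lap_inj2 => [||s s0]; [exact: lh|exact: LT_B|].
rewrite Lap_B // !Lap_conv // ?Lap_heav //; last exact: LT_heav.
rewrite ha hr // hX //.
have D0 := Dh_gt0 s0 TT; rewrite /Dh in D0 *; field; rewrite !lt0r_neq0 //.
Qed.

(** In [X_eq] both [a] and [rho] are supported above S = e^T, so [X] vanishes below S. There [Nf] is
    the primitive of [k0]: the trace up to time T is read off from the initial renewal function. *)
Lemma X_lt : {ae mu, forall z, z < S -> X z = 0}.
Proof.
have [la va ha] := a_props; have [lr vr hr] := rho_props; have [[mX cX _] _] := LX.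
have ch : vanish 0 heav by case: (LT_heav R).
have v1 := vanish_conv va ch; have v2 := vanish_conv vr cX; rewrite addr0 in v1 v2.
by apply: ae_S X_eq => z h zS; rewrite v1 // v2 // subr0 in h.
Qed.

(** Below 2 S the convolution of [rho] with [X] vanishes, both factors being supported above S. *)
Lemma X_near : {ae mu, forall z, z < S + S -> X z = conv a heav z}.
Proof.
have [la va ha] := a_props; have [lr vr hr] := rho_props; have [[mX cX _] _] := LX.
pose X' z := ind (S <= z) * X z.
have mX' : measurable_fun setT X' by apply: measurable_funM => //; exact: measurable_ind_ge.
have vX' : vanish S X' by move=> z zS; rewrite /X' indF ?mul0r // -ltNge.
have XX' : {ae mu, forall z, X z = X' z}.
  apply: ae_S X_lt => z h; rewrite /X'; have [Sz|/h] := leP S z; first by rewrite (@indT _ true) ?mul1r.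
  by rewrite (@indF _ false) // mul0r.
have v2 := vanish_conv vr vX'; have mr := L1_meas lr.
apply: ae_S X_eq => z h zS; rewrite h (conv_congr z mr mX mr mX' (ae_T (fun=> erefl)) XX').
by rewrite v2 // subr0.
Qed.

Lemma Nf_const z : S <= z -> Nf z = Int bb.
Proof.
move=> Sz; apply: Int_eq => r; have [rT|rT] := boolP (0 <= r <= T); last by rewrite /bb b0 // !mul0r.
by rewrite indT ?mulr1 //; apply: le_trans Sz; rewrite ler_expR; case/andP: rT.
Qed.

Let mk0 : measurable_fun setT k0. Proof. by case: Lk0. Qed.

(** The endpoint S escapes the almost everywhere identity below S, so it is approached from the
    right: at suitable points z slightly above S, [Nf] has its final value, the primitive of [k0] is
    nearly its value at S, and [X] is small because it is the integral of [a] over [S, z]. *)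
Lemma bb_prim : Int bb = prim k0 S.
Proof.
have [la va ha] := a_props.
apply/eqP; rewrite -subr_eq0 -normr_le0; apply/ler_addgt0Pr => eps eps0; rewrite add0r.
have e2 : 0 < eps / 2 by rewrite divr_gt0.
have lk := LT_loc (S + S) Lk0.
have [d1 d10 h1] := Int_small la e2; have [d2 d20 h2] := Int_small lk e2.
pose d := Num.min S (Num.min d1 d2).
have d0 : 0 < d by rewrite !lt_min S_gt0 d10.
have Sd : S < S + d by rewrite ltrDl.
have [z /andP[Sz zd] hz] := ae_pick Sd X_near.
have dS : d <= S by rewrite ge_min lexx.
have dd1 : d <= d1 by rewrite !ge_min lexx orbT.
have dd2 : d <= d2 by rewrite !ge_min lexx !orbT.
have {}hz := hz (_ : z < S + S); have zS2 : z < S + S by lra.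
have {}hz := hz zS2; rewrite /X prim_heav // Nf_const ?(ltW Sz) // in hz.
have m1 : measurable_fun setT (fun x : R => S <= x <= z).
  by apply: measurable_and; apply: measurable_fun_ler.
have lp u : u <= S + S -> L1 (fun x => ind (x <= u) * k0 x).
  move=> uS; have m : measurable_fun setT (fun x : R => x <= u) by apply: measurable_fun_ler.
  apply: L1_eq (L1_indM m lk) => x; rewrite /ind; case: (leP x u) => xu; last by rewrite !mul0r.
  by rewrite (le_trans xu uS) !mul1r.
have k1 : `|prim k0 z - prim k0 S| <= eps / 2.
  apply: le_trans (h2 S z (ltW Sz) _); last by lra.
  rewrite /prim -IntB; [|by apply: lp; lra..].
  apply: le_trans (Int_absL1 _) _; first by apply: L1B; apply: lp; lra.
  apply: Int_le => [||x]; first by apply: L1_abs; apply: L1B; apply: lp; lra.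
    by apply: L1_indM => //; exact: L1_abs.
  have [xS|xS] := leP x S; first by rewrite (le_trans xS (ltW Sz)) subrr normr0 mulr_ge0 ?ind_ge0.
  rewrite (@indF _ false) // mul0r subr0 (ltW xS) /=.
  have [xz|xz] := leP x z; last by rewrite (@indF _ false) // !mul0r normr0.
  by rewrite (@indT _ true) // !mul1r (@indT _ (x <= S + S)) ?mul1r //; lra.
have k2 : `|conv a heav z| <= eps / 2.
  rewrite convC; [|exact: L1_meas|by case: (LT_heav R)].
  rewrite conv_heav; last exact: L1_meas.
  apply: le_trans (h1 S z (ltW Sz) _); last by lra.
  have l := L1_prim z la; apply: le_trans (Int_absL1 l) _.
  apply: Int_le => [||x]; [exact: L1_abs|by apply: L1_indM => //; exact: L1_abs|].
  rewrite normrM ger0_norm ?ind_ge0 //; have [xS|xS] := leP S x; first by [].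
  by rewrite va // normr0 !mulr0.
rewrite -hz in k2; have -> : Int bb - prim k0 S = (prim k0 z - prim k0 S) - (prim k0 z - Int bb) by ring.
by apply: le_trans (ler_normB _ _) _; lra.
Qed.

Lemma X_ge z : S <= z -> X z = prim k0 z - prim k0 S.
Proof. by move=> Sz; rewrite /X prim_heav // Nf_const // bb_prim. Qed.

Lemma prim_split z : S <= z -> prim k0 z - prim k0 S = Int (fun x => ind (S < x <= z) * k0 x).
Proof.
move=> Sz; rewrite /prim -IntB; [|exact: LT_loc..].
apply: Int_eq => x; rewrite -mulrBl; congr (_ * _).
by rewrite /ind ltNge; have [xS|xS] /= := leP x S; [rewrite (le_trans xS Sz) subrr|rewrite subr0].
Qed.

Let kS x := ind (S <= x) * k0 x.

Lemma LkS : LT kS.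
Proof.
apply: (LT_le _ Lk0) => [|x]; last exact: indM_norm.
by apply: measurable_funM => //; exact: measurable_ind_ge.
Qed.

Lemma X_conv : {ae mu, forall z, X z = conv heav kS z}.
Proof.
have [mk ck lk] := LkS.
apply: ae_S X_lt => z h; rewrite prim_heav //; have [Sz|zS] := leP S z; last first.
  rewrite h // /prim -[LHS](Int0 R); apply: Int_eq => x; have [xz|xz] := leP x z.
    by rewrite (@indT _ true) // mul1r /kS indF ?mul0r // -ltNge (le_lt_trans xz).
  by rewrite (@indF _ false) // mul0r.
have ls := LT_loc z LkS.
rewrite X_ge // prim_split //; apply: Int_ae; [|exact: L1_meas ls|].
  apply: measurable_funM => //; apply: measurable_ind; apply: measurable_and.
    exact: measurable_fun_ltr.
  exact: measurable_fun_ler.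
exists [set S]; split; [exact: measurable_set1|exact: lebesgue_measure_set1|].
move=> x /= nx; apply: contrapT => /eqP xS; apply: nx; rewrite /kS lt_neqAle eq_sym xS /=.
by rewrite mulrA; congr (_ * _); rewrite /ind; case: (S <= x); case: (x <= z); rewrite ?mulr1 ?mulr0.
Qed.

(** Subtracting [Nf] removes from the primitive of [k0] exactly its part below S, so [X] is the
    primitive of [k0] restricted to [S, oo). Rescaling by S returns to the variable y. *)
Lemma identify s : 0 < s -> Lap (fun y => y * e T y) s =
  (1 - P.[Lap (e T) s]) * Lap (fun y => ind (1 <= y) * k0 (S * y)) s.
Proof.
move=> s0; have s1 : 0 < s / S by rewrite divr_gt0 ?S_gt0.
have [lX hX] := LX; have h := hX _ s1.
have [mk ck lk] := LkS; have LkS' := LkS.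
have lh := LT_conv (LT_heav R) LkS.
have cX : causal X by case: lX.
have [_ e1] := LT_ae (LT_meas lX) cX lh (ae_S (fun z (h : X z = conv heav kS z) => esym h) X_conv).
have kE : Lap kS (s / S) = S * Lap (fun y => ind (1 <= y) * k0 (S * y)) s.
  have lw := lk _ s1; rewrite /Lap -(proj2 (Int_scale S_gt0 lw)) -IntZ; last first.
    apply: measurable_ew; apply: measurable_funM; first exact: measurable_ind_ge.
    exact: msc.
  apply: Int_eq => y; rewrite /ew /kS.
  have -> : (S <= S * y) = (1 <= y) by rewrite -{1}[S]mulr1 ler_pM2l ?S_gt0.
  by congr (_ * (expR _ * _)); field; rewrite lt0r_neq0 ?S_gt0.
have sS : s / S * expR T = s by rewrite divfK // lt0r_neq0 // S_gt0.
have D0 := Dh_gt0 s1 TT.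
have : Ah (s / S) T = Dh (s / S) T * Lap kS (s / S).
  apply: (@mulIf _ (s / S)^-1); first by rewrite invr_eq0 lt0r_neq0.
  apply: (@mulfI _ (Dh (s / S) T)^-1); first by rewrite invr_eq0 lt0r_neq0.
  rewrite [RHS]mulrA mulKf ?lt0r_neq0 //.
  by rewrite mulrA [_^-1 * _]mulrC -h e1 (Lap_conv s1 (LT_heav R) LkS) Lap_heav // mulrC.
rewrite kE /Ah /Dh /Fh sS mulrCA => h2; apply: (@mulfI _ S); first by rewrite lt0r_neq0 ?S_gt0.
exact: h2.
Qed.

(** Up to S the image of the measure b e^r dr under the exponential has the primitive of [k0] as
    distribution function; integrating 1 / x against it recovers the integral of [b]. [layer]
    expresses both sides through distribution functions, and the maxima with 0 satisfy its sign
    condition. *)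
Lemma B_formula : L1 (fun r => ind (1 < r <= S) * k0 r / r) /\
  B T = prim k0 1 + Int (fun r => ind (1 < r <= S) * k0 r / r).
Proof.
pose h2 r := ind (1 < r <= S) * k0 r; pose u2 (r : R) := Num.max (r - 1) 0.
pose u1 r := Num.max (expR r - 1) 0 : R.
have mint : measurable_fun setT (fun r : R => 1 < r <= S).
  by apply: measurable_and; [exact: measurable_fun_ltr|exact: measurable_fun_ler].
have lh2 : L1 h2.
  apply: L1_eq (L1_indM mint (LT_loc S Lk0)) => r; rewrite /h2 /ind.
  by case: (leP r S) => rS; rewrite ?andbF ?andbT ?mul1r ?mul0r.
have mu2 : measurable_fun setT u2 by apply: measurable_maxr => //; exact: measurable_funB.
have mu1 : measurable_fun setT u1.
  by apply: measurable_maxr => //; apply: measurable_funB => //; exact: measurable_expR.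
have p1 r : 0 <= u1 r by rewrite le_max lexx orbT.
have p2 r : 0 <= u2 r by rewrite le_max lexx orbT.
have [l1 e1] := layer L1bb mu1 p1; have [l2 e2] := layer lh2 mu2 p2.
have i1 r : bb r / (1 + u1 r) = b r.
  have [/andP[r0 _]|rT] := boolP (0 <= r <= T); last by rewrite /bb b0 // !mul0r.
  rewrite /u1 (max_idPl _) ?subr_ge0 -?expR0 ?ler_expR // expR0 addrC subrK /bb mulfK //.
  by rewrite lt0r_neq0 // expR_gt0.
have i2 r : h2 r / (1 + u2 r) = ind (1 < r <= S) * k0 r / r.
  rewrite /h2; have [/andP[r1 _]|] := boolP (1 < r <= S); last by rewrite (@indF _ false) // !mul0r.
  by rewrite /u2 (max_idPl _) ?subr_ge0 ?(ltW r1) // addrC subrK.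
have lh3 : L1 (fun r => ind (1 < r <= S) * k0 r / r).
  apply: (L1_le _ (L1_abs lh2)) => [|r].
    have -> : (fun r => ind (1 < r <= S) * k0 r / r) = (fun r => h2 r / (1 + u2 r)).
      by apply/funext => r; rewrite i2.
    apply: measurable_funM; first exact: L1_meas lh2.
    have -> : (fun r => (1 + u2 r)^-1) = (fun r => wt (-1) (u2 r)).
      by apply/funext => r; rewrite wt_nneg // powR_inv1 // addr_ge0.
    exact: (measurableT_comp (measurable_wt (-1))).
  rewrite -i2 normrM -[leRHS]mulr1 ler_wpM2l // ger0_norm; last by rewrite invr_ge0 addr_ge0.
  by rewrite invf_le1 ?lerDl // ltr_pwDl.
split=> //; rewrite (Int_eq i2) in e2.
have eB : B T = Int b.
  apply: Int_eq => r; have [rT|rT] := leP r T; first by rewrite (@indT _ true) // mul1r.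
  by rewrite (@indF _ false) // mul0r b0 // negb_and -!ltNge rT orbT.
rewrite eB -(Int_eq i1) e1 e2.
have [lw iw] := powint_inf (lexx (0 : R)); rewrite addr0 invr1 in iw.
rewrite -[prim k0 1]mulr1 -[X in _ * X]iw -IntZ; last exact: L1_meas lw.
rewrite -(IntD (L1Z _ lw) l2).
apply: Int_ae; [exact: L1_meas l1|exact: L1_meas (L1D (L1Z _ lw) l2)|].
have Xs : {ae mu, forall x, 1 * x + 1 < S -> X (1 * x + 1) = 0} := ae_affine 1 (oner_neq0 _) X_lt.
apply: ae_S Xs => x; rewrite mul1r => hx; have [x0|x0] := leP 0 x; last by rewrite (@indF _ false) // !mul0r mulr0 addr0.
rewrite [prim k0 1 * _]mulrC -mulrDr; congr (_ * _).
have -> : Int (fun r => bb r * ind (u1 r <= x)) = Nf (x + 1).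
  by apply: Int_eq => r; rewrite ge_max x0 andbT lerBlDr.
have -> : Nf (x + 1) = prim k0 (Num.min (x + 1) S).
  rewrite minEle; have [Sx|xS] := leP (x + 1) S; last by rewrite Nf_const ?bb_prim // ltW.
  have [xS|xS] := ltP (x + 1) S; last by rewrite Nf_const // bb_prim (le_anti (introT andP (conj Sx xS))).
  by have := hx xS; rewrite /X prim_heav // => /eqP; rewrite subr_eq0 => /eqP.
have m1 : 1 <= Num.min (x + 1) S by rewrite le_min S_ge1 andbT lerDr.
have -> : prim k0 (Num.min (x + 1) S) = prim k0 1 + (prim k0 (Num.min (x + 1) S) - prim k0 1) by ring.
congr (_ + _); rewrite /prim -IntB; [|exact: LT_loc..].
apply: Int_eq => r; rewrite -mulrBl /h2 /u2 ge_max x0 andbT lerBlDr le_min.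
rewrite mulrAC; congr (_ * _); rewrite /ind ltNge; have [r1|r1] /= := leP r 1.
  rewrite mul0r (_ : (r <= x + 1) && (r <= S)) ?subrr //.
  by rewrite !(le_trans r1) ?S_ge1 ?lerDr.
by rewrite subr0; case: (r <= x + 1); case: (r <= S); rewrite ?mulr1 ?mulr0.
Qed.

End Identify.

End Fixed.
End Evolution.

(** * Profile of the solution *)

Section Summary.
Variable R : realType.
Implicit Types (f h phi J : R -> R) (s t x y M : R).
Local Notation mu := (@lebesgue_measure R).
Local Notation ind := (@ind R).
Local Notation conv := (@convolution R).
Local Notation heav := (@heav R).

Lemma H_wt s t f : H s f -> H (s - t) (fun x => wt t x * f x).
Proof.
move=> [mf hf]; split; first by apply: measurable_funM => //; exact: measurable_wt.
rewrite (_ : (fun x => wt (s - t) x * (wt t x * f x)) = (fun x => wt s x * f x)) //.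
by apply/funext => x; rewrite mulrA -wtD subrK.
Qed.

(** Dividing by 1 + r raises the weight exponent by one, to s + 1 > 1/2, where weighted L2 embeds in
    L1; and 1 / r <= 2 / (1 + r) for r >= 1. *)
Lemma L1_over f s : - 2^-1 < s -> H s f -> L1 (fun r : R => ind (1 <= r) * (`|f r| / r)).
Proof.
move=> s1 hf; pose k : R := -1.
have hw := H_wt k hf; have sk : 2^-1 < s - k by rewrite /k; lra.
have lw := L1_abs (H_L1' sk hw).
have mf : measurable_fun setT f by case: hf.
have mi : measurable_fun setT (fun r : R => ind (1 <= r) * (`|f r| / r)).
  have E : (fun r : R => ind (1 <= r) * (`|f r| / r)) = (fun r => ind (1 <= r) * (`|f r| * wt k (r - 1))).
    apply/funext => r; rewrite /ind; have [r1|r1] := leP 1 r; last by rewrite !mul0r.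
    by rewrite wt_nneg ?subr_ge0 // powR_inv1 addrC subrK //; apply: le_trans r1.
  rewrite E; apply: measurable_funM; first exact: measurable_ind_ge.
  apply: measurable_funM; first exact: measurableT_comp.
  by apply: L1_comp; [exact: measurable_wt|exact: measurable_funB].
apply: (L1_le mi (L1Z 2 lw)) => r; rewrite normrM ger0_norm ?ind_ge0 //.
have [r1|r1] := leP 1 r; last by rewrite (@indF _ false) // mul0r mulr_ge0.
have r0 : 0 < r := lt_le_trans ltr01 r1.
rewrite (@indT _ true) // mul1r normrM normr_id (normrM (wt k r)) (ger0_norm (wt_ge0 _ _)).
rewrite mulrA mulrC ler_wpM2r // ger0_norm ?invr_ge0 ?(ltW r0) //.
rewrite wt_nneg ?(ltW r0) // powR_inv1; last by lra.
rewrite -[2]invrK -invfM lef_pV2 ?posrE ?mulr_gt0 ?invr_gt0 //; last lra.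
lra.
Qed.

(** On y >= 1 one has 1 + y <= 2 e^(-T) (1 + e^T y), which gains e^(-2 s T) in the square; the
    change of variables gains one more e^(-T). Without the cutoff at 1 the weight would give no
    decay near 0. *)
Lemma H_scaled s g T : 0 <= s -> 0 <= T -> H s g ->
  H s (fun y => ind (1 <= y) * g (expR T * y)) /\
  n2 s (fun y => ind (1 <= y) * g (expR T * y)) <= (2 `^ s) ^+ 2 * expR (- (2 * s + 1) * T) * n2 s g.
Proof.
move=> s0 T0 [mg [_ lg]]; set gT := fun y => _.
have mgT : measurable_fun setT gT.
  by apply: measurable_funM; [exact: measurable_ind_ge|apply: L1_comp => //; exact: measurable_funM].
have eT := expR_gt0 T.
have [l i] := Int_scale eT lg.
pose K := (2 `^ s) ^+ 2 * expR (- (2 * s + 1) * T).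
have K0 : 0 <= K by rewrite mulr_ge0 ?sqr_ge0 ?expR_ge0.
have mw : measurable_fun setT (fun y => wt s y * gT y).
  by apply: measurable_funM => //; exact: measurable_wt.
have le y : (wt s y * gT y) ^+ 2 <= K * (expR T * (wt s (expR T * y) * g (expR T * y)) ^+ 2).
  rewrite /gT; have [y1|y1] := leP 1 y; last first.
    by rewrite (@indF _ false) // mul0r mulr0 expr0n /= mulr_ge0 // mulr_ge0 ?sqr_ge0 // ltW.
  rewrite (@indT _ true) // mul1r.
  have y0 : 0 <= y := le_trans ler01 y1.
  have h : wt s y <= 2 `^ s * expR (- s * T) * wt s (expR T * y).
    rewrite wt_nneg // wt_nneg ?mulr_ge0 ?(ltW eT) //.
    have -> : expR (- s * T) = expR (- T) `^ s by rewrite -expRM; congr expR; ring.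
    rewrite -powRM ?expR_ge0 // -powRM ?mulr_ge0 ?expR_ge0 ?addr_ge0 ?mulr_ge0 ?expR_ge0 //.
    apply: ge0_ler_powR => //; rewrite ?nnegrE ?mulr_ge0 ?addr_ge0 ?mulr_ge0 ?expR_ge0 //.
    rewrite mulrDr mulr1 -mulrA [expR (- T) * _]mulrA -expRD addNr expR0 mul1r.
    have := expR_ge0 (- T); lra.
  have -> : K * (expR T * (wt s (expR T * y) * g (expR T * y)) ^+ 2) =
     ((2 `^ s * expR (- s * T)) * (wt s (expR T * y) * g (expR T * y))) ^+ 2.
    rewrite [RHS]exprMn mulrA; congr (_ * _); rewrite /K [RHS]exprMn -mulrA -expRD.
    by rewrite [expR _ ^+ 2]expr2 -expRD; congr (_ * expR _); ring.
  have h2 : `|wt s y * g (expR T * y)| <= `|2 `^ s * expR (- s * T) * (wt s (expR T * y) * g (expR T * y))|.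
    rewrite mulrA !normrM ler_wpM2r // -normrM -[leRHS]normrM.
    by rewrite ger0_norm ?wt_ge0 // ger0_norm ?mulr_ge0 ?powR_ge0 ?expR_ge0 ?wt_ge0.
  by rewrite -(ger0_norm (sqr_ge0 (wt s y * _))) -[leRHS](ger0_norm (sqr_ge0 _)) !normrX lerXn2r ?nnegrE.
have lK := L1Z K l.
have lq : L1 (fun y => (wt s y * gT y) ^+ 2).
  apply: (L1_le _ lK) => [|y]; first exact: measurable_funX.
  by rewrite ger0_norm ?sqr_ge0.
split; first by split.
by apply: le_trans (Int_le lq lK le) _; rewrite IntZ ?i //; exact: L1_meas l.
Qed.

Lemma H_shift1 s f : 0 <= s -> H s f ->
  H s (fun y => f (y - 1)) /\ n2 s (fun y => f (y - 1)) <= (2 `^ s) ^+ 2 * n2 s f.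
Proof.
move=> s0 [mf [_ lf]]; set h := fun y => _.
have mh : measurable_fun setT h by apply: L1_comp => //; exact: measurable_funB.
have [l i] := L1_shift 1 lf.
have mw : measurable_fun setT (fun y => wt s y * h y).
  by apply: measurable_funM => //; exact: measurable_wt.
have le y : (wt s y * h y) ^+ 2 <= (2 `^ s) ^+ 2 * (wt s (y - 1) * f (y - 1)) ^+ 2.
  have hw : wt s y <= 2 `^ s * wt s (y - 1).
    rewrite /wt -powRM ?addr_ge0 //; apply: ge0_ler_powR => //; rewrite ?nnegrE ?mulr_ge0 ?addr_ge0 //.
    have : `|y| <= `|y - 1| + `|1| by rewrite -{1}(subrK 1 y) ler_normD.
    rewrite normr1; have := normr_ge0 (y - 1); lra.
  rewrite -exprMn mulrA.
  rewrite -(ger0_norm (sqr_ge0 (wt s y * _))) -[leRHS](ger0_norm (sqr_ge0 _)) !normrX lerXn2r ?nnegrE //.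
  rewrite !normrM ler_wpM2r // -normrM (ger0_norm (wt_ge0 _ _)) ger0_norm //.
  by rewrite mulr_ge0 ?powR_ge0 ?wt_ge0.
have lK := L1Z ((2 `^ s) ^+ 2) l.
have lq : L1 (fun y => (wt s y * h y) ^+ 2).
  apply: (L1_le _ lK) => [|y]; first exact: measurable_funX.
  by rewrite ger0_norm ?sqr_ge0.
split; first by split.
by apply: le_trans (Int_le lq lK le) _; rewrite IntZ ?i //; exact: L1_meas l.
Qed.

Lemma Int_inv S : 1 <= S -> L1 (fun r => ind (1 < r <= S) / r) /\ Int (fun r => ind (1 < r <= S) / r) <= ln S.
Proof.
move=> S1; have mi : measurable_fun setT (fun r : R => ind (1 < r <= S) / r).
  have -> : (fun r : R => ind (1 < r <= S) / r) = (fun r => ind (1 < r <= S) * wt (-1) (r - 1)).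
    apply/funext => r; rewrite /ind; have [r1|r1] := ltP 1 r; last by rewrite !mul0r.
    by rewrite wt_nneg ?subr_ge0 ?(ltW r1) // addrC subrK powR_inv1 // (le_trans _ (ltW r1)).
  apply: measurable_funM; last by apply: L1_comp; [exact: measurable_wt|exact: measurable_funB].
  by apply: measurable_ind; apply: measurable_and; [exact: measurable_fun_ltr|exact: measurable_fun_ler].
move: S1; rewrite le_eqVlt => /predU1P[<-|S1].
  have E : (fun r : R => ind (1 < r <= 1) / r) = fun=> 0.
    by apply/funext => r; rewrite indF ?mul0r //; apply/negP => /andP[a b]; have := lt_le_trans a b; rewrite ltxx.
  by rewrite E Int0 ln1; split=> //; exact: L1_0.
have [||l i] := @FTC_Int R (@ln R) (fun x => x^-1) 1 S S1.
- by move=> x /andP[x1 _]; apply: is_derive1_ln; exact: lt_le_trans x1.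
- by move=> x /andP[x1 _]; apply: inv_continuous; rewrite lt0r_neq0 // (lt_le_trans ltr01).
rewrite ln1 subr0 in i; have le r : `|ind (1 < r <= S) / r| <= ind (1 <= r <= S) * r^-1.
  have [r1|r1] := leP 1 r; last by rewrite (@indF _ (1 < r <= S)) ?mul0r ?normr0 // ltNge (ltW r1).
  have i0 : 0 <= r^-1 by rewrite invr_ge0 (le_trans ler01).
  rewrite ger0_norm ?mulr_ge0 ?ind_ge0 // ler_wpM2r // /ind ler_nat.
  by case: (r <= S); rewrite ?andbF ?andbT //; case: (1 < r).
split; first exact: L1_le l le.
rewrite -i; apply: Int_le => //; first exact: L1_le l le.
by move=> r; apply: le_trans (ler_norm _) (le r).
Qed.


Lemma sum4_le (x1 x2 x3 x4 y1 y2 y3 y4 a b : R) : a <= 2 * (x1 + x2) -> b <= 2 * (x3 + x4) ->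
  x1 <= y1 -> x2 <= y2 -> x3 <= y3 -> x4 <= y4 -> 2 * (a + b) <= 4 * (y1 + y2 + y3 + y4).
Proof. lra. Qed.

(** The primitive of [g] at l y is split at l: the part below is a number, which joins the constant
    [d], and the part above is l times the primitive of the rescaled [gl]. *)
Lemma kappa_split (g : R -> R) (c d l y : R) : L1 g -> 0 < l ->
  let gl := fun y => ind (1 <= y) * g (l * y) in
  ind (1 <= y) * (d * heav (l * y) + (g (l * y) + c * conv heav g (l * y))) =
  (d + c * prim g l) * heav (y - 1) + (gl y + c * l * conv heav gl y).
Proof.
move=> lg l0 gl; have mg := L1_meas lg.
have mgl : measurable_fun setT gl.
  apply: measurable_funM; first exact: measurable_ind_ge.
  by apply: (L1_comp mg); apply: measurable_funM.
rewrite !prim_heav // /heav subr_ge0; have [y1|y1] := leP 1 y; last first.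
  rewrite (@indF _ false) // !mul0r !mulr0 add0r /gl indF -?ltNge // mul0r add0r.
  rewrite /prim (@Int_eq _ _ (fun=> 0)) ?Int0 ?mulr0 // => x.
  have [xy|xy] := leP x y; last by rewrite (@indF _ false) // mul0r.
  by rewrite [X in _ * (X * _)]indF ?mul0r ?mulr0 // -ltNge (le_lt_trans xy).
rewrite (@indT _ true) // mul1r !mulr1 /gl y1 (@indT _ true) // mul1r.
rewrite indT ?mulr1; last by rewrite mulr_ge0 ?(ltW l0) // (le_trans ler01).
have ly : l <= l * y by rewrite ler_peMr // ltW.
have [lk ek] := prim_diff lg ly; have [_ es] := Int_scale l0 lk.
suff -> : prim g (l * y) = prim g l + l * prim gl y by ring.
apply/eqP; rewrite addrC -subr_eq ek -es; apply/eqP; rewrite /prim -IntZ; last first.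
  by apply: measurable_funM => //; exact: measurable_ind_le.
apply: Int_ae.
- apply: measurable_funM => //; apply: (@L1_comp R (fun z => ind (l < z <= l * y) * g z)); first exact: L1_meas.
  by apply: measurable_funM.
- by apply: measurable_funM => //; apply: measurable_funM => //; exact: measurable_ind_le.
apply: ae_S (ae_neq 1) => x x1; rewrite ltr_pMr // ler_pM2l // /gl lt_neqAle eq_sym x1 /=.
by case: (1 <= x); case: (x <= y); rewrite /= ?(@indT _ true) ?(@indF _ false) ?mul1r ?mul0r.
Qed.

Section Solution.
Variables (N : nat) (p : nat -> R) (gam : R).
Hypotheses (hp0 : forall j : nat, (1 <= j <= N)%N -> 0 <= p j) (hp1 : \sum_(1 <= j < N.+1) p j = 1).
Hypothesis hgam : 3 / 2 < gam.
Local Notation Q := (Qconv N p).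
Local Notation P := (Qpoly N p).
Local Notation q := (qmean N p).
Variables (eta : R -> R -> R) (eta0 : R -> R) (beta : R -> R).
Hypothesis hP : forall t, 0 <= t -> inP (eta t).
Hypothesis h0P : inP eta0.
Hypothesis hbeta : forall T : R, mu.-integrable `[0, T] (EFin \o beta).
Hypothesis hsol : forall tau : R, 0 <= tau ->
  exists2 J : R -> R,
   is_bochner_integral `[0, tau]%classic
     (fun s y => beta s * Sop (tau - s) (T1op (Q (eta s))) y) J &
   {ae mu, forall y : R, 1 <= y -> eta tau y = Sop tau eta0 y + J y}.
Hypothesis hH : forall t, 0 <= t -> H gam (rep (eta t)).
Local Notation e t := (rep (eta t)).

Lemma q_ge1 : 1 <= q. Proof. exact: qmean_ge1 hp0 hp1. Qed.
Lemma q_gt0 : 0 < q. Proof. exact: lt_le_trans ltr01 q_ge1. Qed.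

Lemma Le t : 0 <= t -> L1 (e t). Proof. by move=> /hP /inP_rep[]. Qed.
Lemma Inte t : 0 <= t -> Int (e t) = 1. Proof. by move=> /hP /inP_rep[]. Qed.
Lemma Lxe t : 0 <= t -> L1 (fun x => x * e t x). Proof. by move=> /hH; exact: L1_mulx. Qed.
Lemma n1e t : 0 <= t -> n1 (e t) <= 1.
Proof.
by move=> t0; rewrite /n1 (@Int_eq _ _ (e t)) ?Inte // => x; rewrite ger0_norm // rep_ge0.
Qed.

(** [renewal] is applied to Q[e 0], whose mean is q times that of e 0. Since Int g = 0, the term
    heav convolved with g is minus the tail of g and decays, so the renewal function is 1 / q plus a
    remainder. The first moment is bounded uniformly in time along the way, because the absorption
    arguments below start from it. *)
Lemma evolution : exists c g Cm, [/\ L1 g, causal g, H (gam - 1) g, Int g = 0 & forall T, 0 <= T ->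
  Int (fun x => x * e T x) <= Cm /\ forall s, 0 < s ->
  Lap (fun y => y * e T y) s = (1 - P.[Lap (e T) s]) *
    Lap (fun y => ind (1 <= y) * (q^-1 * heav (expR T * y) + (g (expR T * y) + c * conv heav g (expR T * y)))) s].
Proof.
have z0 : (0 : R) <= 0 := lexx 0.
have l0 := Le z0; have v0 := @vanish_rep _ (eta 0).
have q0 := q_gt0.
have [lxQ iQ] := Int_mulx_Q N p l0 v0 (Lxe z0) (Inte z0).
have hgam' := hgam; have gam0 : 0 <= gam by lra.
have [K K0 hK] := H_Q hp0 hp1 gam0.
have [hQ _] := hK _ l0 v0 (n1e z0) (hH z0).
have lQ := L1_Q N p l0 v0; have vQ := vanish_Q N p v0.
have Q0 := Q_ge0 hp0 v0 (@rep_ge0 _ (eta 0)).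
have IQ : Int (Q (e 0)) = 1 by rewrite Int_Q // Inte // P1.
have ca : causal (fun x => x * e 0 x) by move=> x x0; rewrite v0 ?mulr0 //; lra.
have ha : H (gam - 1) (fun x => x * e 0 x).
  by apply: (proj1 (H_mulx _)); rewrite subrK; exact: hH.
have [c [g [c0 lg cg hg [Ig hren]]]] := renewal hgam lQ Q0 vQ IQ hQ (Lxe z0) ca ha q0 iQ.
have mg := L1_meas lg.
pose w x := g x + c * conv heav g x.
pose k0 x := q^-1 * heav x + w x.
have Lg := L1_LT cg lg; have Lh := LT_heav R; have Lhg := LT_conv Lh Lg.
have Lw : LT w by apply: LT_D => //; exact: LT_Z.
have Lk0 : LT k0 by apply: LT_D => //; exact: LT_Z.
have hk0 s : 0 < s -> Lap k0 s * (1 - P.[Lap (e 0) s]) = Lap (fun x => x * e 0 x) s.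
  move=> s0; rewrite -hren // Lap_Q //; congr (_ * _).
  rewrite (Lap_D s0 (LT_Z _ Lh) Lw) Lap_Z // Lap_heav // (Lap_D s0 Lg (LT_Z _ Lhg)) Lap_Z // Lap_conv // Lap_heav //.
  by rewrite invfM; ring.
have cw r : 0 <= r -> conv heav g r = - ctail g r.
  move=> r0; rewrite ctailE // Ig mul0r sub0r opprK //.
(* The remainder is w = g - c ctail g, with g of weight gam - 1 and its tail of weight gam - 2; the
   latter exceeds - 1/2 exactly because gam > 3/2. *)
have ow : L1 (fun r : R => ind (1 <= r) * (`|w r| / r)).
  have hg2 : H (gam - 2) (ctail g).
    by apply: H_ctail; [lra|rewrite (_ : gam - 2 + 1 = gam - 1) //; ring].
  have s2 : - 2^-1 < gam - 2 by lra.
  have s1 : - 2^-1 < gam - 1 by lra.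
  have o1 := L1_over s1 hg; have o2 := L1_over s2 hg2.
  have ml : measurable_fun setT (fun r : R => ind (1 <= r) * (`|w r| / r)).
    have E : (fun r : R => ind (1 <= r) * (`|w r| / r)) = (fun r => ind (1 <= r) * (`|w r| * wt (-1) (r - 1))).
      apply/funext => r; rewrite /ind; have [r1|r1] := leP 1 r; last by rewrite !mul0r.
      by rewrite wt_nneg ?subr_ge0 // powR_inv1 addrC subrK //; apply: le_trans r1.
    rewrite E; apply: measurable_funM; first exact: measurable_ind_ge.
    apply: measurable_funM; first by apply: measurableT_comp => //; exact: LT_meas.
    by apply: L1_comp; [exact: measurable_wt|exact: measurable_funB].
  apply: (L1_le ml (L1D o1 (L1Z `|c| o2))) => r.
  have [r1|r1] := leP 1 r; last by rewrite (@indF _ false) // !mul0r mulr0 normr0 addr0.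
  have r0 : 0 <= r := le_trans ler01 r1; have i0 : 0 <= r^-1 by rewrite invr_ge0.
  rewrite (@indT _ true) // !mul1r normrM normr_id (ger0_norm i0) mulrA -mulrDl ler_wpM2r //.
  by rewrite /w cw // (le_trans (ler_normD _ _)) // normrM normrN.
pose Cw := Int (fun r : R => ind (1 <= r) * (`|w r| / r)).
pose m0 := Int (fun x => x * e 0 x).
have m00 : 0 <= m0.
  apply: Int_ge0 => x; have [x0|x0] := leP 0 x; first by rewrite mulr_ge0 // rep_ge0.
  by rewrite ca.
exists c, g, (m0 * expR (q * (`|prim k0 1| + Cw))); split=> // T T0.
have hb := L1_bT hbeta T.
have b0 r : ~~ (0 <= r <= T) -> bT beta T r = 0 by move=> h; rewrite /bT indF ?mul0r.
have le t : 0 <= t <= T -> L1 (e t) by case/andP => t0 _; exact: Le.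
have lxe t : 0 <= t <= T -> L1 (fun x => x * e t x) by case/andP => t0 _; exact: Lxe.
have Ie t : 0 <= t <= T -> Int (e t) = 1 by case/andP => t0 _; exact: Inte.
have ve t : vanish 1 (e t) by exact: vanish_rep.
have e0 t x : 0 <= e t x by exact: rep_ge0.
have WI := @weak_incr R N p eta eta0 beta hP h0P hbeta hsol T.
have hS : 1 <= expR T by rewrite -expR0 ler_expR.
split.
  have mb := mean_bound hp0 hp1 T0 hb b0 le lxe ve e0 Ie WI.
  have [lB eB] := B_formula hp0 hp1 T0 hb b0 le lxe ve e0 Ie WI Lk0 hk0.
  have [li ii] := Int_inv hS; rewrite expRK in ii.
  (* The constant 1 / q in [k0] contributes ln(e^T) / q = T / q. Hence exp(q B(T)) exceeds e^T only
     by a constant factor, and [mean_bound] yields a mean independent of T. *)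
  have BT : prim (bT beta T) T <= `|prim k0 1| + Cw + T / q.
    rewrite eB -addrA; apply: lerD; first exact: ler_norm.
    have lr : L1 (fun r : R => ind (1 <= r) * (`|w r| / r) + q^-1 * (ind (1 < r <= expR T) / r)).
      by apply: L1D => //; exact: L1Z.
    have le1 (r : R) : ind (1 < r <= expR T) * k0 r / r <= ind (1 <= r) * (`|w r| / r) + q^-1 * (ind (1 < r <= expR T) / r).
      have [r1|r1] := ltP 1 r; last first.
        rewrite (@indF _ (false && _)) // !mul0r mulr0 addr0.
        have [r2|r2] := leP 1 r; last by rewrite (@indF _ false) // mul0r.
        by rewrite mulr_ge0 ?ind_ge0 // divr_ge0 // (le_trans ler01 r2).
      have r0 : 0 <= r by rewrite (le_trans ler01 (ltW r1)).
      rewrite (ltW r1) (@indT _ true) // mul1r /=.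
      have [rS|rS] := leP r (expR T); last by rewrite (@indF _ false) // !mul0r mulr0 addr0 divr_ge0.
      rewrite (@indT _ true) // mul1r /k0 /heav indT // mulr1 mulrDl addrC div1r lerD2r.
      by rewrite ler_wpM2r ?invr_ge0 // ler_norm.
    apply: le_trans (Int_le lB lr le1) _; rewrite IntD //; last exact: L1Z.
    rewrite IntZ; last exact: L1_meas.
    by rewrite lerD2l mulrC ler_wpM2r // invr_ge0 ltW.
  rewrite -(ler_pM2r (expR_gt0 T)); apply: (le_trans mb).
  rewrite -mulrA ler_wpM2l // -expRD ler_expR.
  apply: le_trans (_ : q * (`|prim k0 1| + Cw + T / q) <= _); first by rewrite ler_pM2l.
  by rewrite mulrDr (mulrC q (T / q)) divfK // lt0r_neq0.
move=> s s0.
by have := identify hp0 hp1 T0 hb b0 le lxe ve e0 Ie WI Lk0 hk0 s0.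
Qed.

Lemma H_conv2 s f g F1 F2 G1 G2 : 0 <= s -> L1 f -> L1 g -> H s f -> H s g ->
  n1 g ^+ 2 * n2 s f <= F1 * F2 -> n1 f ^+ 2 * n2 s g <= G1 * G2 ->
  H s (conv f g) /\ n2 s (conv f g) <= 2 * (2 `^ s) ^+ 2 * (F1 * F2 + G1 * G2).
Proof.
move=> s0 lf lg hf hg h1 h2; have [h n] := H_conv s0 lf lg hf hg; split=> //.
by apply: le_trans n _; rewrite ler_wpM2l ?lerD // mulr_ge0 ?sqr_ge0.
Qed.

(** Inserting [kappa_split] into the identity of [evolution], the constant 1 / q gives the
    self-similar term and everything built from [g] goes into [f]. Only convolutions with rho = Q[u]
    and its tail occur, so [f] is bounded linearly in [n2 gam (e T)]. *)
Lemma profile : exists C Cm, [/\ 0 <= C, 0 <= Cm & forall T, 0 <= T -> Int (fun x => x * e T x) <= Cm /\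
  exists f, [/\ vanish 1 f, H (gam - 1) f,
   n2 (gam - 1) f <= C * expR (- (2 * gam - 3) * T) * (1 + n2 gam (e T)) &
   {ae mu, forall y, y * e T y = q^-1 * ctail (Q (e T)) (y - 1) + f y}]].
Proof.
have [c [g [Cm [lg cg hg Ig hT]]]] := evolution.
have hgam' := hgam; have q0 := q_gt0; pose s := gam - 1.
have s0 : 0 <= s by rewrite /s; lra.
have sh : 2^-1 < s by rewrite /s; lra.
have sh' : - 2^-1 < s by lra.
have gam0 : 0 <= gam by lra.
have s1 : s + 1 = gam by rewrite /s subrK.
have sgam : s <= gam by rewrite /s; lra.
have a0 : 0 <= 2 * gam - 3 by lra.
have [KQ KQ0 hQ] := H_Q hp0 hp1 gam0.
have [CH CH0 hH1] := hardy sh'; have [CL CL0 hL] := H_L1 sh; have [CT CT0 hTb] := tail_bound sh.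
have Cm0 : 0 <= Cm.
  apply: le_trans (proj1 (hT 0 (lexx 0))); apply: Int_ge0 => x.
  have [x1|/vanish_rep ->] := leP 1 x; last by rewrite mulr0.
  by rewrite mulr_ge0 ?rep_ge0 // (le_trans ler01).
have [two [two0 twoE]] : exists two : R, 0 <= two /\ (2 `^ s) ^+ 2 = two.
  by exists ((2 `^ s) ^+ 2); split=> //; exact: sqr_ge0.
have [c2 [c20 c2E]] : exists c2 : R, 0 <= c2 /\ c ^+ 2 = c2.
  by exists (c ^+ 2); split=> //; exact: sqr_ge0.
have [m2 [m20 m2E]] : exists m2 : R, 0 <= m2 /\ (q * Cm) ^+ 2 = m2.
  by exists ((q * Cm) ^+ 2); split=> //; exact: sqr_ge0.
pose B0 := n2 s g; have B00 : 0 <= B0 := n2_ge0 _ _.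
pose A := two * B0; have A0 : 0 <= A by rewrite mulr_ge0.
pose C1 := A.
pose C2 := 2 * two * (CL * A * KQ + A).
pose C3 := c2 * (CT * B0) * (two * (CH * KQ)).
pose C4 := c2 * (2 * two * (CL * A * (CH * KQ) + m2 * A)).
have C20 : 0 <= C2 by rewrite mulr_ge0 ?mulr_ge0 // addr_ge0 // !mulr_ge0.
have C30 : 0 <= C3 by rewrite !mulr_ge0.
have C40 : 0 <= C4 by rewrite mulr_ge0 // mulr_ge0 ?mulr_ge0 // addr_ge0 // !mulr_ge0.
exists (4 * (C1 + C2 + C3 + C4)), Cm; split=> //; first by rewrite mulr_ge0 // !addr_ge0.
move=> T T0; have [hm hL0] := hT T T0; split=> //.
pose M := n2 gam (e T); have M0 : 0 <= M := n2_ge0 _ _.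
pose E := expR (- (2 * gam - 3) * T); have E0 : 0 <= E := expR_ge0 _.
pose lam := expR T; have lam0 : 0 < lam := expR_gt0 _.
have mg := L1_meas lg.
pose gT y := ind (1 <= y) * g (lam * y).
have [hgT ngT] := H_scaled s0 T0 hg; rewrite -/gT -/lam twoE in hgT ngT.
have lgT : L1 gT := H_L1' sh hgT.
have vgT : vanish 1 gT by move=> y y1; rewrite /gT indF ?mul0r // -ltNge.
have LgT : LT gT := LT_vanish lgT vgT.
pose GT := prim g lam.
pose rho := Q (e T); have le := Le T0; have ve := @vanish_rep _ (eta T).
have [hr nr] : H gam rho /\ n2 gam rho <= KQ * M by apply: hQ => //; [exact: n1e|exact: hH].
have lr : L1 rho by exact: L1_Q.
have vr : vanish 1 rho by exact: vanish_Q.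
have r0 : forall x, 0 <= rho x by apply: (Q_ge0 hp0 ve); exact: rep_ge0.
have Ir : Int rho = 1 by rewrite Int_Q // Inte // P1.
have Lr := LT_vanish lr vr; have cr : causal rho by exact: vanish_causal ler01 vr.
have [lxr ixr] := Int_mulx_Q N p le ve (Lxe T0) (Inte T0).
have [lcr icr] := Int_ctail lr cr lxr.
have ccr := @causal_ctail _ rho.
have Lcr := L1_LT ccr lcr.
have [hcr ncr] : H s (ctail rho) /\ n2 s (ctail rho) <= CH * n2 gam rho.
  by rewrite -s1; apply: hH1; rewrite s1.
(* The slowest terms carry a factor e^T from the rescaled primitive. Squared, it turns the exponent
   2 s + 1 of [H_scaled] into 2 s - 1 = 2 gam - 3. *)
have lamT : expR T ^+ 2 * expR (- (2 * s + 1) * T) = E.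
  by rewrite expr2 -!expRD; congr expR; rewrite /s; ring.
have Eh : expR (- (2 * s + 1) * T) <= E.
  by rewrite ler_expR ler_wpM2r // /s; lra.
have n2gT : n2 s gT <= A * E.
  apply: le_trans ngT _; rewrite -/B0 /A mulrAC -!mulrA ler_wpM2l // ler_wpM2l //.
have lgTn : lam ^+ 2 * n2 s gT <= A * E.
  apply: (le_trans (ler_wpM2l (sqr_ge0 _) ngT)); rewrite -/B0.
  by rewrite -lamT /A /lam le_eqVlt; apply/orP; left; apply/eqP; ring.
have [_ n1gT] := hL _ hgT.
have n1gT' : n1 gT ^+ 2 <= CL * A * E.
  by apply: le_trans n1gT _; rewrite -mulrA ler_wpM2l.
have ln1gT : lam ^+ 2 * n1 gT ^+ 2 <= CL * A * E.
  apply: (le_trans (ler_wpM2l (sqr_ge0 _) n1gT)); rewrite mulrCA -[CL * A * E]mulrA ler_wpM2l //.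
(* Int g = 0 converts the partial integral up to e^T into a tail, which decays by [tail_bound]. *)
have GTE : GT = - tail g lam by rewrite tail_split // Ig sub0r opprK.
have GT2 : GT ^+ 2 <= CT * B0 * E.
  have [_ _ t1] := hTb g lam (ltW lam0) hg.
  rewrite GTE sqrrN; have t2 := tail_abs lam lg.
  apply: le_trans (_ : tail (fun x => `|g x|) lam ^+ 2 <= _).
    by rewrite -(ger0_norm (sqr_ge0 (tail g lam))) normrX lerXn2r ?nnegrE // (le_trans _ t2).
  apply: le_trans t1 _; rewrite -[leRHS]mulrA [B0 * E]mulrC mulrA; apply: ler_pM.
  - by rewrite mulr_ge0 ?wt_ge0.
  - by apply: Int_ge0 => x; rewrite mulr_ge0 ?ind_ge0 ?sqr_ge0.
  - rewrite ler_wpM2l // wt_nneg ?(ltW lam0) //.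
    have -> : 1 - (s + s) = - (2 * gam - 3) by rewrite /s; ring.
    rewrite /E [- (2 * gam - 3) * T]mulrC expRM -/lam !powRN.
    rewrite lef_pV2 ?posrE ?powR_gt0 //; last by rewrite addr_gt0.
    by apply: ge0_ler_powR => //; rewrite ?nnegrE ?addr_ge0 ?(ltW lam0) ?lerDr.
  - have [_ [_ lB]] := hg; apply: Int_le => //.
      by apply: L1_indM => //; apply: measurable_fun_ltr.
    by move=> x; apply: le_trans (ler_norm _) _; apply: le_trans (indM_norm _ _) _; rewrite ger0_norm ?sqr_ge0.
pose F1 y := ctail rho (y - 1).
have [hF1 nF1] := H_shift1 s0 hcr; rewrite -/F1 twoE in hF1 nF1.
have nrs : n2 s rho <= KQ * M.
  by apply: le_trans nr; exact: (proj2 (H_mono sgam hr)).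
have hrs : H s rho := proj1 (H_mono sgam hr).
have ncr' : n2 s (ctail rho) <= CH * KQ * M.
  by rewrite -mulrA; exact: (le_trans ncr (ler_wpM2l CH0 nr)).
have n1r : n1 rho = 1 by rewrite -Ir; apply: Int_eq => x; rewrite ger0_norm.
have n1cr : n1 (ctail rho) <= q * Cm.
  rewrite /n1 (@Int_eq _ _ (ctail rho)) => [|x]; last by rewrite ger0_norm // mulr_ge0 ?ind_ge0 ?tail_ge0.
  by rewrite icr ixr ler_pM2l.
have n1cr2 : n1 (ctail rho) ^+ 2 <= m2.
  by rewrite -m2E lerXn2r ?nnegrE ?n1_ge0 // mulr_ge0 // ltW.
have [h2 b2] : H s (conv rho gT) /\ n2 s (conv rho gT) <= 2 * two * (CL * A * E * (KQ * M) + 1 * (A * E)).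
  rewrite -twoE; apply: H_conv2 => //; first by apply: ler_pM; rewrite ?sqr_ge0 ?n2_ge0.
  by rewrite n1r expr1n !mul1r.
have [h4 b4] := H_conv s0 lcr lgT hcr hgT.
have b4' : lam ^+ 2 * n2 s (conv (ctail rho) gT) <=
    2 * two * (CL * A * E * (CH * KQ * M) + m2 * (A * E)).
  apply: le_trans (ler_wpM2l (sqr_ge0 _) b4) _; rewrite mulrCA twoE ler_wpM2l ?mulr_ge0 //.
  rewrite mulrDr; apply: lerD.
    rewrite (mulrA (lam ^+ 2)); apply: ler_pM => //; last exact: n2_ge0.
    by apply: mulr_ge0; exact: sqr_ge0.
  rewrite (mulrCA (lam ^+ 2)); apply: ler_pM => //; first exact: sqr_ge0.
  by apply: mulr_ge0; [exact: sqr_ge0|exact: n2_ge0].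
have [h2N n2N] := HZ (-1) h2.
have [h3 n3] := HZ (c * GT) hF1; have [h4' n4] := HZ (c * lam) h4.
have [h12 n12] := HD hgT h2N; have [h34 n34] := HD h3 h4'; have [hf nf] := HD h12 h34.
(* This is the kernel of [kappa_split], without its part 1 / q, multiplied by 1 - Lap rho: since Int
   rho = 1, the factor turns a Heaviside function into [ctail rho], shifted by 1 in the term with
   [GT]. *)
pose f y := gT y + -1 * conv rho gT y + (c * GT * F1 y + c * lam * conv (ctail rho) gT y).
have LF1 : LT F1 by case: (Lap_shift 1 (ler01) Lcr).
have L2 := LT_conv Lr LgT; have L4 := LT_conv Lcr LgT.
have Lf12 : LT (fun y => gT y + -1 * conv rho gT y) by apply: LT_D => //; exact: LT_Z.
have Lf34 : LT (fun y => c * GT * F1 y + c * lam * conv (ctail rho) gT y).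
  by apply: LT_D; exact: LT_Z.
have Lf : LT f by apply: LT_D.
exists f; split=> //.
- move=> y y1; rewrite /f vgT // (vanish_conv cr vgT) ?add0r // (vanish_conv ccr vgT) ?add0r //.
  by rewrite /F1 ccr ?mulr0 ?addr0 // subr_lt0.
- apply: le_trans nf _.
  have k1 : n2 s gT <= C1 * E * (1 + M).
    apply: le_trans n2gT _; rewrite -[leLHS]mulr1 ler_wpM2l ?mulr_ge0 // lerDl //.
  have k2 : n2 s (fun x => -1 * conv rho gT x) <= C2 * E * (1 + M).
    rewrite n2N sqrrN expr1n mul1r; apply: le_trans b2 _.
    rewrite -[leLHS]addr0 -[leRHS](_ : 2 * two * (CL * A * E * (KQ * M) + 1 * (A * E)) + 2 * two * (CL * A * KQ * E + A * E * M) = _).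
      by rewrite lerD2l !mulr_ge0 // addr_ge0 // !mulr_ge0.
    by rewrite /C2; ring.
  have k3 : n2 s (fun x => c * GT * F1 x) <= C3 * E * (1 + M).
    rewrite n3 exprMn c2E; apply: le_trans (_ : c2 * (CT * B0 * E) * (two * (CH * KQ * M)) <= _).
      apply: (@ler_pM _ (c2 * GT ^+ 2)).
      - by apply: mulr_ge0 => //; exact: sqr_ge0.
      - exact: n2_ge0.
      - exact: ler_wpM2l.
      by apply: le_trans nF1 _; rewrite ler_wpM2l.
    have -> : c2 * (CT * B0 * E) * (two * (CH * KQ * M)) = C3 * E * M by rewrite /C3; ring.
    by apply: ler_wpM2l; [exact: mulr_ge0|rewrite lerDr].
  have k4 : n2 s (fun x => c * lam * conv (ctail rho) gT x) <= C4 * E * (1 + M).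
    rewrite n4 exprMn c2E -(mulrA c2); apply: le_trans (ler_wpM2l c20 b4') _.
    rewrite -[leLHS]addr0 -[leRHS](_ : c2 * (2 * two * (CL * A * E * (CH * KQ * M) + m2 * (A * E))) +
      c2 * (2 * two * (CL * A * E * (CH * KQ) + m2 * (A * E) * M)) = _); last by rewrite /C4; ring.
    by rewrite lerD2l; apply: mulr_ge0 => //; apply: mulr_ge0; [exact: mulr_ge0|rewrite addr_ge0 // !mulr_ge0].
  have -> : 4 * (C1 + C2 + C3 + C4) * expR (- (2 * gam - 3) * T) * (1 + n2 gam (e T)) =
     4 * (C1 * E * (1 + M) + C2 * E * (1 + M) + C3 * E * (1 + M) + C4 * E * (1 + M)) by rewrite /E /M; ring.
  exact: (sum4_le n12 n34 k1 k2 k3 k4).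
pose rhs y := q^-1 * F1 y + f y.
have Lrhs : LT rhs by apply: LT_D => //; exact: LT_Z.
have Lye : LT (fun y => y * e T y).
  apply: L1_LT; last exact: Lxe.
  by move=> y y0; rewrite ve ?mulr0 // (lt_trans y0).
apply: (Lap_inj2 Lye Lrhs) => sg sg0; rewrite hL0 //.
have Lh := LT_heav R; have Lhg := LT_conv Lh LgT.
have [Lh1 eh1] := Lap_shift sg ler01 Lh.
have kE : (fun y => ind (1 <= y) * (q^-1 * heav (expR T * y) + (g (expR T * y) + c * conv heav g (expR T * y)))) =
   (fun y => (q^-1 + c * GT) * heav (y - 1) + (gT y + c * lam * conv heav gT y)).
  by apply/funext => y; exact: (kappa_split c q^-1 y lg lam0).
rewrite kE /rhs /f.
have LZ1 := LT_Z (q^-1 + c * GT) Lh1; have LZ2 := LT_Z (c * lam) Lhg.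
have LZ3 := LT_Z (-1) L2; have LZ4 := LT_Z (c * GT) LF1; have LZ5 := LT_Z (c * lam) L4.
have LZ6 := LT_Z q^-1 LF1.
have [_ eF1] := Lap_shift sg ler01 Lcr.
rewrite (Lap_D sg0 LZ1 (LT_D LgT LZ2)) (Lap_D sg0 LgT LZ2) (Lap_D sg0 LZ6 Lf) (Lap_D sg0 Lf12 Lf34).
rewrite (Lap_D sg0 LgT LZ3) (Lap_D sg0 LZ4 LZ5) (Lap_Z _ _ Lh1) (Lap_Z _ _ LF1) (Lap_Z _ _ L2) (Lap_Z _ _ Lhg) (Lap_Z _ _ L4) (Lap_Z _ _ LF1).
rewrite (Lap_conv sg0 Lr LgT) (Lap_conv sg0 Lh LgT) (Lap_conv sg0 Lcr LgT) (eh1 sg0) (eF1 sg0) (Lap_heav sg0) (Lap_ctail sg0 lr cr) Ir.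
rewrite -(Lap_Q N p le ve sg0) -/rho; by field; rewrite !lt0r_neq0.
Qed.

End Solution.
End Summary.

(** * Absolute continuity and the self-similar profile *)

Section AbsoluteContinuity.
Variable R : realType.
Implicit Types (f g h G : R -> R) (a b c e s t x y : R).
Local Notation mu := (@lebesgue_measure R).
Local Notation ind := (@ind R).

(** Outer regularity encloses the exceptional null set in an open set of small measure; splitting
    |h| at a high level makes its integral over that open set small as well. *)
Lemma null_open (P : R -> Prop) h e : {ae mu, forall x, P x} -> L1 h -> 0 < e ->
  exists U : set R, [/\ open U, forall x, ~ P x -> U x, L1 (\1_U : R -> R),
    Int (\1_U : R -> R) <= e & Int (fun x => \1_U x * `|h x|) <= e].
Proof.
move=> [A [mA A0 PA]] lh e0; have e2 : 0 < e / 2 by rewrite divr_gt0.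
have [n [lx ix]] := L1_excess lh e2.
pose d := Num.min e (e / 2 / n.+1%:R).
have d0 : 0 < d by rewrite lt_min e0 divr_gt0.
have [|U [oU AU mU]] := @lebesgue_regularity_outer R A d mA _ d0; first by apply: (@le_lt_trans _ _ 0%E); [rewrite le_eqVlt; apply/orP; left; apply/eqP|exact: ltry].
have mUd : (mu U < d%:E)%E.
  rewrite -(setDUK AU) measureU //; [|exact: measurableD (open_measurable oU) mA|exact: setDIK].
  by rewrite [X in (X + _)%E](_ : _ = 0%E) ?add0e //; exact: A0.
have [lU iU] := Int_indic (open_measurable oU) (lt_trans mUd (ltry _)).
have iUd : Int (\1_U : R -> R) <= d.
  rewrite iU -lee_fin fineK ?(ltW mUd) // ge0_fin_numE //; exact: lt_trans mUd (ltry _).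
exists U; split=> //.
- by move=> x nP; apply/AU/PA.
- by apply: le_trans iUd _; rewrite ge_min lexx.
have mh := L1_meas lh.
apply: le_trans (_ : Int (fun x => n.+1%:R * \1_U x + Num.max (`|h x| - n.+1%:R) 0) <= _).
  apply: Int_le; [|by apply: L1D => //; exact: L1Z|].
    apply: (L1_le _ (L1_abs lh)) => [|x].
      by apply: measurable_funM; [exact: L1_meas|exact: measurableT_comp].
    by rewrite indicE normrM normr_id; case: (x \in U); rewrite /= ?normr0 ?normr1 ?mul0r ?mul1r.
  move=> x; rewrite indicE; case: (x \in U); rewrite /= ?mul1r ?mul0r ?mulr1 ?mulr0 ?add0r.
    by rewrite -lerBlDl le_max lexx.
  by rewrite le_max lexx orbT.
rewrite IntD // ?IntZ; [|exact: L1_meas|exact: L1Z].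
have : n.+1%:R * Int (\1_U : R -> R) <= e / 2.
  by rewrite mulrC -ler_pdivlMr //; apply: le_trans iUd _; rewrite ge_min lexx orbT.
lra.
Qed.

Lemma null_deriv_straddle G t e : derivable G t 1 -> 'D_1 G t = 0 -> 0 < e ->
  exists2 d, 0 < d & forall z, `|z - t| <= d -> `|G z - G t| <= e * `|z - t|.
Proof.
move=> dG G0 e0; have := dG; rewrite /derivable => /cvg_ex[l cl].
have l0 : l = 0 by rewrite -G0; apply/esym/cvg_lim => //; exact: cl.
move: cl; rewrite l0 => /cvgr0Pnorm_le /(_ _ e0) /nbhs_ballP[d /= d0 hd].
exists (d / 2) => [|z zt]; first by rewrite divr_gt0.
have [->|zt0] := eqVneq z t; first by rewrite !subrr normr0 mulr0.
have zt1 : z - t != 0 by rewrite subr_eq0.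
have := hd (z - t); rewrite /ball /= sub0r normrN => /(_ _ zt1).
rewrite /GRing.scale /= mulr1 subrK normrM normfV ler_pdivrMl ?normr_gt0 // mulrC; apply.
by apply: le_lt_trans zt _; rewrite ltr_pdivrMr // ltr_pMr // ltrDl.
Qed.

(** Around an exceptional point a short interval stays inside the open set of [null_open], and the
    increment of [G] is charged to [f] and [h] there; elsewhere the derivative is 0. [cousin]
    assembles a partition: the exceptional intervals have total length below the modulus of absolute
    continuity of [f], so all charges are small. *)
Lemma ac_null_deriv a b f h G L : a <= b -> abs_continuous_on a b f -> L1 h -> 0 <= L ->
  (forall x y, a <= x -> x <= y -> y <= b ->
    `|G y - G x| <= L * `|f y - f x| + Int (fun z => ind (x < z <= y) * `|h z|)) ->
  {ae mu, forall y, a < y < b -> derivable G y 1 /\ 'D_1 G y = 0} -> G b = G a.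
Proof.
move=> ab acf lh L0 hG hd; apply/eqP; rewrite -subr_eq0 -normr_le0; apply/ler_addgt0Pr => e e0.
rewrite add0r; pose e1 := e / (b - a + L + 2).
have c0 : 0 < b - a + L + 2 by lra.
have e10 : 0 < e1 by rewrite divr_gt0.
have [d d0 ac] := acf e1 e10.
pose r := Num.min e1 (d / 2); have r0 : 0 < r by rewrite lt_min e10 divr_gt0.
(* The endpoints are added to the exceptional set, because the derivative is controlled on the open
   interval only. *)
have [U [oU bU lU iU iUh]] := null_open (ae_I hd (ae_I (ae_neq a) (ae_neq b))) lh r0.
pose V := prim (\1_U : R -> R); pose W := prim (fun z => \1_U z * `|h z|).
have lUh : L1 (fun z => \1_U z * `|h z|).
  apply: (L1_le _ (L1_abs lh)) => [|x].
    by apply: measurable_funM; [exact: L1_meas|apply: measurableT_comp => //; exact: L1_meas].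
  by rewrite indicE normrM normr_id; case: (x \in U); rewrite /= ?normr0 ?normr1 ?mul0r ?mul1r.
have U0 z : 0 <= \1_U z :> R by rewrite indicE ler0n.
have mono k x y : L1 k -> (forall z, 0 <= k z) -> x <= y -> prim k x <= prim k y.
  move=> lk k0 xy; rewrite -subr_ge0 (proj2 (prim_diff lk xy)); apply: Int_ge0 => z.
  by rewrite mulr_ge0 ?ind_ge0.
pose P x y := exists s : seq (R * R), [/\
  all (fun u => [&& x <= u.1, u.1 <= u.2 & u.2 <= y]) s,
  pairwise (fun u v => (u.2 <= v.1) || (v.2 <= u.1)) s,
  \sum_(u <- s) (u.2 - u.1) <= V y - V x &
  `|G y - G x| <= e1 * (y - x) + L * \sum_(u <- s) `|f u.2 - f u.1| + (W y - W x)].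
have [s [sall spw sV sG]] : P a b.
  suff : a <= b -> P a b by apply.
  move=> _; apply: (cousin (P := fun x y => x <= y -> P x y)) => //.
    move=> x y z xy yz h1 h2 _; have [s1 [a1 p1 v1 g1]] := h1 xy; have [s2 [a2 p2 v2 g2]] := h2 yz.
    exists (s1 ++ s2); split.
    - rewrite all_cat; apply/andP; split.
        by apply: sub_all a1 => u /and3P[-> -> h0]; rewrite (le_trans h0 yz).
      by apply: sub_all a2 => u /and3P[h0 -> ->]; rewrite (le_trans xy h0).
    - rewrite pairwise_cat p1 p2 !andbT; apply/allrelP => u v /(allP a1) /and3P[_ _ h3] /(allP a2) /and3P[h4 _ _].
      by rewrite (le_trans h3 h4).
    - by rewrite big_cat /=; lra.
    - rewrite big_cat /= mulrDr.
      have : `|G z - G x| <= `|G z - G y| + `|G y - G x|.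
        by rewrite -[G z - G x](subrKA (G y)) ler_normD.
      lra.
  move=> t /andP[at_ tb]; have [Ut|nUt] := pselect (U t).
    have [k k0 hk] : exists2 k, 0 < k & forall z, `|z - t| <= k -> U z.
      have /nbhs_ballP[k /= k0 hk] := oU t Ut; exists (k / 2); first by rewrite divr_gt0.
      move=> z zk; apply: hk; rewrite /ball /= distrC; apply: le_lt_trans zk _.
      by rewrite ltr_pdivrMr // ltr_pMr // ltrDl.
    exists k => // x y ax xt ty yb yx xy.
    have inU z : x < z <= y -> \1_U z = 1 :> R.
      move=> /andP[xz zy]; rewrite indicE mem_set //; apply: hk; rewrite ler_norml; lra.
    have WE : W y - W x = Int (fun z => ind (x < z <= y) * `|h z|).
      rewrite (proj2 (prim_diff lUh xy)); apply: Int_eq => z.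
      by have [/inU ->|/negP h1] := boolP (x < z <= y); rewrite ?mul1r // indF ?mul0r //; exact/negP.
    have VE : V y - V x = y - x.
      rewrite (proj2 (prim_diff lU xy)) -(proj2 (Int_itv xy)); apply: Int_ae.
      - by apply: L1_meas; case: (prim_diff lU xy).
      - by apply: L1_meas; case: (Int_itv xy).
      apply: ae_S (ae_neq x) => z zx.
      have [/[dup]/inU -> h1|/negP h1] := boolP (x < z <= y).
        by rewrite mulr1 indT // indT // (andP h1).2 ltW // (andP h1).1.
      rewrite (@indF _ false) // mul0r indF //.
      by apply/negP => /andP[h2 h3]; apply: h1; rewrite h3 lt_neqAle eq_sym zx h2.
    exists [:: (x, y)]; split=> /=.
    - by rewrite lexx xy lexx.
    - by [].
    - by rewrite big_seq1 /= VE.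
    - rewrite big_seq1 /= WE; apply: le_trans (hG x y ax xy yb) _.
      by rewrite lerD2r lerDr mulr_ge0 ?subr_ge0 // ltW.
  have [hdt [ta tb']] : (a < t < b -> derivable G t 1 /\ 'D_1 G t = 0) /\ (t != a) /\ (t != b).
    by apply: contrapT => /bU.
  have [|dG G0] := hdt; first by rewrite !lt_neqAle eq_sym ta at_ tb' tb.
  have [k k0 hk] := null_deriv_straddle dG G0 e10.
  exists k => // x y ax xt ty yb yx xy; exists [::]; split=> //=.
    by rewrite big_nil subr_ge0 mono.
  rewrite big_nil mulr0 addr0.
  have WW : 0 <= W y - W x by rewrite subr_ge0 mono // => z; rewrite mulr_ge0.
  have h1 : `|G y - G t| <= e1 * (y - t).
    by have := hk y; rewrite ger0_norm ?subr_ge0 //; apply; lra.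
  have h2 : `|G x - G t| <= e1 * (t - x).
    by have := hk x; rewrite distrC ger0_norm ?subr_ge0 //; apply; lra.
  have : `|G y - G x| <= `|G y - G t| + `|G x - G t|.
    by rewrite -[G y - G x](subrKA (G t)) (distrC (G x)) ler_normD.
  rewrite mulrBr in h1; rewrite mulrBr in h2; rewrite mulrBr; lra.
have lim k x : L1 k -> (forall z, 0 <= k z) -> prim k b - prim k a <= Int k.
  move=> lk k0; have [l1 ->] := prim_diff lk ab; apply: Int_le => // z.
  by have [h1|h1] := boolP (a < z <= b); [rewrite indT ?mul1r|rewrite indF ?mul0r].
have Vd : \sum_(u <- s) (u.2 - u.1) < d.
  apply: le_lt_trans sV _; apply: le_lt_trans (lim _ a lU U0) _; apply: le_lt_trans iU _.
  by apply: le_lt_trans (_ : d / 2 < d); rewrite ?ge_min ?lexx ?orbT // ltr_pdivrMr // ltr_pMr // ltrDl.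
have := ac s sall spw Vd => h1.
have h2 : W b - W a <= e1.
  apply: le_trans (lim _ a lUh _) _; first by move=> z; rewrite mulr_ge0.
  by apply: le_trans iUh _; rewrite ge_min lexx.
apply: le_trans sG _; apply: le_trans (_ : e1 * (b - a + L + 2) <= _); last by rewrite /e1 divfK // lt0r_neq0.
have h3 : L * (\sum_(u <- s) `|f u.2 - f u.1|) <= L * e1 by rewrite ler_wpM2l // ltW.
rewrite !mulrDr (mulrC e1 L); lra.
Qed.

End AbsoluteContinuity.

(** * The integrated equation of the self-similar profile *)

Section Star.
Variable R : realType.
Implicit Types (f g h G : R -> R) (a b c e s t x y : R).
Local Notation mu := (@lebesgue_measure R).
Local Notation ind := (@ind R).
Variables (N : nat) (p : nat -> R).
Hypotheses (hp0 : forall j : nat, (1 <= j <= N)%N -> 0 <= p j)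
           (hp1 : \sum_(1 <= j < N.+1) p j = 1).
Local Notation q := (qmean N p).
Local Notation P := (Qpoly N p).
Local Notation Q := (Qconv N p).

Lemma ac_bounded a b f : a <= b -> abs_continuous_on a b f ->
  exists2 M, 0 <= M & forall z, a <= z <= b -> `|f z| <= M.
Proof.
move=> ab /(_ 1 ltr01)[d d0 hd].
have loc x y : a <= x -> x <= y -> y <= b -> y - x < d -> `|f y - f x| < 1.
  move=> ax xy yb yx; have := hd [:: (x, y)]; rewrite !big_seq1 /= ax xy yb; exact.
apply: (cousin (P := fun x y => exists2 M, 0 <= M & forall z, x <= z <= y -> `|f z| <= M)) => //.
  move=> x y z xy yz [M1 M10 h1] [M2 M20 h2]; exists (M1 + M2); first exact: addr_ge0.
  move=> u /andP[xu uz]; have [uy|uy] := leP u y.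
    by apply: (@le_trans _ _ M1); [apply: h1; rewrite xu|rewrite lerDl].
  by apply: (@le_trans _ _ M2); [apply: h2; rewrite ltW|rewrite lerDr].
move=> t /andP[at_ tb]; exists (d / 2) => [|x y ax xt ty yb yx]; first by rewrite divr_gt0.
have dd : d / 2 < d by rewrite ltr_pdivrMr // ltr_pMr // ltrDl.
exists (`|f t| + 1) => [|z /andP[xz zy]]; first by rewrite addr_ge0.
have : `|f z| <= `|f z - f t| + `|f t| by rewrite -{1}[f z](subrK (f t)) ler_normD.
suff : `|f z - f t| < 1 by lra.
have [zt|zt] := leP z t; last by apply: loc => //; [exact: ltW|exact: le_trans yb|lra].
by rewrite distrC; apply: loc => //; [exact: le_trans xz|lra].
Qed.

(** The sum [G] of y f(y) and q^-1 times the primitive of the shifted source has zero derivative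
    almost everywhere and is therefore equal to its value 1 / q at y = 1. As Q[f] has mass 1, 1 / q
    minus that primitive term is q^-1 times a tail. *)
Lemma star_eq f : inP f -> is_eta_star1 N p f ->
  {ae mu, forall y, y * rep f y = q^-1 * ctail (Q (rep f)) (y - 1)}.
Proof.
move=> fP [acf df f1]; have [lw Iw lf ae_fw] := inP_rep fP.
have vf := @vanish_ext1 _ f; have vw := @vanish_rep _ f.
pose r := Q f; have rE : Q (ext1 f) = r by exact: Q_ext1.
have lr : L1 r by rewrite -rE; exact: L1_Q.
have vr : vanish 1 r by rewrite -rE; exact: vanish_Q.
have Ir : Int r = 1.
  rewrite -rE Int_Q // (Int_ae (L1_meas lf) (L1_meas lw) ae_fw) Iw; exact: P1.
have q0 : 0 < q by exact: lt_le_trans ltr01 (qmean_ge1 hp0 hp1).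
have [lr1 _] := L1_shift 1 lr; pose r1 z := r (z - 1); rewrite -/r1 in lr1.
have pr1 z : prim r1 z = prim r (z - 1).
  rewrite /prim -(proj2 (L1_shift 1 (L1_prim (z - 1) lr))); apply: Int_eq => x.
  by rewrite lerD2r.
have ftc : {ae mu, forall x, derivable (prim r1) x 1 /\ 'D_1 (prim r1) x = r1 x}.
  have il z : mu.-integrable `]-oo, z] (EFin \o r1).
    by apply: (@integrableS _ _ _ mu setT) => //; exact: (proj1 (L1P r1) lr1).
  have := @FTC1Ny R r1 il.
  have loc : locally_integrable setT r1.
    by apply: open_integrable_locally; [exact: openT|exact: (proj1 (L1P r1) lr1)].
  move=> /(_ loc); rewrite (_ : (fun x => _) = prim r1); last first.
    apply/funext => x; rewrite /prim.
    have Px z : (z <= x) <-> `]-oo, x]%classic z by rewrite /= in_itv.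
    by have [_ ->] := @L1_restrict R `]-oo, x] (fun z => z <= x) r1 (measurable_itv _) Px.
  by apply: ae_S => x; rewrite derive1E.
pose G z := z * f z + q^-1 * prim r1 z.
have G1 : G 1 = q^-1.
  rewrite /G f1 mul1r pr1 subrr /prim (@Int_eq _ _ (fun=> 0)) ?Int0 ?mulr0 ?addr0 // => x.
  by have [x0|x0] := leP x 0; rewrite ?(@indF _ false) ?mul0r // vr ?mulr0 // (le_lt_trans x0).
have Gc y : 1 <= y -> G y = q^-1.
  move=> y1; rewrite -G1; have [M M0 hM] := ac_bounded y1 (acf y).
  have [lI _] := Int_itv y1; have y0 : 0 <= y by exact: le_trans y1.
  pose h z := M * ind (1 <= z <= y) + q^-1 * `|r1 z|.
  have lr1' := L1_abs lr1.
  have lh : L1 h by apply: L1D; exact: L1Z.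
  apply: (ac_null_deriv y1 (acf y) lh y0); last first.
    apply: ae_S (ae_I df ftc) => z [h1 [d2 e2]] /andP[z1 _]; have [d1 e1] := h1 z1.
    have d3 : derivable (fun x => q^-1 * prim r1 x) z 1 by exact: derivableZ.
    split; first exact: derivableD.
    rewrite /G (deriveD d1 d3) -derive1E; move: e1 => /eqP; rewrite addr_eq0 => /eqP ->.
    rewrite (deriveZ _ d2) e2 /T1op /r1; case: ifP => [_|/negbT]; first by rewrite addNr.
    rewrite -ltNge => z2; rewrite vr; last by lra.
    by rewrite scaler0 mulr0 oppr0 addr0.
  move=> x z x1 xz zy; have z0 : 0 <= z by lra.
  have -> : G z - G x = z * (f z - f x) + (f x * (z - x) + q^-1 * (prim r1 z - prim r1 x)).
    by rewrite /G; ring.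
  apply: le_trans (ler_normD _ _) _; apply: lerD.
    by rewrite normrM ger0_norm // ler_wpM2r.
  apply: le_trans (ler_normD _ _) _.
  have [lp ep] := prim_diff lr1 xz; have [lpa _] := prim_diff lr1' xz.
  have [lJ iJ] := Int_itv xz.
  apply: le_trans (_ : Int (fun u => M * ind (x <= u <= z) + q^-1 * (ind (x < u <= z) * `|r1 u|)) <= _).
    rewrite IntD ?IntZ ?iJ; [|exact: L1_meas|exact: L1_meas|exact: L1Z|exact: L1Z].
    apply: lerD.
      rewrite normrM [`|z - x|]ger0_norm ?subr_ge0 // ler_wpM2r ?subr_ge0 //.
      by apply: hM; rewrite x1 (le_trans xz).
    rewrite normrM ger0_norm ?invr_ge0 ?(ltW q0) // ler_pM2l ?invr_gt0 // ep.
    apply: le_trans (Int_absL1 lp) _; apply: Int_le => [||u]; [exact: L1_abs|exact: lpa|].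
    by rewrite normrM (ger0_norm (ind_ge0 _ _)).
  apply: Int_leae.
  - by apply: L1D; exact: L1Z.
  - apply: (L1_le _ (L1_abs lh)) => [|u]; last by apply: le_trans (indM_norm _ _) _; rewrite normr_id.
    apply: measurable_funM; last by apply: measurableT_comp => //; exact: L1_meas.
    by apply: measurable_ind; apply: measurable_and; [exact: measurable_fun_ltr|exact: measurable_fun_ler].
  apply: ae_S (ae_neq x) => u ux; have h0 : 0 <= h u.
    by rewrite addr_ge0 // mulr_ge0 ?ind_ge0 ?invr_ge0 ?(ltW q0).
  rewrite (ger0_norm h0); have [/andP[h1 h2]|h1] := boolP (x < u <= z).
    rewrite (@indT _ true) // !mul1r (ltW h1) h2 indT // /h indT // (le_trans h2 zy) andbT.
    by rewrite (le_trans x1) // ltW.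
  rewrite (@indF _ false) // !mul0r mulr0 addr0 indF ?mulr0 //.
  by apply: contra h1 => /andP[h2 ->]; rewrite lt_neqAle eq_sym ux h2.
have aeQ : {ae mu, forall x, r x = Q (rep f) x} by rewrite -rE; exact: ae_Q.
have lQ : L1 (Q (rep f)) by exact: L1_Q.
apply: ae_S ae_fw => y fy; have [y1|y1] := leP 1 y; last first.
  by rewrite vw // mulr0 /ctail indF ?mul0r ?mulr0 // -ltNge subr_lt0.
have := Gc y y1; rewrite -fy ext1E indT // mul1r /ctail indT ?subr_ge0 // mul1r.
rewrite /G pr1 => /eqP; rewrite -subr_eq0 => /eqP E.
have -> : tail (Q (rep f)) (y - 1) = tail r (y - 1).
  apply: Int_ae; [by apply: L1_meas; apply: L1_indM => //; exact: measurable_fun_ltr|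
    by apply: L1_meas; apply: L1_indM => //; exact: measurable_fun_ltr|].
  by apply: ae_S aeQ => x ->.
rewrite tail_split // Ir -/(prim r (y - 1)) mulrBr mulr1; lra.
Qed.

End Star.

(** * Equations for tails *)

Section Recursion.
Variable R : realType.
Implicit Types (f g h u w x : R -> R) (b c e s t y : R).
Local Notation mu := (@lebesgue_measure R).
Local Notation ind := (@ind R).
Local Notation conv := (@convolution R).
Local Notation heav := (@heav R).

Lemma n2_mulx_ae s f g : measurable_fun setT f -> {ae mu, forall y, wt 1 y * `|f y| <= g y} ->
  H (s - 1) g -> H s f /\ n2 s f <= n2 (s - 1) g.
Proof.
move=> mf fg [mg lg]; have e y : wt s y = wt (s - 1) y * wt 1 y by rewrite -wtD subrK.
have [l n] : L2 (fun y => wt s y * f y) /\ sq (fun y => wt s y * f y) <= sq (fun y => wt (s - 1) y * g y).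
  apply: L2_leae => //; first by apply: measurable_funM => //; exact: measurable_wt.
  apply: ae_S fg => y h; rewrite e -mulrA !normrM !(ger0_norm (wt_ge0 _ _)) ler_wpM2l ?wt_ge0 //.
  by apply: (le_trans h); exact: ler_norm.
by split.
Qed.

Lemma wt1 y : wt 1 y = 1 + `|y|.
Proof. by rewrite /wt powRr1 // addr_ge0. Qed.

Lemma H_mulx_inv s f : H (s - 1) f -> H (s - 1) (fun y => y * f y) ->
  H s f /\ n2 s f <= 2 * (n2 (s - 1) f + n2 (s - 1) (fun y => y * f y)).
Proof.
move=> hf hx; have [[ha na] [hb nb]] := (H_abs hf, H_abs hx).
have [hh nn] := HD ha hb.
have [|h n] := @n2_mulx_ae s f (fun y => `|f y| + `|y * f y|) (proj1 hf) _ hh.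
  by apply: ae_T => y; rewrite wt1 mulrDl mul1r normrM.
by split=> //; apply: le_trans n _; apply: le_trans nn _; rewrite na nb.
Qed.

(** On the support y >= 1 one has 1 + y <= 2 y, so multiplication by y gains a full power of the
    weight without any lower-order term. *)
Lemma H_vanish1 s f : measurable_fun setT f -> vanish 1 f -> H (s - 1) (fun y => y * f y) ->
  H s f /\ n2 s f <= 4 * n2 (s - 1) (fun y => y * f y).
Proof.
move=> mf vf hx; have [hz nz] := HZ 2 (proj1 (H_abs hx)).
have [|h n] := @n2_mulx_ae s f (fun y => 2 * `|y * f y|) mf _ hz.
  apply: ae_T => y; have [y1|/vf ->] := leP 1 y; last by rewrite normr0 !mulr0 normr0 mulr0.
  rewrite wt1 normrM mulrA ler_wpM2r //; have := ler_norm y; lra.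
split=> //; apply: le_trans n _; rewrite nz (proj2 (H_abs hx)); lra.
Qed.

(** A Horner scheme for sums of products of convolution powers. With a_i equal to the tail of u - w
    convolved with w^i, it builds the tail of u^j - w^j from that of u - w, parallel to [dpow] on
    the transform side. *)
Fixpoint zrec (u : R -> R) (a : nat -> R -> R) (j : nat) : R -> R :=
  if j is i.+1 then fun y => conv u (zrec u a i) y + a i y else fun=> 0.

(* [dpow U W j] is the sum of [U ^+ (j.-1 - i) * W ^+ i] for [i < j]. *)
Fixpoint dpow (U W : R) j := if j is i.+1 then U * dpow U W i + W ^+ i else 0.

Lemma dpowE U W j : (U - W) * dpow U W j = U ^+ j - W ^+ j.
Proof.
elim: j => [|j IH] /=; first by rewrite mulr0 subrr.
by rewrite mulrDr mulrCA IH !exprS; ring.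
Qed.

Section Rec.
Variables (u : R -> R) (a : nat -> R -> R).
Hypothesis lu : LT u.

Lemma zrec_LT : (forall j, LT (a j)) -> forall j, LT (zrec u a j).
Proof.
move=> ha; elim=> [|j IH] /=; first by apply: L1_LT; [|exact: L1_0].
by apply: LT_D => //; exact: LT_conv.
Qed.

Lemma zrec_Lap s : (forall j, LT (a j)) -> 0 < s -> forall j,
  Lap (zrec u a j.+1) s = Lap u s * Lap (zrec u a j) s + Lap (a j) s.
Proof.
move=> ha s0 j; have hz := zrec_LT ha j.
by rewrite Lap_D ?Lap_conv //; exact: LT_conv.
Qed.

Lemma Lap_0 s : Lap (fun=> 0 : R) s = 0.
Proof. by rewrite /Lap (@Int_eq _ _ (fun=> 0)) ?Int0 // => y; rewrite /ew mulr0. Qed.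

Lemma zrec_Lap_dpow W Z s : (forall j, LT (a j)) -> 0 < s ->
  (forall j, Lap (a j) s = Z * W ^+ j) -> forall j, Lap (zrec u a j) s = Z * dpow (Lap u s) W j.
Proof.
move=> ha s0 hZ; elim=> [|j IH]; first by rewrite /= Lap_0 mulr0.
by rewrite zrec_Lap // IH hZ /=; ring.
Qed.

(** The decomposition (j + 1) - dpow (j + 1) = U (j - dpow j) + j (1 - U) + (1 - W^j) expresses the
    deficit recursively; divided by s, the last two terms are transforms of tails of probability
    densities. *)
Lemma zrec_Lap_cum W s : (forall j, LT (a j)) -> 0 < s ->
  (forall j, Lap (a j) s = (j%:R * (1 - Lap u s) + (1 - W ^+ j)) / s) ->
  forall j, Lap (zrec u a j) s = (j%:R - dpow (Lap u s) W j) / s.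
Proof.
move=> ha s0 hZ; elim=> [|j IH]; first by rewrite /= Lap_0 subrr mul0r.
rewrite zrec_Lap // IH hZ /= -[in RHS]natr1; field; exact: lt0r_neq0.
Qed.

End Rec.

Lemma zrec_H s : 0 <= s -> forall n, exists2 K, 0 <= K & forall u (a : nat -> R -> R) A1 A2,
  L1 u -> n1 u <= 1 -> H s u -> 0 <= A1 -> 0 <= A2 ->
  (forall j, (j < n)%N -> [/\ L1 (a j), n1 (a j) <= A1, H s (a j) & n2 s (a j) <= A2]) ->
  forall j, (j <= n)%N -> [/\ L1 (zrec u a j), n1 (zrec u a j) <= j%:R * A1, H s (zrec u a j) &
    n2 s (zrec u a j) <= K * (A1 ^+ 2 * n2 s u + A2)].
Proof.
move=> s0; elim=> [|n [K K0 IH]].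
  exists 0 => // u a A1 A2 lu nu hu A10 A20 _ j; rewrite leqn0 => /eqP ->.
  have [h n] := H0 s; rewrite mul0r mul0r n; split=> //; first exact: L1_0.
  by rewrite /n1 (@Int_eq _ _ (fun=> 0)) ?Int0 // => y; rewrite normr0.
have [c [c0 cE]] : exists c : R, 0 <= c /\ 2 * (2 `^ s) ^+ 2 = c.
  by exists (2 * (2 `^ s) ^+ 2); split=> //; rewrite mulr_ge0 ?sqr_ge0.
have [k [k0 kE]] : exists k : R, 0 <= k /\ n%:R ^+ 2 = k.
  by exists (n%:R ^+ 2); split=> //; exact: sqr_ge0.
exists (K + 2 * (c * (k + K) + 1)) => [|u a A1 A2 lu nu hu A10 A20 ha j].
  by rewrite addr_ge0 // mulr_ge0 // addr_ge0 // mulr_ge0 // addr_ge0.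
have ha' i : (i < n)%N -> [/\ L1 (a i), n1 (a i) <= A1, H s (a i) & n2 s (a i) <= A2].
  by move=> jn; apply: ha; exact: ltnW.
have [B [B0 BE]] : exists B, 0 <= B /\ A1 ^+ 2 * n2 s u = B.
  by exists (A1 ^+ 2 * n2 s u); split=> //; rewrite mulr_ge0 ?sqr_ge0 ?n2_ge0.
have h0 := IH u a A1 A2 lu nu hu A10 A20 ha'; rewrite BE in h0 *.
rewrite leq_eqVlt ltnS => /orP[/eqP ->|jn]; last first.
  have [l nn hh n2z] := h0 j jn; split=> //; apply: le_trans n2z _.
  by rewrite ler_wpM2r ?addr_ge0 // lerDl mulr_ge0 // addr_ge0 // mulr_ge0 // addr_ge0.
have [la na hha n2a] := ha n (leqnn _); have [lz nz hz n2z] := h0 n (leqnn _).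
have [hc nc] := H_conv s0 lu lz hu hz; have lc := conv_L1 lu lz.
have nz2 : n1 (zrec u a n) ^+ 2 * n2 s u <= k * B.
  rewrite -kE -BE mulrA -exprMn ler_wpM2r ?n2_ge0 // lerXn2r ?nnegrE ?n1_ge0 //.
  by rewrite mulr_ge0.
have nu2 : n1 u ^+ 2 * n2 s (zrec u a n) <= K * (B + A2).
  by apply: le_trans n2z; rewrite ler_piMl ?n2_ge0 // expr_le1 ?n1_ge0.
rewrite cE in nc; have [hh nn] := HD hc hha.
split=> //=; first exact: L1D.
  apply: le_trans (n1_le_add lc la) _; rewrite -natr1 mulrDl mul1r lerD //.
  apply: le_trans (conv_n1 lu lz) _; apply: le_trans (_ : 1 * n1 (zrec u a n) <= _).
    by rewrite ler_wpM2r ?n1_ge0.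
  by rewrite mul1r.
apply: le_trans nn _; have h1 : n2 s (conv u (zrec u a n)) <= c * (k * B + K * (B + A2)).
  by apply: le_trans nc _; rewrite ler_wpM2l // lerD.
apply: le_trans (_ : 2 * (c * (k * B + K * (B + A2)) + A2) <= _).
  by rewrite ler_pM2l // lerD.
have p1 : 0 <= c * (k * A2) by rewrite !mulr_ge0.
have p2 : 0 <= K * (B + A2) by rewrite mulr_ge0 // addr_ge0.
rewrite -subr_ge0 (_ : _ - _ = K * (B + A2) + 2 * (c * (k * A2) + B)); last by ring.
by rewrite !addr_ge0 // mulr_ge0 // addr_ge0.
Qed.

Lemma Lap_mulx_heav s : 0 < s -> Lap (fun y => y * heav y) s = s^-1 / s.
Proof.
move=> s0; have Lh := LT_heav R.
have E y : y * heav y = conv heav heav y + 0.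
  rewrite addr0 conv_heav; last exact: LT_meas.
  rewrite /heav; have [y0|y0] := leP 0 y; last first.
    rewrite (@indF _ false) // mulr0 (@Int_eq _ _ (fun=> 0)) ?Int0 // => x.
    have [xy|xy] := leP x y; last by rewrite (@indF _ false) // mul0r.
    by rewrite [X in _ * X]indF ?mulr0 // -ltNge (le_lt_trans xy).
  have [_ i] := Int_itv y0; rewrite (@indT _ true) // mulr1 -[LHS]subr0 -i.
  by apply: Int_eq => x; rewrite /ind andbC; case: (x <= y); case: (0 <= x) => /=; rewrite ?mul1r ?mul0r.
rewrite /Lap (@Int_eq _ _ (ew s (conv heav heav))) => [|y]; last by rewrite /ew E addr0.
by rewrite -/(Lap _ s) Lap_conv // Lap_heav.
Qed.

(** This is minus the s-derivative of (Int x - Lap x s) / s, computed from products with the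
    Heaviside function instead of by differentiation. *)
Lemma Lap_mulx_ctail x s : 0 < s -> L1 x -> causal x ->
  Lap (fun y => y * ctail x y) s = Lap (ctail x) s / s - Lap (fun y => y * x y) s / s.
Proof.
move=> s0 lx cx; have Lx := L1_LT cx lx; have Lh := LT_heav R.
have Lm := LT_mulx Lh; have Lc := LT_conv Lh Lx.
have E y : ew s (fun y => y * ctail x y) y = ew s (fun y => Int x * (y * heav y) - y * conv heav x y) y.
  by rewrite /ew ctailE //; ring.
rewrite /Lap (Int_eq E) -!/(Lap _ s) Lap_B //; [|exact: LT_Z|exact: LT_mulx].
rewrite Lap_Z // Lap_mulx_heav // Lap_mulx_conv // Lap_mulx_heav // Lap_heav // -/(Lap (ctail x) s) Lap_ctail //.
by field; exact: lt0r_neq0.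
Qed.

End Recursion.

(** * The convolution equation for tails and its gain of weight *)

Section TailEquation.
Variable R : realType.
Implicit Types (f g h u w x : R -> R) (b c e s t y : R).
Local Notation mu := (@lebesgue_measure R).
Local Notation ind := (@ind R).
Local Notation conv := (@convolution R).
Local Notation heav := (@heav R).
Variables (N : nat) (p : nat -> R).
Hypotheses (hp0 : forall j : nat, (1 <= j <= N)%N -> 0 <= p j)
           (hp1 : \sum_(1 <= j < N.+1) p j = 1).
Local Notation q := (qmean N p).
Local Notation P := (Qpoly N p).
Local Notation Q := (Qconv N p).

Definition mix (F : nat -> R -> R) y := \sum_(1 <= j < N.+1) p j * F j y.

Lemma mix_H s : exists2 K, 0 <= K & forall (F : nat -> R -> R) b, 0 <= b ->
  (forall j, (j <= N)%N -> H s (F j) /\ n2 s (F j) <= b) -> H s (mix F) /\ n2 s (mix F) <= K * b.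
Proof.
have [K K0 hK] := @H_sum R s nat (index_iota 1 N.+1); exists K => // F b b0 hF.
pose G j y := if (1 <= j <= N)%N then p j * F j y else 0.
have -> : mix F = (fun y => \sum_(1 <= j < N.+1) G j y).
  by apply/funext => y; apply: eq_big_nat => j; rewrite /G ltnS => ->.
apply: hK => j; have [jN|jN] := boolP (1 <= j <= N)%N; last first.
  have -> : G j = (fun=> 0) by apply/funext => y; rewrite /G (negbTE jN).
  by have [h ->] := H0 s.
have -> : G j = (fun y => p j * F j y) by apply/funext => y; rewrite /G jN.
have [h n] := hF j (proj2 (andP jN)); have [hz ->] := HZ (p j) h; split=> //.
by apply: le_trans n; rewrite ler_piMl ?n2_ge0 // expr_le1 ?hp0 ?(p_le1 hp0 hp1).
Qed.

Lemma mix_LT F : (forall j, LT (F j)) -> LT (mix F) /\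
  forall s, 0 < s -> Lap (mix F) s = \sum_(1 <= j < N.+1) p j * Lap (F j) s.
Proof.
move=> hF; rewrite /mix; elim: (index_iota 1 N.+1) => [|j r [IH1 IH2]].
  have -> : (fun y => \sum_(j <- [::]) p j * F j y) = (fun=> 0).
    by apply/funext => y; rewrite big_nil.
  split=> [|s s0]; first by apply: L1_LT; [|exact: L1_0].
  by rewrite Lap_0 big_nil.
have -> : (fun y => \sum_(j <- j :: r) p j * F j y) = (fun y => p j * F j y + \sum_(j <- r) p j * F j y).
  by apply/funext => y; rewrite big_cons.
have L1 := LT_Z (p j) (hF j); split=> [|s s0]; first exact: LT_D.
by rewrite Lap_D // Lap_Z // IH2 // big_cons.
Qed.

(* [v j] stands for the sum over [i < j] of the tails of u^(j-1-i) * w^i (convolution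
   powers), so that the Laplace transform of [vker v] is
   (1 - q^-1 exp(-s) (P(U) - P(W)) / (U - W)) / s. *)
Definition vker (v : nat -> R -> R) y := (heav y - heav (y - 1)) + q^-1 * mix v (y - 1).

(** [D] holds the transform-side difference quotients. The transform of y ctail x is (Lap (ctail x)
    - Lap (y x)) / s. After inserting the equation for y x, the factor multiplying Lap (ctail x) is
    the transform of [vker v], and Int f = 0 makes - Lap f / s the transform of [ctail f]. *)
Lemma tail_equation x f (z v : nat -> R -> R) (D : nat -> R -> R) :
  L1 x -> causal x -> L1 f -> causal f -> Int f = 0 ->
  (forall j, LT (z j)) -> (forall j, LT (v j)) ->
  (forall j s, 0 < s -> Lap (z j) s = Lap (ctail x) s * D j s) ->
  (forall j s, 0 < s -> Lap (v j) s = (j%:R - D j s) / s) ->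
  {ae mu, forall y, y * x y = q^-1 * mix z (y - 1) + f y} ->
  LT (vker v) /\ {ae mu, forall y, y * ctail x y = conv (ctail x) (vker v) y + ctail f y}.
Proof.
move=> lx cx lf cf If Lz Lv Dz Dv aex.
have Lx := L1_LT cx lx; have Lf := L1_LT cf lf; have Lh := LT_heav R.
have [Lmz emz] := mix_LT Lz; have [Lmv emv] := mix_LT Lv.
have Lh1 s := Lap_shift s (@ler01 R) Lh.
have Lz1 s := Lap_shift s (@ler01 R) Lmz; have Lv1 s := Lap_shift s (@ler01 R) Lmv.
have Lhh := LT_B Lh (proj1 (Lh1 1)); have Lqv := LT_Z q^-1 (proj1 (Lv1 1)).
have LV : LT (vker v) by apply: LT_D.
have Lc := LT_ctail lx cx; have Lcf := LT_ctail lf cf; have LcV := LT_conv Lc LV.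
split=> //; apply: Lap_inj2; [exact: LT_mulx|exact: LT_D|move=> s s0].
rewrite (Lap_D s0 LcV Lcf) (Lap_conv s0 Lc LV) Lap_mulx_ctail //.
have -> : Lap (vker v) s = s^-1 - expR (- s * 1) / s + q^-1 * (expR (- s * 1) * ((q - \sum_(1 <= j < N.+1) p j * D j s) / s)).
  rewrite (Lap_D s0 Lhh Lqv) (Lap_B s0 Lh (proj1 (Lh1 s))) (Lap_Z _ _ (proj1 (Lv1 s))).
  rewrite (proj2 (Lh1 s) s0) (proj2 (Lv1 s) s0) !Lap_heav // emv //; congr (_ + _ * (_ * _)).
  rewrite qmeanE -sumrB mulr_suml; apply: eq_bigr => j _; rewrite Dv //; ring.
have -> : Lap (fun y => y * x y) s = q^-1 * (expR (- s * 1) * (Lap (ctail x) s * \sum_(1 <= j < N.+1) p j * D j s)) + Lap f s.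
  have Lqz := LT_Z q^-1 (proj1 (Lz1 s)).
  have [_ cyx _] := LT_mulx Lx.
  have aex' : {ae mu, forall y, q^-1 * mix z (y - 1) + f y = y * x y} by apply: ae_S aex => y ->.
  have [_ ->] := LT_ae (LT_meas (LT_mulx Lx)) cyx (LT_D Lqz Lf) aex'.
  rewrite (Lap_D s0 Lqz Lf) (Lap_Z _ _ (proj1 (Lz1 s))) (proj2 (Lz1 s) s0) emz //; congr (_ * (_ * _) + _).
  by rewrite mulr_sumr; apply: eq_bigr => j _; rewrite Dz //; ring.
rewrite (Lap_ctail s0 lf cf) If.
have q0 : q != 0 by rewrite lt0r_neq0 // (lt_le_trans ltr01) // (qmean_ge1 hp0 hp1).
by field; rewrite q0 lt0r_neq0.
Qed.

Lemma x_bound t s' : t <= s' -> 0 <= s' -> exists2 K, 0 <= K & forall x f (z : nat -> R -> R) b,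
  0 <= b -> measurable_fun setT x -> vanish 1 x -> H t f ->
  (forall j, (j <= N)%N -> H s' (z j) /\ n2 s' (z j) <= b) ->
  {ae mu, forall y, y * x y = q^-1 * mix z (y - 1) + f y} ->
  H (t + 1) x /\ n2 (t + 1) x <= K * (b + n2 t f).
Proof.
move=> ts s0; have [Km Km0 hm] := mix_H s'.
have [a1 [a10 a1E]] : exists c : R, 0 <= c /\ q^-1 ^+ 2 = c.
  by exists (q^-1 ^+ 2); split=> //; exact: sqr_ge0.
have [a2 [a20 a2E]] : exists c : R, 0 <= c /\ (2 `^ s') ^+ 2 = c.
  by exists ((2 `^ s') ^+ 2); split=> //; exact: sqr_ge0.
pose c := a1 * a2; have c0 : 0 <= c by exact: mulr_ge0.
exists (8 * (c * Km + 1)) => [|x f z b b0 mx vx hf hz aex].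
  by rewrite mulr_ge0 // addr_ge0 // mulr_ge0.
have [hM nM] := hm z b b0 hz; have [hS nS] := H_shift1 s0 hM.
have [hS' nS'] := HZ q^-1 (proj1 (H_mono ts hS)); have [hh nn] := HD hS' hf.
have mxx : measurable_fun setT (fun y => y * x y) by exact: measurable_funM.
have [hx nx] : H t (fun y => y * x y) /\ n2 t (fun y => y * x y) =
    n2 t (fun y => q^-1 * mix z (y - 1) + f y).
  by apply: H_ae => //; apply: ae_S aex => y ->.
have t1 : t + 1 - 1 = t by rewrite addrK.
have [|h n] := @H_vanish1 R (t + 1) x mx vx; rewrite ?t1 //.
split=> //; rewrite t1 in n; apply: (le_trans n); rewrite nx.
have n3 : n2 t (fun y => q^-1 * mix z (y - 1)) <= c * Km * b.
  rewrite nS' a1E /c -!mulrA; apply: ler_wpM2l => //.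
  by apply: (le_trans (proj2 (H_mono ts hS))); apply: (le_trans nS); rewrite a2E; exact: ler_wpM2l.
have f0 := n2_ge0 t f; have p0 : 0 <= c * Km by exact: mulr_ge0.
have p1 : 0 <= c * Km * n2 t f by exact: mulr_ge0.
rewrite (_ : 8 * _ * _ = 8 * (c * Km * b + c * Km * n2 t f + b + n2 t f)); last by ring.
lra.
Qed.

(** The right-hand side of the equation for y Z has weight s - 1: the convolution because s - 1 <=
    s', and the tail of [f] by Hardy's inequality, which needs s - 1 > - 1/2. Removing the factor y
    then gives weight s. *)
Lemma tail_bound_step s s' : 2^-1 < s -> s - 1 <= s' -> 0 <= s' -> exists2 K, 0 <= K &
  forall (Z V f : R -> R), L1 Z -> L1 V -> H s' Z -> H s' V -> H s f ->
  {ae mu, forall y, y * Z y = conv Z V y + ctail f y} ->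
  H s Z /\ n2 s Z <= K * (n2 s' Z + (n1 V ^+ 2 * n2 s' Z + n1 Z ^+ 2 * n2 s' V) + n2 s f).
Proof.
move=> s2 ss s0; have [|CH CH0 hH] := @hardy R (s - 1); first by lra.
have [c [c0 cE]] : exists c : R, 0 <= c /\ 2 * (2 `^ s') ^+ 2 = c.
  by exists (2 * (2 `^ s') ^+ 2); split=> //; rewrite mulr_ge0 ?sqr_ge0.
exists (2 + 4 * c + 4 * CH) => [|Z V f lZ lV hZ hV hf ae].
  by rewrite addr_ge0 ?addr_ge0 ?mulr_ge0.
have [hc nc] := H_conv s0 lZ lV hZ hV; rewrite cE in nc.
have [hc' nc'] := H_mono ss hc; have [hZ' nZ'] := H_mono ss hZ.
have [ht nt] : H (s - 1) (ctail f) /\ n2 (s - 1) (ctail f) <= CH * n2 s f.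
  by have := hH f; rewrite subrK; apply.
have [hh nn] := HD hc' ht.
have mZ : measurable_fun setT (fun y => y * Z y) by apply: measurable_funM => //; case: hZ.
have [hx nx] : H (s - 1) (fun y => y * Z y) /\ n2 (s - 1) (fun y => y * Z y) =
    n2 (s - 1) (fun y => conv Z V y + ctail f y).
  by apply: H_ae => //; apply: ae_S ae => y ->.
have [h n] := H_mulx_inv hZ' hx; split=> //; apply: (le_trans n); rewrite nx.
have [B BE] : exists B, n1 V ^+ 2 * n2 s' Z + n1 Z ^+ 2 * n2 s' V = B by eexists.
have B0 : 0 <= B by rewrite -BE addr_ge0 // mulr_ge0 ?sqr_ge0 ?n2_ge0.
rewrite BE in nc *; have z0 := n2_ge0 s' Z; have f0 := n2_ge0 s f.
have p1 := mulr_ge0 c0 z0; have p2 := mulr_ge0 c0 f0; have p3 := mulr_ge0 CH0 z0; have p4 := mulr_ge0 CH0 B0.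
rewrite (_ : (2 + 4 * c + 4 * CH) * (_ + B + _) = 2 * n2 s' Z + 4 * (c * B) + 4 * (CH * n2 s f) +
  (2 * B + 2 * n2 s f + 4 * (c * n2 s' Z) + 4 * (c * n2 s f) + 4 * (CH * n2 s' Z) + 4 * (CH * B))); last by ring.
apply: le_trans (_ : 2 * n2 s' Z + 4 * (c * B) + 4 * (CH * n2 s f) <= _); last first.
  by rewrite lerDl !addr_ge0 ?mulr_ge0.
have nc2 := le_trans nc' nc; rewrite (_ : _ + _ = 2 * (n2 s' Z + 2 * (c * B + CH * n2 s f))); last by ring.
rewrite ler_pM2l //; apply: lerD => //; apply: (le_trans nn); rewrite ler_pM2l //; exact: lerD.
Qed.

Lemma mix_n1 F b : (forall j, (j <= N)%N -> L1 (F j) /\ n1 (F j) <= b) -> L1 (mix F) /\ n1 (mix F) <= b.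
Proof.
move=> hF; have aux (r : seq nat) : (forall j, j \in r -> (1 <= j <= N)%N) ->
    L1 (fun y => \sum_(j <- r) p j * F j y) /\
    n1 (fun y => \sum_(j <- r) p j * F j y) <= \sum_(j <- r) p j * b.
  elim: r => [|j r IH] hr.
    have -> : (fun y => \sum_(j <- [::]) p j * F j y) = (fun=> 0).
      by apply/funext => y; rewrite big_nil.
    rewrite /n1 (@Int_eq _ _ (fun=> 0)) ?Int0 ?big_nil //; last by move=> y; rewrite normr0.
    by split; first exact: L1_0.
  have -> : (fun y => \sum_(j <- j :: r) p j * F j y) = (fun y => p j * F j y + \sum_(j <- r) p j * F j y).
    by apply/funext => y; rewrite big_cons.
  have [|l n] := IH; first by move=> i ir; apply: hr; rewrite inE ir orbT.
  have jN := hr j (mem_head _ _); have [lj nj] := hF j (proj2 (andP jN)).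
  have lz := L1Z (p j) lj; split; first exact: L1D.
  apply: le_trans (n1_le_add lz l) _; rewrite big_cons lerD // n1Z // ger0_norm ?hp0 //.
  by rewrite ler_wpM2l ?hp0.
have [|l n] := aux (index_iota 1 N.+1); first by move=> j; rewrite mem_index_iota ltnS.
by split=> //; apply: le_trans n _; rewrite -mulr_suml hp1 mul1r.
Qed.

Lemma vker_bound s' : 0 <= s' -> exists2 K, 0 <= K & forall (v : nat -> R -> R) b1 b2, 0 <= b1 -> 0 <= b2 ->
  (forall j, (j <= N)%N -> [/\ L1 (v j), n1 (v j) <= b1, H s' (v j) & n2 s' (v j) <= b2]) ->
  [/\ L1 (vker v), n1 (vker v) <= 1 + b1, H s' (vker v) & n2 s' (vker v) <= K * (1 + b2)].
Proof.
move=> s0; have q1 := qmean_ge1 hp0 hp1; have q0 : 0 < q by exact: lt_le_trans q1.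
pose k y := heav y - heav (y - 1).
have [lI iI] := Int_itv (@ler01 R).
have mk : measurable_fun setT k.
  have [m _ _] := LT_heav R; apply: measurable_funB => //; apply: (L1_comp m); exact: measurable_funB.
have kle y : `|k y| <= ind (0 <= y <= 1).
  rewrite /k /heav subr_ge0 /ind; have [y0|y0] := leP 0 y; have [y1|y1] := leP 1 y => /=.
  - by rewrite subrr normr0 ler0n.
  - by rewrite (ltW y1) subr0 normr1.
  - by have := le_lt_trans y1 y0; rewrite ltr10.
  - by rewrite subrr normr0.
have lk : L1 k := L1_le mk lI kle.
have nk : n1 k <= 1.
  apply: le_trans (_ : Int (fun y => ind (0 <= y <= 1)) <= _); last by rewrite iI subr0.
  by apply: Int_le => //; exact: L1_abs.
have hk : H s' k.
  have mw := @measurable_wt R s'.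
  split=> //; split; first exact: measurable_funM.
  apply: (L1_le _ (L1Z (wt s' 1 ^+ 2) lI)) => [|y].
    by apply: measurable_funX; exact: measurable_funM.
  rewrite ger0_norm ?sqr_ge0 // exprMn; have := kle y; rewrite /ind.
  have [/andP[y0 y1]|_] /= := boolP (0 <= y <= 1).
    move=> h; apply: ler_pM; rewrite ?sqr_ge0 //.
      rewrite lerXn2r ?nnegrE ?wt_ge0 // !wt_nneg //; apply: ge0_ler_powR; rewrite ?nnegrE ?addr_ge0 ?lerD2l //.
    by rewrite -(ger0_norm (sqr_ge0 _)) normrX expr_le1.
  by rewrite normr_le0 => /eqP ->; rewrite expr0n /= !mulr0.
have [Km Km0 hm] := mix_H s'.
have [c [c0 cE]] : exists c : R, 0 <= c /\ (2 `^ s') ^+ 2 = c.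
  by exists ((2 `^ s') ^+ 2); split=> //; exact: sqr_ge0.
have K0 := n2_ge0 s' k.
exists (2 * (n2 s' k + c * Km)) => [|v b1 b2 b10 b20 hv].
  by rewrite mulr_ge0 // addr_ge0 // mulr_ge0.
have [|lm nm] := @mix_n1 v b1; first by move=> j /hv[].
have [|hM nM] := hm v b2 b20; first by move=> j /hv[].
have [ls es] := L1_shift 1 lm; have [hS nS] := H_shift1 s0 hM.
have lq := L1Z q^-1 ls; have [hq nq] := HZ q^-1 hS.
have iq : 0 <= q^-1 <= 1 by rewrite invr_ge0 (ltW q0) invf_le1.
have [hh nn] := HD hk hq; split=> //; first exact: L1D.
  apply: le_trans (n1_le_add lk lq) _; rewrite lerD // n1Z // ger0_norm ?(andP iq).1 //.
  have -> : n1 (fun y => mix v (y - 1)) = n1 (mix v).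
    by rewrite /n1 -[RHS](proj2 (L1_shift 1 (L1_abs lm))).
  apply: le_trans nm; rewrite ler_piMl ?n1_ge0 // (andP iq).2 //.
apply: (le_trans nn); rewrite nq; rewrite cE in nS.
have h1 : q^-1 ^+ 2 * n2 s' (fun y => mix v (y - 1)) <= c * Km * b2.
  apply: le_trans (_ : n2 s' (fun y => mix v (y - 1)) <= _).
    by rewrite ler_piMl ?n2_ge0 // expr_le1 ?(andP iq).1 ?(andP iq).2.
  by apply: (le_trans nS); rewrite -mulrA ler_wpM2l.
have p1 := mulr_ge0 K0 b20; have p2 := mulr_ge0 c0 Km0.
rewrite (_ : 2 * (n2 s' k + c * Km) * (1 + b2) = 2 * (n2 s' k + c * Km * b2 + (n2 s' k * b2 + c * Km))); last by ring.
lra.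
Qed.

End TailEquation.

(** * Uniform weighted bound *)

Section Estimates.
Variable R : realType.
Implicit Types (f g h u w x : R -> R) (b c e s t y : R).
Local Notation mu := (@lebesgue_measure R).
Local Notation ind := (@ind R).
Local Notation conv := (@convolution R).
Local Notation heav := (@heav R).

Definition dens u := [/\ L1 u, forall y, 0 <= u y, vanish 1 u & Int u = 1].

Lemma dens_LT u : dens u -> LT u.
Proof. by case=> lu _ vu _; exact: LT_vanish. Qed.

Lemma dens_causal u : dens u -> causal u.
Proof. by case=> _ _ vu _; exact: vanish_causal (@ler01 R) vu. Qed.

Lemma dens_n1 u : dens u -> n1 u = 1.
Proof. by case=> _ u0 _ <-; apply: Int_eq => y; rewrite ger0_norm. Qed.

Lemma dens_convpow u j : dens u -> dens (convpow u j.+1).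
Proof.
case=> lu u0 vu Iu; split; [exact: L1_convpow|exact: convpow_ge0|exact: vanish_convpow|].
by rewrite Int_convpow // Iu expr1n.
Qed.

(** Being a probability density on [1, oo), [u] averages the values of [g] at points at most y - 1,
    so only bounds of [g] to the left of y matter. *)
Lemma conv_dens_le u g y b : dens u -> measurable_fun setT g -> (forall t, t <= y -> `|g t| <= b) ->
  `|conv u g y| <= b.
Proof.
case=> lu u0 vu Iu mg hg; rewrite convE.
have b0 : 0 <= b by apply: le_trans (hg y (lexx y)).
have h t : `|u t * g (y - t)| <= b * u t.
  have [t1|/vu ->] := leP 1 t; last by rewrite mulr0 mul0r normr0.
  rewrite normrM ger0_norm // mulrC ler_wpM2r //; apply: hg; lra.
have l : L1 (fun t => u t * g (y - t)).
  by apply: (L1_le _ (L1Z b lu) h); apply: measurable_convkerx => //; exact: L1_meas.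
apply: le_trans (Int_absL1 l) _; apply: le_trans (Int_le (L1_abs l) (L1Z b lu) h) _.
by rewrite IntZ ?Iu ?mulr1 //; exact: L1_meas.
Qed.

Lemma dens_tail u : dens u -> L1 (fun y => y * u y) ->
  [/\ LT (ctail u), L1 (ctail u), n1 (ctail u) = Int (fun y => y * u y) & forall y, 0 <= ctail u y <= 1].
Proof.
move=> du lx; have cu := dens_causal du; case: du => lu u0 vu Iu.
have [l i] := Int_ctail lu cu lx.
have h0 y : 0 <= ctail u y by rewrite mulr_ge0 ?ind_ge0 ?tail_ge0.
split=> //; first exact: LT_ctail.
  by rewrite -i; apply: Int_eq => y; rewrite ger0_norm.
move=> y; rewrite h0 /= /ctail; apply: le_trans (_ : tail u y <= _).
  by rewrite ler_piMl ?tail_ge0 ?ind_le1.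
by rewrite -Iu tail_le.
Qed.

(* The case [w] = Dirac mass at 0 of [zx] and [vx] below: [zt u j] is the tail of the
   j-th convolution power of [u]. *)
Definition zt u := zrec u (fun=> ctail u).
Definition vt u := zrec u (fun (j : nat) y => j%:R * ctail u y).

Section Mix.
Variables (N : nat) (p : nat -> R).
Hypotheses (hp0 : forall j : nat, (1 <= j <= N)%N -> 0 <= p j)
           (hp1 : \sum_(1 <= j < N.+1) p j = 1).
Local Notation q := (qmean N p).
Local Notation P := (Qpoly N p).
Local Notation Q := (Qconv N p).

Section TCase.
Variable u : R -> R.
Hypothesis du : dens u.

Lemma zt_LT j : LT (zt u j).
Proof.
apply: zrec_LT => [|_]; first exact: dens_LT.
by apply: LT_ctail; [case: du|exact: dens_causal].
Qed.

Lemma vt_LT j : LT (vt u j).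
Proof.
apply: zrec_LT => [|i]; first exact: dens_LT.
by apply: LT_Z; apply: LT_ctail; [case: du|exact: dens_causal].
Qed.

Lemma zt_Lap j s : 0 < s -> Lap (zt u j) s = Lap (ctail u) s * dpow (Lap u s) 1 j.
Proof.
move=> s0; apply: zrec_Lap_dpow => // [|_|i]; [exact: dens_LT| |by rewrite expr1n mulr1].
by apply: LT_ctail; [case: du|exact: dens_causal].
Qed.

Lemma vt_Lap j s : 0 < s -> Lap (vt u j) s = (j%:R - dpow (Lap u s) 1 j) / s.
Proof.
have cu := dens_causal du; case: (du) => lu _ _ Iu.
move=> s0; apply: zrec_Lap_cum => // [|i|i]; [exact: dens_LT|by apply: LT_Z; apply: LT_ctail|].
rewrite Lap_Z; last exact: LT_ctail.
by rewrite Lap_ctail // Iu expr1n subrr addr0 mulrA.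
Qed.

(** On transforms, (1 - U) dpow U 1 j = 1 - U^j, so each [zt u j] has the transform of the tail of
    the j-th convolution power. *)
Lemma mix_zt : {ae mu, forall y, ctail (Q u) y = mix N p (zt u) y}.
Proof.
have cu := dens_causal du; case: (du) => lu _ vu Iu.
have [lm em] := mix_LT N p zt_LT; have lQ := L1_Q N p lu vu.
have cQ : causal (Q u) by apply: vanish_causal (@ler01 R) _; exact: vanish_Q.
apply: Lap_inj2 => // [|s s0]; first exact: LT_ctail.
rewrite Lap_ctail // em // Int_Q // Iu P1 // Lap_Q // P_eval.
rewrite -[X in X - _]hp1 -sumrB mulr_suml; apply: eq_bigr => j _.
rewrite zt_Lap // Lap_ctail // Iu mulrAC.
have -> : (1 - Lap u s) * dpow (Lap u s) 1 j = 1 - Lap u s ^+ j.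
  by rewrite -opprB mulNr dpowE expr1n opprB.
by ring.
Qed.

Lemma zt_le j y : `|zt u j y| <= j%:R.
Proof.
have cu := dens_causal du; case: (du) => lu u0 vu Iu.
elim: j y => [|j IH] y /=; first by rewrite normr0.
apply: le_trans (ler_normD _ _) _; rewrite -natr1 lerD //.
  by apply: conv_dens_le => [//||t _]; [exact: LT_meas (zt_LT j)|exact: IH].
have h0 : 0 <= ctail u y by rewrite mulr_ge0 ?ind_ge0 ?tail_ge0.
rewrite ger0_norm // /ctail; apply: le_trans (_ : tail u y <= _).
  by rewrite ler_piMl ?tail_ge0 ?ind_le1.
by rewrite -Iu tail_le.
Qed.

End TCase.

Lemma scaleE c k y E : 0 <= c -> y <= k * E -> c * y <= c * k * E.
Proof. by move=> c0 h; rewrite -mulrA ler_wpM2l. Qed.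

(** The linear bookkeeping of [density_bound]: [U] and [T] stand for the squared norms of the
    density and of its tail, [nv] and [nV] for those of the kernels, [b] for the lower-order norm
    and [e] for that of the forcing. The constant [c] depends on none of these. *)
Lemma absorb1 K2 K3 K5 K6 a1 a2 a3 a4 : 0 <= K2 -> 0 <= K3 -> 0 <= K5 -> 0 <= K6 ->
  0 <= a1 -> 0 <= a2 -> 0 <= a3 -> 0 <= a4 -> exists2 c, 0 <= c & forall U T nv nV b e, 0 <= b -> 0 <= e ->
  U <= K3 * (b + e) -> nv <= K2 * (a2 * U + a3 * b) -> nV <= K6 * (1 + nv) ->
  T <= K5 * (b + (a1 * b + a4 * nV) + e) -> a4 * U + T <= c * (1 + b + e).
Proof.
move=> K20 K30 K50 K60 a10 a20 a30 a40.
exists (a4 * K3 + K5 * (1 + (a1 + a4 * (K6 * (1 + K2 * (a2 * K3 + a3)))) + 1)).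
  by do 20?[apply: addr_ge0 => //|apply: mulr_ge0 => //].
move=> U T nv nV b e b0 e0 hU hv hV hT; set E := 1 + b + e.
have E1 : 1 <= 1 * E by rewrite mul1r /E; lra.
have Eb : b <= 1 * E by rewrite mul1r /E; lra.
have Ee : e <= 1 * E by rewrite mul1r /E; lra.
have Eb' : b <= E by rewrite /E; lra.
have UE : U <= K3 * E by apply: (le_trans hU); rewrite ler_wpM2l // /E; lra.
have vE : nv <= K2 * (a2 * K3 + a3) * E.
  apply: (le_trans hv); apply: scaleE => //; rewrite mulrDl lerD //; first exact: scaleE.
  by rewrite ler_wpM2l.
have VE : nV <= K6 * (1 + K2 * (a2 * K3 + a3)) * E.
  by apply: (le_trans hV); apply: scaleE => //; rewrite mulrDl lerD.
have TE : T <= K5 * (1 + (a1 + a4 * (K6 * (1 + K2 * (a2 * K3 + a3)))) + 1) * E.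
  apply: (le_trans hT); apply: scaleE => //; rewrite !mulrDl lerD // lerD // -mulrDl mulrDl lerD //.
    by rewrite ler_wpM2l.
  exact: scaleE.
by rewrite mulrDl lerD //; exact: scaleE.
Qed.

Lemma half_le y E : y <= E + 2^-1 * y -> y <= 2 * E.
Proof. lra. Qed.

Lemma final_le c y E e : y <= c * (1 + E) -> c * E <= c * (e * (1 + y)) -> c * (e * (1 + y)) <= 2^-1 * (1 + y) ->
  y <= 2 * c + 1.
Proof. rewrite mulrDr mulr1; lra. Qed.

(** Integrating the equation: the tail of Q[u] has integral equal to the mean of Q[u], that is q
    times the mean of [u], so the first two terms already balance. *)
Lemma Int_f0 u f : dens u -> L1 (fun y => y * u y) -> L1 f ->
  {ae mu, forall y, y * u y = q^-1 * ctail (Q u) (y - 1) + f y} -> Int f = 0.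
Proof.
move=> du lx lf ae; have cu := dens_causal du; case: (du) => lu _ vu Iu.
have cQ : causal (Q u) by apply: vanish_causal (@ler01 R) _; exact: vanish_Q.
have q0 : q != 0 := lt0r_neq0 (lt_le_trans ltr01 (qmean_ge1 hp0 hp1)).
have lQ := L1_Q N p lu vu; have [lxQ iQ] := Int_mulx_Q N p lu vu lx Iu; clear Iu.
have [lc ic] := Int_ctail lQ cQ lxQ; have [ls es] := L1_shift 1 lc.
have E := Int_ae (L1_meas lx) (L1_meas (L1D (L1Z q^-1 ls) lf)) ae; move: E.
rewrite (IntD (L1Z q^-1 ls) lf) (IntZ _ (L1_meas ls)) es ic iQ (mulKf q0) -[LHS]addr0 => /addrI e.
exact: esym e.
Qed.

Lemma ae_shift1 (Pr : R -> Prop) : {ae mu, forall y, Pr y} -> {ae mu, forall y, Pr (y - 1)}.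
Proof.
move=> h; have := ae_affine (-1) (oner_neq0 R) h; apply: ae_S => y; by rewrite mul1r.
Qed.

(** The weight climbs from s' to gam - 1 by [x_bound] and the tail equation, and then to gam by
    [x_bound] again. The norm at level s' is interpolated between a small multiple of that at level
    gam - 1, which is absorbed, and a local L2 norm, which is bounded by the mean. The forcing is
    proportional to 1 + n2 gam u, hence the smallness threshold [e0]; in the application it is met
    for late times. *)
Lemma density_bound gam Cm : 3 / 2 < gam -> 0 <= Cm -> exists C e0, [/\ 0 <= C, 0 < e0 &
  forall u f e, dens u -> H gam u -> Int (fun y => y * u y) <= Cm -> vanish 1 f -> H (gam - 1) f ->
  n2 (gam - 1) f <= e * (1 + n2 gam u) -> e <= e0 ->
  {ae mu, forall y, y * u y = q^-1 * ctail (Q u) (y - 1) + f y} -> n2 gam u <= C].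
Proof.
(* [s'] is s - 1 raised to 0 where needed, because the convolution estimates require a nonnegative
   exponent; it is still strictly below s, which interpolation requires. *)
move=> hgam Cm0; pose s := gam - 1; pose s' := Num.max (gam - 2) 0.
have s'0 : 0 <= s' by rewrite le_max lexx orbT.
have ss' : s - 1 <= s' by rewrite le_max /s; apply/orP; left; lra.
have s's : s' < s by rewrite gt_max /s; apply/andP; split; lra.
have s0 : 0 <= s by rewrite /s; lra.
have s2 : 2^-1 < s by rewrite /s; lra.
have s2' : - 2^-1 < s by lra.
have gE : s + 1 = gam by rewrite /s subrK.
have sE : s - 1 + 1 = s by rewrite subrK.
have sm : s - 1 <= s by rewrite gerBl.
have sg : s <= gam by rewrite /s; lra.
have [K1 K10 h1] := zrec_H s0 N; have [K2 K20 h2] := zrec_H s'0 N.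
have [K3 K30 h3] := x_bound hp0 hp1 ss' s'0; have [K4 K40 h4] := x_bound hp0 hp1 (lexx s) s0.
have [K5 K50 h5] := tail_bound_step s2 ss' s'0; have [K6 K60 h6] := vker_bound hp0 hp1 s'0.
pose n : R := N%:R; have n0 : 0 <= n by exact: ler0n.
pose b1 := n * (n * Cm); have b10 : 0 <= b1 by rewrite !mulr_ge0.
have [cG cG0 hG] := absorb1 K20 K30 K50 K60 (sqr_ge0 (1 + b1)) (sqr_ge0 (n * Cm)) (sqr_ge0 n) (sqr_ge0 Cm).
(* With this interpolation parameter the term returned by [absorb1] costs at most half of G; the
   added 1 keeps the denominator positive. *)
pose d := (2 * (cG * (1 + K1) + 1))^-1.
have cK : 0 <= cG * (1 + K1) by rewrite mulr_ge0 // addr_ge0.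
have d0 : 0 < d by rewrite invr_gt0 mulr_gt0 // ltr_wpDl.
have [Y [Ki [Y0 Ki0 hi]]] := n2_interp s's d0.
pose B := Ki * ((n ^+ 2 + 1) * Cm).
have B0 : 0 <= B by rewrite mulr_ge0 // mulr_ge0 // addr_ge0 // sqr_ge0.
pose cM := K4 * (K1 * (2 * cG * (1 + B)) + K1 * (2 * cG) + 1).
have cM0 : 0 <= cM by rewrite /cM; do 20?[apply: addr_ge0 => //|apply: mulr_ge0 => //].
(* With M = n2 gam u and E the squared norm of [f]: from M <= cM (1 + E), E <= e (1 + M) and cM e <=
   1/2 one gets M <= cM + (1 + M) / 2, that is M <= 2 cM + 1. *)
exists (2 * cM + 1), (2 * (cM + 1))^-1; split; first by rewrite addr_ge0 // mulr_ge0.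
  by rewrite invr_gt0 mulr_gt0 // ltr_wpDl.
move=> u f e du hu um vf hf nf ee aeu.
have lx : L1 (fun y => y * u y) by exact: L1_mulx hgam hu.
have lf : L1 f := H_L1' s2 hf.
have [LTt lT nT T1] := dens_tail du lx; have cu := dens_causal du.
have hT : H s (ctail u) by apply: H_ctail => //; rewrite gE.
have [hu1 _] := H_mono sg hu; have [hu2 nu2] := H_mono (ltW s's) hu1.
have [hT2 nT2] := H_mono (ltW s's) hT.
have n1u : n1 u <= 1 by rewrite dens_n1.
have nTm : n1 (ctail u) <= Cm by rewrite nT.
clear nT um.
pose U := n2 s u; pose T := n2 s (ctail u); pose G := Cm ^+ 2 * U + T; pose E := n2 s f.
have U0 : 0 <= U := n2_ge0 _ _; have T0 : 0 <= T := n2_ge0 _ _; have E0 : 0 <= E := n2_ge0 _ _.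
have CU : 0 <= Cm ^+ 2 * U by rewrite mulr_ge0 ?sqr_ge0.
have G0 : 0 <= G by rewrite addr_ge0.
have TG : T <= G by rewrite lerDr.
pose b := d * ((1 + K1) * G) + B.
have b0 : 0 <= b by rewrite addr_ge0 // mulr_ge0 ?(ltW d0) // mulr_ge0 // addr_ge0.
(* Locally |g|^2 <= k |g|, so the local L2 norm follows from a sup bound and an L1 bound. Both are
   available for tails of probability densities with bounded mean, independently of the weighted
   norms to be estimated. *)
have loc g k : L1 g -> H s g -> 0 <= k -> (forall y, `|g y| <= k) -> n2 s g <= (1 + K1) * G -> k * n1 g <= (n ^+ 2 + 1) * Cm ->
    n2 s' g <= b.
  move=> lg hg k0 gk g1 g2; have [[_ lq] hh] := hi g hg; apply: (le_trans hh); rewrite /b lerD //.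
    by rewrite ler_wpM2l // ltW.
  rewrite ler_wpM2l //; apply: le_trans g2; rewrite /sq /n1 -IntZ; last by apply: L1_meas; exact: L1_abs.
  apply: Int_le => //; first by apply: L1Z; exact: L1_abs.
  move=> y; rewrite exprMn -[X in _ <= X]mul1r; apply: ler_pM; rewrite ?sqr_ge0 //.
    by rewrite expr_le1 ?ind_ge0 ?ind_le1.
  by rewrite -(ger0_norm (sqr_ge0 (g y))) normrX expr2 ler_wpM2r.
have hz j : (j <= N)%N -> [/\ L1 (zt u j), n1 (zt u j) <= j%:R * Cm, H s (zt u j) & n2 s (zt u j) <= K1 * G].
  by case: (du) => lu _ _ _; exact: (h1 u _ Cm T lu n1u hu1 Cm0 T0 (fun i _ => And4 lT nTm hT (lexx _)) j).
have hz' j : (j <= N)%N -> H s' (zt u j) /\ n2 s' (zt u j) <= b.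
  move=> jN; have [lz nz hz1 nz1] := hz j jN; split; first by case: (H_mono (ltW s's) hz1).
  have jn : j%:R <= n by rewrite ler_nat.
  apply: (loc _ n) => // [y||].
  - by apply: le_trans (zt_le du j y) _.
  - by apply: (le_trans nz1); rewrite ler_wpM2r // lerDr.
  - apply: le_trans (_ : n * (n * Cm) <= _).
      by rewrite ler_wpM2l //; apply: (le_trans nz); rewrite ler_wpM2r.
    by rewrite mulrA -expr2 mulrDl lerDl mul1r.
have Tb : n2 s' (ctail u) <= b.
  apply: (loc _ 1) => // [y||].
  - by have /andP[h _] := T1 y; rewrite ger0_norm //; have /andP[] := T1 y.
  - by apply: (le_trans TG); rewrite ler_peMl // lerDl.
  - by rewrite mul1r; apply: (le_trans nTm); rewrite mulrDl mul1r lerDr mulr_ge0 ?sqr_ge0.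
have Ef : n2 (s - 1) f <= E by case: (H_mono sm hf).
have aez : {ae mu, forall y, y * u y = q^-1 * mix N p (zt u) (y - 1) + f y}.
  apply: ae_S (ae_I aeu (ae_shift1 (mix_zt du))) => y [-> ->] //.
have mu1 : measurable_fun setT u by case: (du) => /L1_meas.
have vu : vanish 1 u by case: du.
have UE : U <= K3 * (b + E).
  have [_ k] := h3 u f (zt u) b b0 mu1 vu (proj1 (H_mono sm hf)) hz' aez.
  rewrite sE in k; apply: (le_trans k); exact: (ler_wpM2l K30 (lerD (lexx b) Ef)).
have hv j : (j <= N)%N -> [/\ L1 (vt u j), n1 (vt u j) <= b1, H s' (vt u j) &
    n2 s' (vt u j) <= K2 * ((n * Cm) ^+ 2 * U + n ^+ 2 * b)].
  move=> jN; have [lu u0 _ _] := du.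
  have [i iN|lv nv hv nnv] := h2 u (fun (j : nat) y => j%:R * ctail u y) (n * Cm) (n ^+ 2 * b) lu n1u hu2 (mulr_ge0 n0 Cm0) (mulr_ge0 (sqr_ge0 n) b0) _ j jN.
    have in1 : i%:R <= n by rewrite ler_nat ltnW.
    have [hc nc] := HZ i%:R hT2; split=> //; first exact: L1Z.
      by rewrite n1Z // ger0_norm // ler_pM // n1_ge0.
    by rewrite nc ler_pM ?sqr_ge0 ?n2_ge0 // lerXn2r ?nnegrE.
  split; [exact: lv| |exact: hv|].
    by apply: (le_trans nv); rewrite ler_wpM2r ?mulr_ge0 // ler_nat.
  by apply: (le_trans nnv); exact: (ler_wpM2l K20 (lerD (ler_wpM2l (sqr_ge0 (n * Cm)) nu2) (lexx _))).
have kv0 : 0 <= K2 * ((n * Cm) ^+ 2 * U + n ^+ 2 * b).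
  by rewrite mulr_ge0 // addr_ge0 // mulr_ge0 ?sqr_ge0.
have [lV nV hV n2V] := h6 (vt u) b1 _ b10 kv0 hv.
have cf : causal f by exact: vanish_causal (@ler01 R) vf.
have lu : L1 u by case: du.
have [_ aeT] := tail_equation hp0 hp1 lu cu lf cf (Int_f0 du lx lf aeu) (zt_LT du) (vt_LT du) (zt_Lap du) (vt_Lap du) aez.
have [_ TE] := h5 _ _ _ lT lV hT2 hV hf aeT.
have TE' : T <= K5 * (b + ((1 + b1) ^+ 2 * b + Cm ^+ 2 * n2 s' (vker N p (vt u))) + E).
  apply: (le_trans TE); apply: (ler_wpM2l K50); apply: lerD (lexx E); apply: (lerD Tb); apply: lerD.
    apply: ler_pM; rewrite ?sqr_ge0 ?n2_ge0 // lerXn2r ?nnegrE ?n1_ge0 ?addr_ge0 //.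
  by rewrite ler_wpM2r ?n2_ge0 // lerXn2r ?nnegrE ?n1_ge0.
have GE := hG U T _ _ b E b0 E0 UE (lexx _) n2V TE'; rewrite -/G in GE.
have GE2 : G <= 2 * cG * (1 + B) + 2 * cG * E.
  have k1 : cG * (d * ((1 + K1) * G)) <= 2^-1 * G.
    rewrite !mulrA ler_wpM2r // mulrAC /d ler_pdivrMr ?mulr_gt0 ?ltr_wpDl //.
    by rewrite mulrA mulVf // mul1r lerDl.
  rewrite -!mulrA -mulrDr; apply: half_le; apply: (le_trans GE).
  rewrite /b (_ : cG * _ = cG * (1 + B) + cG * E + cG * (d * ((1 + K1) * G))); last by ring.
  by rewrite lerD2l.
have hzs j : (j <= N)%N -> H s (zt u j) /\ n2 s (zt u j) <= K1 * G by move=> /hz[].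
have [_ ME] := h4 u f (zt u) (K1 * G) (mulr_ge0 K10 G0) mu1 vu hf hzs aez.
rewrite gE -/E in ME; move: nf; rewrite -/s -/E => nf.
pose M := n2 gam u; have M0 : 0 <= M := n2_ge0 _ _.
have ME2 : M <= cM * (1 + E).
  apply: (le_trans ME); rewrite /cM -mulrA ler_wpM2l //.
  have k1 : K1 * G <= K1 * (2 * cG * (1 + B)) + K1 * (2 * cG) * E.
    by rewrite -(mulrA K1 (2 * cG)) -mulrDr ler_wpM2l.
  have k2 : 0 <= K1 * (2 * cG * (1 + B)) by rewrite !mulr_ge0 // addr_ge0.
  have k3 : 0 <= K1 * (2 * cG) by rewrite !mulr_ge0.
  have k4 := mulr_ge0 k2 E0; have k5 := addr_ge0 (addr_ge0 k4 k3) (@ler01 R).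
  rewrite (_ : _ * (1 + E) = K1 * (2 * cG * (1 + B)) + K1 * (2 * cG) * E + E + (K1 * (2 * cG * (1 + B)) * E + K1 * (2 * cG) + 1)); last by ring.
  by rewrite -[leLHS]addr0; exact: (lerD (lerD k1 (lexx E)) k5).
have e1 : cM * (e * (1 + M)) <= 2^-1 * (1 + M).
  rewrite mulrA ler_wpM2r ?addr_ge0 //; apply: le_trans (_ : cM * (2 * (cM + 1))^-1 <= _).
    by rewrite ler_wpM2l.
  rewrite ler_pdivrMr ?mulr_gt0 ?ltr_wpDl // mulrA mulVf // mul1r lerDl //.
have e2 : cM * E <= cM * (e * (1 + M)) by rewrite ler_wpM2l.
exact: (final_le ME2 e2 e1).
Qed.

End Mix.
End Estimates.

(** * Differences of densities *)

Section Difference.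
Variable R : realType.
Implicit Types (f g h u w x : R -> R) (b c e s t y : R).
Local Notation mu := (@lebesgue_measure R).
Local Notation ind := (@ind R).
Local Notation conv := (@convolution R).
Local Notation heav := (@heav R).
Variables (N : nat) (p : nat -> R).
Hypotheses (hp0 : forall j : nat, (1 <= j <= N)%N -> 0 <= p j)
           (hp1 : \sum_(1 <= j < N.+1) p j = 1).
Local Notation q := (qmean N p).
Local Notation P := (Qpoly N p).
Local Notation Q := (Qconv N p).

Section Pair.
Variables u w : R -> R.
Hypotheses (du : dens u) (dw : dens w).

Definition dif y := u y - w y.
(* [zx j] is a.e. the tail of the difference of the j-th convolution powers of [u] and [w]. *)
Definition zx := zrec u (fun j => if j is i.+1 then conv (ctail dif) (convpow w i.+1) else ctail dif).
(** The added terms have transforms (j (1 - U) + (1 - W^j)) / s, as [zrec_Lap_cum] asks. The case j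
    = 0 is separate because [convpow w 0] is [w] itself and not the Dirac mass. *)
Definition vx := zrec u (fun j y => j%:R * ctail u y + (if j is i.+1 then ctail (convpow w i.+1) y else 0)).

Let lu : L1 u. Proof. by case: du. Qed.
Let lw : L1 w. Proof. by case: dw. Qed.
Let Lu : LT u := dens_LT du.
Let Lw : LT w := dens_LT dw.
Let cu : causal u := dens_causal du.
Let cw : causal w := dens_causal dw.

Lemma L1_dif : L1 dif. Proof. exact: L1B. Qed.

Lemma vanish_dif : vanish 1 dif.
Proof. by move=> y y1; rewrite /dif; case: du dw => _ _ -> // _ [_ _ -> // _]; rewrite subrr. Qed.

Lemma causal_dif : causal dif.
Proof. exact: vanish_causal (@ler01 R) vanish_dif. Qed.

Lemma Int_dif : Int dif = 0.
Proof. by rewrite /dif IntB //; case: du dw => _ _ _ -> [_ _ _ ->]; rewrite subrr. Qed.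

Let Lz : LT (ctail dif). Proof. exact: LT_ctail L1_dif causal_dif. Qed.

Lemma Lap_ctail_dif s : 0 < s -> Lap (ctail dif) s = - (Lap u s - Lap w s) / s.
Proof. by move=> s0; rewrite (Lap_ctail s0 L1_dif causal_dif) Int_dif sub0r /dif Lap_B. Qed.

Lemma LT_convpow_w i : LT (convpow w i.+1).
Proof. exact: dens_LT (dens_convpow i dw). Qed.

Lemma ax_LT j : LT (if j is i.+1 then conv (ctail dif) (convpow w i.+1) else ctail dif).
Proof. by case: j => // i; apply: LT_conv => //; exact: LT_convpow_w. Qed.

Lemma zx_LT j : LT (zx j). Proof. by apply: zrec_LT => //; exact: ax_LT. Qed.

Lemma LT_ctail_convpow i : LT (ctail (convpow w i.+1)).
Proof.
have d := dens_convpow i dw; apply: LT_ctail; [by case: d|exact: dens_causal d].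
Qed.

Lemma bx_LT (j : nat) : LT (fun y => j%:R * ctail u y + (if j is i.+1 then ctail (convpow w i.+1) y else 0)).
Proof.
have Lt : LT (fun y => j%:R * ctail u y) by apply: LT_Z; exact: LT_ctail.
apply: LT_D => //; case: j {Lt} => [|i]; first by apply: L1_LT; [|exact: L1_0].
exact: LT_ctail_convpow.
Qed.

Lemma vx_LT j : LT (vx j). Proof. by apply: zrec_LT => //; exact: bx_LT. Qed.

Lemma zx_Lap j s : 0 < s -> Lap (zx j) s = Lap (ctail dif) s * dpow (Lap u s) (Lap w s) j.
Proof.
move=> s0; apply: zrec_Lap_dpow => // [|i]; first exact: ax_LT.
case: i => [|i]; first by rewrite expr0 mulr1.
by rewrite (Lap_conv s0 Lz (LT_convpow_w i)); case: dw => lw' _ vw _; rewrite Lap_convpow.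
Qed.

Lemma vx_Lap j s : 0 < s -> Lap (vx j) s = (j%:R - dpow (Lap u s) (Lap w s) j) / s.
Proof.
move=> s0; apply: zrec_Lap_cum => // [|i]; first exact: bx_LT.
have Lt := LT_ctail lu cu; have Iu : Int u = 1 by case: du.
have eu : Lap (fun y => i%:R * ctail u y) s = i%:R * (1 - Lap u s) / s.
  by rewrite (Lap_Z _ _ Lt) (Lap_ctail s0 lu cu) Iu mulrA.
case: i eu => [|i] eu.
  rewrite (_ : (fun y => 0%:R * ctail u y + 0) = fun=> 0); last by apply/funext => y; rewrite mul0r addr0.
  by rewrite Lap_0 mul0r expr0 subrr addr0 mul0r.
have di := dens_convpow i dw; have [li _ _ Ii] := di.
rewrite (Lap_D s0 (LT_Z _ Lt) (LT_ctail_convpow i)) eu (Lap_ctail s0 li (dens_causal di)) Ii.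
case: dw => lw' _ vw _; rewrite Lap_convpow //; ring.
Qed.

Lemma mix_zx : {ae mu, forall y, ctail (Q u) y - ctail (Q w) y = mix N p zx y}.
Proof.
have [lm em] := mix_LT N p zx_LT.
case: (du) => _ _ vu Iu; case: (dw) => _ _ vw Iw.
have lQ := L1_Q N p lu vu; have lQ' := L1_Q N p lw vw.
have cQ : causal (Q u) by apply: vanish_causal (@ler01 R) _; exact: vanish_Q.
have cQ' : causal (Q w) by apply: vanish_causal (@ler01 R) _; exact: vanish_Q.
have L1Q := LT_ctail lQ cQ; have L2Q := LT_ctail lQ' cQ'.
apply: Lap_inj2 => // [|s s0]; first exact: LT_B.
rewrite (em s s0).
apply: (etrans (Lap_B s0 L1Q L2Q)).
apply: (etrans (congr2 (fun a b => a - b) (Lap_ctail s0 lQ cQ) (Lap_ctail s0 lQ' cQ'))).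
rewrite (Int_Q N p lu vu) (Int_Q N p lw vw) Iu Iw (Lap_Q N p lu vu s0) (Lap_Q N p lw vw s0) !P_eval.
have -> : \sum_(1 <= j < N.+1) p j * Lap (zx j) s =
   - \sum_(1 <= j < N.+1) (p j * Lap u s ^+ j - p j * Lap w s ^+ j) / s.
  rewrite -sumrN; apply: eq_bigr => j _; rewrite zx_Lap // Lap_ctail_dif // !mulNr mulrN.
  by congr (- _); rewrite -!mulrBr -dpowE; ring.
by rewrite -mulr_suml sumrB; ring.
Qed.

Definition cum y := prim (fun t => `|dif t|) y.

Lemma cum_mono y t : t <= y -> cum t <= cum y.
Proof.
by have [c1 _] := prim_ctrl L1_dif => ty; have := c1 t y ty => h; rewrite -subr_ge0; exact: le_trans h.
Qed.

Lemma cum_ge0 y : 0 <= cum y.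
Proof. by apply: Int_ge0 => t; rewrite mulr_ge0 ?ind_ge0. Qed.

(** The difference of two probability densities has integral zero, so its tail beyond y is minus its
    integral up to y: a quantity at infinity is controlled from the left. *)
Lemma ctail_dif_le y : `|ctail dif y| <= cum y.
Proof.
have l := L1_dif; rewrite /ctail; apply: le_trans (indM_norm _ _) _.
rewrite tail_split // Int_dif sub0r normrN; apply: le_trans (Int_absL1 (L1_prim y l)) _.
apply: Int_le => [||t]; [exact: L1_abs (L1_prim y l)|exact: L1_prim (L1_abs l)|].
by rewrite normrM (ger0_norm (ind_ge0 _ _)).
Qed.

Lemma zx_le j y : `|zx j y| <= j%:R * cum y.
Proof.
elim: j y => [|j IH] y; first by rewrite /= normr0 mul0r.
rewrite [zx]lock /= -lock; apply: le_trans (ler_normD _ _) _; rewrite -natr1 mulrDl mul1r lerD //.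
  apply: conv_dens_le => [//||t ty]; first exact: LT_meas (zx_LT j).
  by apply: (le_trans (IH t)); rewrite ler_wpM2l // cum_mono.
case: j {IH} => [|i]; first exact: ctail_dif_le.
rewrite convC; [|exact: LT_meas|exact: LT_meas (LT_convpow_w i)].
apply: (conv_dens_le (dens_convpow i dw)) => [|t ty]; first exact: LT_meas.
by apply: (le_trans (ctail_dif_le t)); exact: cum_mono.
Qed.

Lemma mix_zx_le y : `|mix N p zx y| <= q * cum y.
Proof.
rewrite /mix qmeanE mulr_suml; apply: le_trans (ler_norm_sum _ _ _) _.
rewrite big_seq [leRHS]big_seq; apply: ler_sum => j jN.
have pj := hp0' hp0 jN; rewrite normrM ger0_norm // -mulrA ler_wpM2l //; exact: zx_le.
Qed.

End Pair.

(** The delay by 1 carries the induction: on [1, n + 1] the mixture at y - 1 sees the difference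
    only up to n. The factor q of [mix_zx_le] cancels q^-1, dividing by y >= 1 costs nothing, and n
    + 1 in the new constant is the length of the interval. *)
Lemma local_bound (n : nat) : exists2 C, 0 <= C & forall u w f, dens u -> dens w -> L1 f ->
  {ae mu, forall y, y * dif u w y = q^-1 * (ctail (Q u) (y - 1) - ctail (Q w) (y - 1)) + f y} ->
  cum u w n%:R <= C * n1 f.
Proof.
elim: n => [|n [C C0 IH]].
  exists 0 => // u w f du dw lf _; rewrite mul0r /cum /prim (@Int_eq _ _ (fun=> 0)) ?Int0 // => t.
  have [t0|t0] := leP t 0; last by rewrite (@indF _ false) // mul0r.
  by rewrite (vanish_dif du dw) ?normr0 ?mulr0 // (le_lt_trans t0).
exists (n.+1%:R * C + 1) => [|u w f du dw lf ae]; first by rewrite addr_ge0 // mulr_ge0.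
have ld := L1_dif du dw; have lp := L1_prim n.+1%:R (L1_abs ld).
have n0 : (0 : R) <= n.+1%:R by exact: ler0n.
have [lI iI] := Int_itv n0; have lc := L1Z (cum u w n%:R) lI; have lf' := L1_abs lf.
have q1 := qmean_ge1 hp0 hp1; have q0 : 0 < q by exact: lt_le_trans q1.
apply: le_trans (_ : Int (fun t => cum u w n%:R * ind (0 <= t <= n.+1%:R) + `|f t|) <= _).
  apply: Int_leae => //; first exact: L1D.
  apply: ae_S (ae_I ae (ae_shift1 (mix_zx du dw))) => t [e1 e2].
  have [t1|t1] := leP 1 t; last first.
    by rewrite (vanish_dif du dw) // normr0 mulr0 addr_ge0 // mulr_ge0 ?cum_ge0 ?ind_ge0.
  have [tn|tn] := leP t n.+1%:R; last first.
    by rewrite (@indF _ false) // mul0r addr_ge0 // mulr_ge0 ?cum_ge0 ?ind_ge0.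
  rewrite (@indT _ true) // mul1r indT ?(le_trans ler01) // mulr1.
  have t0 : 0 <= t by exact: le_trans t1.
  apply: le_trans (_ : `|t * dif u w t| <= _); first by rewrite normrM (ger0_norm t0) ler_peMl.
  rewrite e1 e2; apply: le_trans (ler_normD _ _) _; rewrite lerD2r normrM ger0_norm ?invr_ge0 ?(ltW q0) //.
  rewrite ler_pdivrMl //; apply: (le_trans (mix_zx_le du dw _)); rewrite ler_pM2l //.
  by apply: cum_mono => //; rewrite lerBlDr natr1.
rewrite (IntD lc lf') (IntZ _ (L1_meas lI)) iI subr0 mulrDl mul1r lerD //.
by rewrite mulrC -mulrA ler_wpM2l //; exact: IH.
Qed.

Section Bounds.
Variables (gam Cm Mb : R).
Hypotheses (hgam : 3 / 2 < gam) (Cm0 : 0 <= Cm) (Mb0 : 0 <= Mb).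

Definition nice u := [/\ dens u, H gam u, n2 gam u <= Mb & Int (fun y => y * u y) <= Cm].

Let s := gam - 1.
Let gE : s + 1 = gam. Proof. by rewrite /s subrK. Qed.
Let sg : s <= gam. Proof. by rewrite /s gerBl. Qed.
Let s2 : 2^-1 < s. Proof. by have := hgam; rewrite /s; lra. Qed.
Let s0 : 0 <= s. Proof. by apply: le_trans (ltW s2); rewrite invr_ge0. Qed.
Let gam0 : 0 <= gam. Proof. exact: le_trans sg. Qed.

Lemma vx_bound s' : 0 <= s' -> s' <= s -> exists b1 b2, [/\ 0 <= b1, 0 <= b2 & forall u w, nice u -> nice w ->
  forall j, (j <= N)%N -> [/\ L1 (vx u w j), n1 (vx u w j) <= b1, H s' (vx u w j) & n2 s' (vx u w j) <= b2]].
Proof.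
move=> s'0 s's; have [K2 K20 h2] := zrec_H s'0 N; have [Kw Kw0 hw] := convpow_H gam0 N.
have sm : - 2^-1 < s by have h := s2; lra.
have [CH CH0 hH] := hardy sm; rewrite gE in hH.
pose n : R := N%:R; have n0 : 0 <= n by exact: ler0n.
pose A := n * Cm + n * Cm; have A0 : 0 <= A by rewrite addr_ge0 // mulr_ge0.
pose A2 := 2 * (n ^+ 2 * (CH * Mb) + CH * (Kw * Mb)).
have A20 : 0 <= A2 by rewrite mulr_ge0 // addr_ge0 //; apply: mulr_ge0; rewrite ?sqr_ge0 // mulr_ge0.
exists (n * A), (K2 * (A ^+ 2 * Mb + A2)); split=> [||u w [du hu nu mu'] [dw hw' nw mw] j jN].
- by rewrite mulr_ge0.
- by rewrite mulr_ge0 // addr_ge0 // mulr_ge0 ?sqr_ge0.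
have lxu := L1_mulx hgam hu; have lxw := L1_mulx hgam hw'.
have [lu u0 vu Iu] := du; have [lw w0 vw Iw] := dw.
have n1u : n1 u <= 1 by rewrite dens_n1.
have n1w : n1 w <= 1 by rewrite dens_n1.
have [_ lt nt _] := dens_tail du lxu.
have [hu1 nu1] := H_mono (le_trans s's sg) hu.
have tb g : H gam g -> H s' (ctail g) /\ n2 s' (ctail g) <= CH * n2 gam g.
  move=> hg; have [h nn] := hH g hg; have [h' nn'] := H_mono s's h.
  by split; [exact: h'|exact: le_trans nn' nn].
have [htu ntu] := tb u hu.
have ntm : n1 (ctail u) <= Cm by rewrite nt.
clear nt.
have bx i : (i < N)%N -> [/\ L1 (fun y => i%:R * ctail u y + (if i is k.+1 then ctail (convpow w k.+1) y else 0)),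
    n1 (fun y => i%:R * ctail u y + (if i is k.+1 then ctail (convpow w k.+1) y else 0)) <= A,
    H s' (fun y => i%:R * ctail u y + (if i is k.+1 then ctail (convpow w k.+1) y else 0)) &
    n2 s' (fun y => i%:R * ctail u y + (if i is k.+1 then ctail (convpow w k.+1) y else 0)) <= A2].
  move=> iN; have in1 : i%:R <= n by rewrite ler_nat ltnW.
  have [hz nz] := HZ i%:R htu; have lz := L1Z i%:R lt.
  have nz1 : n1 (fun y => i%:R * ctail u y) <= n * Cm.
    by rewrite n1Z // ger0_norm // ler_pM // n1_ge0.
  have nz2 : n2 s' (fun y => i%:R * ctail u y) <= n ^+ 2 * (CH * Mb).
    rewrite nz; apply: ler_pM; rewrite ?sqr_ge0 ?n2_ge0 //; first by rewrite lerXn2r ?nnegrE.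
    by apply: (le_trans ntu); rewrite ler_wpM2l.
  have [c [cE lc nc hc n2c]] : exists c : R -> R, [/\ (fun y => (if i is k.+1 then ctail (convpow w k.+1) y else 0)) = c,
      L1 c, n1 c <= n * Cm, H s' c & n2 s' c <= CH * (Kw * Mb)].
    case: i iN {in1 hz nz lz nz1 nz2} => [|k] kN.
      exists (fun=> 0); have [h0 nh0] := H0 s'; split=> //; first exact: L1_0.
        by rewrite /n1 (@Int_eq _ _ (fun=> 0)) ?Int0 ?mulr_ge0 // => y; rewrite normr0.
      by rewrite nh0 !mulr_ge0.
    have dk := dens_convpow k dw; have [lxk ek] := Int_mulx_convpow lw vw k lxw Iw.
    have [_ l nn _] := dens_tail dk lxk; have [hk nk] := hw k.+1 w (ltnW kN) lw n1w hw'.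
    have [h' nn'] := tb _ hk; exists (ctail (convpow w k.+1)); split=> //.
      rewrite nn ek; apply: le_trans (_ : k.+1%:R * Cm <= _); first by rewrite ler_wpM2l.
      by rewrite ler_wpM2r // ler_nat ltnW.
    apply: (le_trans nn'); rewrite ler_wpM2l //; apply: (le_trans nk); rewrite ler_wpM2l //.
  have E : (fun y => i%:R * ctail u y + (if i is k.+1 then ctail (convpow w k.+1) y else 0)) =
      (fun y => i%:R * ctail u y + c y) by rewrite -cE.
  rewrite E; have [h nn] := HD hz hc; split=> //; first exact: L1D.
    by apply: le_trans (n1_le_add lz lc) _; exact: lerD.
  by apply: (le_trans nn); rewrite ler_pM2l //; exact: lerD.
have [l nn h nn2] := h2 u _ A A2 lu n1u hu1 A0 A20 bx j jN.
split=> //.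
  by apply: (le_trans nn); rewrite ler_wpM2r // ler_nat.
exact: (le_trans nn2 (ler_wpM2l K20 (lerD (ler_wpM2l (sqr_ge0 A) (le_trans nu1 nu)) (lexx A2)))).
Qed.

(** The sources of the recursion are linear in the tail of the difference, so the bound is
    proportional to its squared norm; the L1 norm required by the recursion is recovered from that
    same norm, as s > 1/2. Proportionality is what allows absorption in [dif_bound]. *)
Lemma zx_bound : exists2 K, 0 <= K & forall u w, nice u -> nice w -> H s (ctail (dif u w)) ->
  forall j, (j <= N)%N -> H s (zx u w j) /\ n2 s (zx u w j) <= K * n2 s (ctail (dif u w)).
Proof.
have [K1 K10 h1] := zrec_H s0 N; have [Kw Kw0 hw] := convpow_H s0 N; have [CL CL0 hL] := H_L1 s2.
have [cc [cc0 ccE]] : exists c : R, 0 <= c /\ 2 * (2 `^ s) ^+ 2 = c.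
  by exists (2 * (2 `^ s) ^+ 2); split=> //; rewrite mulr_ge0 ?sqr_ge0.
pose k := 1 + cc * (1 + CL * (Kw * Mb)).
have k0 : 0 <= cc * (1 + CL * (Kw * Mb)) by rewrite mulr_ge0 // addr_ge0 // !mulr_ge0.
exists (K1 * (CL * Mb + k)) => [|u w [du hu nu mu'] [dw hw' nw mw] hZ j jN].
  by rewrite mulr_ge0 // addr_ge0 ?mulr_ge0 // addr_ge0.
have [lu u0 vu Iu] := du; have [lw w0 vw Iw] := dw.
have n1u : n1 u <= 1 by rewrite dens_n1.
have n1w : n1 w <= 1 by rewrite dens_n1.
have [hu1 nu1] := H_mono sg hu; have [hw1 nw1] := H_mono sg hw'.
pose Z := ctail (dif u w); rewrite -/Z in hZ *; have [lZ nZ] := hL _ hZ.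
pose B := n2 s Z; have B0 : 0 <= B := n2_ge0 _ _; rewrite -/B in nZ *.
have ax i : (i < N)%N -> [/\ L1 (if i is k.+1 then conv Z (convpow w k.+1) else Z),
   n1 (if i is k.+1 then conv Z (convpow w k.+1) else Z) <= n1 Z,
   H s (if i is k.+1 then conv Z (convpow w k.+1) else Z) &
   n2 s (if i is k.+1 then conv Z (convpow w k.+1) else Z) <= k * B].
  case: i => [|i] iN; first by split=> //; rewrite ler_peMl // lerDl.
  have di := dens_convpow i dw; have [li _ _ _] := di; have ni := dens_n1 di.
  have [hi n2i] := hw i.+1 w (ltnW iN) lw n1w hw1.
  have [h nn] := H_conv s0 lZ li hZ hi; split=> //; first exact: conv_L1.
    by apply: (le_trans (conv_n1 lZ li)); rewrite ni mulr1.
  apply: (le_trans nn); rewrite ccE ni expr1n mul1r.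
  apply: le_trans (_ : cc * (B + CL * B * (Kw * Mb)) <= _).
    rewrite ler_wpM2l // lerD2l; apply: ler_pM => //; rewrite ?sqr_ge0 ?n2_ge0 //.
    exact: (le_trans n2i (ler_wpM2l Kw0 (le_trans nw1 nw))).
  by rewrite (_ : cc * _ = cc * (1 + CL * (Kw * Mb)) * B) ?ler_wpM2r ?lerDr //; ring.
have [l n h n2h] := h1 u _ (n1 Z) (k * B) lu n1u hu1 (n1_ge0 _) (mulr_ge0 (addr_ge0 ler01 k0) B0) ax j jN.
split=> //; apply: (le_trans n2h); rewrite -mulrA ler_wpM2l // [leRHS]mulrDl lerD // [CL * Mb * B]mulrAC.
exact: (ler_pM (sqr_ge0 _) (n2_ge0 _ _) nZ (le_trans nu1 nu)).
Qed.

End Bounds.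

(** On [0, Y] the tail is at most [cum] at an integer beyond Y, which [local_bound] controls by the
    L1 norm of the forcing. *)
Lemma local_sq Y : exists2 K, 0 <= K & forall u w f, dens u -> dens w -> L1 f ->
  {ae mu, forall y, y * dif u w y = q^-1 * (ctail (Q u) (y - 1) - ctail (Q w) (y - 1)) + f y} ->
  sq (fun y => ind (`|y| <= Y) * ctail (dif u w) y) <= K * n1 f ^+ 2.
Proof.
pose n := (Num.truncn Y).+1; have [C C0 hC] := local_bound n.
have n0 : (0 : R) <= n%:R by exact: ler0n.
have [lI iI] := Int_itv n0; exists (C ^+ 2 * n%:R) => [|u w f du dw lf ae]; first by rewrite mulr_ge0 ?sqr_ge0.
have hc := hC u w f du dw lf ae.
have lb := L1Z ((C * n1 f) ^+ 2) lI.
have le y : (ind (`|y| <= Y) * ctail (dif u w) y) ^+ 2 <= (C * n1 f) ^+ 2 * ind (0 <= y <= n%:R).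
  have [yY|yY] := leP `|y| Y; last first.
    by rewrite (@indF _ false) // mul0r expr0n /= mulr_ge0 ?sqr_ge0 ?ind_ge0.
  rewrite (@indT _ true) // mul1r; have [y0|y0] := leP 0 y; last first.
    by rewrite causal_ctail // expr0n /= mulr_ge0 ?sqr_ge0 ?ind_ge0.
  have yn : y <= n%:R.
    by apply: (le_trans (ler_norm y)); apply: (le_trans yY); apply: ltW; exact: truncnS_gt.
  rewrite yn indT // mulr1 -(ger0_norm (sqr_ge0 (ctail _ _))) normrX lerXn2r ?nnegrE ?mulr_ge0 ?n1_ge0 //.
  by apply: (le_trans (ctail_dif_le du dw y)); apply: le_trans hc; exact: cum_mono.
have ms : measurable_fun setT (fun y => (ind (`|y| <= Y) * ctail (dif u w) y) ^+ 2).
  apply: measurable_funX; apply: measurable_funM.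
    by apply: measurable_ind; apply: measurable_fun_ler => //; exact: measurableT_comp.
  by apply: LT_meas; exact: LT_ctail (L1_dif du dw) (causal_dif du dw).
have ls : L1 (fun y => (ind (`|y| <= Y) * ctail (dif u w) y) ^+ 2).
  by apply: (L1_le ms lb) => y; rewrite ger0_norm ?sqr_ge0.
apply: le_trans (Int_le ls lb le) _.
by rewrite (IntZ _ (L1_meas lI)) iI subr0 exprMn mulrAC.
Qed.

Lemma step_le (K5 k CL v2 z2 nZ2 nV2 n2V A E : R) : 0 <= K5 -> 0 <= CL -> 0 <= v2 -> 0 <= E -> 0 <= A -> 0 <= k -> 0 <= z2 -> 0 <= nZ2 -> 0 <= n2V ->
  z2 <= A -> nZ2 <= CL * A -> 0 <= nV2 -> nV2 <= v2 -> n2V <= k ->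
  K5 * (z2 + (nV2 * z2 + nZ2 * n2V) + E) <= K5 * (1 + v2 + CL * k + 1) * (A + E).
Proof.
move=> K50 CL0 v0 E0 A0 k0 z0 Z0 V0 h1 h2 n0 h3 h4; rewrite -mulrA ler_wpM2l //.
have p1 : nV2 * z2 <= v2 * A by exact: ler_pM.
have p2 : nZ2 * n2V <= CL * A * k by exact: ler_pM.
have p3 := mulr_ge0 v0 E0; have p4 := mulr_ge0 (mulr_ge0 CL0 k0) E0.
rewrite (_ : _ * (A + E) = A + v2 * A + CL * A * k + E + (A + v2 * E + CL * k * E + E)); last by ring.
apply: le_trans (_ : A + v2 * A + CL * A * k + E <= _); last by rewrite lerDl !addr_ge0.
by rewrite lerD2r addrA !lerD.
Qed.

(** The estimate is linear in [f]: the tail equation bounds the tail Z of the difference at weight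
    gam - 1 by a lower-order norm of Z plus [f]; interpolation absorbs the former up to a local
    norm, and [local_sq] bounds that by [f] again. [x_bound] then passes from Z to the difference
    itself, at weight gam. *)
Lemma dif_bound gam Cm Mb : 3 / 2 < gam -> 0 <= Cm -> 0 <= Mb -> exists2 C, 0 <= C & forall u w f,
  nice gam Cm Mb u -> nice gam Cm Mb w -> vanish 1 f -> H (gam - 1) f ->
  {ae mu, forall y, y * u y = q^-1 * ctail (Q u) (y - 1) + f y} ->
  {ae mu, forall y, y * w y = q^-1 * ctail (Q w) (y - 1)} ->
  n2 gam (dif u w) <= C * n2 (gam - 1) f.
Proof.
move=> hgam Cm0 Mb0; pose s := gam - 1; pose s' := Num.max (gam - 2) 0.
have s'0 : 0 <= s' by rewrite le_max lexx orbT.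
have ss' : s - 1 <= s' by rewrite le_max /s; apply/orP; left; lra.
(* The exponent [a] built from m lies strictly between max(s', 1/2) and s: above 1/2 so that the L1
   norm of the tail is controlled at level [a], above s' so that level s' is covered, and below s so
   that interpolation has room. *)
have [m [m1 m2 ms]] : exists m : R, [/\ s' <= m, 2^-1 <= m & m < s].
  exists (Num.max s' 2^-1); split; [by rewrite le_max lexx|by rewrite le_max lexx orbT|].
  by rewrite !gt_max /s; apply/andP; split; [apply/andP; split|]; lra.
pose a := (m + s) / 2.
have as_ : a < s by rewrite /a; lra.
have sa : s' <= a by rewrite /a; lra.
have a2 : 2^-1 < a by rewrite /a; lra.
have s0 : 0 <= s by rewrite /s; lra.
have s2 : 2^-1 < s by rewrite /s; lra.
have s2' : - 2^-1 < s by lra.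
have s's : s' <= s by exact: le_trans sa (ltW as_).
have gE : s + 1 = gam by rewrite /s subrK.
have sg : s <= gam by rewrite /s gerBl.
have [K4 K40 h4] := x_bound hp0 hp1 (lexx s) s0.
have [K5 K50 h5] := tail_bound_step s2 ss' s'0; have [K6 K60 h6] := vker_bound hp0 hp1 s'0.
have [CL CL0 hL] := H_L1 a2; have [CS CS0 hS] := H_L1 s2.
have [b1 [b2 [b10 b20 hv]]] := vx_bound hgam Cm0 Mb0 s'0 s's.
have [Kz Kz0 hz] := zx_bound Cm hgam Mb0; rewrite -/s in hv hz.
pose c1 := K5 * (1 + (1 + b1) ^+ 2 + CL * (K6 * (1 + b2)) + 1).
have c10 : 0 <= c1.
  by rewrite mulr_ge0 // !addr_ge0 ?sqr_ge0 // !mulr_ge0 // addr_ge0.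
pose d := (2 * (c1 + 1))^-1.
have d0 : 0 < d by rewrite invr_gt0 mulr_gt0 // ltr_wpDl.
have [Y [Ki [Y0 Ki0 hi]]] := n2_interp as_ d0; have [Kl Kl0 hl] := local_sq Y.
pose c2 := 2 * (c1 * (Ki * (Kl * CS)) + c1).
have c20 : 0 <= c2.
  apply: mulr_ge0 => //; apply: addr_ge0 => //; apply: mulr_ge0 => //; apply: mulr_ge0 => //; exact: mulr_ge0.
exists (K4 * (Kz * c2 + 1)) => [|u w f nu nw vf hf aeu aew].
  by rewrite mulr_ge0 // addr_ge0 // mulr_ge0.
have [du hu _ _] := nu; have [dw hw _ _] := nw.
have cf : causal f by exact: vanish_causal (@ler01 R) vf.
have [lf nf] := hS f hf.
have lxu := L1_mulx hgam hu.
have ae : {ae mu, forall y, y * dif u w y = q^-1 * (ctail (Q u) (y - 1) - ctail (Q w) (y - 1)) + f y}.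
  by apply: ae_S (ae_I aeu aew) => y [e1 e2]; rewrite /dif mulrBr e1 e2 mulrBr addrAC.
have aez : {ae mu, forall y, y * dif u w y = q^-1 * mix N p (zx u w) (y - 1) + f y}.
  by apply: ae_S (ae_I ae (ae_shift1 (mix_zx du dw))) => y [-> ->].
have ld := L1_dif du dw; have cd := causal_dif du dw; have vd := vanish_dif du dw.
have [LV aeT] := tail_equation hp0 hp1 ld cd lf cf (Int_f0 hp0 hp1 du lxu lf aeu) (zx_LT du dw) (vx_LT du dw) (zx_Lap du dw) (vx_Lap du dw) aez.
have [hd _] : H gam (dif u w) /\ _ := HB hu hw.
pose Z := ctail (dif u w); have hZ : H s Z by apply: H_ctail => //; rewrite gE.
have [lV nV hV n2V] := h6 (vx u w) b1 b2 b10 b20 (hv u w nu nw).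
have [hZ' _] := H_mono s's hZ; have [hZa _] := H_mono (ltW as_) hZ.
have [_ nZ'] := H_mono sa hZa.
have [lZ nZ] := hL Z hZa; rewrite -/s in hf nf *.
pose E := n2 s f; have E0 : 0 <= E := n2_ge0 _ _.
have [_ n1] := h5 _ _ _ lZ lV hZ' hV hf aeT; rewrite -/Z -/E in n1.
have n2Z : n2 s Z <= c1 * (n2 a Z + E).
  apply: (le_trans n1); apply: step_le; rewrite ?n2_ge0 ?sqr_ge0 //.
    by rewrite mulr_ge0 // addr_ge0.
  by rewrite lerXn2r ?nnegrE ?n1_ge0 ?addr_ge0.
have [_ ni] := hi Z hZ; have nl := hl u w f du dw lf ae; rewrite -/Z in nl.
have nE : n2 s Z <= c2 * E.
  rewrite /c2 -[2 * _ * E]mulrA; apply: half_le; apply: (le_trans n2Z).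
  apply: le_trans (_ : c1 * ((d * n2 s Z + Ki * (Kl * (CS * E))) + E) <= _).
    rewrite ler_wpM2l // lerD2r; apply: (le_trans ni); rewrite lerD2l ler_wpM2l //.
    by apply: (le_trans nl); rewrite ler_wpM2l.
  rewrite (_ : c1 * _ = (c1 * (Ki * (Kl * CS)) + c1) * E + c1 * d * n2 s Z); last by ring.
  rewrite lerD2l ler_wpM2r ?n2_ge0 // /d ler_pdivrMr ?mulr_gt0 ?ltr_wpDl //.
  by rewrite mulrA mulVf // mul1r lerDl.
have mz : Kz * n2 s Z <= Kz * (c2 * E) by rewrite ler_wpM2l.
have [_ nn] := h4 (dif u w) f (zx u w) (Kz * n2 s Z) (mulr_ge0 Kz0 (n2_ge0 _ _)) (L1_meas ld) vd hf (hz u w nu nw hZ) aez.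
rewrite gE in nn; apply: (le_trans nn); rewrite -mulrA ler_wpM2l //.
by rewrite -/E mulrDl mul1r lerD2r -mulrA.
Qed.

End Difference.

(** * Convergence *)

Section Norms.
Variable R : realType.
Implicit Types (f g : R -> R) (b c e s t y k K : R).
Local Notation mu := (@lebesgue_measure R).
Local Notation ind := (@ind R).

Lemma norm2E s f : norm2 s f = sqrte (\int[mu]_y (y `^ (2 * s) * ext1 f y ^+ 2)%:E)%E.
Proof.
rewrite /norm2 integral_mkcond; congr (sqrte _); apply: eq_integral => y _; rewrite patchE ext1E.
case: ifPn => [/set_mem/itv1P ->|/negP h]; first by rewrite mul1r real_normK ?num_real.
by rewrite indF ?mul0r ?expr0n ?mulr0 //; apply/negP => /itv1P/mem_set.
Qed.

Lemma measurable_norm2 s f : measurable_fun setT (ext1 f) ->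
  measurable_fun setT (fun y => y `^ (2 * s) * ext1 f y ^+ 2).
Proof. by move=> mf; apply: measurable_funM; [exact: measurable_powR|exact: measurable_funX]. Qed.

Lemma powR_wt_le s y : 0 <= s -> 1 <= y -> y `^ (2 * s) <= wt s y ^+ 2.
Proof.
move=> s0 y1; have y0 : 0 <= y by exact: le_trans y1.
rewrite wt_sqr wt_nneg // mulrDl mul1r; apply: ge0_ler_powR; rewrite ?nnegrE ?addr_ge0 ?lerDr //.
Qed.

(** On y >= 1 one has 1 + y <= 2 y; with [powR_wt_le] this makes [norm2] and the square root of [n2]
    equivalent. *)
Lemma wt_powR_le s y : 0 <= s -> 1 <= y -> wt s y ^+ 2 <= (2 `^ s) ^+ 2 * y `^ (2 * s).
Proof.
move=> s0 y1; have y0 : 0 <= y by exact: le_trans y1.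
have -> : y `^ (2 * s) = (y `^ s) ^+ 2 by rewrite -powR_mulrn ?powR_ge0 // -powRrM mulrC.
rewrite -exprMn -powRM // lerXn2r ?nnegrE ?wt_ge0 ?powR_ge0 // wt_nneg //.
apply: ge0_ler_powR; rewrite ?nnegrE ?addr_ge0 ?mulr_ge0 //; lra.
Qed.

Lemma norm2_le s f : 0 <= s -> H s (ext1 f) -> (norm2 s f <= (Num.sqrt (n2 s (ext1 f)))%:E)%E.
Proof.
move=> s0 [mf [_ lf]]; rewrite norm2E.
have -> : (Num.sqrt (n2 s (ext1 f)))%:E = sqrte (n2 s (ext1 f))%:E by [].
rewrite lee_sqrt ?lee_fin ?n2_ge0 // /n2 /sq -IntE //.
apply: ge0_le_integral => //.
- by move=> y _; rewrite lee_fin mulr_ge0 ?powR_ge0 ?sqr_ge0.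
- by apply/measurable_EFinP; exact: measurable_norm2.
- by apply/measurable_EFinP; exact: L1_meas.
move=> y _; rewrite lee_fin exprMn ext1E; have [y1|y1] := leP 1 y; last first.
  by rewrite (@indF _ false) // mul0r expr0n /= !mulr0.
by rewrite ler_wpM2r ?sqr_ge0 // powR_wt_le.
Qed.

Lemma norm2_H s f c : 0 <= s -> 0 <= c -> measurable_fun setT (ext1 f) -> (norm2 s f <= c%:E)%E ->
  H s (ext1 f) /\ n2 s (ext1 f) <= (2 `^ s) ^+ 2 * c ^+ 2.
Proof.
move=> s0 c0 mf; rewrite norm2E.
have -> : c%:E = sqrte (c ^+ 2)%:E by rewrite /= sqrtr_sqr ger0_norm.
rewrite lee_sqrt ?lee_fin ?sqr_ge0 // => h.
have [|l i] := L1_ge0 (measurable_norm2 s mf) _ h; first by move=> y; rewrite mulr_ge0 ?powR_ge0 ?sqr_ge0.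
have le y : (wt s y * ext1 f y) ^+ 2 <= (2 `^ s) ^+ 2 * (y `^ (2 * s) * ext1 f y ^+ 2).
  rewrite exprMn ext1E; have [y1|y1] := leP 1 y; last first.
    by rewrite (@indF _ false) // mul0r expr0n /= !mulr0.
  by rewrite [leRHS]mulrA ler_wpM2r ?sqr_ge0 // wt_powR_le.
have mw : measurable_fun setT (fun y => wt s y * ext1 f y).
  by apply: measurable_funM => //; exact: measurable_wt.
have lz := L1Z ((2 `^ s) ^+ 2) l.
have lq : L1 (fun y => (wt s y * ext1 f y) ^+ 2).
  by apply: (L1_le _ lz) => [|y]; [exact: measurable_funX|rewrite ger0_norm ?sqr_ge0].
split; first by split.
by apply: le_trans (Int_le lq lz le) _; rewrite IntZ ?ler_wpM2l ?sqr_ge0 //; exact: L1_meas.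
Qed.

Lemma inPgamma_H s f : 0 <= s -> inPgamma s f -> H s (rep f).
Proof.
move=> s0 [fP [_ fn]]; have [_ _ lf ae] := inP_rep fP.
have n0 : (0 <= norm2 s f)%E by exact: sqrte_ge0.
have fin : (norm2 s f \is a fin_num) by rewrite ge0_fin_numE.
have [||h _] := @norm2_H s f (fine (norm2 s f)) s0 _ (L1_meas lf).
- exact: fine_ge0.
- by rewrite fineK.
by case: (@H_abs R s (ext1 f) h).
Qed.

Lemma exp_decay k K e : 0 < k -> 0 <= K -> 0 < e -> exists2 T0, 0 <= T0 &
  forall T, T0 <= T -> K * expR (- k * T) <= e.
Proof.
move=> k0 K0 e0; exists (K / (e * k)) => [|T hT]; first by rewrite divr_ge0 // mulr_ge0 ?ltW.
have T0 : 0 <= T by apply: le_trans hT; rewrite divr_ge0 // mulr_ge0 ?ltW.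
rewrite mulNr expRN ler_pdivrMr ?expR_gt0 //; apply: le_trans (_ : e * (1 + k * T) <= _).
  rewrite mulrDr mulr1 mulrA; apply: le_trans (_ : e * k * T <= _); last by rewrite lerDr ltW.
  by rewrite mulrC -ler_pdivrMr ?mulr_gt0.
by rewrite ler_wpM2l ?(ltW e0) //; exact: expR_ge1Dx.
Qed.

End Norms.

(** * Application to a solution *)

Section Main.
Variable R : realType.
Local Notation mu := (@lebesgue_measure R).
Local Notation ind := (@ind R).
Variables (N : nat) (p : nat -> R).
Hypotheses (hp0 : forall j : nat, (1 <= j <= N)%N -> 0 <= p j)
           (hp1 : \sum_(1 <= j < N.+1) p j = 1).
Variable gam : R.
Hypothesis hgam : 3 / 2 < gam.
Local Notation q := (qmean N p).
Local Notation Q := (Qconv N p).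

Let gam0 : 0 <= gam. Proof. by have h := hgam; lra. Qed.

(** Compactness of [0, T]: continuity bounds the norm near each time by the norm at that time plus a
    constant, and [cousin] joins the local bounds. *)
Lemma C0_bounded (eta : R -> R -> R) (T : R) : C0_Pgamma gam eta -> 0 <= T ->
  exists2 M, 0 <= M & forall t, 0 <= t <= T -> n2 gam (rep (eta t)) <= M.
Proof.
move=> [hP hC] T0.
have [K [K0 KE]] : exists c : R, 0 <= c /\ (2 `^ gam) ^+ 2 = c.
  by exists ((2 `^ gam) ^+ 2); split=> //; exact: sqr_ge0.
apply: (cousin (P := fun x y => exists2 M, 0 <= M & forall t, x <= t <= y -> n2 gam (rep (eta t)) <= M)) => //.
  move=> x y z xy yz [M1 M10 h1] [M2 M20 h2]; exists (M1 + M2); first exact: addr_ge0.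
  move=> t /andP[xt tz]; have [ty|ty] := leP t y.
    by apply: (@le_trans _ _ M1); [apply: h1; rewrite xt|rewrite lerDl].
  by apply: (@le_trans _ _ M2); [apply: h2; rewrite ltW|rewrite lerDr].
move=> t /andP[t0 tT]; have := ecvg0_lt _ (hC t t0) (@ltr01 R); rewrite near_withinE => -[d /= d0 hd].
exists (d / 2) => [|x y x0 xt ty yT yx]; first by rewrite divr_gt0.
exists (2 * (K + n2 gam (rep (eta t)))) => [|r /andP[xr ry]].
  by rewrite mulr_ge0 // addr_ge0 ?n2_ge0.
have r0 : 0 <= r by exact: le_trans xr.
have dd : d / 2 < d by rewrite ltr_pdivrMr // ltr_pMr // ltrDl.
have h : (norm2 gam (eta r \- eta t)%R <= 1%:E)%E.
  by apply: ltW; apply: hd; rewrite /= ?in_itv /= ?r0 // /ball /= ltr_norml; lra.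
have [Pr _] := hP r r0; have [Pt _] := hP t t0.
have [_ _ lr aer] := inP_rep Pr; have [_ _ lt aet] := inP_rep Pt.
have Ht := inPgamma_H gam0 (hP t t0).
have eB : ext1 (eta r \- eta t) = (fun y => ext1 (eta r) y - ext1 (eta t) y) := ext1B _ _.
have [|hB nB] := norm2_H gam0 (@ler01 R) _ h; first by rewrite eB; exact: L1_meas (L1B lr lt).
have [hS nS] := HD hB Ht; rewrite KE expr1n mulr1 in nB.
have [_ ->] : H gam (rep (eta r)) /\ n2 gam (rep (eta r)) = n2 gam (fun y => ext1 (eta r \- eta t) y + rep (eta t) y).
  apply: H_ae => //; first by apply: L1_meas; case: (inP_rep Pr).
  by apply: ae_S (ae_I aer aet) => z [e1 e2]; rewrite eB e1 e2 subrK.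
by apply: (le_trans nS); rewrite ler_pM2l // lerD2r.
Qed.

Variables (eta : R -> R -> R) (eta0 star : R -> R).
Hypotheses (hC : C0_Pgamma gam eta) (h0 : inPgamma gam eta0) (hs : is_solution N p eta0 eta)
  (hsP : inP star) (hstar : is_eta_star1 N p star).
Local Notation e t := (rep (eta t)).
Local Notation w := (rep star).

Lemma rep_dens (f : R -> R) : inP f -> dens (rep f).
Proof. by move=> /inP_rep[l i _ _]; split=> //; [exact: rep_ge0|exact: vanish_rep]. Qed.

Lemma convergence : exists M K, [/\ 0 <= M, 0 <= K, H gam w &
  forall t, 0 <= t -> [/\ H gam (e t), n2 gam (e t) <= M &
    n2 gam (dif (e t) w) <= K * expR (- (2 * gam - 3) * t)]].
Proof.
have hP t : 0 <= t -> inP (eta t) by move=> /(proj1 hC)[].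
have hH t : 0 <= t -> H gam (e t) by move=> /(proj1 hC); exact: inPgamma_H.
have [_ [beta [hb hsol _]]] := hs.
have [C [Cm [C0 Cm0 prof]]] := profile hp0 hp1 hgam hP (proj1 h0) hb hsol hH.
have [C1 [e0 [C10 e00 db]]] := density_bound hp0 hp1 hgam Cm0.
have k0 : 0 < 2 * gam - 3 by have h := hgam; lra.
have s2 : 2^-1 < gam - 1 by have h := hgam; lra.
have [T1 T10 hT1] := exp_decay k0 C0 e00.
have late t : T1 <= t -> n2 gam (e t) <= C1.
  move=> tt; have t0 : 0 <= t by exact: le_trans tt.
  have [hm [f [vf hf nf aef]]] := prof t t0.
  exact: (db (e t) f _ (rep_dens (hP t t0)) (hH t t0) hm vf hf nf (hT1 t tt) aef).
have [M1 M10 early] := C0_bounded hC T10.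
pose M := C1 + M1; have M0 : 0 <= M by exact: addr_ge0.
have nM t : 0 <= t -> n2 gam (e t) <= M.
  move=> t0; have [tT|tT] := leP T1 t; first by apply: (le_trans (late t tT)); rewrite lerDl.
  by apply: (@le_trans _ _ M1); [apply: early; rewrite t0 ltW|rewrite lerDr].
have dw := rep_dens hsP; have aew := star_eq hp0 hp1 hsP hstar.
have [lw _ _ _] := dw.
have [CS CS0 hS] := H_L1 s2.
have fb t f : 0 <= t -> n2 (gam - 1) f <= C * expR (- (2 * gam - 3) * t) * (1 + n2 gam (e t)) ->
    n2 (gam - 1) f <= C * (1 + M) * expR (- (2 * gam - 3) * t).
  move=> t0 nf; apply: (le_trans nf); rewrite mulrAC ler_wpM2r ?expR_ge0 // ler_wpM2l // lerD2l; exact: nM.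
(* The profile is so far only known to be a probability density. [local_bound] shows that e (T1 + n)
   converges to it in L1 on bounded sets, and lower semicontinuity transfers the uniform weighted
   bound to the limit. *)
have hw : H gam w /\ n2 gam w <= M.
  apply: (@H_lsc R gam (fun n => e (T1 + n%:R)) w M); first exact: L1_meas.
  - by move=> n; have tn := addr_ge0 T10 (ler0n R n); split; [exact: hH|exact: nM].
  - move=> m n; have [lT _ _ _] := rep_dens (hP (T1 + n%:R) (addr_ge0 T10 (ler0n _ n))).
    apply: L1_indM; last exact: L1B.
    by apply: measurable_fun_ler => //; exact: measurableT_comp.
  - move=> m c c0; have [Cl Cl0 hl] := local_bound hp0 hp1 m.
    have KK : 0 <= Cl ^+ 2 * (CS * (C * (1 + M))).
      by rewrite mulr_ge0 ?sqr_ge0 // !mulr_ge0 // addr_ge0.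
    have [T2 T20 hT2] := exp_decay k0 KK (exprn_gt0 2 c0).
    exists (Num.truncn T2).+1; set T := T1 + _; have T0 : 0 <= T by rewrite addr_ge0.
    have TT : T2 <= T by apply: (le_trans (ltW (truncnS_gt T2))); rewrite lerDr.
    have [_ [f [vf hf nf aef]]] := prof T T0; have dT := rep_dens (hP T T0).
    have [lf n1f] := hS f hf; have [lT _ _ _] := dT.
    have ld := L1_dif dT dw.
    apply: le_trans (_ : cum (e T) w m%:R <= _).
      apply: Int_le => [||y].
      - apply: L1_abs; apply: L1_indM => //.
        by apply: measurable_fun_ler => //; exact: measurableT_comp.
      - exact: L1_prim (L1_abs ld).
      rewrite normrM (ger0_norm (ind_ge0 _ _)) ler_wpM2r //.
      have [h|h] := leP `|y| m%:R; last by rewrite (@indF _ false) // ind_ge0.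
      by rewrite [X in _ <= X]indT ?ind_le1 //; exact: le_trans (ler_norm _) h.
    have ae : {ae mu, forall y, y * dif (e T) w y = q^-1 * (ctail (Q (e T)) (y - 1) - ctail (Q w) (y - 1)) + f y}.
      by apply: ae_S (ae_I aef aew) => y [e1 e2]; rewrite /dif mulrBr e1 e2 mulrBr addrAC.
    apply: (le_trans (hl (e T) w f dT dw lf ae)).
    rewrite -(@ler_pXn2r _ 2) ?nnegrE ?(ltW c0) ?mulr_ge0 ?n1_ge0 // exprMn.
    apply: le_trans (hT2 T TT); rewrite -(mulrA (Cl ^+ 2)); apply: ler_wpM2l; first exact: sqr_ge0.
    by apply: (le_trans n1f); rewrite -(mulrA CS); apply: ler_wpM2l => //; exact: fb.
have [Hw nw] := hw; have lxw := L1_mulx hgam Hw.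
pose Cx := Num.max Cm (Int (fun y => y * w y)).
have Cx0 : 0 <= Cx by rewrite le_max Cm0.
have niw : nice gam Cx M w by split=> //; rewrite le_max lexx orbT.
have [C2 C20 h2] := dif_bound hp0 hp1 hgam Cx0 M0.
exists M, (C2 * (C * (1 + M))); split=> // [|t t0].
  by rewrite mulr_ge0 // mulr_ge0 // addr_ge0.
split; [exact: hH|exact: nM|].
have [hm [f [vf hf nf aef]]] := prof t t0.
have nit : nice gam Cx M (e t).
  by split; [exact: rep_dens (hP t t0)|exact: hH|exact: nM|apply: (le_trans hm); rewrite le_max lexx].
by apply: (le_trans (h2 (e t) w f nit niw vf hf aef aew)); rewrite -mulrA ler_wpM2l //; exact: fb.
Qed.

Lemma norm2_dif_le (s t : R) : 0 <= s -> s <= gam -> 0 <= t -> H gam (dif (e t) w) ->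
  (norm2 s (eta t \- star)%R <= (Num.sqrt (n2 gam (dif (e t) w)))%:E)%E.
Proof.
move=> s0 sg t0 hd; have hPt : inP (eta t) by case: (proj1 hC t t0).
have [_ _ lt aet] := inP_rep hPt; have [_ _ lw aew] := inP_rep hsP.
have eB : ext1 (eta t \- star) = (fun y => ext1 (eta t) y - ext1 star y) := ext1B _ _.
have [hs1 ns1] := H_mono sg hd.
have [h n] : H s (ext1 (eta t \- star)) /\ n2 s (ext1 (eta t \- star)) = n2 s (dif (e t) w).
  apply: H_ae => //; first by rewrite eB; exact: L1_meas (L1B lt lw).
  by apply: ae_S (ae_I aet aew) => y [e1 e2]; rewrite eB /dif e1 e2.
apply: le_trans (norm2_le s0 h) _; rewrite lee_fin n; exact: ler_wsqrtr.
Qed.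

End Main.

Theorem theorem5p5 (R : realType) (N : nat) (p : nat -> R)
    (hN : (1 <= N)%N)
    (hp0 : forall j : nat, (1 <= j <= N)%N -> 0 <= p j)
    (hp1 : \sum_(1 <= j < N.+1) p j = 1)
    (eta_star1 : R -> R)
    (hstarP : inP eta_star1)
    (hstar : is_eta_star1 N p eta_star1)
    (gamma : R) (hgamma : 3 / 2 < gamma)
    (eta0 : R -> R) (heta0 : inPgamma gamma eta0)
    (eta : R -> R -> R)
    (hetaC : C0_Pgamma gamma eta)
    (heta : is_solution N p eta0 eta) :
  [/\ exists M : R, forall tau : R, 0 <= tau ->
        (norm2 gamma (eta tau) <= M%:E)%E,
      exists2 C : R, 0 < C & forall tau : R, 0 <= tau ->
        (norm2 (gamma - 1)%R (eta tau \- eta_star1)%R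
           <= (C * expR (- (gamma - 3 / 2) * tau))%:E)%E &
      2 <= gamma ->
      exists2 C : R, 0 < C & forall tau : R, 0 <= tau ->
        (norm2 gamma (eta tau \- eta_star1)%R
           <= (C * (1 + tau) * expR (- (gamma - 3 / 2) * tau))%:E)%E].
Proof.
have [M [K [M0 K0 Hw hc]]] := convergence hp0 hp1 hgamma hetaC heta0 heta hstarP hstar.
have g0 : 0 <= gamma by lra.
(* One bound at weight [gamma] serves all weights [s] below it. The square root halves 2 gamma - 3
   to gamma - 3/2, and the added 1 makes the constant positive. *)
have bound s tau : 0 <= s -> s <= gamma -> 0 <= tau ->
    (norm2 s (eta tau \- eta_star1)%R <= ((Num.sqrt K + 1) * expR (- (gamma - 3 / 2) * tau))%:E)%E.
  move=> s0 sg t0; have [Ht nM nK] := hc tau t0; have [hd _] := HB Ht Hw.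
  apply: le_trans (norm2_dif_le hetaC hstarP s0 sg t0 hd) _; rewrite lee_fin.
  apply: le_trans (ler_wsqrtr nK) _; rewrite sqrtrM //.
  have -> : expR (- (2 * gamma - 3) * tau) = expR (- (gamma - 3 / 2) * tau) ^+ 2.
    by rewrite -expRM_natl; congr expR; field.
  rewrite sqrtr_sqr ger0_norm ?expR_ge0 // ler_wpM2r ?expR_ge0 // lerDl //.
have C0 : 0 < Num.sqrt K + 1 by rewrite ltr_wpDl ?sqrtr_ge0.
split.
- exists (Num.sqrt M) => tau t0; have [Ht nM _] := hc tau t0.
  have [hP _] := proj1 hetaC tau t0; have [_ _ lt aet] := inP_rep hP.
  have [h n] : H gamma (ext1 (eta tau)) /\ n2 gamma (ext1 (eta tau)) = n2 gamma (rep (eta tau)).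
    by apply: H_ae => //; [exact: L1_meas|apply: ae_S aet => y ->].
  by apply: le_trans (norm2_le g0 h) _; rewrite lee_fin n ler_wsqrtr.
- by exists (Num.sqrt K + 1) => // tau t0; apply: bound => //; lra.
(* The bound at weight [gamma] carries no power of tau; the factor 1 + tau is at least 1. *)
- move=> _; exists (Num.sqrt K + 1) => // tau t0; apply: le_trans (bound gamma tau g0 (lexx _) t0) _.
  rewrite lee_fin ler_wpM2r ?expR_ge0 // ler_peMr ?(ltW C0) // lerDl //.
Qed.
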